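(* Let $T>0$. Suppose that the complex valued function $u=u(x,y,t)$ is sufficiently smooth on $\mathbb{R}\times\mathbb{R}_+\times(0,T)$ up to the boundary and decays sufficiently fast as $|(x,y)|\to\infty$; that is, the following holds for some sufficiently large integer $N$: $u\in C^N(\mathbb{R}\times[0,\infty)\times[0,T])$ and all partial derivatives of $u$ of order at most $N$ are bounded by $C(1+|x|+|y|)^{-N}$ for some constant $C$. Suppose that $u$ solves the fourth order (biharmonic) Schrödinger problem $$iu_t+\Delta^2u=0\ \text{ in }\mathbb{R}\times\mathbb{R}_+\times(0,T),$$ $$u(x,0,t)=g_0(x,t),\qquad u_y(x,0,t)=g_1(x,t),\qquad u(x,y,0)=u_0(x,y),$$ where $\Delta^2u=\partial_x^4u+2\partial_x^2\partial_y^2u+\partial_y^4u$. Let $\epsilon>0$ be fixed and sufficiently small, and let $\nu_\kappa=\nu_\kappa(\lambda)=\sqrt{-\lambda^2-2\kappa^2}^{\,*}$, where $\sqrt{z}^{\,*}=|z|^{1/2}e^{i\arg(z)/2}$ with $\arg z\in[\epsilon,2\pi+\epsilon)$. Then for all $(x,y,t)\in\mathbb{R}\times\mathbb{R}_+\times(0,T)$, $$u(x,y,t)=\frac{1}{(2\pi)^2}\int_{-\infty}^\infty\int_{-\infty}^{\infty}E(\kappa,\lambda;x,y,t)\,\widehat{u_0}(\kappa,\lambda)\,d\lambda\, d\kappa+\frac{1}{(2\pi)^2}\int_{-\infty}^\infty\int_{\partial D_\kappa^+}E(\kappa,\lambda;x,y,t)\,G(\kappa,\lambda,t)\,d\lambda\,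 d\kappa,$$ where $E(\kappa,\lambda;x,y,t)=\exp(i(\kappa^2+\lambda^2)^2t+i\kappa x+i\lambda y)$ and $$G(\kappa,\lambda,t)=\frac{2\lambda}{\nu_\kappa-\lambda}\,\widehat{u_0}(\kappa,-\nu_\kappa)-\frac{\lambda+\nu_\kappa}{\nu_\kappa-\lambda}\,\widehat{u_0}(\kappa,-\lambda)$$ $$+2(\lambda^2\nu_\kappa+\lambda\nu_\kappa^2)\,\widetilde{g_0}(\kappa,-i(\kappa^2+\lambda^2)^2,t)+2i(\lambda^2+\lambda\nu_\kappa)\,\widetilde{g_1}(\kappa,-i(\kappa^2+\lambda^2)^2,t).$$
   Context: Notation: $\mathbb{R}_+=(0,\infty)$, $\mathbb{C}_+=\{\lambda\in\mathbb{C}:\operatorname{Im}\lambda>0\}$. Half space Fourier transform: for $\kappa\in\mathbb{R}$ and $\operatorname{Im}\lambda\le 0$, $$\widehat{u_0}(\kappa,\lambda)=\int_{-\infty}^\infty\int_0^\infty e^{-ix\kappa-iy\lambda}u_0(x,y)\,dy\,dx.$$ $t$-transforms: for $j=0,1$, $\kappa\in\mathbb{R}$, $\eta\in\mathbb{C}$, $$\widetilde{g_j}(\kappa,\eta,t)=\int_0^t e^{\eta\tau}\Big(\int_{-\infty}^\infty e^{-ix\kappa}g_j(x,\tau)\,dx\Big)d\tau.$$ For $\kappa\in\mathbb{R}$, $D_\kappa=\{\lambda\in\mathbb{C}:\operatorname{Re}[i(\kappa^2+\lambda^2)^2]>0\}$ and $D_\kappa^+=D_\kappa\cap\mathbb{C}_+$.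 The contour $\partial D_\kappa^+$ is the boundary of $D_\kappa^+$ oriented so that $D_\kappa^+$ lies to its left. On this contour $\nu_\kappa(\lambda)=\lambda$ (for $\kappa\ne0$) only at $\lambda=i|\kappa|$, which is a removable singularity of $G$. All double integrals are iterated (inner integral in $\lambda$, outer in $\kappa$). Integrals in $\lambda$ over unbounded contours are understood, where necessary, as improper integrals, i.e. limits as $R\to\infty$ of the integrals over the part of the contour in $|\lambda|\le R$. ''Sufficiently large $N$'' means: there exists an absolute integer $N$ for which the statement is true. *)

(* Defs.v *)
From Stdlib Require Import Reals Lra Lia Psatz List.
From Coquelicot Require Import Coquelicot.
Import ListNotations.

Open Scope R_scope.
Open Scope C_scope.

(** * Complex exponential and the branch of the square root *)

Definition Cexp (z : C) : C := (exp (Re z) * cos (Im z), exp (Re z) * sin (Im z))%R.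

(* The argument in [0, 2 pi). *)
Definition arg0 (z : C) : R :=
  if Rle_dec 0 (Im z) then acos (Re z / Cmod z)
  else (2 * PI - acos (Re z / Cmod z))%R.

(* For 0 < eps < 2 pi, the argument in [eps, 2 pi + eps); see [arg_from_spec].
   Its value at 0 is irrelevant. *)
Definition arg_from (eps : R) (z : C) : R :=
  if Rlt_dec (arg0 z) eps then (arg0 z + 2 * PI)%R else arg0 z.

Definition sqrt_star (eps : R) (z : C) : C :=
  RtoC (sqrt (Cmod z)) * Cexp (Ci * RtoC (arg_from eps z / 2)).

Definition nu (eps kappa : R) (lambda : C) : C :=
  sqrt_star eps (- lambda ^ 2 - RtoC (2 * kappa ^ 2)).

(** * Derivatives, smoothness up to the boundary and decay *)

(* Derivative of a complex valued function of a real variable. *)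
Definition CDerive (f : R -> C) (s : R) : C :=
  (Derive (fun r => Re (f r)) s, Derive (fun r => Im (f r)) s).

Inductive axis := X | Y | T.

Definition along (a : axis) (u : R -> R -> R -> C) (x y t : R) : R -> C :=
  match a with
  | X => fun s => u s y t
  | Y => fun s => u x s t
  | T => fun s => u x y s
  end.

Definition coord (a : axis) (x y t : R) : R :=
  match a with X => x | Y => y | T => t end.

Definition partial1 (a : axis) (u : R -> R -> R -> C) : R -> R -> R -> C :=
  fun x y t => CDerive (along a u x y t) (coord a x y t).

(* [partial [a1; ...; ak] u] is d_{a1} ... d_{ak} u. *)
Fixpoint partial (w : list axis) (u : R -> R -> R -> C) : R -> R -> R -> C :=
  match w with
  | nil => u
  | a :: w' => partial1 a (partial w' u)
  end.

Definition open_domain (tmax : R) (p : R * R * R) : Prop :=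
  let '(x, y, t) := p in 0 < y /\ 0 < t < tmax.

Definition closed_domain (tmax : R) (p : R * R * R) : Prop :=
  let '(x, y, t) := p in 0 <= y /\ 0 <= t <= tmax.

Definition uncurry3 (u : R -> R -> R -> C) (p : R * R * R) : C :=
  let '(x, y, t) := p in u x y t.

(* u is C^N on the closed domain: every partial derivative of order at most N
   exists in the interior and extends continuously to the closed domain, u
   itself being its own extension. *)
Definition CN_up_to_boundary (N : nat) (tmax : R) (u : R -> R -> R -> C) : Prop :=
  continuous_on (closed_domain tmax) (uncurry3 u) /\
  (forall (w : list axis) (a : axis), (length w < N)%nat ->
     forall x y t : R, open_domain tmax (x, y, t) ->
     ex_derive (K := R_AbsRing) (V := C_R_NormedModule)
       (along a (partial w u) x y t) (coord a x y t)) /\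
  (forall w : list axis, (length w <= N)%nat ->
     exists v : R * R * R -> C,
       continuous_on (closed_domain tmax) v /\
       forall p, open_domain tmax p -> v p = uncurry3 (partial w u) p).

Definition decays (N : nat) (tmax : R) (u : R -> R -> R -> C) : Prop :=
  exists M : R, forall w : list axis, (length w <= N)%nat ->
  forall x y t : R, open_domain tmax (x, y, t) ->
    Cmod (partial w u x y t) <= M / (1 + Rabs x + Rabs y) ^ N.

Definition solves_biharmonic_schrodinger (tmax : R) (u : R -> R -> R -> C) : Prop :=
  forall x y t : R, open_domain tmax (x, y, t) ->
    Ci * partial [T] u x y t
    + (partial [X; X; X; X] u x y t + 2 * partial [X; X; Y; Y] u x y t
       + partial [Y; Y; Y; Y] u x y t) = 0.

(* u_y on the boundary y = 0 is the trace of the interior derivative. *)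
Definition has_data (tmax : R) (u : R -> R -> R -> C)
    (u0 g0 g1 : R -> R -> C) : Prop :=
  (forall x t, 0 < t < tmax -> u x 0 t = g0 x t) /\
  (forall x t, 0 < t < tmax ->
     filterlim (fun y => partial [Y] u x y t) (at_right 0) (locally (g1 x t))) /\
  (forall x y, 0 < y -> u x y 0 = u0 x y).

(** * Transforms *)

Definition CInt (f : R -> C) (a b : R) : C :=
  RInt (V := C_R_CompleteNormedModule) f a b.

Definition CInt_line (f : R -> C) : C :=
  RInt_gen (V := C_R_CompleteNormedModule) f (Rbar_locally m_infty) (Rbar_locally p_infty).

Definition CInt_half (f : R -> C) : C :=
  RInt_gen (V := C_R_CompleteNormedModule) f (at_point 0) (Rbar_locally p_infty).

Definition half_space_transform (u0 : R -> R -> C) (kappa : R) (lambda : C) : C :=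
  CInt_line (fun x => CInt_half (fun y =>
    Cexp (- (Ci * RtoC x * RtoC kappa) - Ci * RtoC y * lambda) * u0 x y)).

Definition t_transform (g : R -> R -> C) (kappa : R) (eta : C) (t : R) : C :=
  CInt (fun tau =>
    Cexp (eta * RtoC tau) *
    CInt_line (fun x => Cexp (- (Ci * RtoC x * RtoC kappa)) * g x tau)) 0 t.

(** * Contours

    A contour is a finite list of arcs.  The two bounds of an arc depend on the
    cut-off radius r: [pt] maps [[from r, to r]] onto the part of the arc lying
    in |lambda| <= r. *)

Record arc := Arc { pt : R -> C; from : R -> R; to : R -> R }.

Fixpoint is_CInt_cut (f : C -> C) (gamma : list arc) (r : R) (l : C) : Prop :=
  match gamma with
  | nil => l = 0
  | a :: gamma' => exists l1 l2 : C,
      is_RInt (V := C_R_NormedModule)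
        (fun s => f (pt a s) * CDerive (pt a) s) (from a r) (to a r) l1 /\
      is_CInt_cut f gamma' r l2 /\ l = l1 + l2
  end.

Definition is_CInt_contour (f : C -> C) (gamma : list arc) (l : C) : Prop :=
  filterlimi (is_CInt_cut f gamma) (Rbar_locally p_infty) (locally l).

(* Iterated integral: inner contour integral in lambda, outer integral over
   the real line in kappa. *)
Definition is_iterated_CInt (f : R -> C -> C) (gamma : R -> list arc) (l : C) : Prop :=
  exists inner : R -> C,
    (forall kappa : R, is_CInt_contour (f kappa) (gamma kappa) (inner kappa)) /\
    is_RInt_gen (V := C_R_NormedModule) inner
      (Rbar_locally m_infty) (Rbar_locally p_infty) l.

Definition real_line : list arc := [Arc RtoC (fun r => (- r)%R) (fun r => r)].

Definition D (kappa : R) (lambda : C) : Prop :=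
  0 < Re (Ci * (RtoC (kappa ^ 2) + lambda ^ 2) ^ 2).

Definition Dplus (kappa : R) (lambda : C) : Prop := D kappa lambda /\ 0 < Im lambda.

(* Writing lambda = a + i b, Dplus consists of {a > 0, b^2 > kappa^2 + a^2} and
   {a < 0, 0 < b, b^2 < kappa^2 + a^2} (see [DplusE]).  The second component is
   bounded by the negative real axis, the segment [0, i |kappa|] and the left
   half of the hyperbola b^2 = kappa^2 + a^2; the first one by the imaginary
   axis above i |kappa| and the right half of the hyperbola.  That these arcs
   make up the boundary, with Dplus on the left, is proved in [boundary_trace]
   and [boundary_left]. *)
Definition hyperbola_cut (kappa r : R) : R := sqrt ((r ^ 2 - kappa ^ 2) / 2).

Definition boundary_Dplus (kappa : R) : list arc :=
  [ Arc (fun s => (s, 0%R)) (fun r => (- r)%R) (fun _ => 0%R);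
    Arc (fun s => (0%R, s)) (fun _ => 0%R) (fun _ => Rabs kappa);
    Arc (fun s => (- s, sqrt (kappa ^ 2 + s ^ 2))%R) (fun _ => 0%R) (hyperbola_cut kappa);
    Arc (fun s => (0, - s)%R) (fun r => (- r)%R) (fun _ => (- Rabs kappa)%R);
    Arc (fun s => (s, sqrt (kappa ^ 2 + s ^ 2))%R) (fun _ => 0%R) (hyperbola_cut kappa) ].

(** * The representation formula *)

Definition E (kappa : R) (lambda : C) (x y t : R) : C :=
  Cexp (Ci * (RtoC (kappa ^ 2) + lambda ^ 2) ^ 2 * RtoC t
        + Ci * RtoC kappa * RtoC x + Ci * lambda * RtoC y).

(* On the contour the denominator nu - lambda vanishes only at lambda = i |kappa|;
   this is an endpoint of arcs, so the value of G there does not affect the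
   integrals. *)
Definition G (eps : R) (u0 g0 g1 : R -> R -> C) (kappa : R) (lambda : C) (t : R) : C :=
  let n := nu eps kappa lambda in
  let eta := - (Ci * (RtoC (kappa ^ 2) + lambda ^ 2) ^ 2) in
  2 * lambda / (n - lambda) * half_space_transform u0 kappa (- n)
  - (lambda + n) / (n - lambda) * half_space_transform u0 kappa (- lambda)
  + 2 * (lambda ^ 2 * n + lambda * n ^ 2) * t_transform g0 kappa eta t
  + 2 * Ci * (lambda ^ 2 + lambda * n) * t_transform g1 kappa eta t.

(** * Checks of the encodings *)

Lemma Cexp_imag (th : R) : Cexp (Ci * RtoC th) = (cos th, sin th).
Proof.
  unfold Cexp, Ci, RtoC; simpl.
  replace (0 * th - 1 * 0)%R with 0%R by ring.
  replace (0 * 0 + 1 * th)%R with th by ring.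
  now rewrite exp_0, !Rmult_1_l.
Qed.

Lemma arg0_spec (z : C) : z <> 0 ->
  0 <= arg0 z < 2 * PI /\ z = RtoC (Cmod z) * Cexp (Ci * RtoC (arg0 z)).
Proof.
  intros Hz.
  assert (Hm := Cmod_gt_0 z). apply Hm in Hz. clear Hm.
  destruct z as [a b].
  set (m := Cmod (a, b)) in *.
  assert (Hmm : (m * m = a ^ 2 + b ^ 2)%R).
  { unfold m, Cmod; simpl fst; simpl snd. apply sqrt_sqrt. nra. }
  assert (Hq : (-1 <= a / m <= 1)%R).
  { split; [apply Rmult_le_reg_r with m|apply Rmult_le_reg_r with m];
      trivial; unfold Rdiv; rewrite Rmult_assoc, Rinv_l; nra. }
  assert (Hs : sqrt (1 - (a / m) ^ 2) = (Rabs b / m)%R).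
  { replace (1 - (a / m) ^ 2)%R with ((Rabs b / m) ^ 2)%R.
    - apply sqrt_pow2. apply Rmult_le_pos; [apply Rabs_pos|].
      left; now apply Rinv_0_lt_compat.
    - assert (Hb : (Rabs b ^ 2 = m * m - a ^ 2)%R) by (rewrite pow2_abs; lra).
      unfold Rdiv; rewrite Rpow_mult_distr, Hb. field. lra. }
  assert (HPI := PI_RGT_0).
  assert (HB := acos_bound (a / m)).
  rewrite Cexp_imag. unfold arg0; fold m; simpl Re; simpl Im.
  destruct (Rle_dec 0 b) as [Hb|Hb].
  - split; [lra|].
    rewrite cos_acos, sin_acos by trivial.
    rewrite Rsqr_pow2, Hs, Rabs_pos_eq by trivial.
    unfold RtoC, Cmult; simpl. f_equal; field; lra.
  - assert (Hne : (acos (a / m) <> 0)%R).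
    { intro H0. assert (H1 : sin (acos (a / m)) = 0%R) by (rewrite H0; apply sin_0).
      rewrite sin_acos, Rsqr_pow2, Hs in H1 by trivial.
      rewrite Rabs_left in H1 by lra.
      assert (H2 : (- b / m * m = 0)%R) by (rewrite H1; ring).
      unfold Rdiv in H2. rewrite Rmult_assoc, Rinv_l in H2; lra. }
    split; [lra|].
    replace (2 * PI - acos (a / m))%R with (- acos (a / m) + 2 * INR 1 * PI)%R
      by (simpl; ring).
    rewrite cos_period, sin_period, cos_neg, sin_neg.
    rewrite cos_acos, sin_acos by trivial.
    rewrite Rsqr_pow2, Hs, Rabs_left by lra.
    unfold RtoC, Cmult; simpl. f_equal; field; lra.
Qed.

Lemma arg_from_spec (eps : R) (z : C) : 0 < eps < 2 * PI -> z <> 0 ->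
  eps <= arg_from eps z < 2 * PI + eps /\
  z = RtoC (Cmod z) * Cexp (Ci * RtoC (arg_from eps z)).
Proof.
  intros He Hz. destruct (arg0_spec z Hz) as [Hb Hp].
  unfold arg_from. destruct (Rlt_dec (arg0 z) eps) as [Hlt|Hlt].
  - split; [lra|]. rewrite Hp at 1. f_equal.
    rewrite !Cexp_imag.
    replace (arg0 z + 2 * PI)%R with (arg0 z + 2 * INR 1 * PI)%R by (simpl; ring).
    now rewrite cos_period, sin_period.
  - split; [lra|exact Hp].
Qed.

Lemma DplusE (kappa : R) (a b : R) :
  Dplus kappa (a, b) <-> (0 < b /\ a * (kappa ^ 2 + a ^ 2 - b ^ 2) < 0)%R.
Proof.
  unfold Dplus, D.
  replace (Re (Ci * (RtoC (kappa ^ 2) + (a, b) ^ 2) ^ 2))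
    with (- 4 * b * (a * (kappa ^ 2 + a ^ 2 - b ^ 2)))%R
    by (unfold RtoC; simpl; ring).
  simpl Im. split; intros [H1 H2]; split; nra.
Qed.

Definition frontier (A : C -> Prop) (z : C) : Prop :=
  forall eps : R, 0 < eps ->
    (exists w, Cmod (w - z) < eps /\ A w) /\ (exists w, Cmod (w - z) < eps /\ ~ A w).

Lemma Cmod_sq (a b : R) : (0 <= Cmod (a, b) /\ Cmod (a, b) ^ 2 = a ^ 2 + b ^ 2)%R.
Proof.
  split; [apply Cmod_ge_0|]. unfold Cmod; simpl fst; simpl snd.
  apply pow2_sqrt. nra.
Qed.

Lemma Cmod_sub_lt (x y a b d : R) : Cmod ((x, y) - (a, b)) < d ->
  Rabs (x - a) < d /\ Rabs (y - b) < d.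
Proof.
  intro Hw. assert (H := Rmax_Cmod ((x, y) - (a, b))).
  cbn in H.
  assert (H1 := Rmax_l (Rabs (x + - a)) (Rabs (y + - b))).
  assert (H2 := Rmax_r (Rabs (x + - a)) (Rabs (y + - b))).
  unfold Rminus; split; lra.
Qed.

Lemma frontier_Dplus (kappa a b : R) :
  frontier (Dplus kappa) (a, b) <->
  (0 <= b /\ (a = 0 \/ kappa ^ 2 + a ^ 2 = b ^ 2 \/ (b = 0 /\ a < 0)))%R.
Proof.
  split.
  - intro HF.
    assert (Hcont : forall f : R * R -> R, continuous f (a, b) -> 0 < f (a, b) ->
      exists d : R, 0 < d /\ forall w : C, Cmod (w - (a, b)) < d -> 0 < f w).
    { intros f Hf Hp.
      destruct (Hf (fun v => 0 < v)) as [d Hd].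
      { exists (mkposreal _ Hp). intros v Hv.
        unfold ball in Hv; simpl in Hv; unfold AbsRing_ball, abs, minus, plus, opp in Hv; simpl in Hv.
        apply Rabs_def2 in Hv. lra. }
      exists d. split; [apply cond_pos|]. intros [x y] Hw. apply Hd.
      apply Cmod_sub_lt in Hw.
      split; unfold ball; simpl; unfold AbsRing_ball, abs, minus, plus, opp; simpl; apply Hw. }
    assert (Hfst : continuous (fun p : R * R => fst p) (a, b)) by apply continuous_fst.
    assert (Hsnd : continuous (fun p : R * R => snd p) (a, b)) by apply continuous_snd.
    set (q := fun p : R * R => (fst p * (kappa ^ 2 + fst p * fst p - snd p * snd p))%R).
    assert (Hq : continuous q (a, b)).
    { apply (continuous_mult (K := R_AbsRing) (fun p : R * R => fst p)); trivial.
      apply (continuous_minus (V := R_NormedModule)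
        (fun p : R * R => kappa ^ 2 + fst p * fst p)%R (fun p => snd p * snd p)%R).
      - apply (continuous_plus (V := R_NormedModule)); [apply continuous_const|].
        now apply (continuous_mult (K := R_AbsRing) (fun p : R * R => fst p)).
      - now apply (continuous_mult (K := R_AbsRing) (fun p : R * R => snd p)). }
    assert (Hb : (0 <= b)%R).
    { destruct (Rle_dec 0 b) as [|Hn]; trivial. exfalso.
      destruct (HF (- b)%R) as [[[x y] [Hw HD]] _]; [lra|].
      apply DplusE in HD.
      apply Cmod_sub_lt in Hw. destruct Hw as [_ Hw]. apply Rabs_def2 in Hw. lra. }
    split; trivial.
    destruct (Req_dec a 0) as [|Ha]; [now left|right].
    destruct (Req_dec (kappa ^ 2 + a ^ 2) (b ^ 2)) as [|Hh]; [now left|right].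
    assert (Hq0 : q (a, b) <> 0%R).
    { unfold q; simpl fst; simpl snd. apply Rmult_integral_contrapositive.
      split; trivial. simpl in Hh. nra. }
    destruct (Rlt_or_le 0 (q (a, b))) as [Hpos|Hneg].
    + destruct (Hcont q Hq Hpos) as [d [Hd Hd']].
      destruct (HF d Hd) as [[[x y] [Hw HD]] _]. exfalso.
      apply DplusE in HD. apply Hd' in Hw. unfold q in Hw; simpl fst in Hw; simpl snd in Hw. nra.
    + assert (Hn : (0 < - q (a, b))%R) by lra.
      destruct (Rle_lt_or_eq_dec 0 b Hb) as [Hb0|Hb0].
      * exfalso.
        destruct (Hcont (fun p => - q p)%R) as [d [Hd Hd']]; trivial.
        { now apply (continuous_opp (V := R_NormedModule) q). }
        destruct (Hcont (fun p => snd p)) as [d2 [Hd2 Hd2']]; trivial.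
        destruct (HF (Rmin d d2)) as [_ [[x y] [Hw HD]]].
        { now apply Rmin_glb_lt. }
        apply HD, DplusE.
        assert (H1 := Rmin_l d d2). assert (H2 := Rmin_r d d2).
        assert (H3 := Hd' (x, y) (Rlt_le_trans _ _ _ Hw H1)).
        assert (H4 := Hd2' (x, y) (Rlt_le_trans _ _ _ Hw H2)).
        unfold q in H3; simpl fst in H3; simpl snd in H3; simpl snd in H4. nra.
      * subst b. split; trivial. unfold q in Hn; simpl fst in Hn; simpl snd in Hn.
        assert (0 <= kappa ^ 2)%R by nra.
        destruct (Rlt_or_le a 0) as [|Ha']; trivial. exfalso.
        assert (0 <= a * (kappa ^ 2 + a * a))%R by (apply Rmult_le_pos; nra). lra.
  - intros [Hb Hor] eps He.
    assert (Hk : (0 <= kappa ^ 2)%R) by nra.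
    split.
    + assert (Hsmall : forall h k : R, (Rabs h <= eps / 4 -> Rabs k <= eps / 2 ->
        Cmod ((a + h, b + k)%R - (a, b)) < eps)%R).
      { intros h k Hh Hk'.
        replace ((a + h, b + k)%R - (a, b)) with ((h, k) : C)
          by (unfold Cminus, Cplus, Copp; simpl; f_equal; ring).
        destruct (Cmod_sq h k) as [H0 H1].
        assert (h ^ 2 <= (eps / 4) ^ 2)%R by (apply pow_maj_Rabs; trivial).
        assert (k ^ 2 <= (eps / 2) ^ 2)%R by (apply pow_maj_Rabs; trivial).
        nra. }
      assert (He4 : Rabs (eps / 4) = (eps / 4)%R) by (apply Rabs_pos_eq; lra).
      assert (He2 : Rabs (eps / 2) = (eps / 2)%R) by (apply Rabs_pos_eq; lra).
      destruct (Rle_dec (kappa ^ 2 + a ^ 2) (b ^ 2)) as [H|H];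
        [destruct (Rle_dec 0 a) as [Ha|Ha]|].
      * exists ((a + eps / 4)%R, (b + eps / 2)%R). split; [apply Hsmall; lra|].
        apply DplusE. split; [lra|].
        assert (a <= b)%R by nra.
        assert (kappa ^ 2 + (a + eps / 4) ^ 2 - (b + eps / 2) ^ 2 < 0)%R by nra.
        nra.
      * assert (Hbp : (0 < b)%R) by (destruct Hb as [|Hb]; trivial; subst b; nra).
        assert (Heq : (kappa ^ 2 + a ^ 2 = b ^ 2)%R) by lra.
        exists ((a + - (eps / 4))%R, (b + 0)%R). split.
        { apply Hsmall; rewrite ?Rabs_Ropp, ?Rabs_R0; lra. }
        apply DplusE. split; [lra|].
        assert (0 < kappa ^ 2 + (a + - (eps / 4)) ^ 2 - (b + 0) ^ 2)%R by nra.
        nra.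
      * assert (Ha : (a <= 0)%R) by lra.
        destruct Hb as [Hb|Hb].
        -- exists ((a + - (eps / 4))%R, (b + 0)%R). split.
           { apply Hsmall; rewrite ?Rabs_Ropp, ?Rabs_R0; lra. }
           apply DplusE. split; [lra|].
           assert (0 < kappa ^ 2 + (a + - (eps / 4)) ^ 2 - (b + 0) ^ 2)%R by nra.
           nra.
        -- subst b. exists ((a + - (eps / 4))%R, (0 + eps / 8)%R). split.
           { apply Hsmall; rewrite ?Rabs_Ropp; try lra.
             rewrite Rabs_pos_eq; lra. }
           apply DplusE. split; [lra|].
           assert (0 < kappa ^ 2 + (a + - (eps / 4)) ^ 2 - (0 + eps / 8) ^ 2)%R by nra.
           nra.
    + exists (a, b). split.
      * replace ((a, b) - (a, b)) with (RtoC 0)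
          by (unfold Cminus, Cplus, Copp, RtoC; simpl; f_equal; ring).
        now rewrite Cmod_0.
      * rewrite DplusE. intros [H1 H2].
        destruct Hor as [H|[H|[H _]]]; [subst a|rewrite H in H2|]; nra.
Qed.

Lemma hyperbola_cutE (kappa r s : R) : Rabs kappa < r -> 0 <= s ->
  (s <= hyperbola_cut kappa r <-> kappa ^ 2 + 2 * s ^ 2 <= r ^ 2)%R.
Proof.
  intros Hr Hs.
  assert (Hk : (kappa ^ 2 <= r ^ 2)%R) by (apply pow_maj_Rabs; lra).
  unfold hyperbola_cut.
  assert (H0 := sqrt_pos ((r ^ 2 - kappa ^ 2) / 2)).
  assert (H1 : (sqrt ((r ^ 2 - kappa ^ 2) / 2) ^ 2 = (r ^ 2 - kappa ^ 2) / 2)%R)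
    by (apply pow2_sqrt; lra).
  split; intro H; nra.
Qed.

Lemma boundary_trace (kappa r : R) (z : C) : Rabs kappa < r ->
  (frontier (Dplus kappa) z /\ Cmod z <= r) <->
  (exists (a : arc) (s : R),
     In a (boundary_Dplus kappa) /\ from a r <= s <= to a r /\ z = pt a s).
Proof.
  intros Hr. destruct z as [a b]. rewrite frontier_Dplus.
  assert (Hak := Rabs_pos kappa).
  assert (Hk2 : (Rabs kappa ^ 2 = kappa ^ 2)%R) by apply pow2_abs.
  destruct (Cmod_sq a b) as [Hm0 Hm].
  assert (Hmr : Cmod (a, b) <= r <-> (a ^ 2 + b ^ 2 <= r ^ 2)%R) by (rewrite <- Hm; split; nra).
  rewrite Hmr. clear Hm0 Hm Hmr. split.
  - intros [[Hb Hor] Hm].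
    destruct (Rle_dec b 0) as [Hb0|Hb0]; [|destruct (Req_dec a 0) as [Ha|Ha]].
    + assert (b = 0)%R by lra. subst b.
      assert (Ha : (a <= 0)%R).
      { destruct Hor as [H|[H|[_ H]]]; try lra.
        assert (0 <= kappa ^ 2)%R by apply pow2_ge_0. nra. }
      eexists; exists a; split; [left; reflexivity|]. simpl.
      split; [split; nra|reflexivity].
    + subst a. destruct (Rle_dec b (Rabs kappa)) as [Hbk|Hbk].
      * eexists; exists b; split; [right; left; reflexivity|]. simpl.
        split; [lra|reflexivity].
      * eexists; exists (- b)%R; split; [do 3 right; left; reflexivity|]. simpl.
        split; [split; [nra|lra]|]. f_equal; ring.
    + assert (Hh : (kappa ^ 2 + a ^ 2 = b ^ 2)%R) by (destruct Hor as [H|[H|[H _]]]; lra).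
      assert (Hs : sqrt (kappa ^ 2 + a ^ 2) = b) by (rewrite Hh; apply sqrt_pow2; lra).
      destruct (Rlt_or_le a 0) as [Ha'|Ha'].
      * eexists; exists (- a)%R; split; [do 2 right; left; reflexivity|]. cbn [from to pt].
        split; [split; [lra|apply hyperbola_cutE; trivial; nra]|].
        replace ((- a) ^ 2)%R with (a ^ 2)%R by ring. rewrite Hs. f_equal; ring.
      * eexists; exists a; split; [do 4 right; left; reflexivity|]. cbn [from to pt].
        split; [split; [lra|apply hyperbola_cutE; trivial; nra]|].
        now rewrite Hs.
  - intros (ar & s & Hin & Hs & Hz).
    assert (Hsq : (0 <= sqrt (kappa ^ 2 + s ^ 2) /\
                   sqrt (kappa ^ 2 + s ^ 2) ^ 2 = kappa ^ 2 + s ^ 2)%R).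
    { split; [apply sqrt_pos|apply pow2_sqrt; nra]. }
    destruct Hsq as [Hsq0 Hsq].
    destruct Hin as [H|[H|[H|[H|[H|[]]]]]]; subst ar; cbn [from to pt] in Hs, Hz;
      assert (Ea := f_equal fst Hz); assert (Eb := f_equal snd Hz);
      cbn [fst snd] in Ea, Eb; subst a b; clear Hz.
    + split; [split; [lra|]|nra].
      destruct (Req_dec s 0) as [->|]; [now left|right; right; lra].
    + split; [split; [lra|now left]|nra].
    + destruct Hs as [Hs0 Hs]. apply hyperbola_cutE in Hs; trivial.
      split; [split; [trivial|right; left]|]; rewrite ?Hsq; nra.
    + split; [split; [lra|now left]|nra].
    + destruct Hs as [Hs0 Hs]. apply hyperbola_cutE in Hs; trivial.
      split; [split; [trivial|right; left]|]; rewrite ?Hsq; nra.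
Qed.

Lemma CDerive_pair (f g : R -> R) (s f' g' : R) :
  is_derive f s f' -> is_derive g s g' ->
  CDerive (fun r => (f r, g r)) s = (f', g').
Proof.
  intros Hf Hg. unfold CDerive; simpl.
  f_equal; now apply is_derive_unique.
Qed.

Lemma is_derive_hyperbola (kappa s : R) : 0 < s ->
  is_derive (fun s => sqrt (kappa ^ 2 + s ^ 2)) s (s / sqrt (kappa ^ 2 + s ^ 2))%R.
Proof.
  intros Hs. assert (0 < kappa ^ 2 + s ^ 2)%R by nra.
  auto_derive; [lra|].
  replace (kappa * (kappa * 1) + s * (s * 1))%R with (kappa ^ 2 + s ^ 2)%R by ring.
  assert (0 < sqrt (kappa ^ 2 + s ^ 2))%R by now apply sqrt_lt_R0.
  field. lra.
Qed.

Lemma boundary_left (kappa r s : R) (a : arc) : Rabs kappa < r ->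
  In a (boundary_Dplus kappa) -> from a r < s < to a r ->
  exists d : R, 0 < d /\ forall h : R, 0 < h < d ->
    Dplus kappa (pt a s + RtoC h * (Ci * CDerive (pt a) s)) /\
    ~ Dplus kappa (pt a s - RtoC h * (Ci * CDerive (pt a) s)).
Proof.
  intros Hr Hin Hs.
  assert (Hak := Rabs_pos kappa).
  assert (Hk2 : (Rabs kappa ^ 2 = kappa ^ 2)%R) by apply pow2_abs.
  assert (HL : forall x y f' g' h : R,
    ((x, y) : C) + RtoC h * (Ci * (f', g')) = (x - h * g', y + h * f')%R).
  { intros. unfold RtoC, Ci, Cplus, Cmult; simpl; f_equal; ring. }
  assert (HR : forall x y f' g' h : R,
    ((x, y) : C) - RtoC h * (Ci * (f', g')) = (x + h * g', y - h * f')%R).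
  { intros. unfold RtoC, Ci, Cminus, Copp, Cplus, Cmult; simpl; f_equal; ring. }
  assert (Hhyp : 0 < s -> exists w : R, 0 < w /\ (w ^ 2 = kappa ^ 2 + s ^ 2)%R /\
            w = sqrt (kappa ^ 2 + s ^ 2)).
  { intro H. exists (sqrt (kappa ^ 2 + s ^ 2)).
    repeat split; [apply sqrt_lt_R0; nra|apply pow2_sqrt; nra]. }
  destruct Hin as [H|[H|[H|[H|[H|[]]]]]]; subst a; cbn [from to pt] in *.
  - rewrite (CDerive_pair (fun s => s) (fun _ => 0%R) s 1 0)
      by (auto_derive; trivial; ring).
    exists (- s)%R. split; [lra|]. intros h Hh. rewrite HL, HR, !DplusE.
    split; [|lra]. split; [lra|].
    assert (0 < kappa ^ 2 + (s - h * 0) ^ 2 - (0 + h * 1) ^ 2)%R by nra. nra.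
  - rewrite (CDerive_pair (fun _ => 0%R) (fun s => s) s 0 1)
      by (auto_derive; trivial; ring).
    exists 1%R. split; [lra|]. intros h Hh. rewrite HL, HR, !DplusE.
    assert (s ^ 2 < kappa ^ 2)%R by nra.
    split; [split; [lra|]|intros [_ H']].
    + assert (0 < kappa ^ 2 + (0 - h * 1) ^ 2 - (s + h * 0) ^ 2)%R by nra. nra.
    + assert (0 < kappa ^ 2 + (0 + h * 1) ^ 2 - (s - h * 0) ^ 2)%R by nra. nra.
  - destruct (Hhyp (proj1 Hs)) as (w & Hw & Hw2 & Hws).
    rewrite (CDerive_pair (fun s => (- s)%R) (fun s => sqrt (kappa ^ 2 + s ^ 2)) s (-1) (s / w)).
    2: auto_derive; trivial; ring.
    2: rewrite Hws; apply is_derive_hyperbola; lra.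
    rewrite <- Hws.
    set (q := (s / w)%R).
    assert (Hq : (0 < q /\ q * w = s)%R).
    { split; [apply Rdiv_lt_0_compat; lra|unfold q; field; lra]. }
    clearbody q. destruct Hq as [Hq0 Hq].
    assert (Hsw : (s <= w)%R) by nra.
    assert (Hq1 : (q <= 1)%R) by (apply Rmult_le_reg_r with w; lra).
    exists (Rmin w s). split; [apply Rmin_glb_lt; lra|]. intros h Hh.
    assert (H1 := Rmin_l w s). assert (H2 := Rmin_r w s).
    assert (0 < h * w)%R by nra.
    assert (0 < h * (s * q))%R by (repeat apply Rmult_lt_0_compat; lra).
    assert (h * h < h * w)%R by nra.
    assert (h * q <= h * 1)%R by (apply Rmult_le_compat_l; lra).
    assert (0 <= h ^ 2 * q ^ 2)%R by (apply Rmult_le_pos; apply pow2_ge_0).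
    assert (h ^ 2 * q ^ 2 <= h ^ 2 * 1)%R by (apply Rmult_le_compat_l; nra).
    rewrite HL, HR, !DplusE.
    split; [split; [lra|]|intros [_ H']].
    + assert (0 < kappa ^ 2 + (- s - h * q) ^ 2 - (w + h * -1) ^ 2)%R by nra.
      assert (- s - h * q < 0)%R by nra. nra.
    + assert (kappa ^ 2 + (- s + h * q) ^ 2 - (w - h * -1) ^ 2 < 0)%R by nra.
      assert (- s + h * q <= 0)%R by nra. nra.
  - rewrite (CDerive_pair (fun _ => 0%R) (fun s => (- s)%R) s 0 (-1))
      by (auto_derive; trivial; ring).
    exists (- s - Rabs kappa)%R. split; [lra|]. intros h Hh. rewrite HL, HR, !DplusE.
    assert (kappa ^ 2 + h ^ 2 < s ^ 2)%R by nra.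
    split; [split; [lra|]|intros [_ H']]; nra.
  - destruct (Hhyp (proj1 Hs)) as (w & Hw & Hw2 & Hws).
    rewrite (CDerive_pair (fun s => s) (fun s => sqrt (kappa ^ 2 + s ^ 2)) s 1 (s / w)).
    2: auto_derive; trivial; ring.
    2: rewrite Hws; apply is_derive_hyperbola; lra.
    rewrite <- Hws.
    set (q := (s / w)%R).
    assert (Hq : (0 < q /\ q * w = s)%R).
    { split; [apply Rdiv_lt_0_compat; lra|unfold q; field; lra]. }
    clearbody q. destruct Hq as [Hq0 Hq].
    assert (Hsw : (s <= w)%R) by nra.
    assert (Hq1 : (q <= 1)%R) by (apply Rmult_le_reg_r with w; lra).
    exists (Rmin w s). split; [apply Rmin_glb_lt; lra|]. intros h Hh.
    assert (H1 := Rmin_l w s). assert (H2 := Rmin_r w s).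
    assert (0 < h * w)%R by nra.
    assert (0 < h * (s * q))%R by (repeat apply Rmult_lt_0_compat; lra).
    assert (h * h < h * w)%R by nra.
    assert (h * q <= h * 1)%R by (apply Rmult_le_compat_l; lra).
    assert (0 <= h ^ 2 * q ^ 2)%R by (apply Rmult_le_pos; apply pow2_ge_0).
    assert (h ^ 2 * q ^ 2 <= h ^ 2 * 1)%R by (apply Rmult_le_compat_l; nra).
    rewrite HL, HR, !DplusE.
    split; [split; [lra|]|intros [_ H']].
    + assert (kappa ^ 2 + (s - h * q) ^ 2 - (w + h * 1) ^ 2 < 0)%R by nra.
      assert (h * q < s)%R by nra. nra.
    + assert (0 < kappa ^ 2 + (s + h * q) ^ 2 - (w - h * 1) ^ 2)%R by nra.
      assert (0 < s + h * q)%R by nra. nra.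
Qed.

(* Main.v *)
Require Import Defs.
From Stdlib Require Import Reals Lra Lia List Classical IndefiniteDescription FunctionalExtensionality.
From Coquelicot Require Import Coquelicot.
Import ListNotations.
Open Scope R_scope.
Open Scope C_scope.

(** The Fourier transform w(y,t) of u in x solves, for each kappa, a problem on
    the half line.  Integrating it against exp(i z y) and over time yields the
    global relation: for Im z >= 0,
      exp(i omega t) L[w(.,0)](z) - L[w(.,t)](z) = B(-z),
    with L the Laplace type transform, omega = (kappa^2 + z^2)^2, and B(lambda) a
    combination of the t-transforms of w, w_y, w_yy, w_yyy at y = 0 that is entire
    in lambda.  On the contour lambda and nu both lie in the closed upper half
    plane and give the same omega.  The global relations at lambda and nu eliminate
    the unknown traces w_yy and w_yyy, which turns E G into exp(i kappa x) (A - B~)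
    with B~ = exp(i lambda y) B(lambda) and A built from L[w(.,t)] only.

    A is holomorphic with decay in each component of D^+, where sg = -1 (left)
    and sg = 1 (right) select the branch of nu, so its contour integral vanishes.
    B~ is holomorphic with decay in the complementary parts of the upper half
    plane, where Im omega >= 0, so its contour can be pushed down to the real line.
    There the global relation with z = - lambda and Fourier inversion on the half
    line leave 2 pi exp(i kappa x) w(y,t) minus the inner integral of the first
    term.  Fourier inversion in kappa finishes the proof. *)

(** * Continuity of complex valued functions *)

(** Three obstacles shape the development. The inner integral of the datum term in general converges
    only conditionally, since the half space transform decays like 1/lambda when u0 does not vanish
    at y = 0; splitting off the leading term and integrating by parts along the phase replaces it by
    an absolutely convergent integral with a bound that is integrable in kappa. The denominator nu -
    lambda vanishes at i |kappa|, a point of the contour; A is therefore written with a difference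
    quotient of L, which is continuous there. Finally u is smooth only up to the boundary; its
    derivatives are replaced by total continuous functions through projection onto the closed
    domain, differentiability is demanded only inside, and boundary statements follow by continuity.

    A and B~ decay only like 1/|lambda|, which is too slow for closing arcs by length alone. The
    factor exp(- y Im lambda) with y > 0 supplies the rest, as in Jordan's lemma. All limits are
    carried by explicit rates O(1/r), so that uniqueness of limits is a numerical comparison. *)

Lemma continuous_C_iff {T : UniformSpace} (f : T -> C) (x : T) :
  continuous f x <-> continuous (fun p => Re (f p)) x /\ continuous (fun p => Im (f p)) x.
Proof.
  split.
  - intro H. split.
    + apply (continuous_comp f Re); trivial. apply continuous_fst.
    + apply (continuous_comp f Im); trivial. apply continuous_snd.
  - intros [H1 H2]. apply (continuous_ext (fun p => (Re (f p), Im (f p)))).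
    { intro p. now destruct (f p). }
    apply (continuous_comp_2 (fun p => Re (f p)) (fun p => Im (f p)) (fun a b => (a, b))); trivial.
    apply (continuous_ext (fun p : R * R => p)); [now intros []|apply continuous_id].
Qed.

Section ContRules.
Context {T : UniformSpace}.
Implicit Types (f g : T -> R) (u v : T -> C) (x : T).

Lemma cont_pair f g x : continuous f x -> continuous g x ->
  continuous (fun p => (f p, g p) : C) x.
Proof. intros. apply continuous_C_iff. split; assumption. Qed.
Lemma cont_Re u x : continuous u x -> continuous (fun p => Re (u p)) x.
Proof. apply continuous_C_iff. Qed.
Lemma cont_Im u x : continuous u x -> continuous (fun p => Im (u p)) x.
Proof. apply continuous_C_iff. Qed.
Lemma cont_Rplus f g x : continuous f x -> continuous g x ->
  continuous (fun p => f p + g p)%R x.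
Proof. apply (continuous_plus (V := R_NormedModule)). Qed.
Lemma cont_Rminus f g x : continuous f x -> continuous g x ->
  continuous (fun p => f p - g p)%R x.
Proof. apply (continuous_minus (V := R_NormedModule)). Qed.
Lemma cont_Ropp f x : continuous f x -> continuous (fun p => - f p)%R x.
Proof. apply (continuous_opp (V := R_NormedModule)). Qed.
Lemma cont_Rmult f g x : continuous f x -> continuous g x ->
  continuous (fun p => f p * g p)%R x.
Proof. apply (continuous_mult (K := R_AbsRing)). Qed.
Lemma cont_Rpow f n x : continuous f x -> continuous (fun p => f p ^ n)%R x.
Proof.
  intro H. induction n as [|n IH]; simpl.
  - apply continuous_const.
  - now apply cont_Rmult.
Qed.
Lemma cont_real (h : R -> R) f x : continuity_pt h (f x) -> continuous f x ->
  continuous (fun p => h (f p)) x.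
Proof.
  intros H1 H2. apply (continuous_comp f h); trivial.
  now apply continuity_pt_filterlim.
Qed.
Lemma cont_Rinv f x : f x <> 0%R -> continuous f x -> continuous (fun p => / f p)%R x.
Proof.
  intros H1 H2. apply (continuous_comp f Rinv); trivial. now apply continuous_Rinv.
Qed.
Lemma cont_Rdiv f g x : g x <> 0%R -> continuous f x -> continuous g x ->
  continuous (fun p => f p / g p)%R x.
Proof. intros. apply cont_Rmult; trivial. now apply cont_Rinv. Qed.
Lemma cont_exp f x : continuous f x -> continuous (fun p => exp (f p)) x.
Proof. apply cont_real. apply derivable_continuous_pt, derivable_pt_exp. Qed.
Lemma cont_cos f x : continuous f x -> continuous (fun p => cos (f p)) x.
Proof. apply cont_real. apply derivable_continuous_pt, derivable_pt_cos. Qed.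
Lemma cont_sin f x : continuous f x -> continuous (fun p => sin (f p)) x.
Proof. apply cont_real. apply derivable_continuous_pt, derivable_pt_sin. Qed.
Lemma cont_Rabs f x : continuous f x -> continuous (fun p => Rabs (f p)) x.
Proof. intro. apply (continuous_comp f Rabs); trivial. apply continuous_Rabs. Qed.
Lemma cont_sqrt f x : continuous f x -> continuous (fun p => sqrt (f p)) x.
Proof. intro. apply (continuous_comp f sqrt); trivial. apply continuous_sqrt. Qed.
Lemma cont_Rmax f g x : continuous f x -> continuous g x ->
  continuous (fun p => Rmax (f p) (g p)) x.
Proof.
  intros. apply (continuous_ext (fun p => (f p + g p + Rabs (f p - g p)) * / 2)%R).
  { intro p. unfold Rmax, Rabs. destruct (Rle_dec (f p) (g p)), (Rcase_abs (f p - g p)); lra. }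
  apply cont_Rmult; [|apply continuous_const].
  apply cont_Rplus; [now apply cont_Rplus|]. now apply cont_Rabs, cont_Rminus.
Qed.
Lemma cont_Rmin f g x : continuous f x -> continuous g x ->
  continuous (fun p => Rmin (f p) (g p)) x.
Proof.
  intros. apply (continuous_ext (fun p => (f p + g p - Rabs (f p - g p)) * / 2)%R).
  { intro p. unfold Rmin, Rabs. destruct (Rle_dec (f p) (g p)), (Rcase_abs (f p - g p)); lra. }
  apply cont_Rmult; [|apply continuous_const].
  apply cont_Rminus; [now apply cont_Rplus|]. now apply cont_Rabs, cont_Rminus.
Qed.
Lemma cont_RtoC f x : continuous f x -> continuous (fun p => RtoC (f p)) x.
Proof. intro. apply cont_pair; trivial. apply continuous_const. Qed.
Lemma cont_Cplus u v x : continuous u x -> continuous v x -> continuous (fun p => u p + v p) x.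
Proof. apply (continuous_plus (V := C_R_NormedModule)). Qed.
Lemma cont_Copp u x : continuous u x -> continuous (fun p => - u p) x.
Proof. apply (continuous_opp (V := C_R_NormedModule)). Qed.
Lemma cont_Cminus u v x : continuous u x -> continuous v x -> continuous (fun p => u p - v p) x.
Proof. intros. apply cont_Cplus; trivial. now apply cont_Copp. Qed.
Lemma cont_Cmult u v x : continuous u x -> continuous v x -> continuous (fun p => u p * v p) x.
Proof.
  intros Hu Hv. assert (H1 := cont_Re _ _ Hu). assert (H2 := cont_Im _ _ Hu).
  assert (H3 := cont_Re _ _ Hv). assert (H4 := cont_Im _ _ Hv).
  apply cont_pair; [apply cont_Rminus|apply cont_Rplus]; apply cont_Rmult; assumption.
Qed.
Lemma cont_Cpow u n x : continuous u x -> continuous (fun p => u p ^ n) x.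
Proof.
  intro H. induction n as [|n IH]; simpl.
  - apply continuous_const.
  - now apply cont_Cmult.
Qed.
Lemma cont_Cexp u x : continuous u x -> continuous (fun p => Cexp (u p)) x.
Proof.
  intro H. apply cont_pair; apply cont_Rmult.
  1, 3: now apply cont_exp, cont_Re.
  - now apply cont_cos, cont_Im.
  - now apply cont_sin, cont_Im.
Qed.
Lemma cont_Cmod u x : continuous u x -> continuous (fun p => Cmod (u p)) x.
Proof.
  intro H. apply cont_sqrt, cont_Rplus; apply cont_Rpow; [now apply cont_Re|now apply cont_Im].
Qed.
Lemma cont_Cinv u x : u x <> 0 -> continuous u x -> continuous (fun p => / u p) x.
Proof.
  intros H0 H.
  assert (Hn : (Re (u x) ^ 2 + Im (u x) ^ 2 <> 0)%R).
  { intro E. apply H0. destruct (u x) as [a b]; simpl in E. unfold RtoC. f_equal; nra. }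
  assert (H1 := cont_Re _ _ H). assert (H2 := cont_Im _ _ H).
  assert (H3 : continuous (fun p => Re (u p) ^ 2 + Im (u p) ^ 2)%R x).
  { apply cont_Rplus; apply cont_Rpow; assumption. }
  apply cont_pair; apply cont_Rdiv; try assumption. apply cont_Ropp; assumption.
Qed.
Lemma cont_Cdiv u v x : v x <> 0 -> continuous u x -> continuous v x ->
  continuous (fun p => u p / v p) x.
Proof. intros. apply cont_Cmult; trivial. now apply cont_Cinv. Qed.
End ContRules.

Lemma cont_fst {A B : UniformSpace} {T : UniformSpace} (f : T -> A * B) x :
  continuous f x -> continuous (fun p => fst (f p)) x.
Proof. intro. apply (continuous_comp f fst); trivial. apply continuous_fst. Qed.
Lemma cont_snd {A B : UniformSpace} {T : UniformSpace} (f : T -> A * B) x :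
  continuous f x -> continuous (fun p => snd (f p)) x.
Proof. intro. apply (continuous_comp f snd); trivial. apply continuous_snd. Qed.

(* Joint continuity, in a form that composes by [apply]. *)
Definition jcont2 (F : R -> R -> C) := forall (T : UniformSpace) (a b : T -> R) (p : T),
  continuous a p -> continuous b p -> continuous (fun q => F (a q) (b q)) p.
Definition jcont3 (F : R -> R -> R -> C) := forall (T : UniformSpace) (a b c : T -> R) (p : T),
  continuous a p -> continuous b p -> continuous c p ->
  continuous (fun q => F (a q) (b q) (c q)) p.

Ltac cont1 :=
  match goal with
  | H : context [continuous] |- _ => solve [apply H; repeat cont1]
  | H : jcont2 _ |- _ => apply H
  | H : jcont3 _ |- _ => apply H
  | |- continuous (fun _ => ?c) _ => apply continuous_const
  | |- continuous (fun x => x) _ => apply continuous_id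
  | |- continuous (fun x => fst x) _ => apply continuous_fst
  | |- continuous (fun x => snd x) _ => apply continuous_snd
  | |- continuous (fun x => fst _) _ => apply cont_fst
  | |- continuous (fun x => snd _) _ => apply cont_snd
  | |- continuous (fun x => Re _) _ => apply cont_Re
  | |- continuous (fun x => Im _) _ => apply cont_Im
  | |- continuous (fun x => (_ + _)%R) _ => apply cont_Rplus
  | |- continuous (fun x => (_ - _)%R) _ => apply cont_Rminus
  | |- continuous (fun x => (- _)%R) _ => apply cont_Ropp
  | |- continuous (fun x => (_ * _)%R) _ => apply cont_Rmult
  | |- continuous (fun x => (_ ^ _)%R) _ => apply cont_Rpow
  | |- continuous (fun x => (_ / _)%R) _ => apply cont_Rdiv
  | |- continuous (fun x => (/ _)%R) _ => apply cont_Rinv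
  | |- continuous (fun x => exp _) _ => apply cont_exp
  | |- continuous (fun x => cos _) _ => apply cont_cos
  | |- continuous (fun x => sin _) _ => apply cont_sin
  | |- continuous (fun x => sqrt _) _ => apply cont_sqrt
  | |- continuous (fun x => Rabs _) _ => apply cont_Rabs
  | |- continuous (fun x => Rmax _ _) _ => apply cont_Rmax
  | |- continuous (fun x => Rmin _ _) _ => apply cont_Rmin
  | |- continuous (fun x => RtoC _) _ => apply cont_RtoC
  | |- continuous (fun x => (_ + _)) _ => apply cont_Cplus
  | |- continuous (fun x => (_ - _)) _ => apply cont_Cminus
  | |- continuous (fun x => (- _)) _ => apply cont_Copp
  | |- continuous (fun x => (_ * _)) _ => apply cont_Cmult
  | |- continuous (fun x => (_ ^ _)) _ => apply cont_Cpow
  | |- continuous (fun x => Cexp _) _ => apply cont_Cexp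
  | |- continuous (fun x => Cmod _) _ => apply cont_Cmod
  | |- continuous (fun x => (_ / _)) _ => apply cont_Cdiv
  | |- continuous (fun x => (/ _)) _ => apply cont_Cinv
  | |- continuous (fun x => (_, _)) _ => apply cont_pair
  | |- continuous _ _ => solve [auto]
  end.
Ltac cont := repeat cont1.

(** * Differentiation of complex valued functions of a real variable *)

Notation is_Cderive := (is_derive (K := R_AbsRing) (V := C_R_NormedModule)).

Lemma is_Cderive_iff (f : R -> C) (x : R) (l : C) :
  is_Cderive f x l <->
  is_derive (fun s => Re (f s)) x (Re l) /\ is_derive (fun s => Im (f s)) x (Im l).
Proof.
  split.
  - intros H. split.
    + eapply filterdiff_ext_lin.
      * apply (filterdiff_comp f Re _ (fun y => Re y) H).
        apply filterdiff_linear, is_linear_fst.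
      * intro y. reflexivity.
    + eapply filterdiff_ext_lin.
      * apply (filterdiff_comp f Im _ (fun y => Im y) H).
        apply filterdiff_linear, is_linear_snd.
      * intro y. reflexivity.
  - intros [H1 H2].
    apply (is_derive_ext (fun s => (Re (f s), Im (f s)) : C)).
    { intro t. now destruct (f t). }
    eapply filterdiff_ext_lin.
    + apply (filterdiff_comp_2 (fun s => Re (f s)) (fun s => Im (f s)) (fun a b => (a, b) : C) _ _ (fun a b => (a, b) : C) H1 H2).
      apply (filterdiff_ext_lin _ (fun t => t)).
      * apply (filterdiff_ext (fun t => t)); [now intros []|]. apply filterdiff_id.
      * now intros [].
    + intro y. destruct l; reflexivity.
Qed.

Lemma is_Cderive_continuous f x l : is_Cderive f x l -> continuous f x.
Proof. intro H. apply (ex_derive_continuous (V := C_R_NormedModule)). now exists l. Qed.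

Lemma Cd_const (c : C) (x : R) : is_Cderive (fun _ => c) x (RtoC 0).
Proof. apply (is_derive_const (V := C_R_NormedModule)). Qed.
Lemma Cd_plus (f g : R -> C) (x : R) (a b : C) : is_Cderive f x a -> is_Cderive g x b ->
  is_Cderive (fun s => f s + g s) x (a + b).
Proof. apply (is_derive_plus (V := C_R_NormedModule)). Qed.
Lemma Cd_opp (f : R -> C) (x : R) (a : C) : is_Cderive f x a -> is_Cderive (fun s => - f s) x (- a).
Proof. apply (is_derive_opp (V := C_R_NormedModule)). Qed.
Lemma Cd_minus (f g : R -> C) (x : R) (a b : C) : is_Cderive f x a -> is_Cderive g x b ->
  is_Cderive (fun s => f s - g s) x (a - b).
Proof. apply (is_derive_minus (V := C_R_NormedModule)). Qed.
Lemma Rd_mult (f g : R -> R) (x a b : R) : is_derive f x a -> is_derive g x b ->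
  is_derive (fun s => f s * g s)%R x (a * g x + f x * b)%R.
Proof. intros. apply (is_derive_mult (K := R_AbsRing)); trivial. intros; apply Rmult_comm. Qed.
Lemma Cd_mult (f g : R -> C) (x : R) (a b : C) : is_Cderive f x a -> is_Cderive g x b ->
  is_Cderive (fun s => f s * g s) x (a * g x + f x * b).
Proof.
  rewrite !is_Cderive_iff. intros [H1 H2] [H3 H4]. split.
  - replace (Re (a * g x + f x * b)) with
      ((Re a * Re (g x) + Re (f x) * Re b) - (Im a * Im (g x) + Im (f x) * Im b))%R
      by (unfold Re, Im; simpl; ring).
    apply (is_derive_minus (V := R_NormedModule)); now apply Rd_mult.
  - replace (Im (a * g x + f x * b)) with
      ((Re a * Im (g x) + Re (f x) * Im b) + (Im a * Re (g x) + Im (f x) * Re b))%R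
      by (unfold Re, Im; simpl; ring).
    apply (is_derive_plus (V := R_NormedModule)); now apply Rd_mult.
Qed.
Lemma Cd_scal (c : C) (f : R -> C) (x : R) (a : C) : is_Cderive f x a -> is_Cderive (fun s => c * f s) x (c * a).
Proof.
  intro H. replace (c * a) with (0 * f x + c * a) by ring.
  apply (Cd_mult (fun _ => c)); trivial. apply Cd_const.
Qed.
Lemma Cd_RtoC (f : R -> R) (x a : R) : is_derive f x a -> is_Cderive (fun s => RtoC (f s)) x (RtoC a).
Proof.
  intro H. apply is_Cderive_iff. split; [exact H|].
  change (is_derive (fun _ : R => 0%R) x (zero : R_NormedModule)).
  apply (@is_derive_const R_AbsRing R_NormedModule).
Qed.
Lemma Cd_id (x : R) : is_Cderive RtoC x (RtoC 1).
Proof. apply (Cd_RtoC (fun s => s)). apply (@is_derive_id R_AbsRing). Qed.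
Lemma Cd_Cexp (f : R -> C) (x : R) (a : C) : is_Cderive f x a -> is_Cderive (fun s => Cexp (f s)) x (a * Cexp (f x)).
Proof.
  rewrite !is_Cderive_iff. intros [H1 H2].
  assert (He := is_derive_comp exp _ _ _ _ (is_derive_exp (Re (f x))) H1).
  assert (Hc := is_derive_comp cos _ _ _ _ (is_derive_cos (Im (f x))) H2).
  assert (Hs := is_derive_comp sin _ _ _ _ (is_derive_sin (Im (f x))) H2).
  assert (H3 := Rd_mult _ _ _ _ _ He Hc). assert (H4 := Rd_mult _ _ _ _ _ He Hs).
  unfold scal in H3, H4; simpl in H3, H4; unfold mult in H3, H4; simpl in H3, H4.
  split.
  - replace (Re (a * Cexp (f x))) with (Re a * exp (Re (f x)) * cos (Im (f x)) +
      exp (Re (f x)) * (Im a * - sin (Im (f x))))%R by (unfold Cexp, Re, Im; simpl; ring).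
    exact H3.
  - replace (Im (a * Cexp (f x))) with (Re a * exp (Re (f x)) * sin (Im (f x)) +
      exp (Re (f x)) * (Im a * cos (Im (f x))))%R by (unfold Cexp, Re, Im; simpl; ring).
    exact H4.
Qed.
Lemma Cd_pair (f g : R -> R) (x a b : R) : is_derive f x a -> is_derive g x b ->
  is_Cderive (fun s => (f s, g s)) x (a, b).
Proof. intros. now apply is_Cderive_iff. Qed.
(** Separates the two halves of a derivative computation: the rules produce some value by
    unification, and algebra then matches it with the expected one. *)
Lemma Cd_eq (f : R -> C) (x : R) (a b : C) : is_Cderive f x a -> a = b -> is_Cderive f x b.
Proof. now intros H <-. Qed.
Lemma Cd_comp (f : R -> C) (g : R -> R) (x : R) (df : C) (dg : R) :
  is_Cderive f (g x) df -> is_derive g x dg -> is_Cderive (fun s => f (g s)) x (RtoC dg * df).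
Proof.
  intros H1 H2. eapply Cd_eq; [exact (is_derive_comp f g x df dg H1 H2)|].
  apply injective_projections; simpl; unfold scal; simpl; unfold mult; simpl; ring.
Qed.

Lemma Cexp_plus a b : Cexp (a + b) = Cexp a * Cexp b.
Proof.
  destruct a as [a1 a2], b as [b1 b2]. unfold Cexp, Cmult, Cplus; simpl.
  rewrite exp_plus, cos_plus, sin_plus. f_equal; ring.
Qed.
Lemma Cexp_0 : Cexp 0 = 1.
Proof. unfold Cexp, RtoC; simpl. rewrite exp_0, cos_0, sin_0. f_equal; ring. Qed.
Lemma Cmod_Cexp z : Cmod (Cexp z) = exp (Re z).
Proof.
  unfold Cmod, Cexp; simpl fst; simpl snd.
  replace ((exp (Re z) * cos (Im z)) ^ 2 + (exp (Re z) * sin (Im z)) ^ 2)%R with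
    (exp (Re z) ^ 2 * (Rsqr (sin (Im z)) + Rsqr (cos (Im z))))%R by (unfold Rsqr; ring).
  rewrite sin2_cos2, Rmult_1_r. apply sqrt_pow2. left; apply exp_pos.
Qed.
Lemma exp_le_1 a : (a <= 0)%R -> (exp a <= 1)%R.
Proof.
  intros [H| ->]; [|rewrite exp_0; lra]. left. rewrite <- exp_0. now apply exp_increasing.
Qed.
Lemma Cmod_Cexp_le z : (Re z <= 0)%R -> (Cmod (Cexp z) <= 1)%R.
Proof. intro H. rewrite Cmod_Cexp. now apply exp_le_1. Qed.
Lemma Re_le_Cmod z : (Rabs (Re z) <= Cmod z)%R.
Proof. assert (H := Rmax_Cmod z). eapply Rle_trans; [apply Rmax_l|exact H]. Qed.
Lemma Im_le_Cmod z : (Rabs (Im z) <= Cmod z)%R.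
Proof. assert (H := Rmax_Cmod z). eapply Rle_trans; [apply Rmax_r|exact H]. Qed.
Lemma Cmod_sum_le a b : (Cmod (a, b) <= Rabs a + Rabs b)%R.
Proof.
  destruct (Cmod_sq a b) as [H1 H2]. assert (H3 := Rabs_pos a). assert (H4 := Rabs_pos b).
  rewrite <- (pow2_abs a), <- (pow2_abs b) in H2. nra.
Qed.

(** * Integrals of continuous functions over compact intervals *)

Ltac cring := match goal with |- @eq _ ?a ?b => change (@eq C a b) end; cbv beta; ring.

Notation is_CRInt := (is_RInt (V := C_R_NormedModule)).
Notation ex_CRInt := (ex_RInt (V := C_R_NormedModule)).
Notation Cont f := (forall z, continuous f z).

Lemma ex_CInt (f : R -> C) (a b : R) : Cont f -> ex_CRInt f a b.
Proof.
  intro H. apply (@ex_RInt_continuous C_R_CompleteNormedModule). intros z _. apply H.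
Qed.
Lemma CInt_correct (f : R -> C) (a b : R) : Cont f -> is_CRInt f a b (CInt f a b).
Proof. intro H. apply (@RInt_correct C_R_CompleteNormedModule). now apply ex_CInt. Qed.
Lemma CInt_unique (f : R -> C) (a b : R) (l : C) : is_CRInt f a b l -> CInt f a b = l.
Proof. apply (@is_RInt_unique C_R_CompleteNormedModule). Qed.

Lemma is_CRInt_scal (c : C) (f : R -> C) (a b : R) (l : C) :
  is_CRInt f a b l -> is_CRInt (fun x => c * f x) a b (c * l).
Proof.
  intro H.
  assert (H1 := is_RInt_fct_extend_fst f a b l H).
  assert (H2 := is_RInt_fct_extend_snd f a b l H).
  apply (is_RInt_fct_extend_pair (U := R_NormedModule) (V := R_NormedModule)).
  - apply (is_RInt_minus (V := R_NormedModule)); now apply (is_RInt_scal (V := R_NormedModule)).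
  - apply (is_RInt_plus (V := R_NormedModule)); now apply (is_RInt_scal (V := R_NormedModule)).
Qed.
Lemma is_CRInt_plus (f g : R -> C) (a b : R) (l m : C) :
  is_CRInt f a b l -> is_CRInt g a b m -> is_CRInt (fun x => f x + g x) a b (l + m).
Proof. apply (is_RInt_plus (V := C_R_NormedModule)). Qed.
Lemma is_CRInt_minus (f g : R -> C) (a b : R) (l m : C) :
  is_CRInt f a b l -> is_CRInt g a b m -> is_CRInt (fun x => f x - g x) a b (l - m).
Proof. apply (is_RInt_minus (V := C_R_NormedModule)). Qed.
Lemma is_CRInt_ext (f g : R -> C) (a b : R) (l : C) :
  (forall x, (Rmin a b < x < Rmax a b)%R -> f x = g x) -> is_CRInt f a b l -> is_CRInt g a b l.
Proof. apply (is_RInt_ext (V := C_R_NormedModule)). Qed.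

Lemma CInt_plus (f g : R -> C) (a b : R) : Cont f -> Cont g ->
  CInt (fun x => f x + g x) a b = CInt f a b + CInt g a b.
Proof. intros. apply CInt_unique, is_CRInt_plus; now apply CInt_correct. Qed.
Lemma CInt_minus (f g : R -> C) (a b : R) : Cont f -> Cont g ->
  CInt (fun x => f x - g x) a b = CInt f a b - CInt g a b.
Proof. intros. apply CInt_unique, is_CRInt_minus; now apply CInt_correct. Qed.
Lemma CInt_scal (c : C) (f : R -> C) (a b : R) : Cont f ->
  CInt (fun x => c * f x) a b = c * CInt f a b.
Proof. intros. apply CInt_unique, is_CRInt_scal; now apply CInt_correct. Qed.
Lemma CInt_ext (f g : R -> C) (a b : R) :
  (forall x, (Rmin a b < x < Rmax a b)%R -> f x = g x) -> CInt f a b = CInt g a b.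
Proof. apply (@RInt_ext C_R_CompleteNormedModule). Qed.
Lemma CInt_ext_le (f g : R -> C) (a b : R) : (a <= b)%R ->
  (forall x, (a < x < b)%R -> f x = g x) -> CInt f a b = CInt g a b.
Proof.
  intros Hab H. apply CInt_ext. intros x Hx.
  rewrite Rmin_left, Rmax_right in Hx by trivial. now apply H.
Qed.
Lemma CInt_point (f : R -> C) (a : R) : CInt f a a = 0.
Proof. apply (@RInt_point C_R_CompleteNormedModule). Qed.
Lemma CInt_Chasles (f : R -> C) (a b c : R) : Cont f ->
  CInt f a b + CInt f b c = CInt f a c.
Proof. intro H. apply (@RInt_Chasles C_R_CompleteNormedModule); now apply ex_CInt. Qed.
Lemma CInt_swap (f : R -> C) (a b : R) : Cont f -> CInt f b a = - CInt f a b.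
Proof.
  intro H. assert (E := CInt_Chasles f a b a H). rewrite CInt_point in E.
  replace (CInt f b a) with (CInt f a b + CInt f b a - CInt f a b) by ring. rewrite E. ring.
Qed.

Lemma is_CRInt_bound (f : R -> C) (a b : R) (l : C) (M : R) : (a <= b)%R ->
  (forall x, (a <= x <= b)%R -> (Cmod (f x) <= M)%R) -> is_CRInt f a b l ->
  (Cmod l <= (b - a) * M)%R.
Proof.
  intros Hab H Hl. rewrite Cmod_norm.
  apply (norm_RInt_le_const (V := C_R_NormedModule) f a b); trivial.
  intros x Hx. rewrite <- Cmod_norm. now apply H.
Qed.
Lemma CInt_bound (f : R -> C) (a b : R) (M : R) : Cont f -> (a <= b)%R ->
  (forall x, (a <= x <= b)%R -> (Cmod (f x) <= M)%R) ->
  (Cmod (CInt f a b) <= (b - a) * M)%R.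
Proof.
  intros. apply is_CRInt_bound with f; trivial. now apply CInt_correct.
Qed.
Lemma CInt_bound_abs (f : R -> C) (a b : R) (M : R) : Cont f ->
  (forall x, (Rmin a b <= x <= Rmax a b)%R -> (Cmod (f x) <= M)%R) ->
  (Cmod (CInt f a b) <= Rabs (b - a) * M)%R.
Proof.
  intros Hf H. rewrite Cmod_norm.
  apply (norm_RInt_le_const_abs (V := C_R_NormedModule) f a b).
  - intros x Hx. rewrite <- Cmod_norm. now apply H.
  - now apply CInt_correct.
Qed.
Lemma CInt_bound_fun (f : R -> C) (g : R -> R) (a b l : R) : Cont f -> (a <= b)%R ->
  is_RInt g a b l ->
  (forall x, (a <= x <= b)%R -> (Cmod (f x) <= g x)%R) -> (Cmod (CInt f a b) <= l)%R.
Proof.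
  intros Hf Hab Hg H. rewrite Cmod_norm.
  apply (norm_RInt_le (V := C_R_NormedModule) f g a b); trivial.
  - intros x Hx. rewrite <- Cmod_norm. now apply H.
  - now apply CInt_correct.
Qed.

Lemma CInt_subst (f : R -> C) (g dg : R -> R) (a b : R) : Cont f ->
  (forall x, (Rmin a b <= x <= Rmax a b)%R -> is_derive g x (dg x) /\ continuous dg x) ->
  is_CRInt (fun x => RtoC (dg x) * f (g x)) a b (CInt f (g a) (g b)).
Proof.
  intros Hf Hg.
  assert (H := @is_RInt_comp C_R_CompleteNormedModule f g dg a b (fun x _ => Hf (g x)) Hg).
  eapply is_CRInt_ext; [|exact H].
  intros x _. unfold scal. destruct (f (g x)) as [u v].
  apply injective_projections; simpl; unfold scal; simpl; unfold mult; simpl; ring.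
Qed.

Lemma continuous_Cmod_iff {T : UniformSpace} (f : T -> C) (p : T) :
  continuous f p <-> forall e : R, (0 < e)%R -> locally p (fun q => (Cmod (f q - f p) < e)%R).
Proof.
  split.
  - intros H e He.
    assert (H' := proj1 (filterlim_locally_ball_norm (K := R_AbsRing) (U := C_R_NormedModule) f (f p)) H (mkposreal e He)).
    revert H'. apply filter_imp. intros q Hq. unfold ball_norm in Hq. rewrite Cmod_norm. exact Hq.
  - intro H. apply (filterlim_locally_ball_norm (K := R_AbsRing) (U := C_R_NormedModule) f (f p)).
    intros [e He]. generalize (H e He). apply filter_imp. intros q Hq.
    unfold ball_norm. rewrite Cmod_norm in Hq. exact Hq.
Qed.

(** Continuity at a zero by squeezing; it serves at the endpoint of the compactified interval. *)
Lemma continuous_dominated {T : UniformSpace} (f : T -> C) (g : T -> R) (p : T) :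
  f p = 0 -> g p = 0%R -> continuous g p -> locally p (fun q => (Cmod (f q) <= g q)%R) ->
  continuous f p.
Proof.
  intros Hf Hg Hc Hd. apply continuous_Cmod_iff. intros e He.
  assert (H1 : locally p (fun q => (g q < e)%R)).
  { apply (Hc (fun v => (v < e)%R)). rewrite Hg. exists (mkposreal e He). intros v Hv.
    apply Rabs_def2 in Hv. simpl in Hv. unfold minus, plus, opp in Hv; simpl in Hv. lra. }
  generalize (filter_and _ _ Hd H1). apply filter_imp. intros q [Hq1 Hq2].
  rewrite Hf. replace (f q - 0) with (f q) by ring. lra.
Qed.

(** Tube lemma. Joint continuity gives each [s] a radius on which [F] stays within [e / 2] of
    [F p s]; these radii form a gauge on the compact interval, and a positive lower bound for the
    gauge gives one neighbourhood of [p] that works for all [s]. *)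
Lemma uniform_tube {T : UniformSpace} (F : T -> R -> C) (a b : R) (p : T) :
  (forall s, (a <= s <= b)%R -> continuous (fun z : T * R => F (fst z) (snd z)) (p, s)) ->
  forall e : R, (0 < e)%R ->
  locally p (fun q => forall s, (a <= s <= b)%R -> (Cmod (F q s - F p s) < e)%R).
Proof.
  intros H e He.
  assert (Hd : forall s, exists d : posreal, (a <= s <= b)%R -> forall q s', ball p d q ->
    (Rabs (s' - s) < d)%R -> (Cmod (F q s' - F p s) < e / 2)%R).
  { intro s. destruct (classic ((a <= s <= b)%R)) as [Hs|Hs].
    - assert (H1 := proj1 (continuous_Cmod_iff _ _) (H s Hs) (e / 2)%R ltac:(lra)).
      destruct H1 as [d Hd]. exists d. intros _ q s' Hq Hs'.
      apply (Hd (q, s')). split; trivial.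
    - exists (mkposreal 1 Rlt_0_1). intro; contradiction. }
  pose (dl := fun s => proj1_sig (constructive_indefinite_description _ (Hd s))).
  assert (Hdl : forall s, (a <= s <= b)%R -> forall q s', ball p (dl s) q ->
    (Rabs (s' - s) < dl s)%R -> (Cmod (F q s' - F p s) < e / 2)%R).
  { intro s. unfold dl. now destruct (constructive_indefinite_description _ (Hd s)). }
  (* Compactness returns a uniform radius [d] and, under a double negation, a centre [t] near [s]
     whose radius is at least [d]; hence the argument by contradiction. Both [F q s] and [F p s] are
     then compared with [F p t]. *)
  destruct (compactness_value_1d a b dl) as [d Hd2].
  exists d. intros q Hq s Hs.
  apply NNPP. intro Hn. apply (Hd2 s Hs). intros (t & Ht & Hst & Hdt). apply Hn.
  replace (F q s - F p s) with ((F q s - F p t) - (F p s - F p t)) by ring.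
  eapply Rle_lt_trans; [apply Cmod_triangle|]. rewrite Cmod_opp.
  assert (H1 := Hdl t Ht q s (ball_le _ _ _ Hdt _ Hq) Hst).
  assert (H2 := Hdl t Ht p s (ball_center _ _) Hst). lra.
Qed.

Lemma cont_section {T : UniformSpace} (F : T -> R -> C) (q : T) (s : R) :
  continuous (fun z : T * R => F (fst z) (snd z)) (q, s) -> continuous (F q) s.
Proof.
  intro H. apply (continuous_comp (fun s => (q, s)) (fun z : T * R => F (fst z) (snd z))); trivial.
  apply (continuous_comp_2 (fun _ => q) (fun s => s) (fun a b => (a, b))).
  - apply continuous_const.
  - apply continuous_id.
  - apply (continuous_ext (fun z : T * R => z)); [now intros []|apply continuous_id].
Qed.

Lemma cont_CInt_param {T : UniformSpace} (F : T -> R -> C) (a b : R) (p : T) : (a <= b)%R ->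
  (forall q s, continuous (fun z : T * R => F (fst z) (snd z)) (q, s)) ->
  continuous (fun q => CInt (F q) a b) p.
Proof.
  intros Hab H. apply continuous_Cmod_iff. intros e He.
  (* The added 1 keeps the quotient positive and defined when [a = b]. *)
  assert (He' : (0 < e / (b - a + 1))%R) by (apply Rdiv_lt_0_compat; lra).
  generalize (uniform_tube F a b p (fun s _ => H p s) _ He'). apply filter_imp.
  intros q Hq. rewrite <- CInt_minus by (intro; apply cont_section, H).
  eapply Rle_lt_trans.
  - apply CInt_bound; trivial.
    + intro z. apply cont_Cminus; apply cont_section, H.
    + intros s Hs. left. apply Hq, Hs.
  - apply Rlt_le_trans with ((b - a + 1) * (e / (b - a + 1)))%R.
    + apply Rmult_lt_compat_r; lra.
    + right. field. lra.
Qed.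

Lemma is_derive_CInt (f : R -> C) (a z : R) : Cont f -> is_Cderive (fun b => CInt f a b) z (f z).
Proof.
  intro H. apply (is_derive_RInt (V := C_R_NormedModule) f _ a).
  - apply filter_forall. intro b. now apply CInt_correct.
  - apply H.
Qed.

Lemma is_Cderive_eps (f : R -> C) (x : R) (l : C) :
  (forall e : R, (0 < e)%R -> locally x (fun y => (Cmod (f y - f x - RtoC (y - x) * l) <= e * Rabs (y - x))%R)) ->
  is_Cderive f x l.
Proof.
  intro H. split; [apply is_linear_scal_l|].
  intros x' Hx'. apply (is_filter_lim_locally_unique (V := AbsRing_NormedModule R_AbsRing)) in Hx'. subst x'.
  intros [e He]. generalize (H e He). apply filter_imp. intros y Hy.
  simpl. eapply Rle_trans; [|exact Hy]. right. rewrite Cmod_norm. f_equal.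
  unfold minus, plus, opp, scal; simpl. destruct (f y), (f x), l.
  apply injective_projections; simpl; unfold plus, opp, scal; simpl; unfold mult; simpl; ring.
Qed.

(** The mean value theorem fails for complex values, so it is applied to the real and imaginary
    parts. Only interior derivatives enter, which suits functions that are merely continuous up to
    the boundary. *)
Lemma derive0_const (h : R -> C) (a b : R) : (a <= b)%R ->
  (forall x, (a <= x <= b)%R -> continuous h x) ->
  (forall x, (a < x < b)%R -> is_Cderive h x (RtoC 0)) -> h b = h a.
Proof.
  intros Hab Hc Hd.
  assert (HR : forall P : C -> R, (forall x, (a <= x <= b)%R -> continuous (fun s => P (h s)) x) ->
    (forall x, (a < x < b)%R -> is_derive (fun s => P (h s)) x 0%R) -> P (h b) = P (h a)).
  { intros P H1 H2.
    destruct (MVT_gen (fun s => P (h s)) a b (fun _ => 0%R)) as [c [_ E]].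
    - rewrite Rmin_left, Rmax_right by trivial. exact H2.
    - rewrite Rmin_left, Rmax_right by trivial. intros x Hx.
      apply continuity_pt_filterlim. now apply H1.
    - lra. }
  rewrite (surjective_pairing (h b)), (surjective_pairing (h a)). f_equal.
  - apply (HR Re); intros x Hx; [apply cont_Re; auto|].
    exact (proj1 (proj1 (is_Cderive_iff _ _ _) (Hd x Hx))).
  - apply (HR Im); intros x Hx; [apply cont_Im; auto|].
    exact (proj2 (proj1 (is_Cderive_iff _ _ _) (Hd x Hx))).
Qed.

(** The difference of [f] and the primitive of [g] has zero derivative inside. At the endpoints
    continuity is enough, which is all that is known at traces such as y = 0 and at the initial
    time. *)
Lemma CInt_FTC (f g : R -> C) (a b : R) : (a <= b)%R -> Cont g ->
  (forall x, (a <= x <= b)%R -> continuous f x) ->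
  (forall x, (a < x < b)%R -> is_Cderive f x (g x)) -> CInt g a b = f b - f a.
Proof.
  intros Hab Hg Hf Hd.
  assert (E : f b - CInt g a b = f a - CInt g a a).
  { apply (derive0_const (fun x => f x - CInt g a x)); trivial.
    - intros x Hx. apply cont_Cminus; auto.
      eapply is_Cderive_continuous. now apply is_derive_CInt.
    - intros x Hx. eapply Cd_eq; [apply Cd_minus; [now apply Hd|now apply is_derive_CInt]|].
      ring. }
  rewrite CInt_point in E. replace (f b) with (f b - CInt g a b + CInt g a b) by ring.
  rewrite E. ring.
Qed.

Lemma jcont2_pair (F : R -> R -> C) (x y : R) : jcont2 F ->
  continuous (fun z : R * R => F (fst z) (snd z)) (x, y).
Proof. intro H. apply H; [apply continuous_fst|apply continuous_snd]. Qed.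
Lemma jcont2_swap (F : R -> R -> C) : jcont2 F -> jcont2 (fun x y => F y x).
Proof. intros H T a b p Ha Hb. now apply H. Qed.
Lemma jcont2_l (F : R -> R -> C) (y : R) : jcont2 F -> Cont (fun x => F x y).
Proof. intros H z. apply H; [apply continuous_id|apply continuous_const]. Qed.
Lemma jcont2_r (F : R -> R -> C) (x : R) : jcont2 F -> Cont (F x).
Proof. intros H z. apply (H _ (fun _ => x) (fun s => s)); [apply continuous_const|apply continuous_id]. Qed.

(** By [uniform_tube] the increment of the inner integral from [z] to [b] differs from (b - z) F z y
    by at most a small multiple of |b - z|, uniformly in [y]; this error survives the integration
    over [c, d]. *)
Lemma is_derive_CInt_CInt (F : R -> R -> C) (a c d z : R) : (c <= d)%R -> jcont2 F ->
  is_Cderive (fun b => CInt (fun y => CInt (fun x => F x y) a b) c d) z (CInt (F z) c d).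
Proof.
  intros Hcd HF.
  assert (Hin : forall b, Cont (fun y => CInt (fun x => F x y) a b)).
  { intros b y. destruct (Rle_dec a b) as [H|H].
    - apply (cont_CInt_param (fun y x => F x y)); trivial.
      intros. apply HF; [apply continuous_snd|apply continuous_fst].
    - apply (continuous_ext (fun y => - CInt (fun x => F x y) b a)).
      { intro y'. symmetry. apply CInt_swap. now apply jcont2_l. }
      apply cont_Copp, (cont_CInt_param (fun y x => F x y)); [lra|].
      intros. apply HF; [apply continuous_snd|apply continuous_fst]. }
  apply is_Cderive_eps. intros e He.
  assert (He' : (0 < e / (d - c + 1))%R) by (apply Rdiv_lt_0_compat; lra).
  destruct (uniform_tube F c d z (fun s _ => jcont2_pair F z s HF) _ He') as [dl Hdl].
  exists dl. intros b Hb.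
  rewrite <- CInt_minus by trivial.
  rewrite <- CInt_scal by now apply jcont2_r.
  assert (Hc0 : Cont (fun y => CInt (fun x => F x y) a b - CInt (fun x => F x y) a z)).
  { intro y. apply cont_Cminus; apply Hin. }
  assert (Hc1 : Cont (fun y => RtoC (b - z) * F z y)).
  { intro y. apply cont_Cmult; [apply continuous_const|now apply jcont2_r]. }
  rewrite <- CInt_minus by trivial.
  eapply Rle_trans.
  - apply (CInt_bound _ c d (Rabs (b - z) * (e / (d - c + 1)))); trivial.
    { intro y. now apply cont_Cminus. }
    intros y Hy.
    assert (Hcy : Cont (fun x => F x y)) by now apply jcont2_l.
    rewrite <- (CInt_Chasles (fun x => F x y) a z b Hcy).
    assert (Ek : RtoC (b - z) * F z y = CInt (fun _ => F z y) z b).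
    { symmetry. apply CInt_unique.
      assert (H := is_RInt_const (V := C_R_NormedModule) z b (F z y)).
      eapply eq_ind; [exact H|]. destruct (F z y).
      apply injective_projections; simpl; unfold scal; simpl; unfold mult; simpl; ring. }
    rewrite Ek.
    replace (CInt (fun x => F x y) a z + CInt (fun x => F x y) z b -
      CInt (fun x => F x y) a z - CInt (fun _ => F z y) z b) with
      (CInt (fun x => F x y) z b - CInt (fun _ => F z y) z b) by ring.
    rewrite <- CInt_minus; trivial; [|intro; apply continuous_const].
    apply CInt_bound_abs.
    { intro x. apply cont_Cminus; [apply Hcy|apply continuous_const]. }
    intros x Hx. left. apply Hdl; trivial.
    assert (Hb' : (Rabs (b - z) < dl)%R) by exact Hb.
    change (Rabs (x - z) < dl)%R. eapply Rle_lt_trans; [|exact Hb'].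
    revert Hx. unfold Rmin, Rmax, Rabs.
    destruct (Rle_dec z b), (Rcase_abs (x - z)), (Rcase_abs (b - z)); lra.
  - assert (Hp := Rabs_pos (b - z)).
    replace ((d - c) * (Rabs (b - z) * (e / (d - c + 1))))%R with
      ((d - c) / (d - c + 1) * (e * Rabs (b - z)))%R by (field; lra).
    rewrite <- (Rmult_1_l (e * Rabs (b - z))) at 2.
    apply Rmult_le_compat_r; [nra|].
    apply Rle_div_l; lra.
Qed.

(** As functions of the upper limit [b] both sides have the derivative given by the inner integral,
    and both vanish at [b = a]. *)
Lemma CInt_Fubini (F : R -> R -> C) (a b c d : R) : (c <= d)%R -> jcont2 F ->
  CInt (fun x => CInt (F x) c d) a b = CInt (fun y => CInt (fun x => F x y) a b) c d.
Proof.
  intros Hcd HF.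
  assert (H : is_CRInt (fun x => CInt (F x) c d) a b
     (CInt (fun y => CInt (fun x => F x y) a b) c d - CInt (fun y => CInt (fun x => F x y) a a) c d)).
  { apply (is_RInt_derive (V := C_R_CompleteNormedModule)
      (fun b => CInt (fun y => CInt (fun x => F x y) a b) c d)).
    - intros x _. now apply is_derive_CInt_CInt.
    - intros x _. apply (cont_CInt_param F); trivial.
      intros. now apply jcont2_pair. }
  rewrite (CInt_unique _ _ _ _ H).
  rewrite (CInt_ext (fun y => CInt (fun x => F x y) a a) (fun _ => 0)).
  2: { intros x _. apply CInt_point. }
  replace (CInt (fun _ => 0) c d) with (RtoC 0); [ring|].
  symmetry. apply CInt_unique.
  assert (H0 := is_RInt_const (V := C_R_NormedModule) c d (RtoC 0)).
  eapply eq_ind; [exact H0|].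
  apply injective_projections; simpl; unfold scal; simpl; unfold mult; simpl; ring.
Qed.

(** Near [p] the integral of [F q] equals the integral of [F p0] plus, by Fubini, the integral over
    [p0, q] of the integral of [F1]. The second form is differentiated by the fundamental theorem,
    so no difference quotient has to be estimated. *)
Lemma is_derive_CInt_param (F F1 : R -> R -> C) (al be a b p : R) : (a <= b)%R ->
  jcont2 F -> jcont2 F1 -> (al < p < be)%R ->
  (forall q s, (al < q < be)%R -> (a <= s <= b)%R -> is_Cderive (fun r => F r s) q (F1 q s)) ->
  is_Cderive (fun q => CInt (F q) a b) p (CInt (F1 p) a b).
Proof.
  intros Hab HF HF1 Hp Hd.
  pose (p0 := ((al + p) / 2)%R).
  assert (Hc1 : Cont (fun q => CInt (F1 q) a b)).
  { intro q. apply (cont_CInt_param F1); trivial. intros. now apply jcont2_pair. }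
  apply (is_derive_ext_loc (fun q => CInt (F p0) a b + CInt (fun r => CInt (F1 r) a b) p0 q)).
  - assert (Hl : (0 < Rmin (p - p0) (be - p))%R) by (unfold p0; apply Rmin_glb_lt; lra).
    exists (mkposreal _ Hl). intros q Hq.
    assert (Hq' : (Rabs (q - p) < Rmin (p - p0) (be - p))%R) by exact Hq.
    apply Rabs_def2 in Hq'.
    assert (H1 := Rmin_l (p - p0) (be - p)). assert (H2 := Rmin_r (p - p0) (be - p)).
    rewrite CInt_Fubini by trivial.
    rewrite (CInt_ext_le (fun s => CInt (fun r => F1 r s) p0 q) (fun s => F q s - F p0 s) a b Hab).
    + rewrite CInt_minus by now apply jcont2_r. cring.
    + intros s Hs. apply (CInt_FTC (fun r => F r s)); [lra|now apply (jcont2_l F1)| |].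
      * intros x _. now apply (jcont2_l F).
      * intros x Hx. apply Hd; unfold p0 in *; lra.
  - eapply Cd_eq; [apply Cd_plus; [apply Cd_const|now apply is_derive_CInt]|]. ring.
Qed.

(** * Improper integrals by compactification *)

(* The substitution x = (1 - s)^(-2) - 1 turns the integral over [0, oo) of a
   continuous function that is O(x^(-2)) into the integral of a continuous
   function over [0, 1], so that Fubini and continuity in parameters reduce to
   the compact case. *)
Definition cpt_x (s : R) : R := (/ (1 - s) ^ 2 - 1)%R.
Definition cpt_dx (s : R) : R := (2 * / (1 - s) ^ 3)%R.
Definition cpt (f : R -> C) (s : R) : C :=
  if Rlt_dec s 1 then RtoC (cpt_dx s) * f (cpt_x s) else 0.
Definition CI (f : R -> C) : C := CInt (cpt f) 0 1.
Definition dom2 (M : R) (f : R -> C) : Prop :=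
  forall x, (0 <= x)%R -> (Cmod (f x) <= M * / (1 + x) ^ 2)%R.

Lemma cpt_lt f s : (s < 1)%R -> cpt f s = RtoC (cpt_dx s) * f (cpt_x s).
Proof. intro H. unfold cpt. destruct (Rlt_dec s 1); [reflexivity|lra]. Qed.
Lemma cpt_ge f s : (1 <= s)%R -> cpt f s = 0.
Proof. intro H. unfold cpt. destruct (Rlt_dec s 1); [lra|reflexivity]. Qed.
Lemma cpt_x_ge0 s : (0 <= s < 1)%R -> (0 <= cpt_x s)%R.
Proof.
  intros H. unfold cpt_x.
  assert (1 <= / (1 - s) ^ 2)%R; [|lra].
  rewrite <- Rinv_1. apply Rinv_le_contravar; nra.
Qed.

Lemma dom2_M0 M f : dom2 M f -> (0 <= M)%R.
Proof.
  intro H. specialize (H 0%R (Rle_refl _)). assert (H0 := Cmod_ge_0 (f 0%R)).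
  replace ((1 + 0) ^ 2)%R with 1%R in H by ring. rewrite Rinv_1 in H. lra.
Qed.

(** Since 1 + x = (1 - s)^(-2), a bound M (1 + x)^(-2) becomes M (1 - s)^4, and the Jacobian 2 (1 -
    s)^(-3) leaves 2 M (1 - s). This vanishes at s = 1, so extension by 0 is continuous. *)
Lemma cpt_bound M f s : dom2 M f -> (0 <= s)%R -> (Cmod (cpt f s) <= 2 * M * Rabs (1 - s))%R.
Proof.
  intros H Hs. assert (HM := dom2_M0 _ _ H). unfold cpt. destruct (Rlt_dec s 1) as [H1|H1].
  - rewrite Cmod_mult, Cmod_R. assert (Hd := H (cpt_x s) (cpt_x_ge0 s (conj Hs H1))).
    rewrite (Rabs_pos_eq (1 - s)) by lra.
    assert (Hp : (0 < cpt_dx s)%R).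
    { unfold cpt_dx. apply Rmult_lt_0_compat; [lra|]. apply Rinv_0_lt_compat, pow_lt; lra. }
    rewrite Rabs_pos_eq by lra.
    eapply Rle_trans; [apply Rmult_le_compat_l; [lra|exact Hd]|].
    right. unfold cpt_x, cpt_dx. field. lra.
  - rewrite Cmod_0. assert (H0 := Rabs_pos (1 - s)). nra.
Qed.

Lemma locally_snd_lt {T : UniformSpace} (q : T) (s c : R) : (s < c)%R ->
  locally ((q, s) : T * R) (fun z => (snd z < c)%R).
Proof.
  intro H. assert (Hp : (0 < c - s)%R) by lra. exists (mkposreal _ Hp). intros [q' s'] [_ Hs].
  apply Rabs_def2 in Hs. simpl in Hs. unfold minus, plus, opp in Hs; simpl in Hs. simpl. lra.
Qed.
Lemma locally_snd_gt {T : UniformSpace} (q : T) (s c : R) : (c < s)%R ->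
  locally ((q, s) : T * R) (fun z => (c < snd z)%R).
Proof.
  intro H. assert (Hp : (0 < s - c)%R) by lra. exists (mkposreal _ Hp). intros [q' s'] [_ Hs].
  apply Rabs_def2 in Hs. simpl in Hs. unfold minus, plus, opp in Hs; simpl in Hs. simpl. lra.
Qed.

Lemma cpt_cont {T : UniformSpace} (F : T -> R -> C) (M : R) :
  (forall (q : T) (s : R), continuous (fun z : T * R => F (fst z) (snd z)) (q, s)) ->
  (forall q, dom2 M (F q)) ->
  forall (q : T) (s : R), continuous (fun z : T * R => cpt (F (fst z)) (snd z)) (q, s).
Proof.
  intros HF HM q s.
  destruct (Rtotal_order s 1) as [Hs|[Hs|Hs]].
  - apply (continuous_ext_loc _ (fun z : T * R => RtoC (cpt_dx (snd z)) * F (fst z) (cpt_x (snd z)))).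
    + generalize (locally_snd_lt q s 1 Hs). apply filter_imp. intros z Hz. symmetry. now apply cpt_lt.
    + assert (Hc : continuous (fun z : T * R => (1 - snd z)%R) (q, s)).
      { apply cont_Rminus; [apply continuous_const|apply continuous_snd]. }
      apply cont_Cmult.
      * apply cont_RtoC, cont_Rmult; [apply continuous_const|].
        apply cont_Rinv; [apply pow_nonzero; simpl; lra|]. now apply cont_Rpow.
      * apply (continuous_comp (fun z : T * R => (fst z, cpt_x (snd z))) (fun z : T * R => F (fst z) (snd z))).
        2: apply HF.
        apply (continuous_comp_2 (fun z : T * R => fst z) (fun z : T * R => cpt_x (snd z)) (fun a b => (a, b))).
        -- apply continuous_fst.
        -- apply cont_Rminus; [|apply continuous_const].
           apply cont_Rinv; [apply pow_nonzero; simpl; lra|]. now apply cont_Rpow.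
        -- apply (continuous_ext (fun z : T * R => z)); [now intros []|apply continuous_id].
  - subst s. apply (continuous_dominated _ (fun z => 2 * M * Rabs (1 - snd z))%R).
    + unfold cpt. simpl. destruct (Rlt_dec 1 1); [lra|reflexivity].
    + simpl. replace (1 - 1)%R with 0%R by ring. rewrite Rabs_R0. ring.
    + apply cont_Rmult; [apply continuous_const|].
      apply cont_Rabs, cont_Rminus; [apply continuous_const|apply continuous_snd].
    + generalize (locally_snd_gt q 1 0 Rlt_0_1). apply filter_imp. intros z Hz.
      apply cpt_bound; [apply HM|lra].
  - apply (continuous_ext_loc _ (fun z : T * R => RtoC 0)); [|apply continuous_const].
    generalize (locally_snd_gt q s 1 Hs). apply filter_imp. intros z Hz. symmetry. now apply cpt_ge, Rlt_le.
Qed.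

Lemma cpt_Cont (f : R -> C) M : Cont f -> dom2 M f -> Cont (cpt f).
Proof.
  intros Hf Hd s.
  apply (cont_section (fun (_ : R) s => cpt f s) 0%R).
  apply (cpt_cont (fun _ : R => f) M); [|now intro].
  intros q s'. apply (continuous_comp (fun z : R * R => snd z) f); [apply continuous_snd|apply Hf].
Qed.

Lemma CI_plus f g M N : Cont f -> Cont g -> dom2 M f -> dom2 N g ->
  CI (fun x => f x + g x) = CI f + CI g.
Proof.
  intros. unfold CI. rewrite <- CInt_plus by (eapply cpt_Cont; eassumption).
  apply CInt_ext. intros s _. unfold cpt. destruct (Rlt_dec s 1); ring.
Qed.
Lemma CI_minus f g M N : Cont f -> Cont g -> dom2 M f -> dom2 N g ->
  CI (fun x => f x - g x) = CI f - CI g.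
Proof.
  intros. unfold CI. rewrite <- CInt_minus by (eapply cpt_Cont; eassumption).
  apply CInt_ext. intros s _. unfold cpt. destruct (Rlt_dec s 1); ring.
Qed.
Lemma CI_scal c f M : Cont f -> dom2 M f -> CI (fun x => c * f x) = c * CI f.
Proof.
  intros. unfold CI. rewrite <- CInt_scal by (eapply cpt_Cont; eassumption).
  apply CInt_ext. intros s _. unfold cpt. destruct (Rlt_dec s 1); ring.
Qed.
Lemma CI_ext f g : (forall x, (0 < x)%R -> f x = g x) -> CI f = CI g.
Proof.
  intro H. apply CInt_ext_le; [exact Rle_0_1|]. intros s Hs. unfold cpt.
  destruct (Rlt_dec s 1); trivial. f_equal. apply H. unfold cpt_x.
  assert (1 < / (1 - s) ^ 2)%R; [|lra].
  rewrite <- Rinv_1. apply Rinv_lt_contravar; nra.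
Qed.
Lemma CI_bound f M : Cont f -> dom2 M f -> (Cmod (CI f) <= 2 * M)%R.
Proof.
  intros Hf Hd. assert (HM := dom2_M0 _ _ Hd).
  eapply Rle_trans.
  - apply (CInt_bound _ 0 1 (2 * M)%R); [now apply cpt_Cont with M|lra|].
    intros s Hs. eapply Rle_trans; [apply cpt_bound; [exact Hd|lra]|].
    rewrite Rabs_pos_eq by lra. nra.
  - lra.
Qed.

Lemma cont_CI_param {T : UniformSpace} (F : T -> R -> C) (M : R) (p : T) :
  (forall (q : T) (s : R), continuous (fun z : T * R => F (fst z) (snd z)) (q, s)) ->
  (forall q, dom2 M (F q)) -> continuous (fun q => CI (F q)) p.
Proof.
  intros HF HM. apply (cont_CInt_param (fun q => cpt (F q))); [lra|]. now apply cpt_cont with M.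
Qed.

Lemma cpt_jcont2 (F : R -> R -> C) (M : R) : jcont2 F -> (forall q, dom2 M (F q)) ->
  jcont2 (fun q s => cpt (F q) s).
Proof.
  intros HF HM T a b p Ha Hb.
  apply (continuous_comp_2 a b (fun q s => cpt (F q) s)); trivial.
  apply (cpt_cont F M); trivial. intros. now apply jcont2_pair.
Qed.

Lemma CInt_CI_Fubini (F : R -> R -> C) (M a b : R) : jcont2 F -> (forall q, dom2 M (F q)) ->
  CInt (fun q => CI (F q)) a b = CI (fun x => CInt (fun q => F q x) a b).
Proof.
  intros HF HM. unfold CI. rewrite CInt_Fubini; [|lra|now apply cpt_jcont2 with M].
  apply CInt_ext_le; [exact Rle_0_1|]. intros s Hs. rewrite (cpt_lt _ s) by lra.
  rewrite <- CInt_scal by now apply (jcont2_l F).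
  apply CInt_ext. intros q _. apply cpt_lt. lra.
Qed.

(** [CI] samples nonnegative arguments only, but the continuity and domination lemmas quantify over
    every parameter. Inserting [Rmax 0] extends the bound to negative parameters without changing
    the integrals. *)
Lemma CI_CI_Fubini (F : R -> R -> C) (M : R) : jcont2 F ->
  (forall x y, (0 <= x)%R -> (0 <= y)%R -> (Cmod (F x y) <= M * / (1 + x) ^ 2 * / (1 + y) ^ 2)%R) ->
  CI (fun x => CI (F (Rmax 0 x))) = CI (fun y => CI (fun x => F (Rmax 0 x) y)).
Proof.
  intros HF HM.
  assert (HM0 : (0 <= M)%R).
  { specialize (HM 0%R 0%R (Rle_refl _) (Rle_refl _)). assert (H := Cmod_ge_0 (F 0%R 0%R)).
    replace ((1 + 0) ^ 2)%R with 1%R in HM by ring. rewrite Rinv_1 in HM. lra. }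
  assert (Hi : forall x, (0 <= x)%R -> (0 < / (1 + x) ^ 2 <= 1)%R).
  { intros x Hx. split; [apply Rinv_0_lt_compat, pow_lt; lra|].
    rewrite <- Rinv_1. apply Rinv_le_contravar; nra. }
  set (G := fun x y => F (Rmax 0 x) y).
  assert (HG : jcont2 G).
  { intros T a b p Ha Hb. apply HF; trivial. apply cont_Rmax; trivial. apply continuous_const. }
  assert (HdG : forall x, dom2 M (G x)).
  { intros x y Hy. unfold G. eapply Rle_trans; [apply HM; trivial; apply Rmax_l|].
    assert (H1 := Hi y Hy). assert (H2 := Hi (Rmax 0 x) (Rmax_l _ _)).
    rewrite Rmult_assoc. apply Rmult_le_compat_l; trivial. nra. }
  unfold CI at 1.
  transitivity (CInt (fun s => CI (fun y => cpt (fun x => G x y) s)) 0 1).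
  { apply CInt_ext_le; [exact Rle_0_1|]. intros s Hs. unfold cpt. destruct (Rlt_dec s 1); [|lra].
    symmetry. apply (CI_scal _ (G (cpt_x s)) M); [now apply jcont2_r|apply HdG]. }
  (* One variable is compactified at a time: the outer integral in x is already over [0, 1] while
     the integral in y is still improper. *)
  assert (Hj : jcont2 (fun s y => cpt (fun x => G x (Rmax 0 y)) s)).
  { apply jcont2_swap. apply (cpt_jcont2 (fun y x => G x (Rmax 0 y)) M).
    - intros T a b p Ha Hb. apply HG; trivial. apply cont_Rmax; trivial. apply continuous_const.
    - intros y x Hx. unfold G. eapply Rle_trans; [apply HM; apply Rmax_l|].
      assert (H1 := Hi (Rmax 0 y) (Rmax_l _ _)).
      rewrite (Rmax_right 0 x) by trivial. assert (H2 := Hi x Hx).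
      rewrite Rmult_assoc. apply Rmult_le_compat_l; trivial. nra. }
  transitivity (CInt (fun s => CI (fun y => cpt (fun x => G x (Rmax 0 y)) (Rmax 0 s))) 0 1).
  { apply CInt_ext_le; [exact Rle_0_1|]. intros s Hs. apply CI_ext. intros y Hy.
    now rewrite !Rmax_right by lra. }
  rewrite (CInt_CI_Fubini (fun s y => cpt (fun x => G x (Rmax 0 y)) (Rmax 0 s)) (2 * M)%R).
  - apply CI_ext. intros y Hy. apply CInt_ext_le; [exact Rle_0_1|]. intros s Hs.
    now rewrite !Rmax_right by lra.
  - intros T a b p Ha Hb. apply Hj; trivial. apply cont_Rmax; trivial. apply continuous_const.
  - intros s y Hy. rewrite (Rmax_right 0 y) by trivial.
    assert (H1 := Hi y Hy).
    assert (Hd : dom2 (M * / (1 + y) ^ 2) (fun x => G x y)).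
    { intros x Hx. unfold G. rewrite (Rmax_right 0 x) by trivial.
      eapply Rle_trans; [now apply HM|]. right; ring. }
    unfold cpt. destruct (Rlt_dec (Rmax 0 s) 1) as [H|H].
    + assert (H2 := cpt_bound _ _ (Rmax 0 s) Hd (Rmax_l _ _)).
      unfold cpt in H2. destruct (Rlt_dec (Rmax 0 s) 1); [|lra].
      eapply Rle_trans; [exact H2|].
      assert (H3 := Rmax_l 0 s). rewrite Rabs_pos_eq by lra.
      assert (0 <= M * / (1 + y) ^ 2)%R by (apply Rmult_le_pos; lra). nra.
    + rewrite Cmod_0. apply Rmult_le_pos; lra.
Qed.

Lemma is_derive_CI_param (F F1 : R -> R -> C) (M M1 al be p : R) :
  jcont2 F -> jcont2 F1 -> (forall q, dom2 M (F q)) -> (forall q, dom2 M1 (F1 q)) ->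
  (al < p < be)%R ->
  (forall q s, (al < q < be)%R -> (0 <= s)%R -> is_Cderive (fun r => F r s) q (F1 q s)) ->
  is_Cderive (fun q => CI (F q)) p (CI (F1 p)).
Proof.
  intros HF HF1 HM HM1 Hp Hd.
  apply (is_derive_CInt_param (fun q => cpt (F q)) (fun q => cpt (F1 q)) al be);
    [exact Rle_0_1| | |exact Hp|].
  - now apply cpt_jcont2 with M.
  - now apply cpt_jcont2 with M1.
  - intros q s Hq Hs. unfold cpt. destruct (Rlt_dec s 1).
    + apply Cd_scal, Hd; trivial. apply cpt_x_ge0; lra.
    + apply Cd_const.
Qed.

(** * Truncation estimates and improper integrals *)

Definition cpt_inv (b : R) : R := (1 - / sqrt (1 + b))%R.
Lemma cpt_inv_spec b : (0 <= b)%R ->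
  (0 <= cpt_inv b < 1)%R /\ cpt_x (cpt_inv b) = b /\ ((1 - cpt_inv b) ^ 2 = / (1 + b))%R.
Proof.
  intro Hb. unfold cpt_inv, cpt_x.
  assert (Hs : (sqrt (1 + b) * sqrt (1 + b) = 1 + b)%R) by (apply sqrt_sqrt; lra).
  assert (H1 : (1 <= sqrt (1 + b))%R).
  { rewrite <- sqrt_1 at 1. apply sqrt_le_1_alt. lra. }
  assert (H2 : (0 < / sqrt (1 + b) <= 1)%R).
  { split; [apply Rinv_0_lt_compat; lra|]. rewrite <- Rinv_1 at 2. apply Rinv_le_contravar; lra. }
  assert (H3 : ((1 - (1 - / sqrt (1 + b))) ^ 2 = / (1 + b))%R).
  { generalize dependent (sqrt (1 + b)). intros r Hs H1 _. rewrite <- Hs. field. lra. }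
  repeat split; try lra.
  rewrite H3. rewrite Rinv_inv. ring.
Qed.

(** After substitution the tail lives on [s, 1], of length 1 - s, with integrand at most 2 M (1 -
    s); and (1 - s)^2 = 1 / (1 + b). This explicit rate identifies [CI] with the improper integral
    and drives the later limit arguments. *)
Lemma CI_tail f M b : Cont f -> dom2 M f -> (0 <= b)%R ->
  (Cmod (CI f - CInt f 0 b) <= 2 * M * / (1 + b))%R.
Proof.
  intros Hf Hd Hb. assert (HM := dom2_M0 _ _ Hd).
  destruct (cpt_inv_spec b Hb) as ((H1 & H2) & H3 & H4). set (s := cpt_inv b) in *.
  assert (Hc := cpt_Cont f M Hf Hd).
  assert (E : CInt f 0 b = CInt (cpt f) 0 s).
  { assert (H := CInt_subst f cpt_x cpt_dx 0 s Hf).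
    replace (cpt_x 0) with 0%R in H by (unfold cpt_x; field).
    rewrite H3 in H. symmetry. apply CInt_unique.
    eapply is_CRInt_ext; [|apply H].
    - intros x Hx. rewrite Rmin_left, Rmax_right in Hx by trivial.
      unfold cpt. destruct (Rlt_dec x 1); [reflexivity|lra].
    - intros x Hx. rewrite Rmin_left, Rmax_right in Hx by trivial. split.
      + unfold cpt_x, cpt_dx. auto_derive; [apply Rgt_not_eq; simpl; nra|].
        field. lra.
      + unfold cpt_dx. apply cont_Rmult; [apply continuous_const|].
        apply cont_Rinv; [apply pow_nonzero; lra|]. apply cont_Rpow.
        apply cont_Rminus; [apply continuous_const|apply continuous_id]. }
  rewrite E. unfold CI. rewrite <- (CInt_Chasles (cpt f) 0 s 1 Hc).
  replace (CInt (cpt f) 0 s + CInt (cpt f) s 1 - CInt (cpt f) 0 s) with (CInt (cpt f) s 1) by ring.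
  eapply Rle_trans.
  - apply (CInt_bound _ s 1 (2 * M * (1 - s))%R Hc); [lra|].
    intros x Hx. eapply Rle_trans; [apply cpt_bound; [exact Hd|lra]|].
    rewrite Rabs_pos_eq by lra. apply Rmult_le_compat_l; lra.
  - rewrite <- H4. right. ring.
Qed.

Lemma le0_of_inv (x K : R) : (forall b, (0 <= b)%R -> (x <= K * / (1 + b))%R) -> (x <= 0)%R.
Proof.
  intro H. apply Rnot_lt_le. intro Hx.
  assert (HK : (0 < K)%R).
  { specialize (H 0%R (Rle_refl _)). rewrite Rplus_0_r, Rinv_1 in H. lra. }
  assert (Hb : (0 <= 2 * K / x)%R) by (apply Rmult_le_pos; [lra|left; now apply Rinv_0_lt_compat]).
  specialize (H _ Hb).
  assert (H1 : (K * / (1 + 2 * K / x) < x)%R); [|lra].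
  assert (Hq : (x * (2 * K / x) = 2 * K)%R) by (field; lra).
  apply Rmult_lt_reg_r with (1 + 2 * K / x)%R; [lra|].
  rewrite Rmult_assoc, Rinv_l by lra. nra.
Qed.

Lemma inv_pow_le (x : R) : (0 <= x)%R -> (/ (1 + x) ^ 2 <= / (1 + x))%R.
Proof. intro H. apply Rinv_le_contravar; nra. Qed.

Lemma Ceq_of_bound (a b : C) (K : R) :
  (forall r, (0 <= r)%R -> (Cmod (a - b) <= K * / (1 + r))%R) -> a = b.
Proof.
  intro H. apply le0_of_inv in H. assert (H0 := Cmod_ge_0 (a - b)).
  assert (E : a - b = 0) by (apply Cmod_eq_0; lra).
  replace a with (a - b + b) by ring. rewrite E. ring.
Qed.

Lemma CI_FTC (f g : R -> C) (M N : R) : Cont f -> Cont g -> dom2 M f -> dom2 N g ->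
  (forall x, (0 < x)%R -> is_Cderive f x (g x)) -> CI g = - f 0%R.
Proof.
  intros Hf Hg HM HN Hd. apply (Ceq_of_bound _ _ (2 * N + M)%R). intros b Hb.
  assert (E : CInt g 0 b = f b - f 0%R).
  { apply CInt_FTC; trivial. intros x Hx. apply Hd. lra. }
  replace (CI g - - f 0%R) with (CI g - CInt g 0 b + f b) by (rewrite E; ring).
  eapply Rle_trans; [apply Cmod_triangle|].
  assert (H1 := CI_tail g N b Hg HN Hb). assert (H2 := HM b Hb).
  assert (H3 := inv_pow_le b Hb). assert (H4 := dom2_M0 _ _ HM). nra.
Qed.

Lemma is_RInt_gen_of_bound (f : R -> C) (l : C) (Fa Fb : (R -> Prop) -> Prop) :
  Cont f -> Filter Fa -> Filter Fb ->
  (forall e, (0 < e)%R -> filter_prod Fa Fb (fun ab => (Cmod (l - CInt f (fst ab) (snd ab)) < e)%R)) ->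
  is_RInt_gen (V := C_R_NormedModule) f Fa Fb l.
Proof.
  intros Hf HFa HFb H P [e He].
  assert (H1 := H (e / 2)%R ltac:(destruct e; simpl; lra)).
  unfold filtermapi. revert H1. apply filter_imp. intros [a b] Hab.
  exists (CInt f a b). split; [now apply CInt_correct|].
  apply He. simpl in Hab.
  assert (Hb2 : (Cmod (CInt f a b - l) < e / 2)%R).
  { rewrite <- Cmod_opp. now replace (- (CInt f a b - l)) with (l - CInt f a b) by ring. }
  assert (H2 := Re_le_Cmod (CInt f a b - l)). assert (H3 := Im_le_Cmod (CInt f a b - l)).
  assert (He0 := cond_pos e).
  split; eapply Rle_lt_trans; [exact H2|lra|exact H3|lra].
Qed.

Lemma eventually_inv_lt (K e : R) : (0 < e)%R ->
  Rbar_locally p_infty (fun b => (0 <= b)%R /\ (K * / (1 + b) < e)%R).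
Proof.
  intro He. exists (Rabs K / e)%R. intros b Hb.
  assert (H0 : (0 <= Rabs K / e)%R).
  { apply Rmult_le_pos; [apply Rabs_pos|]. left. now apply Rinv_0_lt_compat. }
  split; [lra|].
  apply Rmult_lt_reg_r with (1 + b)%R; [lra|]. rewrite Rmult_assoc, Rinv_l by lra.
  assert (H1 : (Rabs K < b * e)%R) by (apply Rlt_div_l; lra).
  assert (H2 := Rle_abs K). lra.
Qed.

Lemma CI_is_RInt_gen f M : Cont f -> dom2 M f ->
  is_RInt_gen (V := C_R_NormedModule) f (at_point 0) (Rbar_locally p_infty) (CI f).
Proof.
  intros Hf Hd. apply is_RInt_gen_of_bound; trivial; try apply _. intros e He.
  exists (fun a => a = 0%R) (fun b => (0 <= b)%R /\ (2 * M * / (1 + b) < e)%R).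
  - reflexivity.
  - now apply eventually_inv_lt.
  - intros a b -> [Hb Hb']. simpl. eapply Rle_lt_trans; [exact (CI_tail f M b Hf Hd Hb)|exact Hb'].
Qed.

(** The line is folded onto the half line, so that every property of [CI] transfers; absolute
    integrability makes this agree with independent limits at both ends. *)
Definition FI (f : R -> C) : C := CI (fun x => f x + f (- x)%R).
Definition fdom2 (M : R) (f : R -> C) : Prop := forall x, (Cmod (f x) <= M * / (1 + Rabs x) ^ 2)%R.

Lemma fdom2_pos M f : fdom2 M f -> dom2 M f.
Proof. intros H x Hx. specialize (H x). now rewrite Rabs_pos_eq in H. Qed.
Lemma fdom2_neg M f : fdom2 M f -> dom2 M (fun x => f (- x)%R).
Proof. intros H x Hx. specialize (H (- x)%R). now rewrite Rabs_Ropp, Rabs_pos_eq in H. Qed.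
Lemma dom2_plus M N f g : dom2 M f -> dom2 N g -> dom2 (M + N) (fun x => f x + g x).
Proof.
  intros H1 H2 x Hx. eapply Rle_trans; [apply Cmod_triangle|].
  rewrite Rmult_plus_distr_r. apply Rplus_le_compat; auto.
Qed.
Lemma dom2_opp M f : dom2 M f -> dom2 M (fun x => - f x).
Proof. intros H x Hx. rewrite Cmod_opp. auto. Qed.
Lemma dom2_scal M c f : dom2 M f -> dom2 (Cmod c * M) (fun x => c * f x).
Proof.
  intros H x Hx. rewrite Cmod_mult, Rmult_assoc.
  apply Rmult_le_compat_l; [apply Cmod_ge_0|auto].
Qed.
Lemma dom2_mult_le1 M e f : (forall x, (0 <= x)%R -> (Cmod (e x) <= 1)%R) -> dom2 M f ->
  dom2 M (fun x => e x * f x).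
Proof.
  intros He H x Hx. rewrite Cmod_mult. assert (H1 := Cmod_ge_0 (f x)). assert (H2 := He x Hx).
  assert (H3 := H x Hx). nra.
Qed.
Lemma fdom2_mult_le1 M e f : (forall x, (Cmod (e x) <= 1)%R) -> fdom2 M f ->
  fdom2 M (fun x => e x * f x).
Proof.
  intros He H x. rewrite Cmod_mult. assert (H1 := Cmod_ge_0 (f x)). assert (H2 := He x).
  assert (H3 := H x). nra.
Qed.
Lemma Cont_neg (f : R -> C) : Cont f -> Cont (fun x => f (- x)%R).
Proof.
  intros H x. apply (continuous_comp (fun x : R => (- x)%R) f); [|apply H].
  apply cont_Ropp, continuous_id.
Qed.
Lemma FI_sym_Cont (f : R -> C) : Cont f -> Cont (fun x => f x + f (- x)%R).
Proof. intros H x. apply cont_Cplus; [apply H|now apply Cont_neg]. Qed.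

Lemma FI_split f M : Cont f -> fdom2 M f -> FI f = CI f + CI (fun x => f (- x)%R).
Proof.
  intros Hf Hd. apply CI_plus with M M; trivial; [now apply Cont_neg|now apply fdom2_pos|now apply fdom2_neg].
Qed.

Lemma CInt_neg (f : R -> C) (a b : R) : Cont f ->
  CInt (fun x => f (- x)%R) a b = CInt f (- b) (- a).
Proof.
  intro Hf. rewrite (CInt_swap f) by trivial.
  assert (H := CInt_subst f (fun x => (- x)%R) (fun _ => (-1)%R) a b Hf).
  assert (H1 : is_CRInt (fun x => RtoC (-1) * f (- x)%R) a b (CInt f (- a) (- b))).
  { apply H. intros x _. split; [auto_derive; trivial|apply continuous_const]. }
  apply (is_CRInt_scal (RtoC (-1))) in H1. apply CInt_unique.
  replace (- CInt f (- a) (- b)) with (RtoC (-1) * CInt f (- a) (- b)).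
  - eapply is_CRInt_ext; [|exact H1]. intros x _. cbv beta.
    rewrite Cmult_assoc, <- RtoC_mult. replace (-1 * -1)%R with 1%R by ring. ring.
  - apply injective_projections; simpl; ring.
Qed.

Lemma FI_tail f M a b : Cont f -> fdom2 M f -> (0 <= a)%R -> (0 <= b)%R ->
  (Cmod (FI f - CInt f (- a) b) <= 2 * M * / (1 + a) + 2 * M * / (1 + b))%R.
Proof.
  intros Hf Hd Ha Hb. rewrite (FI_split f M) by trivial.
  rewrite <- (CInt_Chasles f (- a) 0 b) by trivial.
  assert (E : CInt f (- a) 0 = CInt (fun x => f (- x)%R) 0 a).
  { rewrite CInt_neg by trivial. f_equal. now rewrite Ropp_0. }
  rewrite E.
  replace (CI f + CI (fun x => f (- x)%R) - (CInt (fun x => f (- x)%R) 0 a + CInt f 0 b)) with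
   ((CI (fun x => f (- x)%R) - CInt (fun x => f (- x)%R) 0 a) + (CI f - CInt f 0 b)) by ring.
  eapply Rle_trans; [apply Cmod_triangle|]. apply Rplus_le_compat.
  - apply CI_tail; trivial; [now apply Cont_neg|now apply fdom2_neg].
  - apply CI_tail; trivial. now apply fdom2_pos.
Qed.

Lemma FI_is_RInt_gen f M : Cont f -> fdom2 M f ->
  is_RInt_gen (V := C_R_NormedModule) f (Rbar_locally m_infty) (Rbar_locally p_infty) (FI f).
Proof.
  intros Hf Hd. apply is_RInt_gen_of_bound; trivial; try apply _. intros e He.
  destruct (eventually_inv_lt (2 * M) (e / 2) ltac:(lra)) as [K HK].
  exists (fun a => (a < - K)%R) (fun b => (K < b)%R).
  - now exists (- K)%R.
  - now exists K.
  - intros a b Ha Hb. simpl.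
    destruct (HK (- a)%R ltac:(lra)) as [H1 H2]. destruct (HK b Hb) as [H3 H4].
    replace a with (- - a)%R at 1 by ring.
    eapply Rle_lt_trans; [apply (FI_tail f M); trivial; lra|lra].
Qed.

Lemma CInt_line_FI f M : Cont f -> fdom2 M f -> CInt_line f = FI f.
Proof.
  intros Hf Hd. unfold CInt_line.
  apply (@is_RInt_gen_unique C_R_CompleteNormedModule _ _ _ _).
  exact (FI_is_RInt_gen f M Hf Hd).
Qed.

Lemma FI_bound f M : Cont f -> fdom2 M f -> (Cmod (FI f) <= 4 * M)%R.
Proof.
  intros Hf Hd. eapply Rle_trans.
  - apply (CI_bound _ (M + M)); [now apply FI_sym_Cont|].
    apply dom2_plus; [now apply fdom2_pos|now apply fdom2_neg].
  - lra.
Qed.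
Lemma FI_plus f g M N : Cont f -> Cont g -> fdom2 M f -> fdom2 N g ->
  FI (fun x => f x + g x) = FI f + FI g.
Proof.
  intros. unfold FI. rewrite <- (CI_plus _ _ (M + M) (N + N)); try now apply FI_sym_Cont.
  - apply CI_ext. intros; ring.
  - apply dom2_plus; [now apply fdom2_pos|now apply fdom2_neg].
  - apply dom2_plus; [now apply fdom2_pos|now apply fdom2_neg].
Qed.
Lemma FI_scal c f M : Cont f -> fdom2 M f -> FI (fun x => c * f x) = c * FI f.
Proof.
  intros. unfold FI. rewrite <- (CI_scal c _ (M + M)); try now apply FI_sym_Cont.
  - apply CI_ext. intros; ring.
  - apply dom2_plus; [now apply fdom2_pos|now apply fdom2_neg].
Qed.
Lemma FI_ext f g : (forall x, f x = g x) -> FI f = FI g.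
Proof. intros H. apply CI_ext. intros. now rewrite !H. Qed.

Lemma cont_FI_param {T : UniformSpace} (F : T -> R -> C) (M : R) (p : T) :
  (forall (q : T) (s : R), continuous (fun z : T * R => F (fst z) (snd z)) (q, s)) ->
  (forall q, fdom2 M (F q)) -> continuous (fun q => FI (F q)) p.
Proof.
  intros HF HM. apply (cont_CI_param (fun q x => F q x + F q (- x)%R) (M + M)).
  - intros q s. apply cont_Cplus; [apply HF|].
    apply (continuous_comp (fun z : T * R => (fst z, (- snd z)%R)) (fun z : T * R => F (fst z) (snd z))).
    2: apply HF.
    apply (continuous_comp_2 (fun z : T * R => fst z) (fun z : T * R => (- snd z)%R) (fun a b => (a, b))).
    + apply continuous_fst.
    + apply cont_Ropp, continuous_snd.
    + apply (continuous_ext (fun z : T * R => z)); [now intros []|apply continuous_id].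
  - intro q. apply dom2_plus; [now apply fdom2_pos|now apply fdom2_neg].
Qed.

Lemma jcont2_sym F : jcont2 F -> jcont2 (fun q x => F q x + F q (- x)%R).
Proof.
  intros HF T a b p Ha Hb. apply cont_Cplus; apply HF; trivial. now apply cont_Ropp.
Qed.

Lemma is_derive_FI_param (F F1 : R -> R -> C) (M M1 al be p : R) :
  jcont2 F -> jcont2 F1 -> (forall q, fdom2 M (F q)) -> (forall q, fdom2 M1 (F1 q)) ->
  (al < p < be)%R ->
  (forall q s, (al < q < be)%R -> is_Cderive (fun r => F r s) q (F1 q s)) ->
  is_Cderive (fun q => FI (F q)) p (FI (F1 p)).
Proof.
  intros HF HF1 HM HM1 Hp Hd.
  apply (is_derive_CI_param (fun q x => F q x + F q (- x)%R) (fun q x => F1 q x + F1 q (- x)%R)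
    (M + M) (M1 + M1) al be); [now apply jcont2_sym|now apply jcont2_sym| | |exact Hp|].
  - intro q. apply dom2_plus; [now apply fdom2_pos|now apply fdom2_neg].
  - intro q. apply dom2_plus; [now apply fdom2_pos|now apply fdom2_neg].
  - intros q s Hq _. apply Cd_plus; apply Hd; exact Hq.
Qed.

Lemma FI_FTC (f g : R -> C) (M N : R) : Cont f -> Cont g -> fdom2 M f -> fdom2 N g ->
  (forall x, is_Cderive f x (g x)) -> FI g = 0.
Proof.
  intros Hf Hg HM HN Hd. rewrite (FI_split g N) by trivial.
  rewrite (CI_FTC f g M N Hf Hg (fdom2_pos _ _ HM) (fdom2_pos _ _ HN) (fun x _ => Hd x)).
  rewrite (CI_FTC (fun x => - f (- x)%R) (fun x => g (- x)%R) M N).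
  - rewrite Ropp_0. ring.
  - intro x. apply cont_Copp. now apply Cont_neg.
  - now apply Cont_neg.
  - apply dom2_opp. now apply fdom2_neg.
  - now apply fdom2_neg.
  - intros x _. eapply Cd_eq.
    + apply Cd_opp, (Cd_comp f (fun x => (- x)%R) x (g (- x)%R) (-1)); [apply Hd|].
      auto_derive; trivial.
    + apply injective_projections; simpl; ring.
Qed.

(** * Continuous extensions of the partial derivatives *)

Definition clamp (tmax tau : R) : R := Rmax 0 (Rmin tmax tau).

Lemma clamp_in tmax tau : (0 < tmax)%R -> (0 <= clamp tmax tau <= tmax)%R.
Proof.
  intro H. unfold clamp. split; [apply Rmax_l|]. apply Rmax_lub; [lra|apply Rmin_l].
Qed.
Lemma clamp_id tmax tau : (0 <= tau <= tmax)%R -> clamp tmax tau = tau.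
Proof. intro H. unfold clamp. rewrite Rmin_right, Rmax_right; lra. Qed.

Lemma continuous_pair {T A B : UniformSpace} (f : T -> A) (g : T -> B) (p : T) :
  continuous f p -> continuous g p -> continuous (fun q => (f q, g q)) p.
Proof.
  intros Hf Hg. apply (continuous_comp_2 f g (fun a b => (a, b))); trivial.
  apply (continuous_ext (fun z : A * B => z)); [now intros []|apply continuous_id].
Qed.

(** [continuous_on] controls only approach through the closed domain. The projected points never
    leave it, so the composite is continuous in the unrestricted sense. *)
Lemma clamped_jcont3 (tmax : R) (v : R * R * R -> C) : (0 < tmax)%R ->
  continuous_on (closed_domain tmax) v ->
  jcont3 (fun x y tau => v (x, Rmax 0 y, clamp tmax tau)).
Proof.
  intros Ht Hv T a b c p Ha Hb Hc.
  assert (HD : forall q, closed_domain tmax (a q, Rmax 0 (b q), clamp tmax (c q))).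
  { intro q. split; [apply Rmax_l|now apply clamp_in]. }
  assert (Hphi : continuous (fun q => (a q, Rmax 0 (b q), clamp tmax (c q))) p).
  { apply continuous_pair; [apply continuous_pair|].
    - exact Ha.
    - apply cont_Rmax; [apply continuous_const|exact Hb].
    - unfold clamp. apply cont_Rmax; [apply continuous_const|].
      apply cont_Rmin; [apply continuous_const|exact Hc]. }
  intros P HP. specialize (Hv _ (HD p) P HP). specialize (Hphi _ Hv).
  unfold filtermap in *. revert Hphi. apply filter_imp. intros q Hq. apply Hq, HD.
Qed.

(** Closed conditions pass to the start of a path. The paths used below start at a boundary point
    and lie in the open domain for parameters in (0, 1). *)
Lemma bound_at_0 (Phi : R -> C) (K : R) : continuous Phi 0%R ->
  (forall s, (0 < s < 1)%R -> (Cmod (Phi s) <= K)%R) -> (Cmod (Phi 0%R) <= K)%R.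
Proof.
  intros Hc H. apply Rnot_lt_le. intro Hn.
  destruct (proj1 (continuous_Cmod_iff _ _) Hc (Cmod (Phi 0%R) - K)%R ltac:(lra)) as [d Hd].
  assert (Hd0 := cond_pos d).
  pose (s := (Rmin d 1 / 2)%R).
  assert (H1 := Rmin_l d 1). assert (H2 := Rmin_r d 1).
  assert (H3 : (0 < Rmin d 1)%R) by (apply Rmin_glb_lt; lra).
  assert (Hs : (Cmod (Phi s - Phi 0%R) < Cmod (Phi 0%R) - K)%R).
  { apply Hd. change (Rabs (s - 0) < d)%R. rewrite Rminus_0_r, Rabs_pos_eq; unfold s; lra. }
  assert (HK := H s ltac:(unfold s; lra)).
  assert (H4 : (Cmod (Phi 0%R) <= Cmod (Phi s) + Cmod (Phi s - Phi 0%R))%R).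
  { replace (Phi 0%R) with (Phi s + - (Phi s - Phi 0%R)) at 1 by ring.
    eapply Rle_trans; [apply Cmod_triangle|]. rewrite Cmod_opp. lra. }
  lra.
Qed.
Lemma zero_at_0 (Phi : R -> C) : continuous Phi 0%R ->
  (forall s, (0 < s < 1)%R -> Phi s = 0) -> Phi 0%R = 0.
Proof.
  intros Hc H. apply Cmod_eq_0. apply Rle_antisym; [|apply Cmod_ge_0].
  apply bound_at_0; trivial. intros s Hs. rewrite H, Cmod_0; lra.
Qed.

Lemma is_Cderive_CDerive (f : R -> C) (s : R) :
  ex_derive (K := R_AbsRing) (V := C_R_NormedModule) f s -> is_Cderive f s (CDerive f s).
Proof.
  intros [l Hl]. replace (CDerive f s) with l; trivial.
  apply is_Cderive_iff in Hl. destruct Hl as [H1 H2]. unfold CDerive.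
  rewrite (surjective_pairing l). f_equal; symmetry; apply is_derive_unique; assumption.
Qed.

(** A derivative need not survive a limit towards the boundary, whereas the integral identity for
    increments does. This lemma turns the identity back into a derivative. *)
Lemma is_Cderive_of_increment (f g : R -> C) (a b z : R) : Cont g -> (a < z < b)%R ->
  (forall r s, (a < r)%R -> (r <= s < b)%R -> f s - f r = CInt g r s) -> is_Cderive f z (g z).
Proof.
  intros Hg Hz H. pose (r := ((a + z) / 2)%R).
  apply (is_derive_ext_loc (fun s => f r + CInt g r s)).
  - assert (Hl : (0 < Rmin (z - r) (b - z))%R) by (unfold r; apply Rmin_glb_lt; lra).
    exists (mkposreal _ Hl). intros s Hs.
    assert (Hs' : (Rabs (s - z) < Rmin (z - r) (b - z))%R) by exact Hs.
    apply Rabs_def2 in Hs'.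
    assert (H1 := Rmin_l (z - r) (b - z)). assert (H2 := Rmin_r (z - r) (b - z)).
    rewrite <- H by (unfold r in *; lra). cring.
  - eapply Cd_eq; [apply Cd_plus; [apply Cd_const|now apply is_derive_CInt]|]. ring.
Qed.

Lemma jcont3_12 F c : jcont3 F -> jcont2 (fun x y => F x y c).
Proof. intros H T a b p Ha Hb. apply H; trivial. apply continuous_const. Qed.
Lemma jcont3_23 F c : jcont3 F -> jcont2 (F c).
Proof. intros H T a b p Ha Hb. apply (H _ (fun _ => c) a b); trivial. apply continuous_const. Qed.

(** Total continuous stand-ins for the partial derivatives, indexed by words as in [partial]. They
    are constant beyond the domain in y and in time, hence the restrictions in [se_dY] and [se_dT];
    the tangential derivative exists everywhere, also at boundary points. The separated weights in x
    and y allow Fubini in these two variables. *)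
Record smooth_ext (N : nat) (tmax M : R) (u : R -> R -> R -> C)
    (V : list axis -> R -> R -> R -> C) : Prop := {
  se_cont : forall w, jcont3 (V w);
  se_bound : forall w, (length w <= N)%nat -> forall x y tau,
    (Cmod (V w x y tau) <= M * / (1 + Rabs x) ^ 4 * / (1 + Rmax 0 y) ^ 4)%R;
  se_dX : forall w, (length w < N)%nat -> forall x y tau,
    is_Cderive (fun s => V w s y tau) x (V (X :: w) x y tau);
  se_dY : forall w, (length w < N)%nat -> forall x y tau, (0 < y)%R ->
    is_Cderive (fun s => V w x s tau) y (V (Y :: w) x y tau);
  se_dT : forall w, (length w < N)%nat -> forall x y tau, (0 < tau < tmax)%R ->
    is_Cderive (fun s => V w x y s) tau (V (T :: w) x y tau);
  se_open : forall w, (length w <= N)%nat -> forall x y tau, open_domain tmax (x, y, tau) ->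
    V w x y tau = partial w u x y tau;
  se_u : forall x y tau, closed_domain tmax (x, y, tau) -> V [] x y tau = u x y tau;
  se_pde : forall x y tau, (4 <= N)%nat ->
    Ci * V [T] x y tau + (V [X; X; X; X] x y tau + 2 * V [X; X; Y; Y] x y tau
       + V [Y; Y; Y; Y] x y tau) = 0 }.

(** Every clause holds in the open domain and is carried to the closed one along the path given by
    [ys] and [ts]. The bound and the equation pass directly, the derivatives through their
    integrated form. *)
Lemma smooth_ext_exists (tmax : R) (u : R -> R -> R -> C) : (0 < tmax)%R ->
  CN_up_to_boundary 8 tmax u -> decays 8 tmax u -> solves_biharmonic_schrodinger tmax u ->
  exists M V, smooth_ext 8 tmax M u V.
Proof.
  intros Ht (Hu & Hd & Hv) [M HM] Hpde.
  assert (Hex : forall w : list axis, exists F : R -> R -> R -> C, jcont3 F /\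
    (forall x y tau, F x y tau = F x (Rmax 0 y) (clamp tmax tau)) /\
    ((length w <= 8)%nat -> forall x y tau, open_domain tmax (x, y, tau) -> F x y tau = partial w u x y tau)).
  { intro w. destruct (Compare_dec.le_dec (length w) 8) as [Hw|Hw].
    - destruct (Hv w Hw) as (v & Hv1 & Hv2).
      exists (fun x y tau => v (x, Rmax 0 y, clamp tmax tau)). split; [|split].
      + now apply clamped_jcont3.
      + intros x y tau. rewrite (Rmax_right 0 (Rmax 0 y)) by apply Rmax_l.
        now rewrite (clamp_id tmax (clamp tmax tau)) by now apply clamp_in.
      + intros _ x y tau Ho. destruct Ho as [Hy Htau].
        rewrite Rmax_right, clamp_id by lra. now apply (Hv2 (x, y, tau)).
    (* Longer words receive the value 0, so that the choice runs over all words and [se_cont] needs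
       no length condition. *)
    - exists (fun _ _ _ => 0). split; [|split]; trivial.
      + intros T a b c p _ _ _. apply continuous_const.
      + intros; contradiction. }
  destruct (functional_choice _ Hex) as [V HV].
  assert (Hc : forall w, jcont3 (V w)) by (intro w; apply HV).
  assert (Hcl : forall w x y tau, V w x y tau = V w x (Rmax 0 y) (clamp tmax tau)) by (intro w; apply HV).
  assert (Ho : forall w, (length w <= 8)%nat -> forall x y tau, open_domain tmax (x, y, tau) ->
    V w x y tau = partial w u x y tau) by (intro w; apply HV).
  (* Moves every point of the closed domain into the open one. *)
  pose (ys := fun y s : R => (Rmax 0 y + s)%R).
  pose (ts := fun tau s : R => ((1 - s) * clamp tmax tau + s * (tmax / 2))%R).
  assert (Hys : forall y s, (0 < s)%R -> (0 < ys y s)%R).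
  { intros y s Hs. unfold ys. assert (H := Rmax_l 0 y). lra. }
  assert (Hts : forall tau s, (0 < s < 1)%R -> (0 < ts tau s < tmax)%R).
  { intros tau s Hs. unfold ts. assert (H := clamp_in tmax tau Ht). split; nra. }
  assert (Hys0 : forall y, ys y 0%R = Rmax 0 y) by (intro y; unfold ys; ring).
  assert (Hts0 : forall tau, ts tau 0%R = clamp tmax tau) by (intro tau; unfold ts; field).
  assert (Hysc : forall y s, continuous (ys y) s).
  { intros y s. apply cont_Rplus; [apply continuous_const|apply continuous_id]. }
  assert (Htsc : forall tau s, continuous (ts tau) s).
  { intros tau s. unfold ts. apply cont_Rplus; apply cont_Rmult; try apply continuous_const.
    - apply cont_Rminus; [apply continuous_const|apply continuous_id].
    - apply continuous_id. }
  assert (Hclos : forall w x y tau, V w x (ys y 0%R) (ts tau 0%R) = V w x y tau).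
  { intros. rewrite Hys0, Hts0. symmetry. apply Hcl. }
  assert (HdV : forall w a, (length w < 8)%nat -> forall x y tau, open_domain tmax (x, y, tau) ->
    is_Cderive (along a (partial w u) x y tau) (coord a x y tau) (V (a :: w) x y tau)).
  { intros w a Hw x y tau Hop. rewrite Ho; simpl; trivial; try lia.
    apply is_Cderive_CDerive. now apply Hd. }
  exists M, V. constructor; trivial.
  - intros w Hw x y tau. rewrite <- (Hclos w x y tau).
    apply (bound_at_0 (fun s => V w x (ys y s) (ts tau s))).
    + apply (Hc w _ (fun _ => x)); [apply continuous_const|apply Hysc|apply Htsc].
    + intros s Hs. assert (Hop : open_domain tmax (x, ys y s, ts tau s)).
      { split; [apply Hys; lra|now apply Hts]. }
      rewrite Ho by trivial. assert (HB := HM w Hw _ _ _ Hop).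
      assert (H0 := Cmod_ge_0 (partial w u x (ys y s) (ts tau s))).
      assert (Hy0 := Rmax_l 0 y). assert (Hx0 := Rabs_pos x).
      rewrite (Rabs_pos_eq (ys y s)) in HB by (left; apply Hys; lra).
      assert (HP : (0 < (1 + Rabs x + ys y s) ^ 8)%R) by (apply pow_lt; unfold ys; lra).
      assert (HM0 : (0 <= M)%R).
      { apply Rnot_lt_le. intro Hn.
        assert (M / (1 + Rabs x + ys y s) ^ 8 < 0)%R; [|lra].
        unfold Rdiv. assert (Hi := Rinv_0_lt_compat _ HP). nra. }
      eapply Rle_trans; [exact HB|]. unfold Rdiv. rewrite Rmult_assoc.
      apply Rmult_le_compat_l; trivial. rewrite <- Rinv_mult.
      apply Rinv_le_contravar.
      * apply Rmult_lt_0_compat; apply pow_lt; lra.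
      (* (1 + |x|)(1 + y) is at most (1 + |x| + y)^2, so the eight powers of decay are spent as four
         in x and four in y. *)
      * rewrite <- Rpow_mult_distr.
        replace ((1 + Rabs x + ys y s) ^ 8)%R with (((1 + Rabs x + ys y s) ^ 2) ^ 4)%R by ring.
        apply pow_incr. unfold ys. nra.
  - intros w Hw x y tau.
    apply (is_Cderive_of_increment _ (fun s => V (X :: w) s y tau) (x - 1) (x + 1)); [|lra|].
    { apply (jcont2_l (fun s y => V (X :: w) s y tau)). now apply jcont3_12. }
    intros r s _ Hrs.
    assert (Z : V w s (ys y 0%R) (ts tau 0%R) - V w r (ys y 0%R) (ts tau 0%R) -
       CInt (fun q => V (X :: w) q (ys y 0%R) (ts tau 0%R)) r s = 0).
    { apply (zero_at_0 (fun e => V w s (ys y e) (ts tau e) - V w r (ys y e) (ts tau e) -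
         CInt (fun q => V (X :: w) q (ys y e) (ts tau e)) r s)).
      - apply cont_Cminus; [apply cont_Cminus|].
        + apply (Hc w _ (fun _ => s)); [apply continuous_const|apply Hysc|apply Htsc].
        + apply (Hc w _ (fun _ => r)); [apply continuous_const|apply Hysc|apply Htsc].
        + apply (cont_CInt_param (fun e q => V (X :: w) q (ys y e) (ts tau e))); [lra|].
          intros e q. apply Hc; [apply continuous_snd| |].
          * apply (continuous_comp (fun z : R * R => fst z) (ys y)); [apply continuous_fst|apply Hysc].
          * apply (continuous_comp (fun z : R * R => fst z) (ts tau)); [apply continuous_fst|apply Htsc].
      - intros e He.
        assert (Hop : forall q, open_domain tmax (q, ys y e, ts tau e)).
        { intro q. split; [apply Hys; lra|now apply Hts]. }
        rewrite (CInt_FTC (fun q => V w q (ys y e) (ts tau e))); [ring|lra| | |].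
        + apply (jcont2_l (fun s y => V (X :: w) s y (ts tau e))). now apply jcont3_12.
        + intros q _. apply (jcont2_l (fun s y => V w s y (ts tau e))). now apply jcont3_12.
        + intros q _. apply (is_derive_ext (along X (partial w u) q (ys y e) (ts tau e))).
          * intro q'. symmetry. apply Ho; [lia|apply Hop].
          * apply (HdV w X Hw q). apply Hop. }
    rewrite !Hclos in Z.
    rewrite (CInt_ext (fun q => V (X :: w) q (ys y 0%R) (ts tau 0%R)) (fun q => V (X :: w) q y tau)) in Z
      by (intros; apply Hclos).
    replace (V w s y tau - V w r y tau) with
      (V w s y tau - V w r y tau - CInt (fun q => V (X :: w) q y tau) r s + CInt (fun q => V (X :: w) q y tau) r s) by ring.
    rewrite Z. ring.
  - intros w Hw x y tau Hy.
    apply (is_Cderive_of_increment _ (fun s => V (Y :: w) x s tau) 0 (y + 1)); [|lra|].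
    { apply (jcont2_l (V (Y :: w) x)). now apply jcont3_23. }
    intros r s Hr Hrs.
    (* Here y is already positive, so only the time moves along the path; for the time derivative it
       is the other way round. *)
    assert (Hct : forall w y, V w x y (ts tau 0%R) = V w x y tau).
    { intros w' y'. rewrite Hcl, (Hcl w' x y' tau). f_equal. rewrite Hts0.
      now rewrite (clamp_id tmax (clamp tmax tau)) by now apply clamp_in. }
    assert (Z : V w x s (ts tau 0%R) - V w x r (ts tau 0%R) -
       CInt (fun q => V (Y :: w) x q (ts tau 0%R)) r s = 0).
    { apply (zero_at_0 (fun e => V w x s (ts tau e) - V w x r (ts tau e) -
         CInt (fun q => V (Y :: w) x q (ts tau e)) r s)).
      - apply cont_Cminus; [apply cont_Cminus|].
        + apply (Hc w _ (fun _ => x) (fun _ => s)); [apply continuous_const|apply continuous_const|apply Htsc].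
        + apply (Hc w _ (fun _ => x) (fun _ => r)); [apply continuous_const|apply continuous_const|apply Htsc].
        + apply (cont_CInt_param (fun e q => V (Y :: w) x q (ts tau e))); [lra|].
          intros e q. apply (Hc (Y :: w) _ (fun _ => x)); [apply continuous_const|apply continuous_snd|].
          apply (continuous_comp (fun z : R * R => fst z) (ts tau)); [apply continuous_fst|apply Htsc].
      - intros e He.
        assert (Hop : forall q, (0 < q)%R -> open_domain tmax (x, q, ts tau e)).
        { intros q Hq. split; [trivial|now apply Hts]. }
        rewrite (CInt_FTC (fun q => V w x q (ts tau e))); [ring|lra| | |].
        + apply (jcont2_l (V (Y :: w) x)). now apply jcont3_23.
        + intros q _. apply (jcont2_l (V w x)). now apply jcont3_23.
        + intros q Hq. apply (is_derive_ext_loc (along Y (partial w u) x q (ts tau e))).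
          * assert (Hq0 : (0 < q)%R) by lra. exists (mkposreal q Hq0). intros q' Hq'.
            symmetry. apply Ho; [lia|apply Hop].
            assert (H' : (Rabs (q' - q) < q)%R) by exact Hq'. apply Rabs_def2 in H'. lra.
          * apply (HdV w Y Hw x q). apply Hop. lra. }
    rewrite !Hct in Z.
    rewrite (CInt_ext (fun q => V (Y :: w) x q (ts tau 0%R)) (fun q => V (Y :: w) x q tau)) in Z
      by (intros; apply Hct).
    replace (V w x s tau - V w x r tau) with
      (V w x s tau - V w x r tau - CInt (fun q => V (Y :: w) x q tau) r s + CInt (fun q => V (Y :: w) x q tau) r s) by ring.
    rewrite Z. ring.
  - intros w Hw x y tau Htau.
    apply (is_Cderive_of_increment _ (fun s => V (T :: w) x y s) 0 tmax); [|lra|].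
    { apply (jcont2_r (V (T :: w) x)). now apply jcont3_23. }
    intros r s Hr Hrs.
    assert (Hct : forall w tau, V w x (ys y 0%R) tau = V w x y tau).
    { intros w' tau'. rewrite Hcl, (Hcl w' x y tau'). f_equal. rewrite Hys0.
      now rewrite (Rmax_right 0 (Rmax 0 y)) by apply Rmax_l. }
    assert (Z : V w x (ys y 0%R) s - V w x (ys y 0%R) r -
       CInt (fun q => V (T :: w) x (ys y 0%R) q) r s = 0).
    { apply (zero_at_0 (fun e => V w x (ys y e) s - V w x (ys y e) r -
         CInt (fun q => V (T :: w) x (ys y e) q) r s)).
      - apply cont_Cminus; [apply cont_Cminus|].
        + apply (Hc w _ (fun _ => x) (ys y) (fun _ => s)); [apply continuous_const|apply Hysc|apply continuous_const].
        + apply (Hc w _ (fun _ => x) (ys y) (fun _ => r)); [apply continuous_const|apply Hysc|apply continuous_const].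
        + apply (cont_CInt_param (fun e q => V (T :: w) x (ys y e) q)); [lra|].
          intros e q. apply (Hc (T :: w) _ (fun _ => x)); [apply continuous_const| |apply continuous_snd].
          apply (continuous_comp (fun z : R * R => fst z) (ys y)); [apply continuous_fst|apply Hysc].
      - intros e He.
        assert (Hop : forall q, (0 < q < tmax)%R -> open_domain tmax (x, ys y e, q)).
        { intros q Hq. split; [apply Hys; lra|trivial]. }
        rewrite (CInt_FTC (fun q => V w x (ys y e) q)); [ring|lra| | |].
        + apply (jcont2_r (V (T :: w) x)). now apply jcont3_23.
        + intros q _. apply (jcont2_r (V w x)). now apply jcont3_23.
        + intros q Hq. apply (is_derive_ext_loc (along T (partial w u) x (ys y e) q)).
          * assert (Hq0 : (0 < Rmin q (tmax - q))%R) by (apply Rmin_glb_lt; lra).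
            exists (mkposreal _ Hq0). intros q' Hq'.
            symmetry. apply Ho; [lia|apply Hop].
            assert (H' : (Rabs (q' - q) < Rmin q (tmax - q))%R) by exact Hq'. apply Rabs_def2 in H'.
            assert (H1 := Rmin_l q (tmax - q)). assert (H2 := Rmin_r q (tmax - q)). lra.
          * apply (HdV w T Hw x (ys y e) q). apply Hop. lra. }
    rewrite !Hct in Z.
    rewrite (CInt_ext (fun q => V (T :: w) x (ys y 0%R) q) (fun q => V (T :: w) x y q)) in Z
      by (intros; apply Hct).
    replace (V w x y s - V w x y r) with
      (V w x y s - V w x y r - CInt (fun q => V (T :: w) x y q) r s + CInt (fun q => V (T :: w) x y q) r s) by ring.
    rewrite Z. ring.
  - intros x y tau [Hy Htau].
    assert (HU := clamped_jcont3 tmax (uncurry3 u) Ht Hu).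
    assert (Z : V [] x (ys y 0%R) (ts tau 0%R) - u x (Rmax 0 (ys y 0%R)) (clamp tmax (ts tau 0%R)) = 0).
    { apply (zero_at_0 (fun e => V [] x (ys y e) (ts tau e) - u x (Rmax 0 (ys y e)) (clamp tmax (ts tau e)))).
      - apply cont_Cminus.
        + apply (Hc [] _ (fun _ => x)); [apply continuous_const|apply Hysc|apply Htsc].
        + apply (HU _ (fun _ => x)); [apply continuous_const|apply Hysc|apply Htsc].
      - intros e He. rewrite Ho; [|simpl; lia|split; [apply Hys; lra|now apply Hts]].
        rewrite Rmax_right by (left; apply Hys; lra).
        rewrite clamp_id by (destruct (Hts tau e He); lra). simpl. ring. }
    rewrite Hclos, Hys0, Hts0 in Z. rewrite (clamp_id tmax tau) in Z by trivial.
    rewrite (clamp_id tmax tau) in Z by trivial. rewrite !(Rmax_right 0 y) in Z by trivial.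
    replace (V [] x y tau) with (V [] x y tau - u x y tau + u x y tau) by ring. rewrite Z. ring.
  - intros x y tau _. rewrite <- !Hclos with (y := y) (tau := tau).
    apply (zero_at_0 (fun e => Ci * V [T] x (ys y e) (ts tau e) + (V [X; X; X; X] x (ys y e) (ts tau e)
       + 2 * V [X; X; Y; Y] x (ys y e) (ts tau e) + V [Y; Y; Y; Y] x (ys y e) (ts tau e)))).
    + assert (Hcw : forall w, continuous (fun e => V w x (ys y e) (ts tau e)) 0%R).
      { intro w. apply (Hc w _ (fun _ => x)); [apply continuous_const|apply Hysc|apply Htsc]. }
      apply cont_Cplus; [apply cont_Cmult; [apply continuous_const|exact (Hcw _)]|].
      apply cont_Cplus; [apply cont_Cplus|exact (Hcw _)]; [exact (Hcw _)|].
      apply cont_Cmult; [apply continuous_const|exact (Hcw _)].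
    + intros e He.
      assert (Hop : open_domain tmax (x, ys y e, ts tau e)) by (split; [apply Hys; lra|now apply Hts]).
      rewrite !Ho by (simpl; trivial; lia). now apply Hpde.
Qed.

(** * The Fourier transform in the tangential variable *)

Lemma Cmod_Cexp_x (x k : R) : Cmod (Cexp (- (Ci * RtoC x * RtoC k))) = 1%R.
Proof.
  rewrite Cmod_Cexp. replace (Re (- (Ci * RtoC x * RtoC k))) with 0%R; [apply exp_0|].
  unfold Re; simpl; ring.
Qed.

Lemma inv_pow42 (x : R) : (0 <= x)%R -> (0 < / (1 + x) ^ 4 <= / (1 + x) ^ 2)%R.
Proof.
  intro H. assert (H1 : (0 < 1 + x)%R) by lra. split.
  - apply Rinv_0_lt_compat. now apply pow_lt.
  - apply Rinv_le_contravar; [now apply pow_lt|].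
    replace ((1 + x) ^ 4)%R with ((1 + x) ^ 2 * (1 + x) ^ 2)%R by ring.
    assert (Hp : (1 <= (1 + x) ^ 2)%R) by (simpl; nra). generalize dependent ((1 + x) ^ 2)%R.
    intros p Hp. nra.
Qed.
Lemma inv_pow_pos (n : nat) (x : R) : (0 <= x)%R -> (0 < / (1 + x) ^ n <= 1)%R.
Proof.
  intro H. assert (H1 : (1 <= (1 + x) ^ n)%R).
  { apply pow_R1_Rle. lra. }
  split.
  - apply Rinv_0_lt_compat; lra.
  - apply Rle_trans with (/ 1)%R; [apply Rinv_le_contravar; lra|rewrite Rinv_1; lra].
Qed.

Lemma FI_CI_Fubini (F : R -> R -> C) (M : R) : jcont2 F ->
  (forall x y, (0 <= y)%R -> (Cmod (F x y) <= M * / (1 + Rabs x) ^ 2 * / (1 + y) ^ 2)%R) ->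
  FI (fun x => CI (F x)) = CI (fun y => FI (fun x => F x y)).
Proof.
  intros HF HM.
  assert (HM0 : (0 <= M)%R).
  { specialize (HM 0%R 0%R (Rle_refl _)). assert (H := Cmod_ge_0 (F 0%R 0%R)).
    rewrite Rabs_R0 in HM.
    replace ((1 + 0) ^ 2)%R with 1%R in HM by ring. rewrite Rinv_1 in HM. lra. }
  pose (G := fun x y => F x y + F (- x)%R y).
  assert (HG : jcont2 G).
  { intros T a b p Ha Hb. apply cont_Cplus; apply HF; [exact Ha|exact Hb|apply cont_Ropp; exact Ha|exact Hb]. }
  assert (HdF : forall x, dom2 M (F x)).
  { intros x y Hy. eapply Rle_trans; [now apply HM|].
    assert (H1 := inv_pow_pos 2 y Hy). assert (H2 := inv_pow_pos 2 (Rabs x) (Rabs_pos x)).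
    rewrite Rmult_assoc. apply Rmult_le_compat_l; trivial. nra. }
  transitivity (CI (fun x => CI (G (Rmax 0 x)))).
  - apply CI_ext. intros x Hx. rewrite Rmax_right by lra. symmetry.
    apply (CI_plus (F x) (F (- x)%R) M M); try apply HdF; now apply jcont2_r.
  - rewrite (CI_CI_Fubini G (2 * M) HG).
    + apply CI_ext. intros y Hy. apply CI_ext. intros x Hx. now rewrite Rmax_right by lra.
    + intros x y Hx Hy. unfold G. eapply Rle_trans; [apply Cmod_triangle|].
      assert (H1 := HM x y Hy). assert (H2 := HM (- x)%R y Hy).
      rewrite Rabs_Ropp in H2. rewrite (Rabs_pos_eq x) in H1, H2 by trivial. lra.
Qed.

(** The datum [u0] is prescribed only for y > 0, so at 0 it may disagree with the continuous
    extension that is actually integrated. *)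
Lemma CInt_half_ext (f g : R -> C) (M : R) : (forall y, (0 < y)%R -> f y = g y) ->
  Cont g -> dom2 M g -> CInt_half f = CI g.
Proof.
  intros H Hg Hd. unfold CInt_half.
  apply (@is_RInt_gen_unique C_R_CompleteNormedModule _ _ _ _).
  apply (fun HF => is_RInt_gen_ext (V := C_R_NormedModule) g f (CI g) HF (CI_is_RInt_gen g M Hg Hd)).
  exists (fun a => a = 0%R) (fun b => (0 < b)%R); [reflexivity|now exists 0%R|].
  intros a b -> Hb y Hy. simpl in Hy. rewrite Rmin_left, Rmax_right in Hy by lra.
  symmetry. apply H. lra.
Qed.

Definition fourier_x (f : R -> R -> R -> C) (kappa y tau : R) : C :=
  FI (fun x => Cexp (- (Ci * RtoC x * RtoC kappa)) * f x y tau).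

Section FourierX.
Context (tmax M : R) (u : R -> R -> R -> C) (V : list axis -> R -> R -> R -> C).
Context (HV : smooth_ext 8 tmax M u V).
Notation Vh w := (fourier_x (V w)).

Lemma ext_bound_nonneg : (0 <= M)%R.
Proof.
  assert (H := se_bound _ _ _ _ _ HV [] ltac:(simpl; lia) 0%R 0%R 0%R).
  assert (H0 := Cmod_ge_0 (V [] 0%R 0%R 0%R)).
  rewrite Rabs_R0, Rmax_left in H by lra.
  replace ((1 + 0) ^ 4)%R with 1%R in H by ring. rewrite Rinv_1 in H. lra.
Qed.

Lemma fx_fdom2 w kappa y tau : (length w <= 8)%nat ->
  fdom2 (M * / (1 + Rmax 0 y) ^ 4) (fun x => Cexp (- (Ci * RtoC x * RtoC kappa)) * V w x y tau).
Proof.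
  intros Hw x. rewrite Cmod_mult, Cmod_Cexp_x, Rmult_1_l.
  eapply Rle_trans; [now apply (se_bound _ _ _ _ _ HV)|].
  assert (H1 := inv_pow42 (Rabs x) (Rabs_pos x)).
  assert (H2 := inv_pow_pos 4 (Rmax 0 y) (Rmax_l _ _)).
  assert (H3 := ext_bound_nonneg).
  rewrite Rmult_assoc, (Rmult_comm (/ (1 + Rabs x) ^ 4)), <- Rmult_assoc.
  apply Rmult_le_compat_l; [|lra]. apply Rmult_le_pos; lra.
Qed.
Lemma fx_fdom2_unif w kappa y tau : (length w <= 8)%nat ->
  fdom2 M (fun x => Cexp (- (Ci * RtoC x * RtoC kappa)) * V w x y tau).
Proof.
  intros Hw x. eapply Rle_trans; [now apply fx_fdom2|].
  assert (H1 := inv_pow_pos 2 (Rabs x) (Rabs_pos x)).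
  assert (H2 := inv_pow_pos 4 (Rmax 0 y) (Rmax_l _ _)).
  assert (H3 := ext_bound_nonneg). apply Rmult_le_compat_r; [lra|]. nra.
Qed.

Lemma cont_ex {T : UniformSpace} (a b : T -> R) (p : T) : continuous a p -> continuous b p ->
  continuous (fun q => Cexp (- (Ci * RtoC (a q) * RtoC (b q)))) p.
Proof.
  intros Ha Hb. apply cont_Cexp, cont_Copp, cont_Cmult; [apply cont_Cmult|].
  - apply continuous_const.
  - apply cont_RtoC. exact Ha.
  - apply cont_RtoC. exact Hb.
Qed.

Lemma fx_Cont w kappa y tau : Cont (fun x => Cexp (- (Ci * RtoC x * RtoC kappa)) * V w x y tau).
Proof.
  intro x. apply cont_Cmult.
  - apply (cont_ex (fun x => x) (fun _ => kappa)); [apply continuous_id|apply continuous_const].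
  - apply (jcont2_l (fun x y => V w x y tau)). apply jcont3_12, (se_cont _ _ _ _ _ HV).
Qed.

Lemma fx_jcont3 w : (length w <= 8)%nat -> jcont3 (Vh w).
Proof.
  intros Hw T a b c p Ha Hb Hc.
  apply (continuous_comp (fun q => (a q, b q, c q))
    (fun z : R * R * R => Vh w (fst (fst z)) (snd (fst z)) (snd z))).
  { apply continuous_pair; [apply continuous_pair|]; assumption. }
  apply (cont_FI_param (fun (z : R * R * R) x =>
    Cexp (- (Ci * RtoC x * RtoC (fst (fst z)))) * V w x (snd (fst z)) (snd z)) M).
  - intros q s. apply cont_Cmult.
    + apply (cont_ex (fun z : R * R * R * R => snd z) (fun z => fst (fst (fst z)))).
      * apply continuous_snd.
      * apply cont_fst, cont_fst, continuous_fst.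
    + apply (se_cont _ _ _ _ _ HV w _ (fun z : R * R * R * R => snd z)
        (fun z => snd (fst (fst z))) (fun z => snd (fst z))).
      * apply continuous_snd.
      * apply cont_snd, cont_fst, continuous_fst.
      * apply cont_snd, continuous_fst.
  - intro q. now apply fx_fdom2_unif.
Qed.

Lemma fx_bound w kappa y tau : (length w <= 8)%nat ->
  (Cmod (Vh w kappa y tau) <= 4 * M * / (1 + Rmax 0 y) ^ 4)%R.
Proof.
  intro Hw. rewrite Rmult_assoc. apply FI_bound; [apply fx_Cont|now apply fx_fdom2].
Qed.

Lemma fx_dY w kappa y tau : (length w < 8)%nat -> (0 < y)%R ->
  is_Cderive (fun s => Vh w kappa s tau) y (Vh (Y :: w) kappa y tau).
Proof.
  intros Hw Hy.
  assert (Hj : forall w, jcont2 (fun s x => Cexp (- (Ci * RtoC x * RtoC kappa)) * V w x s tau)).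
  { intros w' T a b p Ha Hb. apply cont_Cmult.
    - apply (cont_ex b (fun _ => kappa)); [exact Hb|apply continuous_const].
    - apply (se_cont _ _ _ _ _ HV w' _ b a (fun _ => tau)); [exact Hb|exact Ha|apply continuous_const]. }
  apply (is_derive_FI_param (fun s x => Cexp (- (Ci * RtoC x * RtoC kappa)) * V w x s tau)
    (fun s x => Cexp (- (Ci * RtoC x * RtoC kappa)) * V (Y :: w) x s tau) M M 0 (y + 1));
    [apply Hj|apply Hj| | |lra|].
  - intro q. apply fx_fdom2_unif. lia.
  - intro q. apply fx_fdom2_unif. simpl; lia.
  - intros q s Hq. apply Cd_scal. apply (se_dY _ _ _ _ _ HV); [lia|lra].
Qed.

Lemma fx_dT w kappa y tau : (length w < 8)%nat -> (0 < tau < tmax)%R ->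
  is_Cderive (fun s => Vh w kappa y s) tau (Vh (T :: w) kappa y tau).
Proof.
  intros Hw Ht.
  assert (Hj : forall w, jcont2 (fun s x => Cexp (- (Ci * RtoC x * RtoC kappa)) * V w x y s)).
  { intros w' T a b p Ha Hb. apply cont_Cmult.
    - apply (cont_ex b (fun _ => kappa)); [exact Hb|apply continuous_const].
    - apply (se_cont _ _ _ _ _ HV w' _ b (fun _ => y) a); [exact Hb|apply continuous_const|exact Ha]. }
  apply (is_derive_FI_param (fun s x => Cexp (- (Ci * RtoC x * RtoC kappa)) * V w x y s)
    (fun s x => Cexp (- (Ci * RtoC x * RtoC kappa)) * V (T :: w) x y s) M M 0 tmax);
    [apply Hj|apply Hj| | |lra|].
  - intro q. apply fx_fdom2_unif. lia.
  - intro q. apply fx_fdom2_unif. simpl; lia.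
  - intros q s Hq. apply Cd_scal. apply (se_dT _ _ _ _ _ HV); [lia|lra].
Qed.

(** The x-derivative of exp(- i x kappa) V w is an exact derivative of a decaying function, so its
    integral over the line is 0. *)
Lemma fx_dX w kappa y tau : (length w < 8)%nat ->
  Vh (X :: w) kappa y tau = Ci * RtoC kappa * Vh w kappa y tau.
Proof.
  intro Hw.
  pose (e := fun x : R => Cexp (- (Ci * RtoC x * RtoC kappa))).
  assert (H : FI (fun x => - (Ci * RtoC kappa) * (e x * V w x y tau) + e x * V (X :: w) x y tau) = 0).
  { apply (FI_FTC (fun x => e x * V w x y tau) _ M (Cmod (- (Ci * RtoC kappa)) * M + M)).
    - apply fx_Cont.
    - intro x. apply cont_Cplus; [apply cont_Cmult; [apply continuous_const|apply fx_Cont]|apply fx_Cont].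
    - apply fx_fdom2_unif; lia.
    - intro x. eapply Rle_trans; [apply Cmod_triangle|]. rewrite Rmult_plus_distr_r.
      apply Rplus_le_compat.
      + rewrite Cmod_mult, Rmult_assoc. apply Rmult_le_compat_l; [apply Cmod_ge_0|].
        apply fx_fdom2_unif; lia.
      + apply fx_fdom2_unif; simpl; lia.
    - intro x. eapply Cd_eq.
      + apply Cd_mult.
        * unfold e. apply Cd_Cexp, Cd_opp.
          apply (Cd_mult (fun s => Ci * RtoC s) (fun _ => RtoC kappa) x (Ci * 1)).
          -- apply Cd_scal, Cd_id.
          -- apply Cd_const.
        * apply (se_dX _ _ _ _ _ HV). lia.
      + unfold e. ring. }
  rewrite (FI_plus _ _ (Cmod (- (Ci * RtoC kappa)) * M) M) in H.
  - rewrite (FI_scal _ _ M) in H; [|apply fx_Cont|apply fx_fdom2_unif; lia].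
    change (FI (fun x => e x * V (X :: w) x y tau) = Ci * RtoC kappa * FI (fun x => e x * V w x y tau)).
    set (a := FI (fun x => e x * V (X :: w) x y tau)) in *.
    set (b := FI (fun x => e x * V w x y tau)) in *.
    replace a with (- (Ci * RtoC kappa) * b + a + Ci * RtoC kappa * b) by ring.
    rewrite H. ring.
  - intro x. apply cont_Cmult; [apply continuous_const|apply fx_Cont].
  - apply fx_Cont.
  - intro x. rewrite Cmod_mult, Rmult_assoc. apply Rmult_le_compat_l; [apply Cmod_ge_0|].
    apply fx_fdom2_unif; lia.
  - apply fx_fdom2_unif; simpl; lia.
Qed.

(** Two tangential derivatives multiply the transform by - kappa^2; adding the bounds for both
    transforms produces the weight 1 + kappa^2, which makes integrals in kappa absolutely
    convergent. *)
Lemma fx_decay2 w kappa y tau : (length w <= 6)%nat ->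
  ((1 + kappa ^ 2) * Cmod (Vh w kappa y tau) <= 8 * M * / (1 + Rmax 0 y) ^ 4)%R.
Proof.
  intro Hw.
  assert (E : Vh (X :: X :: w) kappa y tau = RtoC (- kappa ^ 2) * Vh w kappa y tau).
  { rewrite !fx_dX by (simpl; lia). rewrite Cmult_assoc. f_equal.
    apply injective_projections; simpl; ring. }
  assert (H1 := fx_bound w kappa y tau ltac:(lia)).
  assert (H2 := fx_bound (X :: X :: w) kappa y tau ltac:(simpl; lia)).
  rewrite E, Cmod_mult, Cmod_R, Rabs_Ropp in H2.
  rewrite (Rabs_pos_eq (kappa ^ 2)) in H2 by nra. lra.
Qed.
(** The second factor 1 + kappa^2 pays for the growth in kappa of the remainder [rho] in the
    oscillatory integration by parts. *)
Lemma fx_decay4 w kappa y tau : (length w <= 4)%nat ->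
  ((1 + kappa ^ 2) ^ 2 * Cmod (Vh w kappa y tau) <= 16 * M * / (1 + Rmax 0 y) ^ 4)%R.
Proof.
  intro Hw.
  assert (E : Vh (X :: X :: w) kappa y tau = RtoC (- kappa ^ 2) * Vh w kappa y tau).
  { rewrite !fx_dX by (simpl; lia). rewrite Cmult_assoc. f_equal.
    apply injective_projections; simpl; ring. }
  assert (H1 := fx_decay2 w kappa y tau ltac:(lia)).
  assert (H2 := fx_decay2 (X :: X :: w) kappa y tau ltac:(simpl; lia)).
  rewrite E, Cmod_mult, Cmod_R, Rabs_Ropp in H2.
  rewrite (Rabs_pos_eq (kappa ^ 2)) in H2 by nra. lra.
Qed.

(** The order of integration is exchanged so that the transform in x comes first. The condition on
    [lambda] bounds the kernel in y by 1, which gives the domination required by Fubini. *)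
Lemma half_space_transformE (u0 : R -> R -> C) (kappa : R) (lambda : C) : (0 < tmax)%R ->
  (forall x y, (0 < y)%R -> u x y 0%R = u0 x y) -> (Im lambda <= 0)%R ->
  half_space_transform u0 kappa lambda =
  CI (fun y => Cexp (- (Ci * RtoC y * lambda)) * Vh [] kappa y 0%R).
Proof.
  intros Htm Hu0 Hl.
  pose (F := fun x y : R => Cexp (- (Ci * RtoC x * RtoC kappa)) * V [] x y 0%R * Cexp (- (Ci * RtoC y * lambda))).
  assert (Hey : forall y, (0 <= y)%R -> (Cmod (Cexp (- (Ci * RtoC y * lambda))) <= 1)%R).
  { intros y Hy. apply Cmod_Cexp_le. unfold Im in Hl. unfold Re; simpl. nra. }
  assert (HF : jcont2 F).
  { intros T a b p Ha Hb. apply cont_Cmult; [apply cont_Cmult|].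
    - apply (cont_ex a (fun _ => kappa)); [exact Ha|apply continuous_const].
    - apply (se_cont _ _ _ _ _ HV [] _ a b (fun _ => 0%R)); [exact Ha|exact Hb|apply continuous_const].
    - apply cont_Cexp, cont_Copp, cont_Cmult; [apply cont_Cmult|]; try apply continuous_const.
      apply cont_RtoC; exact Hb. }
  assert (HM := ext_bound_nonneg).
  assert (Hd : forall x y, (0 <= y)%R -> (Cmod (F x y) <= M * / (1 + Rabs x) ^ 2 * / (1 + y) ^ 2)%R).
  { intros x y Hy. unfold F. rewrite Cmod_mult.
    assert (H1 := fx_fdom2 [] kappa y 0%R ltac:(simpl; lia) x). cbv beta in H1.
    rewrite (Rmax_right 0 y) in H1 by trivial.
    assert (H2 := inv_pow42 y Hy). assert (H3 := inv_pow_pos 2 (Rabs x) (Rabs_pos x)).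
    assert (H4 := Hey y Hy). assert (H5 := Cmod_ge_0 (Cexp (- (Ci * RtoC x * RtoC kappa)) * V [] x y 0%R)).
    apply Rle_trans with (M * / (1 + y) ^ 4 * / (1 + Rabs x) ^ 2)%R.
    - rewrite <- (Rmult_1_r (M * / (1 + y) ^ 4 * / (1 + Rabs x) ^ 2)).
      apply Rmult_le_compat; trivial. apply Cmod_ge_0.
    - rewrite Rmult_assoc, (Rmult_comm (/ (1 + y) ^ 4)), <- Rmult_assoc.
      apply Rmult_le_compat_l; [|lra]. apply Rmult_le_pos; lra. }
  assert (HdF : forall x, dom2 (M * / (1 + Rabs x) ^ 2) (F x)).
  { intros x y Hy. now apply Hd. }
  unfold half_space_transform.
  transitivity (CInt_line (fun x => CI (F x))).
  { f_equal. apply functional_extensionality. intro x.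
    apply (CInt_half_ext _ (F x) (M * / (1 + Rabs x) ^ 2)); [|now apply jcont2_r|apply HdF].
    intros y Hy. unfold F.
    rewrite (se_u _ _ _ _ _ HV) by (split; lra). rewrite Hu0 by exact Hy.
    replace (- (Ci * RtoC x * RtoC kappa) - Ci * RtoC y * lambda) with
      (- (Ci * RtoC x * RtoC kappa) + - (Ci * RtoC y * lambda)) by ring.
    rewrite Cexp_plus. ring. }
  rewrite (CInt_line_FI _ (2 * M)).
  - rewrite (FI_CI_Fubini F M HF Hd). apply CI_ext. intros y Hy. unfold fourier_x.
    rewrite <- (FI_scal _ _ M); [|apply fx_Cont|apply fx_fdom2_unif; simpl; lia].
    apply FI_ext. intro x. unfold F. ring.
  - intro x. apply (cont_CI_param F M).
    + intros q s. now apply jcont2_pair.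
    + intros q y Hy. eapply Rle_trans; [now apply HdF|].
      assert (H1 := inv_pow_pos 2 y Hy). assert (H2 := inv_pow_pos 2 (Rabs q) (Rabs_pos q)).
      apply Rmult_le_compat_r; [lra|]. nra.
  - intro x. eapply Rle_trans; [apply CI_bound; [now apply jcont2_r|apply HdF]|]. lra.
Qed.
End FourierX.

(** What the global relation uses for a fixed frequency: [w k] stands for the k-th y-derivative of
    the transform in x and [wt k] for its time derivative. The equation [hs_pde] is iu_t + Delta^2 u
    = 0 with d_x^2 replaced by - kappa^2 and solved for the time derivative. *)
Record halfline_solution (kappa tmax K : R) (w wt : nat -> R -> R -> C) : Prop := {
  hs_cont : forall k, (k <= 4)%nat -> jcont2 (w k);
  hs_tcont : forall k, (k <= 3)%nat -> jcont2 (wt k);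
  hs_bound : forall k, (k <= 4)%nat -> forall y tau, (0 <= y)%R ->
    (Cmod (w k y tau) <= K * / (1 + y) ^ 4)%R;
  hs_tbound : forall k, (k <= 3)%nat -> forall y tau, (0 <= y)%R ->
    (Cmod (wt k y tau) <= K * / (1 + y) ^ 4)%R;
  hs_dY : forall k, (k <= 3)%nat -> forall y tau, (0 < y)%R ->
    is_Cderive (fun s => w k s tau) y (w (S k) y tau);
  hs_dT : forall k, (k <= 3)%nat -> forall y tau, (0 < tau < tmax)%R ->
    is_Cderive (w k y) tau (wt k y tau);
  hs_pde : forall y tau, wt 0%nat y tau =
    Ci * (w 4%nat y tau - RtoC (2 * kappa ^ 2) * w 2%nat y tau + RtoC (kappa ^ 4) * w 0%nat y tau) }.

Lemma halfline_solution_fourier (kappa tmax M : R) u V : smooth_ext 8 tmax M u V ->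
  halfline_solution kappa tmax (4 * M) (fun k => fourier_x (V (repeat Y k)) kappa)
    (fun k => fourier_x (V (T :: repeat Y k)) kappa).
Proof.
  intro HV. constructor.
  - intros k Hk. apply jcont3_23. apply (fx_jcont3 tmax M u V HV). rewrite repeat_length; lia.
  - intros k Hk. apply jcont3_23. apply (fx_jcont3 tmax M u V HV). simpl. rewrite repeat_length; lia.
  - intros k Hk y tau Hy. rewrite <- (Rmax_right 0 y) at 2 by trivial.
    apply (fx_bound tmax M u V HV). rewrite repeat_length; lia.
  - intros k Hk y tau Hy. rewrite <- (Rmax_right 0 y) at 2 by trivial.
    apply (fx_bound tmax M u V HV). simpl. rewrite repeat_length; lia.
  - intros k Hk y tau Hy. apply (fx_dY tmax M u V HV); trivial. rewrite repeat_length; lia.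
  - intros k Hk y tau Ht. apply (fx_dT tmax M u V HV); trivial. rewrite repeat_length; lia.
  - intros y tau. simpl repeat.
    assert (EX : forall w, (length w <= 4)%nat -> fourier_x (V (X :: X :: w)) kappa y tau =
      - RtoC (kappa ^ 2) * fourier_x (V w) kappa y tau).
    { intros w Hw. rewrite !(fx_dX tmax M u V HV) by (simpl; lia). rewrite Cmult_assoc. f_equal.
      apply injective_projections; simpl; ring. }
    assert (Hc := fun w => fx_Cont tmax M u V HV w kappa y tau).
    assert (Hd := fun w Hw => fx_fdom2_unif tmax M u V HV w kappa y tau Hw).
    assert (E4 := EX [X; X] ltac:(simpl; lia)). rewrite (EX []) in E4 by (simpl; lia).
    assert (E2 := EX [Y; Y] ltac:(simpl; lia)).
    assert (Z : Ci * fourier_x (V [T]) kappa y tau + (fourier_x (V [X; X; X; X]) kappa y tau +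
      2 * fourier_x (V [X; X; Y; Y]) kappa y tau + fourier_x (V [Y; Y; Y; Y]) kappa y tau) = 0).
    { unfold fourier_x.
      rewrite <- (FI_scal Ci _ M) by (apply Hc || (apply Hd; simpl; lia)).
      rewrite <- (FI_scal 2 _ M) by (apply Hc || (apply Hd; simpl; lia)).
      assert (Hcs : forall c w, Cont (fun x => c * (Cexp (- (Ci * RtoC x * RtoC kappa)) * V w x y tau))).
      { intros c w x. apply cont_Cmult; [apply continuous_const|apply Hc]. }
      assert (Hds : forall c w, (length w <= 8)%nat ->
        fdom2 (Cmod c * M) (fun x => c * (Cexp (- (Ci * RtoC x * RtoC kappa)) * V w x y tau))).
      { intros c w Hw x. rewrite Cmod_mult, Rmult_assoc.
        apply Rmult_le_compat_l; [apply Cmod_ge_0|]. now apply Hd. }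
      assert (Hdp : forall f g A B, fdom2 A f -> fdom2 B g -> fdom2 (A + B) (fun x => f x + g x)).
      { intros f g A B Hf Hg x. eapply Rle_trans; [apply Cmod_triangle|].
        rewrite Rmult_plus_distr_r. now apply Rplus_le_compat. }
      rewrite <- (FI_plus _ _ M (Cmod 2 * M));
        [|apply Hc|apply Hcs|apply Hd; simpl; lia|apply Hds; simpl; lia].
      rewrite <- (FI_plus _ _ (M + Cmod 2 * M) M);
        [|intro x; apply cont_Cplus; [apply Hc|apply Hcs]|apply Hc
         |apply Hdp; [apply Hd; simpl; lia|apply Hds; simpl; lia]|apply Hd; simpl; lia].
      rewrite <- (FI_plus _ _ (Cmod Ci * M) (M + Cmod 2 * M + M)).
      - rewrite (FI_ext _ (fun x => 0 * (Cexp (- (Ci * RtoC x * RtoC kappa)) * V [] x y tau))).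
        + rewrite (FI_scal 0 _ M); [ring|apply Hc|apply Hd; simpl; lia].
        + intro x.
          transitivity (Cexp (- (Ci * RtoC x * RtoC kappa)) *
            (Ci * V [T] x y tau + (V [X; X; X; X] x y tau + 2 * V [X; X; Y; Y] x y tau
              + V [Y; Y; Y; Y] x y tau))); [ring|].
          rewrite (se_pde _ _ _ _ _ HV) by lia. ring.
      - apply Hcs.
      - intro x. apply cont_Cplus; [apply cont_Cplus; [apply Hc|apply Hcs]|apply Hc].
      - apply Hds; simpl; lia.
      - apply Hdp; [apply Hdp; [apply Hd; simpl; lia|apply Hds; simpl; lia]|apply Hd; simpl; lia]. }
    rewrite E4, E2 in Z.
    set (a := fourier_x (V [T]) kappa y tau) in *.
    set (b := fourier_x (V [Y; Y; Y; Y]) kappa y tau) in *.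
    set (c := fourier_x (V [Y; Y]) kappa y tau) in *.
    set (d := fourier_x (V []) kappa y tau) in *.
    replace a with (- Ci * (Ci * a)) by (unfold Ci; apply injective_projections; simpl; ring).
    replace (Ci * a) with (- (- RtoC (kappa ^ 2) * (- RtoC (kappa ^ 2) * d) + 2 * (- RtoC (kappa ^ 2) * c) + b)).
    + apply injective_projections; simpl; ring.
    + replace (Ci * a) with (Ci * a + (- RtoC (kappa ^ 2) * (- RtoC (kappa ^ 2) * d) + 2 * (- RtoC (kappa ^ 2) * c) + b)
        - (- RtoC (kappa ^ 2) * (- RtoC (kappa ^ 2) * d) + 2 * (- RtoC (kappa ^ 2) * c) + b)) by ring.
      rewrite Z. ring.
Qed.

(** * Holomorphic functions and Cauchy's theorem on parametrised rectangles *)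

(* Holomorphy as existence of a jointly continuous difference quotient: closure
   properties become algebra, and the derivative Q z z is continuous for free. *)
Definition holo (S : C -> Prop) (f : C -> C) : Prop :=
  (forall z, S z -> continuous f z) /\
  exists Q : C -> C -> C, forall z w, S z -> S w ->
    f w - f z = (w - z) * Q z w /\
    continuous (fun p : C * C => Q (fst p) (snd p)) (z, w).

Section Holo.
Context (S : C -> Prop).

Lemma cont_at_fst (f : C -> C) (z w : C) : continuous f z ->
  continuous (fun p : C * C => f (fst p)) (z, w).
Proof. intro H. apply (continuous_comp (fun p : C * C => fst p) f); [apply continuous_fst|exact H]. Qed.
Lemma cont_at_snd (f : C -> C) (z w : C) : continuous f w ->
  continuous (fun p : C * C => f (snd p)) (z, w).
Proof. intro H. apply (continuous_comp (fun p : C * C => snd p) f); [apply continuous_snd|exact H]. Qed.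

Lemma holo_ext (f g : C -> C) : (forall z, S z -> f z = g z) -> (forall z, S z -> continuous g z) ->
  holo S f -> holo S g.
Proof.
  intros E Hc [_ [Q HQ]]. split; [exact Hc|]. exists Q. intros z w Hz Hw.
  rewrite <- !E by assumption. now apply HQ.
Qed.
Lemma holo_const c : holo S (fun _ => c).
Proof.
  split; [intros; apply continuous_const|]. exists (fun _ _ => 0). intros z w _ _.
  split; [ring|apply continuous_const].
Qed.
Lemma holo_id : holo S (fun z => z).
Proof.
  split; [intros; apply continuous_id|]. exists (fun _ _ => 1). intros z w _ _.
  split; [ring|apply continuous_const].
Qed.
Lemma holo_plus (f g : C -> C) : holo S f -> holo S g -> holo S (fun z => f z + g z).
Proof.
  intros [Hf [Q HQ]] [Hg [R HR]]. split; [intros z Hz; apply cont_Cplus; auto|].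
  exists (fun z w => Q z w + R z w). intros z w Hz Hw.
  destruct (HQ z w Hz Hw) as [E1 C1]. destruct (HR z w Hz Hw) as [E2 C2].
  split; [|apply cont_Cplus; [exact C1|exact C2]].
  replace (f w + g w - (f z + g z)) with ((f w - f z) + (g w - g z)) by ring.
  rewrite E1, E2. ring.
Qed.
Lemma holo_mult (f g : C -> C) : holo S f -> holo S g -> holo S (fun z => f z * g z).
Proof.
  intros [Hf [Q HQ]] [Hg [R HR]]. split; [intros z Hz; apply cont_Cmult; auto|].
  exists (fun z w => Q z w * g w + f z * R z w). intros z w Hz Hw.
  destruct (HQ z w Hz Hw) as [E1 C1]. destruct (HR z w Hz Hw) as [E2 C2].
  split.
  - replace (f w * g w - f z * g z) with ((f w - f z) * g w + f z * (g w - g z)) by ring.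
    rewrite E1, E2. ring.
  - apply cont_Cplus; apply cont_Cmult; [exact C1|apply cont_at_snd; auto|apply cont_at_fst; auto|exact C2].
Qed.
Lemma holo_opp (f : C -> C) : holo S f -> holo S (fun z => - f z).
Proof.
  intro H. apply (holo_ext (fun z => (- (1)) * f z)).
  - intros; cring.
  - intros z Hz. apply cont_Copp, H, Hz.
  - apply holo_mult; [apply holo_const|exact H].
Qed.
Lemma holo_minus (f g : C -> C) : holo S f -> holo S g -> holo S (fun z => f z - g z).
Proof. intros Hf Hg. apply (holo_plus f (fun z => - g z) Hf). now apply holo_opp. Qed.
Lemma holo_pow (f : C -> C) (n : nat) : holo S f -> holo S (fun z => f z ^ n).
Proof.
  intro H. induction n as [|n IH]; simpl; [apply holo_const|now apply holo_mult].
Qed.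
Lemma holo_inv (f : C -> C) : (forall z, S z -> f z <> 0) -> holo S f -> holo S (fun z => / f z).
Proof.
  intros H0 [Hf [Q HQ]]. split; [intros z Hz; apply cont_Cinv; [exact (H0 z Hz)|exact (Hf z Hz)]|].
  exists (fun z w => - Q z w / (f z * f w)). intros z w Hz Hw.
  destruct (HQ z w Hz Hw) as [E1 C1].
  split.
  - replace (/ f w - / f z) with (- (f w - f z) / (f z * f w)) by (field; auto).
    rewrite E1. field; auto.
  - apply cont_Cdiv.
    + simpl. apply Cmult_neq_0; auto.
    + apply cont_Copp. exact C1.
    + apply cont_Cmult; [apply cont_at_fst; auto|apply cont_at_snd; auto].
Qed.
Lemma holo_div (f g : C -> C) : (forall z, S z -> g z <> 0) -> holo S f -> holo S g ->
  holo S (fun z => f z / g z).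
Proof. intros H0 Hf Hg. apply holo_mult; [exact Hf|now apply holo_inv]. Qed.

Lemma holo_comp (S' : C -> Prop) (f g : C -> C) : (forall z, S z -> S' (g z)) -> holo S' f -> holo S g ->
  holo S (fun z => f (g z)).
Proof.
  intros HS [Hf [Q HQ]] [Hg [R HR]].
  split; [intros z Hz; apply (continuous_comp g f); auto|].
  exists (fun z w => Q (g z) (g w) * R z w). intros z w Hz Hw.
  destruct (HQ (g z) (g w) (HS z Hz) (HS w Hw)) as [E1 C1]. destruct (HR z w Hz Hw) as [E2 C2].
  split.
  - rewrite E1, E2. ring.
  - apply cont_Cmult; [|exact C2].
    apply (continuous_comp (fun p : C * C => (g (fst p), g (snd p))) (fun p : C * C => Q (fst p) (snd p)));
      [|exact C1].
    apply continuous_pair; [apply cont_at_fst; auto|apply cont_at_snd; auto].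
Qed.

(* A continuous square root with positive imaginary part: n z + n w never vanishes. *)
Lemma holo_sqrt (n h : C -> C) : (forall z, S z -> continuous n z) ->
  (forall z, S z -> n z * n z = h z) -> (forall z, S z -> (0 < Im (n z))%R) ->
  holo S h -> holo S n.
Proof.
  intros Hn Hh Hp [_ [Q HQ]]. split; [exact Hn|].
  exists (fun z w => Q z w / (n z + n w)). intros z w Hz Hw.
  destruct (HQ z w Hz Hw) as [E1 C1].
  assert (H0 : n z + n w <> 0).
  { intro E. assert (E' := f_equal Im E). assert (H1 := Hp z Hz). assert (H2 := Hp w Hw).
    unfold Im in *; simpl in *. lra. }
  split.
  - assert (E2 : (n w - n z) * (n z + n w) = (w - z) * Q z w).
    { rewrite <- E1, <- (Hh z Hz), <- (Hh w Hw). ring. }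
    replace ((w - z) * (Q z w / (n z + n w))) with ((w - z) * Q z w / (n z + n w)) by (field; auto).
    rewrite <- E2. field; auto.
  - apply cont_Cdiv; [exact H0|exact C1|].
    apply cont_Cplus; [apply cont_at_fst; auto|apply cont_at_snd; auto].
Qed.
End Holo.

(** Integrating the derivative along the segment from [z] to [w] gives a quotient that is also
    defined and continuous on the diagonal. *)
Lemma Cexp_quotient (z w : C) :
  Cexp w - Cexp z = (w - z) * CInt (fun s => Cexp (z + RtoC s * (w - z))) 0 1.
Proof.
  assert (Hc : Cont (fun s => Cexp (z + RtoC s * (w - z)))).
  { intro s. apply cont_Cexp, cont_Cplus; [apply continuous_const|].
    apply cont_Cmult; [apply cont_RtoC, continuous_id|apply continuous_const]. }
  rewrite <- CInt_scal by exact Hc.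
  rewrite (CInt_FTC (fun s => Cexp (z + RtoC s * (w - z)))).
  - f_equal; [|f_equal]; f_equal; ring.
  - exact Rle_0_1.
  - intro s. apply cont_Cmult; [apply continuous_const|apply Hc].
  - intros s _. apply Hc.
  - intros s _. eapply Cd_eq.
    + apply Cd_Cexp, Cd_plus; [apply Cd_const|].
      apply Cd_mult; [apply Cd_id|apply Cd_const].
    + cring.
Qed.

Lemma cont_Cexp_segment {T : UniformSpace} (a b : T -> C) (p : T) (c : T -> R) :
  continuous a p -> continuous b p -> continuous c p ->
  continuous (fun q => Cexp (a q + RtoC (c q) * (b q - a q))) p.
Proof.
  intros Ha Hb Hc. apply cont_Cexp, cont_Cplus; [exact Ha|]. apply cont_Cmult.
  - apply cont_RtoC. exact Hc.
  - apply cont_Cminus; [exact Hb|exact Ha].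
Qed.

Lemma holo_Cexp (S : C -> Prop) : holo S Cexp.
Proof.
  split; [intros z _; apply (cont_Cexp (fun z => z)), continuous_id|].
  exists (fun z w => CInt (fun s => Cexp (z + RtoC s * (w - z))) 0 1).
  intros z w _ _. split; [apply Cexp_quotient|].
  apply (cont_CInt_param (fun (p : C * C) s => Cexp (fst p + RtoC s * (snd p - fst p)))).
  - exact Rle_0_1.
  - intros q s. apply (cont_Cexp_segment (fun z : C * C * R => fst (fst z)) (fun z => snd (fst z)) _ (fun z => snd z)).
    + apply cont_fst, continuous_fst.
    + apply cont_snd, continuous_fst.
    + apply continuous_snd.
Qed.

(** A product rule in which [b] is merely continuous: because [a] vanishes at [p], the variation of
    [b] contributes only at second order. It is needed because the quotient in [holo] is only known
    to be continuous. *)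
Lemma is_Cderive_mult_null (a b : R -> C) (p : R) (l : C) : a p = 0 -> is_Cderive a p l ->
  continuous b p -> is_Cderive (fun q => a q * b q) p (l * b p).
Proof.
  intros H0 Ha Hb.
  apply (is_derive_ext (fun q => a q * b p + a q * (b q - b p))).
  { intro q. cring. }
  eapply Cd_eq.
  - apply Cd_plus.
    + apply Cd_mult; [exact Ha|apply Cd_const].
    + apply (is_Cderive_eps _ _ (RtoC 0)). intros e He.
      assert (HL : (0 < Cmod l + 1)%R) by (assert (H := Cmod_ge_0 l); lra).
      assert (H1 := proj1 (continuous_Cmod_iff _ _) Hb (e / (Cmod l + 1))%R ltac:(now apply Rdiv_lt_0_compat)).
      assert (H2 : locally p (fun q => (Cmod (a q) <= (Cmod l + 1) * Rabs (q - p))%R)).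
      { destruct Ha as [_ Ha]. specialize (Ha p (fun P H => H) (mkposreal 1 Rlt_0_1)).
        revert Ha. apply filter_imp. intros q Hq.
        replace (a q) with ((a q - a p - RtoC (q - p) * l) + RtoC (q - p) * l) by (rewrite H0; cring).
        eapply Rle_trans; [apply Cmod_triangle|]. rewrite (Cmod_mult (RtoC (q - p))), Cmod_R.
        assert (Hq' : (Cmod (a q - a p - RtoC (q - p) * l) <= 1 * Rabs (q - p))%R).
        { eapply Rle_trans; [|exact Hq]. right. rewrite Cmod_norm. f_equal.
          unfold minus, plus, opp, scal; simpl. destruct (a q), (a p), l.
          apply injective_projections; simpl; unfold plus, opp, scal; simpl; unfold mult; simpl; ring. }
        lra. }
      generalize (filter_and _ _ H1 H2). apply filter_imp. intros q [Hq1 Hq2].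
      replace (a q * (b q - b p) - a p * (b p - b p) - RtoC (q - p) * 0) with (a q * (b q - b p)) by ring.
      rewrite Cmod_mult. apply Rle_trans with ((Cmod l + 1) * Rabs (q - p) * (e / (Cmod l + 1)))%R.
      * apply Rmult_le_compat; try apply Cmod_ge_0; lra.
      * right. field. lra.
  - cring.
Qed.

(** Chain rule with Q z z as the complex derivative. Along the curve, f (c q) = f (c p) + (c q - c
    p) Q (c p) (c q), a constant plus a product whose first factor vanishes at [p]. *)
Lemma holo_curve (S : C -> Prop) (f : C -> C) (Q : C -> C -> C) (c : R -> C) (p : R) (l : C) :
  (forall z w, S z -> S w -> f w - f z = (w - z) * Q z w /\
    continuous (fun p : C * C => Q (fst p) (snd p)) (z, w)) ->
  locally p (fun q => S (c q)) -> is_Cderive c p l ->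
  is_Cderive (fun q => f (c q)) p (Q (c p) (c p) * l).
Proof.
  intros HQ HS Hc.
  assert (HSp : S (c p)) by exact (locally_singleton _ _ HS).
  apply (is_derive_ext_loc (fun q => f (c p) + (c q - c p) * Q (c p) (c q))).
  - revert HS. apply filter_imp. intros q Hq.
    destruct (HQ (c p) (c q) HSp Hq) as [E _]. rewrite <- E. cring.
  - eapply Cd_eq.
    + apply Cd_plus; [apply Cd_const|].
      apply (is_Cderive_mult_null (fun q => c q - c p) (fun q => Q (c p) (c q)) p l).
      * cring.
      * eapply Cd_eq; [apply Cd_minus; [exact Hc|apply Cd_const]|]. cring.
      * apply (continuous_comp (fun q => (c p, c q)) (fun z : C * C => Q (fst z) (snd z))).
        -- apply continuous_pair; [apply continuous_const|]. exact (is_Cderive_continuous _ _ _ Hc).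
        -- apply (HQ (c p) (c p) HSp HSp).
    + cring.
Qed.

(** * Cauchy's theorem on images of rectangles *)

Definition clip (a b s : R) : R := Rmax a (Rmin b s).
Lemma clip_in a b s : (a <= b)%R -> (a <= clip a b s <= b)%R.
Proof. intro H. unfold clip. split; [apply Rmax_l|]. apply Rmax_lub; [lra|apply Rmin_l]. Qed.
Lemma clip_id a b s : (a <= s <= b)%R -> clip a b s = s.
Proof. intro H. unfold clip. rewrite Rmin_right, Rmax_right; lra. Qed.
Lemma cont_clip {T : UniformSpace} (a b : R) (f : T -> R) (p : T) : continuous f p ->
  continuous (fun q => clip a b (f q)) p.
Proof.
  intro H. apply cont_Rmax; [apply continuous_const|].
  apply cont_Rmin; [apply continuous_const|exact H].
Qed.

Lemma locally_interval (P : R -> Prop) (a b x : R) : (a < x < b)%R ->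
  (forall q, (a < q < b)%R -> P q) -> locally x P.
Proof.
  intros Hx H. assert (Hl : (0 < Rmin (x - a) (b - x))%R) by (apply Rmin_glb_lt; lra).
  exists (mkposreal _ Hl). intros q Hq.
  assert (Hq' : (Rabs (q - x) < Rmin (x - a) (b - x))%R) by exact Hq.
  apply Rabs_def2 in Hq'.
  assert (H1 := Rmin_l (x - a) (b - x)). assert (H2 := Rmin_r (x - a) (b - x)).
  apply H. lra.
Qed.

Lemma Cont_comp_jcont2 (f : C -> C) (g : R -> R -> C) : Cont f -> jcont2 g ->
  jcont2 (fun s th => f (g s th)).
Proof.
  intros Hf Hg T a b p Ha Hb. apply (continuous_comp (fun q => g (a q) (b q)) f); [now apply Hg|apply Hf].
Qed.
Lemma jcont2_mult f g : jcont2 f -> jcont2 g -> jcont2 (fun s th => f s th * g s th).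
Proof. intros Hf Hg T a b p Ha Hb. apply cont_Cmult; [now apply Hf|now apply Hg]. Qed.

Section Rectangle.
Context (S : C -> Prop) (f : C -> C) (g gs gt gst : R -> R -> C).
Context (Hf : Cont f) (Hh : holo S f).
Context (Hg : jcont2 g) (Hgs : jcont2 gs) (Hgt : jcont2 gt) (Hgst : jcont2 gst).
Context (HS : forall s th, (0 < s)%R -> (0 < th < 1)%R -> S (g s th)).
Context (Ds : forall s th, (0 < s)%R -> (0 < th < 1)%R -> is_Cderive (fun r => g r th) s (gs s th)).
Context (Dt : forall s th, (0 < s)%R -> (0 < th < 1)%R -> is_Cderive (g s) th (gt s th)).
Context (Dst : forall s th, (0 < s)%R -> (0 < th < 1)%R -> is_Cderive (gs s) th (gst s th)).
Context (Dts : forall s th, (0 < s)%R -> (0 < th < 1)%R -> is_Cderive (fun r => gt r th) s (gst s th)).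

Lemma rect_P : jcont2 (fun s th => f (g s th) * gs s th).
Proof. apply jcont2_mult; [now apply Cont_comp_jcont2|exact Hgs]. Qed.
Lemma rect_R : jcont2 (fun s th => f (g s th) * gt s th).
Proof. apply jcont2_mult; [now apply Cont_comp_jcont2|exact Hgt]. Qed.

(** Let one side of the rectangle move with the parameter [th]. The derivative in [th] of f(g) g_s
    and the derivative in s of f(g) g_t are the same function [psi], because f is holomorphic and
    the mixed derivatives of g agree. Hence [J] has zero derivative. No double integral is formed.
    The restriction 0 < s1 reflects that derivatives of g are available only for positive s. *)
Lemma rectangle_open (s1 s2 : R) : (0 < s1 <= s2)%R ->
  CInt (fun s => f (g s 1) * gs s 1%R) s1 s2 - CInt (fun s => f (g s 0%R) * gs s 0%R) s1 s2 =
  CInt (fun th => f (g s2 th) * gt s2 th) 0 1 - CInt (fun th => f (g s1 th) * gt s1 th) 0 1.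
Proof.
  intros Hs12. destruct Hh as [_ [Q HQ]].
  set (J := fun th => CInt (fun s => f (g s th) * gs s th) s1 s2 -
    (CInt (fun th => f (g s2 th) * gt s2 th) 0 th - CInt (fun th => f (g s1 th) * gt s1 th) 0 th)).
  assert (HR : forall s, Cont (fun th => f (g s th) * gt s th)) by (intro s; apply (jcont2_r _ s rect_R)).
  assert (EJ : J 1%R = J 0%R).
  { apply derive0_const; [exact Rle_0_1| |].
    - intros th _. apply cont_Cminus.
      + apply (cont_CInt_param (fun th s => f (g s th) * gs s th)); [lra|].
        intros q s. apply (rect_P _ (fun z : R * R => snd z) (fun z => fst z)); [apply continuous_snd|apply continuous_fst].
      + apply cont_Cminus; eapply is_Cderive_continuous; apply is_derive_CInt; apply HR.
    - intros th Hth.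
      (* A closed neighbourhood of [th] inside (0, 1): [psi] involves the quotient [Q], which is
         controlled only over [S], so its arguments are clipped to a compact set whose image stays
         in [S]. *)
      set (a := (th / 2)%R). set (b := ((1 + th) / 2)%R).
      assert (Hab : (a <= b)%R) by (unfold a, b; lra).
      set (psi := fun s th => Q (g s th) (g s th) * gt s th * gs s th + f (g s th) * gst s th).
      assert (Hpsi : forall s q, (0 < s)%R -> (0 < q < 1)%R ->
        forall (T : UniformSpace) (u v : T -> R) (p : T), u p = s -> v p = q ->
        continuous u p -> continuous v p -> continuous (fun x => psi (u x) (v x)) p).
      { intros s q Hs Hq T u v p Eu Ev Hu Hv.
        apply cont_Cplus; apply cont_Cmult.
        - apply cont_Cmult; [|now apply Hgt].
          apply (continuous_comp (fun x => (g (u x) (v x), g (u x) (v x))) (fun z : C * C => Q (fst z) (snd z))).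
          + apply continuous_pair; now apply Hg.
          + rewrite Eu, Ev. apply HQ; now apply HS.
        - now apply Hgs.
        - apply (continuous_comp (fun x => g (u x) (v x)) f); [now apply Hg|apply Hf].
        - now apply Hgst. }
      assert (HD : is_Cderive (fun q => CInt (fun s => f (g s q) * gs s q) s1 s2) th
        (CInt (fun s => psi (clip s1 s2 s) (clip a b th)) s1 s2)).
      { apply (is_derive_CInt_param (fun q s => f (g s q) * gs s q)
          (fun q s => psi (clip s1 s2 s) (clip a b q)) a b).
        - lra.
        - exact (jcont2_swap _ rect_P).
        - intros T u v p Hu Hv.
          assert (H1 := clip_in s1 s2 (v p) ltac:(lra)).
          assert (H2 := clip_in a b (u p) Hab).
          apply (Hpsi (clip s1 s2 (v p)) (clip a b (u p)) ltac:(lra) ltac:(unfold a, b in *; lra)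
            T (fun x => clip s1 s2 (v x)) (fun x => clip a b (u x)) p eq_refl eq_refl);
            apply cont_clip; assumption.
        - unfold a, b; lra.
        - intros q s Hq Hs. rewrite (clip_id s1 s2 s) by lra. rewrite (clip_id a b q) by lra.
          assert (Hq1 : (0 < q < 1)%R) by (unfold a, b in *; lra).
          eapply Cd_eq.
          + apply Cd_mult; [|apply Dst; lra].
            apply (holo_curve S f Q (g s) q (gt s q) HQ).
            * apply (locally_interval _ 0 1); [lra|]. intros q' Hq'. apply HS; lra.
            * apply Dt; lra.
          + unfold psi. cring. }
      assert (EI : CInt (fun s => psi (clip s1 s2 s) (clip a b th)) s1 s2 =
         f (g s2 th) * gt s2 th - f (g s1 th) * gt s1 th).
      { rewrite (clip_id a b th) by (unfold a, b; lra).
        apply (CInt_FTC (fun s => f (g s th) * gt s th)).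
        - lra.
        - intro s. assert (H1 := clip_in s1 s2 s ltac:(lra)).
          apply (Hpsi (clip s1 s2 s) th ltac:(lra) ltac:(lra) _ (fun s => clip s1 s2 s) (fun _ => th) s eq_refl eq_refl).
          + apply cont_clip, continuous_id.
          + apply continuous_const.
        - intros s _. apply (jcont2_l (fun s th => f (g s th) * gt s th) th rect_R).
        - intros s Hs. rewrite (clip_id s1 s2 s) by lra.
          eapply Cd_eq.
          + apply Cd_mult; [|apply Dts; lra].
            apply (holo_curve S f Q (fun r => g r th) s (gs s th) HQ).
            * apply (locally_interval _ 0 (s + 1)); [lra|]. intros q' Hq'. apply HS; lra.
            * apply Ds; lra.
          + unfold psi. cring. }
      rewrite EI in HD.
      eapply Cd_eq.
      + apply Cd_minus; [exact HD|]. apply Cd_minus; apply is_derive_CInt; apply HR.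
      + cbv beta. cring. }
  unfold J in EJ. rewrite !CInt_point in EJ.
  set (A := CInt (fun s => f (g s 1%R) * gs s 1%R) s1 s2) in *.
  set (B := CInt (fun th => f (g s2 th) * gt s2 th) 0 1 - CInt (fun th => f (g s1 th) * gt s1 th) 0 1) in *.
  replace A with (A - B + B) by ring. rewrite EJ. cring.
Qed.

(** The side s = 0 may be singular or collapse to a point, but f, g and their listed companions are
    continuous there; the lower limit e s2 in [rectangle_open] tends to 0. *)
Lemma rectangle (s2 : R) : (0 < s2)%R ->
  CInt (fun s => f (g s 1) * gs s 1%R) 0 s2 - CInt (fun s => f (g s 0%R) * gs s 0%R) 0 s2 =
  CInt (fun th => f (g s2 th) * gt s2 th) 0 1 - CInt (fun th => f (g 0%R th) * gt 0%R th) 0 1.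
Proof.
  intro Hs2.
  set (Phi := fun e => CInt (fun s => f (g s 1) * gs s 1%R) (e * s2) s2
     - CInt (fun s => f (g s 0%R) * gs s 0%R) (e * s2) s2
     - (CInt (fun th => f (g s2 th) * gt s2 th) 0 1
         - CInt (fun th => f (g (e * s2)%R th) * gt (e * s2)%R th) 0 1)).
  assert (HP : forall th, Cont (fun s => f (g s th) * gs s th)).
  { intro th. apply (jcont2_l (fun s th => f (g s th) * gs s th) th rect_P). }
  assert (Hes : forall T : UniformSpace, forall (p : T) (u : T -> R), continuous u p -> continuous (fun q => (u q * s2)%R) p).
  { intros T p u Hu. apply cont_Rmult; [exact Hu|apply continuous_const]. }
  assert (HcI : forall h, Cont h -> forall e, continuous (fun e => CInt h (e * s2) s2) e).
  { intros h Hh' e. apply (continuous_ext (fun e => - CInt h s2 (e * s2))).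
    { intro e'. symmetry. now apply CInt_swap. }
    apply cont_Copp. apply (continuous_comp (fun e : R => (e * s2)%R) (fun b => CInt h s2 b)).
    - apply Hes, continuous_id.
    - eapply is_Cderive_continuous. now apply is_derive_CInt. }
  assert (Z : Phi 0%R = 0).
  { apply zero_at_0.
    - apply cont_Cminus; apply cont_Cminus.
      + apply HcI, HP.
      + apply HcI, HP.
      + apply continuous_const.
      + apply (cont_CInt_param (fun e th => f (g (e * s2)%R th) * gt (e * s2)%R th)); [exact Rle_0_1|].
        intros e th. apply (rect_R _ (fun z : R * R => (fst z * s2)%R) (fun z => snd z)).
        * apply Hes, continuous_fst.
        * apply continuous_snd.
    - intros e He. unfold Phi. rewrite rectangle_open by nra. cring. }
  unfold Phi in Z. rewrite Rmult_0_l in Z.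
  set (A := CInt (fun s => f (g s 1%R) * gs s 1%R) 0 s2 - CInt (fun s => f (g s 0%R) * gs s 0%R) 0 s2) in *.
  match type of Z with _ - ?B = _ => replace A with (A - B + B) by ring end.
  rewrite Z. cring.
Qed.
End Rectangle.

(** * Laplace type transforms and the global relation *)

(* Projection onto the closed upper half plane; it makes the transforms below
   globally continuous. *)
Definition zc (z : C) : C := (Re z, Rmax 0 (Im z)).
(** The kernel exp(i z s) is bounded for Im z >= 0, and the half space transform at - z becomes
    [lap] at z. *)
Definition lap (f : R -> C) (z : C) : C := CI (fun s => Cexp (Ci * zc z * RtoC s) * f s).
(** Fourth-order decay keeps the first moment s f(s) in [dom2], which the difference quotient of
    [lap] requires. *)
Definition dom4 (K : R) (f : R -> C) : Prop :=
  forall s, (0 <= s)%R -> (Cmod (f s) <= K * / (1 + s) ^ 4)%R.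

Lemma zc_id z : (0 <= Im z)%R -> zc z = z.
Proof. intro H. unfold zc. rewrite Rmax_right by exact H. now destruct z. Qed.
Lemma cont_zc {T : UniformSpace} (z : T -> C) (p : T) : continuous z p -> continuous (fun q => zc (z q)) p.
Proof.
  intro H. apply cont_pair; [now apply cont_Re|].
  apply cont_Rmax; [apply continuous_const|now apply cont_Im].
Qed.
Lemma Re_Ci_zc z s : (0 <= s)%R -> (Re (Ci * zc z * RtoC s) <= 0)%R.
Proof.
  intro H. unfold Re, zc; simpl. assert (H0 := Rmax_l 0 (Im z)). nra.
Qed.
Lemma dom4_K0 K f : dom4 K f -> (0 <= K)%R.
Proof.
  intro H. specialize (H 0%R (Rle_refl _)). assert (H0 := Cmod_ge_0 (f 0%R)).
  replace ((1 + 0) ^ 4)%R with 1%R in H by ring. rewrite Rinv_1 in H. lra.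
Qed.
Lemma dom4_dom2 K f : dom4 K f -> dom2 K f.
Proof.
  intros H s Hs. eapply Rle_trans; [now apply H|].
  apply Rmult_le_compat_l; [now apply dom4_K0 with f|]. now apply inv_pow42.
Qed.
Lemma dom4_moment K f : dom4 K f -> dom2 K (fun s => Ci * RtoC s * f s).
Proof.
  intros H s Hs. rewrite !Cmod_mult, Cmod_R, Rabs_pos_eq by exact Hs.
  replace (Cmod Ci) with 1%R.
  2: { unfold Cmod, Ci; simpl. replace (0 * (0 * 1) + 1 * (1 * 1))%R with 1%R by ring. symmetry; apply sqrt_1. }
  assert (HK := dom4_K0 _ _ H). rewrite Rmult_1_l.
  apply Rle_trans with (s * (K * / (1 + s) ^ 4))%R.
  - apply Rmult_le_compat_l; [exact Hs|now apply H].
  - assert (Hp : (0 < 1 + s)%R) by lra.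
    apply Rmult_le_reg_r with ((1 + s) ^ 4)%R; [now apply pow_lt|].
    replace (s * (K * / (1 + s) ^ 4) * (1 + s) ^ 4)%R with (K * s)%R by (field; lra).
    replace (K * / (1 + s) ^ 2 * (1 + s) ^ 4)%R with (K * (1 + s) ^ 2)%R by (field; lra).
    apply Rmult_le_compat_l; nra.
Qed.

Lemma cont_Cexp_zc {T : UniformSpace} (z : T -> C) (s : T -> R) (p : T) :
  continuous z p -> continuous s p -> continuous (fun q => Ci * zc (z q) * RtoC (s q)) p.
Proof.
  intros Hz Hs. apply cont_Cmult; [apply cont_Cmult; [apply continuous_const|now apply cont_zc]|].
  now apply cont_RtoC.
Qed.

Section Laplace.
Context (f : R -> C) (K : R) (Hf : Cont f) (Hd : dom4 K f).

Lemma lap_Cont_integrand z : Cont (fun s => Cexp (Ci * zc z * RtoC s) * f s).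
Proof.
  intro s. apply cont_Cmult; [|apply Hf]. apply cont_Cexp.
  apply (cont_Cexp_zc (fun _ => z) (fun s => s)); [apply continuous_const|apply continuous_id].
Qed.
Lemma lap_dom2 z : dom2 K (fun s => Cexp (Ci * zc z * RtoC s) * f s).
Proof.
  apply dom2_mult_le1; [|now apply dom4_dom2]. intros s Hs. now apply Cmod_Cexp_le, Re_Ci_zc.
Qed.
Lemma lap_bound z : (Cmod (lap f z) <= 2 * K)%R.
Proof. apply CI_bound; [apply lap_Cont_integrand|apply lap_dom2]. Qed.
Lemma lap_cont : Cont (lap f).
Proof.
  intro z. apply (cont_CI_param (fun z s => Cexp (Ci * zc z * RtoC s) * f s) K).
  - intros q s. apply cont_Cmult.
    + apply cont_Cexp. apply (cont_Cexp_zc (fun z : C * R => fst z) (fun z => snd z));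
        [apply continuous_fst|apply continuous_snd].
    + apply (continuous_comp (fun z : C * R => snd z) f); [apply continuous_snd|apply Hf].
  - apply lap_dom2.
Qed.

(** Difference quotient of [lap f], with the quotient of the exponential taken under the integral.
    Being continuous on the diagonal, it also removes the singularity at nu = lambda. *)
Definition lap_quot (z w : C) : C :=
  CI (fun s => CInt (fun r => Cexp (Ci * zc z * RtoC s +
     RtoC r * (Ci * zc w * RtoC s - Ci * zc z * RtoC s))) 0 1 * (Ci * RtoC s * f s)).

Lemma lap_quot_integrand_cont (q : C * C) (s : R) :
  continuous (fun x : C * C * R => CInt (fun r => Cexp (Ci * zc (fst (fst x)) * RtoC (snd x) +
     RtoC r * (Ci * zc (snd (fst x)) * RtoC (snd x) - Ci * zc (fst (fst x)) * RtoC (snd x)))) 0 1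
       * (Ci * RtoC (snd x) * f (snd x))) (q, s).
Proof.
  apply cont_Cmult.
  - apply (cont_CInt_param (fun (x : C * C * R) r => Cexp (Ci * zc (fst (fst x)) * RtoC (snd x) +
     RtoC r * (Ci * zc (snd (fst x)) * RtoC (snd x) - Ci * zc (fst (fst x)) * RtoC (snd x)))));
     [exact Rle_0_1|].
    intros x r. apply (cont_Cexp_segment
      (fun y : C * C * R * R => Ci * zc (fst (fst (fst y))) * RtoC (snd (fst y)))
      (fun y : C * C * R * R => Ci * zc (snd (fst (fst y))) * RtoC (snd (fst y))) _ (fun y => snd y)).
    + apply (cont_Cexp_zc (fun y : C * C * R * R => fst (fst (fst y))) (fun y => snd (fst y))).
      * apply cont_fst, cont_fst, continuous_fst.
      * apply cont_snd, continuous_fst.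
    + apply (cont_Cexp_zc (fun y : C * C * R * R => snd (fst (fst y))) (fun y => snd (fst y))).
      * apply cont_snd, cont_fst, continuous_fst.
      * apply cont_snd, continuous_fst.
    + apply continuous_snd.
  - apply cont_Cmult.
    + apply cont_Cmult; [apply continuous_const|]. apply cont_RtoC, continuous_snd.
    + apply (continuous_comp (fun x : C * C * R => snd x) f); [apply continuous_snd|apply Hf].
Qed.
Lemma lap_quot_dom2 z w : dom2 K (fun s => CInt (fun r => Cexp (Ci * zc z * RtoC s +
     RtoC r * (Ci * zc w * RtoC s - Ci * zc z * RtoC s))) 0 1 * (Ci * RtoC s * f s)).
Proof.
  apply dom2_mult_le1; [|now apply dom4_moment]. intros s Hs.
  replace 1%R with ((1 - 0) * 1)%R at 2 by ring.
  apply CInt_bound; [|exact Rle_0_1|].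
  - intro r. apply (cont_Cexp_segment (fun _ => Ci * zc z * RtoC s) (fun _ => Ci * zc w * RtoC s) r (fun r => r));
      [apply continuous_const|apply continuous_const|apply continuous_id].
  (* The exponent is a convex combination of two exponents with nonpositive real part: the segment
     between two points of the closed upper half plane stays in it. *)
  - intros r Hr. apply Cmod_Cexp_le.
    assert (H1 := Re_Ci_zc z s Hs). assert (H2 := Re_Ci_zc w s Hs).
    replace (Re (Ci * zc z * RtoC s + RtoC r * (Ci * zc w * RtoC s - Ci * zc z * RtoC s)))
      with ((1 - r) * Re (Ci * zc z * RtoC s) + r * Re (Ci * zc w * RtoC s))%R
      by (unfold Re; simpl; ring).
    nra.
Qed.
Lemma lap_quot_cont (z w : C) : continuous (fun p : C * C => lap_quot (fst p) (snd p)) (z, w).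
Proof.
  apply (cont_CI_param (fun (p : C * C) s => CInt (fun r => Cexp (Ci * zc (fst p) * RtoC s +
     RtoC r * (Ci * zc (snd p) * RtoC s - Ci * zc (fst p) * RtoC s))) 0 1 * (Ci * RtoC s * f s)) K).
  - intros q s. apply lap_quot_integrand_cont.
  - intro q. apply lap_quot_dom2.
Qed.
Lemma lap_quotE (z w : C) : (0 <= Im z)%R -> (0 <= Im w)%R ->
  lap f w - lap f z = (w - z) * lap_quot z w.
Proof.
  intros Hz Hw. unfold lap, lap_quot.
  assert (Hqc : Cont (fun s => CInt (fun r => Cexp (Ci * zc z * RtoC s +
     RtoC r * (Ci * zc w * RtoC s - Ci * zc z * RtoC s))) 0 1 * (Ci * RtoC s * f s))).
  { intro s. apply (cont_section (fun (p : C * C) s => CInt (fun r => Cexp (Ci * zc (fst p) * RtoC s +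
     RtoC r * (Ci * zc (snd p) * RtoC s - Ci * zc (fst p) * RtoC s))) 0 1 * (Ci * RtoC s * f s)) (z, w)).
    apply lap_quot_integrand_cont. }
  rewrite <- (CI_minus _ _ K K);
    [|apply lap_Cont_integrand|apply lap_Cont_integrand|apply lap_dom2|apply lap_dom2].
  rewrite <- (CI_scal _ _ K); [|exact Hqc|apply lap_quot_dom2].
  apply CI_ext. intros s Hs.
  replace (Cexp (Ci * zc w * RtoC s) * f s - Cexp (Ci * zc z * RtoC s) * f s) with
    ((Cexp (Ci * zc w * RtoC s) - Cexp (Ci * zc z * RtoC s)) * f s) by ring.
  rewrite Cexp_quotient. rewrite !zc_id by assumption. ring.
Qed.
Lemma holo_lap : holo (fun z => (0 <= Im z)%R) (lap f).
Proof.
  split; [intros z _; apply lap_cont|]. exists lap_quot. intros z w Hz Hw.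
  split; [now apply lap_quotE|apply lap_quot_cont].
Qed.
End Laplace.

Lemma lap_ibp (f g : R -> C) (K L : R) (z : C) : Cont f -> Cont g -> dom4 K f -> dom4 L g ->
  (forall s, (0 < s)%R -> is_Cderive f s (g s)) -> (0 <= Im z)%R ->
  lap g z = - f 0%R - Ci * z * lap f z.
Proof.
  intros Hf Hg HK HL Hd Hz.
  assert (E : CI (fun s => Ci * z * (Cexp (Ci * zc z * RtoC s) * f s) + Cexp (Ci * zc z * RtoC s) * g s)
    = - (Cexp (Ci * zc z * RtoC 0) * f 0%R)).
  { apply (CI_FTC (fun s => Cexp (Ci * zc z * RtoC s) * f s) _ K (Cmod (Ci * z) * K + L)).
    - now apply lap_Cont_integrand.
    - intro s. apply cont_Cplus; [apply cont_Cmult; [apply continuous_const|]|]; now apply lap_Cont_integrand.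
    - now apply lap_dom2.
    - apply dom2_plus; [apply dom2_scal|]; now apply lap_dom2.
    - intros s Hs. eapply Cd_eq.
      + apply Cd_mult; [|now apply Hd]. apply Cd_Cexp. apply Cd_mult; [apply Cd_const|apply Cd_id].
      + rewrite zc_id by exact Hz. cring. }
  rewrite (CI_plus _ _ (Cmod (Ci * z) * K) L) in E.
  - rewrite (CI_scal _ _ K) in E; [|now apply lap_Cont_integrand|now apply lap_dom2].
    fold (lap f z) in E. fold (lap g z) in E.
    rewrite Cmult_0_r, Cexp_0 in E.
    replace (lap g z) with (Ci * z * lap f z + lap g z - Ci * z * lap f z) by ring.
    rewrite E. ring.
  - intro s. apply cont_Cmult; [apply continuous_const|now apply lap_Cont_integrand].
  - now apply lap_Cont_integrand.
  - apply dom2_scal. now apply lap_dom2.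
  - now apply lap_dom2.
Qed.

Lemma Cmod_Ci : Cmod Ci = 1%R.
Proof. unfold Cmod, Ci; simpl. replace (0 * (0 * 1) + 1 * (1 * 1))%R with 1%R by ring. apply sqrt_1. Qed.

(** One integration by parts turns i z times the transform into the boundary value at 0 and the
    transform of the derivative, both bounded. *)
Lemma lap_decay (f g : R -> C) (K L : R) (z : C) : Cont f -> Cont g -> dom4 K f -> dom4 L g ->
  (forall s, (0 < s)%R -> is_Cderive f s (g s)) -> (0 <= Im z)%R ->
  (Cmod z * Cmod (lap f z) <= K + 2 * L)%R.
Proof.
  intros Hf Hg HK HL Hd Hz.
  assert (E := lap_ibp f g K L z Hf Hg HK HL Hd Hz).
  assert (E2 : Ci * z * lap f z = - (f 0%R + lap g z)) by (rewrite E; ring).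
  apply (f_equal Cmod) in E2. rewrite !Cmod_mult, Cmod_Ci, Rmult_1_l, Cmod_opp in E2.
  rewrite E2. eapply Rle_trans; [apply Cmod_triangle|].
  apply Rplus_le_compat.
  - specialize (HK 0%R (Rle_refl _)). replace ((1 + 0) ^ 4)%R with 1%R in HK by ring.
    rewrite Rinv_1 in HK. lra.
  - now apply lap_bound.
Qed.

(** * Time transforms and the global relation *)

Lemma Rd_sub (t s : R) : is_derive (fun tau => t - tau)%R s (-1)%R.
Proof. auto_derive; [exact I|ring]. Qed.

(** The t-transform of the problem multiplied by exp(i zeta t), a factor contributed by [E]. In this
    form the kernel is bounded by 1 as soon as Im zeta >= 0. *)
Definition ttr (h : R -> C) (t : R) (zeta : C) : C :=
  CInt (fun tau => Cexp (Ci * zeta * RtoC (t - tau)) * h tau) 0 t.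

Lemma ttr_Cont_integrand h t zeta : Cont h -> Cont (fun tau => Cexp (Ci * zeta * RtoC (t - tau)) * h tau).
Proof.
  intros Hh tau. apply cont_Cmult; [|apply Hh]. apply cont_Cexp.
  apply cont_Cmult; [apply continuous_const|]. apply cont_RtoC.
  apply cont_Rminus; [apply continuous_const|apply continuous_id].
Qed.

Lemma cont_Ci_zeta {T : UniformSpace} (z : T -> C) (t : R) (s : T -> R) (p : T) :
  continuous z p -> continuous s p -> continuous (fun q => Ci * z q * RtoC (t - s q)) p.
Proof.
  intros Hz Hs. apply cont_Cmult; [apply cont_Cmult; [apply continuous_const|exact Hz]|].
  apply cont_RtoC, cont_Rminus; [apply continuous_const|exact Hs].
Qed.

Lemma holo_ttr (S : C -> Prop) (h : R -> C) (t : R) : (0 <= t)%R -> Cont h -> holo S (ttr h t).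
Proof.
  intros Ht Hh. split.
  - intros z _. apply (cont_CInt_param (fun z tau => Cexp (Ci * z * RtoC (t - tau)) * h tau)); [exact Ht|].
    intros q s. apply cont_Cmult.
    + apply cont_Cexp, (cont_Ci_zeta (fun x : C * R => fst x) t (fun x => snd x));
        [apply continuous_fst|apply continuous_snd].
    + apply (continuous_comp (fun x : C * R => snd x) h); [apply continuous_snd|apply Hh].
  - pose (H := fun (p : C * C) (tau : R) => CInt (fun r => Cexp (Ci * fst p * RtoC (t - tau) +
       RtoC r * (Ci * snd p * RtoC (t - tau) - Ci * fst p * RtoC (t - tau)))) 0 1 * (Ci * RtoC (t - tau) * h tau)).
    assert (HH : forall p s, continuous (fun x : C * C * R => H (fst x) (snd x)) (p, s)).
    { intros p s. apply cont_Cmult.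
      - apply (cont_CInt_param (fun (x : C * C * R) r => Cexp (Ci * fst (fst x) * RtoC (t - snd x) +
          RtoC r * (Ci * snd (fst x) * RtoC (t - snd x) - Ci * fst (fst x) * RtoC (t - snd x)))));
          [exact Rle_0_1|].
        intros x r. apply (cont_Cexp_segment
          (fun y : C * C * R * R => Ci * fst (fst (fst y)) * RtoC (t - snd (fst y)))
          (fun y : C * C * R * R => Ci * snd (fst (fst y)) * RtoC (t - snd (fst y))) _ (fun y => snd y)).
        + apply (cont_Ci_zeta (fun y : C * C * R * R => fst (fst (fst y))) t (fun y => snd (fst y))).
          * apply cont_fst, cont_fst, continuous_fst.
          * apply cont_snd, continuous_fst.
        + apply (cont_Ci_zeta (fun y : C * C * R * R => snd (fst (fst y))) t (fun y => snd (fst y))).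
          * apply cont_snd, cont_fst, continuous_fst.
          * apply cont_snd, continuous_fst.
        + apply continuous_snd.
      - apply cont_Cmult.
        + apply cont_Cmult; [apply continuous_const|].
          apply cont_RtoC, cont_Rminus; [apply continuous_const|apply continuous_snd].
        + apply (continuous_comp (fun x : C * C * R => snd x) h); [apply continuous_snd|apply Hh]. }
    exists (fun z w => CInt (H (z, w)) 0 t). intros z w _ _. split.
    + unfold ttr. rewrite <- CInt_minus by now apply ttr_Cont_integrand.
      rewrite <- CInt_scal by (intro s; apply cont_section, HH).
      apply CInt_ext. intros tau _. unfold H; simpl fst; simpl snd.
      replace (Cexp (Ci * w * RtoC (t - tau)) * h tau - Cexp (Ci * z * RtoC (t - tau)) * h tau) with
        ((Cexp (Ci * w * RtoC (t - tau)) - Cexp (Ci * z * RtoC (t - tau))) * h tau) by ring.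
      rewrite Cexp_quotient. ring.
    + apply (continuous_ext (fun p : C * C => CInt (H p) 0 t)); [now intros []|].
      apply (cont_CInt_param H); [exact Ht|exact HH].
Qed.

(** Integration by parts in time: the two endpoint values contribute 2 K and the integral of the
    derivative t K. *)
Lemma ttr_decay (h h1 : R -> C) (t K : R) (zeta : C) : (0 <= t)%R -> Cont h -> Cont h1 ->
  (forall s, (Cmod (h s) <= K)%R) -> (forall s, (Cmod (h1 s) <= K)%R) ->
  (forall s, (0 < s < t)%R -> is_Cderive h s (h1 s)) -> (0 <= Im zeta)%R ->
  (Cmod zeta * Cmod (ttr h t zeta) <= (2 + t) * K)%R.
Proof.
  intros Ht Hh Hh1 HK HK1 Hd Hz.
  assert (E : CInt (fun tau => - (Ci * zeta) * (Cexp (Ci * zeta * RtoC (t - tau)) * h tau)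
     + Cexp (Ci * zeta * RtoC (t - tau)) * h1 tau) 0 t =
     Cexp (Ci * zeta * RtoC (t - t)) * h t - Cexp (Ci * zeta * RtoC (t - 0)) * h 0%R).
  { apply (CInt_FTC (fun tau => Cexp (Ci * zeta * RtoC (t - tau)) * h tau)); [exact Ht| | |].
    - intro s. apply cont_Cplus; [apply cont_Cmult; [apply continuous_const|]|]; now apply ttr_Cont_integrand.
    - intros s _. now apply ttr_Cont_integrand.
    - intros s Hs. eapply Cd_eq.
      + apply Cd_mult; [|now apply Hd]. apply Cd_Cexp.
        apply Cd_mult; [apply Cd_const|]. exact (Cd_RtoC _ _ _ (Rd_sub t s)).
      + replace (RtoC (-1)) with (- RtoC 1) by (apply injective_projections; simpl; ring). cring. }
  rewrite CInt_plus in E; [|intro s; apply cont_Cmult; [apply continuous_const|now apply ttr_Cont_integrand]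
    |now apply ttr_Cont_integrand].
  rewrite CInt_scal in E by now apply ttr_Cont_integrand.
  fold (ttr h t zeta) in E. fold (ttr h1 t zeta) in E.
  assert (E2 : Ci * zeta * ttr h t zeta = ttr h1 t zeta -
    (Cexp (Ci * zeta * RtoC (t - t)) * h t - Cexp (Ci * zeta * RtoC (t - 0)) * h 0%R)).
  { rewrite <- E. ring. }
  apply (f_equal Cmod) in E2. rewrite !Cmod_mult, Cmod_Ci, Rmult_1_l in E2. rewrite E2.
  assert (He : forall s, (0 <= s <= t)%R -> (Cmod (Cexp (Ci * zeta * RtoC (t - s))) <= 1)%R).
  { intros s Hs. apply Cmod_Cexp_le. unfold Im in Hz. unfold Re; simpl. nra. }
  assert (Hb : forall h', (forall s, (Cmod (h' s) <= K)%R) -> forall s, (0 <= s <= t)%R ->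
    (Cmod (Cexp (Ci * zeta * RtoC (t - s)) * h' s) <= K)%R).
  { intros h' Hh' s Hs. rewrite Cmod_mult. assert (H1 := He s Hs). assert (H2 := Hh' s).
    assert (H3 := Cmod_ge_0 (h' s)). nra. }
  eapply Rle_trans; [apply Cmod_triangle|]. rewrite Cmod_opp.
  assert (H1 : (Cmod (ttr h1 t zeta) <= (t - 0) * K)%R).
  { apply CInt_bound; [now apply ttr_Cont_integrand|exact Ht|]. now apply Hb. }
  assert (H2 : (Cmod (Cexp (Ci * zeta * RtoC (t - t)) * h t - Cexp (Ci * zeta * RtoC (t - 0)) * h 0%R) <= K + K)%R).
  { eapply Rle_trans; [apply Cmod_triangle|]. rewrite Cmod_opp.
    apply Rplus_le_compat; apply Hb; trivial; lra. }
  lra.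
Qed.

Definition omega (kappa : R) (lambda : C) : C := (RtoC (kappa ^ 2) + lambda ^ 2) ^ 2.

(* The boundary term of the global relation; it is entire in lambda. *)
Definition bhat (w : nat -> R -> R -> C) (kappa t : R) (lambda : C) : C :=
  let T k := ttr (w k 0%R) t (omega kappa lambda) in
  Ci * (T 3%nat + Ci * lambda * T 2%nat - (lambda ^ 2 + RtoC (2 * kappa ^ 2)) * T 1%nat
        - Ci * lambda * (lambda ^ 2 + RtoC (2 * kappa ^ 2)) * T 0%nat).

Section GlobalRelation.
Context (kappa tmax K t : R) (w wt : nat -> R -> R -> C).
Context (HW : halfline_solution kappa tmax K w wt) (Ht : (0 < t < tmax)%R).

Lemma hs_Cont_y k tau : (k <= 4)%nat -> Cont (fun y => w k y tau).
Proof. intro Hk. apply (jcont2_l (w k)). now apply (hs_cont _ _ _ _ _ HW). Qed.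
Lemma hs_Cont_t k y : (k <= 4)%nat -> Cont (w k y).
Proof. intro Hk. apply (jcont2_r (w k)). now apply (hs_cont _ _ _ _ _ HW). Qed.
Lemma hs_dom4 k tau : (k <= 4)%nat -> dom4 K (fun y => w k y tau).
Proof. intros Hk s Hs. now apply (hs_bound _ _ _ _ _ HW). Qed.

Lemma lap_succ k tau z : (k <= 3)%nat -> (0 <= Im z)%R ->
  lap (fun y => w (S k) y tau) z = - w k 0%R tau - Ci * z * lap (fun y => w k y tau) z.
Proof.
  intros Hk Hz. apply (lap_ibp (fun y => w k y tau) (fun y => w (S k) y tau) K K).
  - apply hs_Cont_y; lia.
  - apply hs_Cont_y; lia.
  - apply hs_dom4; lia.
  - apply hs_dom4; lia.
  - intros s Hs. now apply (hs_dY _ _ _ _ _ HW).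
  - exact Hz.
Qed.

(** Four integrations by parts replace d_y by - i z up to boundary values, and the symbol z^4 + 2
    kappa^2 z^2 + kappa^4 is exactly [omega]. *)
Lemma lap_wt tau z : (0 <= Im z)%R ->
  lap (fun y => wt 0%nat y tau) z = Ci * (omega kappa z * lap (fun y => w 0%nat y tau) z
    - (w 3%nat 0%R tau - Ci * z * w 2%nat 0%R tau - (z ^ 2 + RtoC (2 * kappa ^ 2)) * w 1%nat 0%R tau
       + Ci * z * (z ^ 2 + RtoC (2 * kappa ^ 2)) * w 0%nat 0%R tau)).
Proof.
  intro Hz.
  assert (E : lap (fun y => wt 0%nat y tau) z = Ci * (lap (fun y => w 4%nat y tau) z
    + (- RtoC (2 * kappa ^ 2) * lap (fun y => w 2%nat y tau) z + RtoC (kappa ^ 4) * lap (fun y => w 0%nat y tau) z))).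
  { unfold lap.
    assert (HI : forall k, (k <= 4)%nat -> Cont (fun s => Cexp (Ci * zc z * RtoC s) * w k s tau)).
    { intros k Hk. now apply lap_Cont_integrand, hs_Cont_y. }
    assert (HD : forall k, (k <= 4)%nat -> dom2 K (fun s => Cexp (Ci * zc z * RtoC s) * w k s tau)).
    { intros k Hk. now apply lap_dom2, hs_dom4. }
    rewrite <- (CI_scal (- RtoC (2 * kappa ^ 2)) _ K) by (apply HI || apply HD; lia).
    rewrite <- (CI_scal (RtoC (kappa ^ 4)) _ K) by (apply HI || apply HD; lia).
    assert (HIs : forall c k, (k <= 4)%nat -> Cont (fun s => c * (Cexp (Ci * zc z * RtoC s) * w k s tau))).
    { intros c k Hk s. apply cont_Cmult; [apply continuous_const|now apply HI]. }
    assert (HDs : forall c k, (k <= 4)%nat -> dom2 (Cmod c * K) (fun s => c * (Cexp (Ci * zc z * RtoC s) * w k s tau))).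
    { intros c k Hk. now apply dom2_scal, HD. }
    rewrite <- (CI_plus _ _ (Cmod (- RtoC (2 * kappa ^ 2)) * K) (Cmod (RtoC (kappa ^ 4)) * K))
      by (first [apply HIs|apply HDs]; lia).
    rewrite <- (CI_plus _ _ K (Cmod (- RtoC (2 * kappa ^ 2)) * K + Cmod (RtoC (kappa ^ 4)) * K)).
    - rewrite <- (CI_scal Ci _ (K + (Cmod (- RtoC (2 * kappa ^ 2)) * K + Cmod (RtoC (kappa ^ 4)) * K))).
      + apply CI_ext. intros s Hs. rewrite (hs_pde _ _ _ _ _ HW). ring.
      + intro s. apply cont_Cplus; [apply HI; lia|]. apply cont_Cplus; apply HIs; lia.
      + apply dom2_plus; [apply HD; lia|]. apply dom2_plus; apply HDs; lia.
    - apply HI; lia.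
    - intro s. apply cont_Cplus; apply HIs; lia.
    - apply HD; lia.
    - apply dom2_plus; apply HDs; lia. }
  rewrite E, (lap_succ 3), (lap_succ 2), (lap_succ 1), (lap_succ 0) by (lia || exact Hz).
  unfold omega.
  set (L := lap (fun y => w 0%nat y tau) z). generalize (w 0%nat 0%R tau) (w 1%nat 0%R tau) (w 2%nat 0%R tau) (w 3%nat 0%R tau).
  intros a b c d.
  replace (RtoC (kappa ^ 4)) with (RtoC (kappa ^ 2) * RtoC (kappa ^ 2)) by (rewrite <- RtoC_mult; f_equal; ring).
  replace (RtoC (2 * kappa ^ 2)) with (2 * RtoC (kappa ^ 2)) by (rewrite <- RtoC_mult; reflexivity).
  generalize (RtoC (kappa ^ 2)). intro k2.
  destruct z as [z1 z2], L as [L1 L2], a, b, c, d, k2.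
  apply injective_projections; simpl; ring.
Qed.

(** The function exp(i omega (t - tau)) L[w(.,tau)](z) has a derivative in tau from which the terms
    with omega L cancel, leaving only boundary values at y = 0. Integration over [0, t] gives the
    identity. The odd powers of z come with the opposite sign to those in [bhat], hence its argument
    - z. *)
Lemma global_relation z : (0 <= Im z)%R ->
  Cexp (Ci * omega kappa z * RtoC t) * lap (fun y => w 0%nat y 0%R) z
    - lap (fun y => w 0%nat y t) z = bhat w kappa t (- z).
Proof.
  intro Hz. set (om := omega kappa z).
  assert (Hj : forall k, (k <= 4)%nat -> jcont2 (fun tau s => Cexp (Ci * zc z * RtoC s) * w k s tau)).
  { intros k Hk T a b p Ha Hb. apply cont_Cmult.
    - apply cont_Cexp, (cont_Cexp_zc (fun _ => z) b); [apply continuous_const|exact Hb].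
    - apply (hs_cont _ _ _ _ _ HW k Hk); [exact Hb|exact Ha]. }
  assert (Hjt : jcont2 (fun tau s => Cexp (Ci * zc z * RtoC s) * wt 0%nat s tau)).
  { intros T a b p Ha Hb. apply cont_Cmult.
    - apply cont_Cexp, (cont_Cexp_zc (fun _ => z) b); [apply continuous_const|exact Hb].
    - apply (hs_tcont _ _ _ _ _ HW 0 ltac:(lia)); [exact Hb|exact Ha]. }
  assert (HwC : forall k, (k <= 4)%nat -> Cont (w k 0%R)) by (intros k Hk; now apply hs_Cont_t).
  pose (c3 := Ci). pose (c2 := Ci * (- (Ci * z))). pose (c1 := Ci * (- (z ^ 2 + RtoC (2 * kappa ^ 2)))).
  pose (c0 := Ci * (Ci * z * (z ^ 2 + RtoC (2 * kappa ^ 2)))).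
  pose (g := fun tau => - (c3 * (Cexp (Ci * om * RtoC (t - tau)) * w 3%nat 0%R tau) +
     (c2 * (Cexp (Ci * om * RtoC (t - tau)) * w 2%nat 0%R tau) +
     (c1 * (Cexp (Ci * om * RtoC (t - tau)) * w 1%nat 0%R tau) +
      c0 * (Cexp (Ci * om * RtoC (t - tau)) * w 0%nat 0%R tau))))).
  assert (Hti : forall c k, (k <= 4)%nat -> Cont (fun tau => c * (Cexp (Ci * om * RtoC (t - tau)) * w k 0%R tau))).
  { intros c k Hk s. apply cont_Cmult; [apply continuous_const|]. now apply ttr_Cont_integrand, HwC. }
  pose (g1 := fun tau => c1 * (Cexp (Ci * om * RtoC (t - tau)) * w 1%nat 0%R tau) +
      c0 * (Cexp (Ci * om * RtoC (t - tau)) * w 0%nat 0%R tau)).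
  pose (g2 := fun tau => c2 * (Cexp (Ci * om * RtoC (t - tau)) * w 2%nat 0%R tau) + g1 tau).
  pose (g3 := fun tau => c3 * (Cexp (Ci * om * RtoC (t - tau)) * w 3%nat 0%R tau) + g2 tau).
  assert (Hg1 : Cont g1).
  { intro s. apply cont_Cplus; [exact (Hti c1 1%nat ltac:(lia) s)|exact (Hti c0 0%nat ltac:(lia) s)]. }
  assert (Hg2 : Cont g2).
  { intro s. apply cont_Cplus; [exact (Hti c2 2%nat ltac:(lia) s)|exact (Hg1 s)]. }
  assert (Hg3 : Cont g3).
  { intro s. apply cont_Cplus; [exact (Hti c3 3%nat ltac:(lia) s)|exact (Hg2 s)]. }
  assert (HgC : Cont g).
  { intro s. apply cont_Copp. exact (Hg3 s). }
  assert (E : CInt g 0 t = Cexp (Ci * om * RtoC (t - t)) * lap (fun y => w 0%nat y t) z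
     - Cexp (Ci * om * RtoC (t - 0)) * lap (fun y => w 0%nat y 0%R) z).
  { apply (CInt_FTC (fun tau => Cexp (Ci * om * RtoC (t - tau)) * lap (fun y => w 0%nat y tau) z)).
    - lra.
    - exact HgC.
    - intros s _. apply cont_Cmult.
      + apply cont_Cexp, cont_Cmult; [apply continuous_const|].
        apply cont_RtoC, cont_Rminus; [apply continuous_const|apply continuous_id].
      + apply (cont_CI_param (fun tau s => Cexp (Ci * zc z * RtoC s) * w 0%nat s tau) K).
        * intros q s'. apply (jcont2_pair (fun tau s => Cexp (Ci * zc z * RtoC s) * w 0%nat s tau)), Hj. lia.
        * intro q. apply (lap_dom2 (fun y => w 0%nat y q)), hs_dom4. lia.
    - intros s Hs. eapply Cd_eq.
      + apply Cd_mult.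
        * apply Cd_Cexp, Cd_mult; [apply Cd_const|].
          exact (Cd_RtoC _ _ _ (Rd_sub t s)).
        * apply (is_derive_CI_param (fun tau s => Cexp (Ci * zc z * RtoC s) * w 0%nat s tau)
             (fun tau s => Cexp (Ci * zc z * RtoC s) * wt 0%nat s tau) K K 0 tmax).
          -- apply Hj. lia.
          -- exact Hjt.
          -- intro q. apply (lap_dom2 (fun y => w 0%nat y q)), hs_dom4. lia.
          -- intro q. apply (lap_dom2 (fun y => wt 0%nat y q)).
             intros y Hy. apply (hs_tbound _ _ _ _ _ HW); [lia|exact Hy].
          -- lra.
          -- intros q s' Hq Hs'. apply Cd_scal. apply (hs_dT _ _ _ _ _ HW); [lia|lra].
      + fold (lap (fun y => wt 0%nat y s) z). rewrite (lap_wt s z Hz). fold om.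
        cbv beta. unfold g, c0, c1, c2, c3.
        set (L := lap (fun y => w 0%nat y s) z).
        replace (RtoC (-1)) with (- RtoC 1) by (apply injective_projections; simpl; ring). cring. }
  assert (EG : CInt g 0 t = - bhat w kappa t (- z)).
  { unfold g, bhat.
    replace (omega kappa (- z)) with om.
    2: { unfold om, omega. ring. }
    transitivity (- CInt g3 0 t).
    { replace (- CInt g3 0 t) with ((- (1)) * CInt g3 0 t) by ring.
      rewrite <- CInt_scal by exact Hg3. apply CInt_ext. intros tau _. unfold g3, g2, g1. ring. }
    f_equal. unfold g3.
    rewrite CInt_plus; [|exact (Hti c3 3%nat ltac:(lia))|exact Hg2]. unfold g2.
    rewrite CInt_plus; [|exact (Hti c2 2%nat ltac:(lia))|exact Hg1]. unfold g1.
    rewrite CInt_plus; [|exact (Hti c1 1%nat ltac:(lia))|exact (Hti c0 0%nat ltac:(lia))].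
    rewrite !CInt_scal by (apply ttr_Cont_integrand, HwC; lia).
    fold (ttr (w 3%nat 0%R) t om). fold (ttr (w 2%nat 0%R) t om).
    fold (ttr (w 1%nat 0%R) t om). fold (ttr (w 0%nat 0%R) t om).
    unfold c0, c1, c2, c3. ring. }
  rewrite EG in E.
  replace (bhat w kappa t (- z)) with (- - bhat w kappa t (- z)) by ring. rewrite E.
  rewrite Rminus_diag, Rminus_0_r, Cmult_0_r, Cexp_0. ring.
Qed.
End GlobalRelation.

(** * Contour deformation *)

Definition hyp (kappa s : R) : R := sqrt (kappa ^ 2 + s ^ 2).
(* The slope of [hyp]; at kappa = 0 it is continued by its limit at 0+. *)
Definition slope (kappa s : R) : R := if Req_EM_T kappa 0 then 1%R else (s / hyp kappa s)%R.

Lemma hyp_sq kappa s : (hyp kappa s ^ 2 = kappa ^ 2 + s ^ 2)%R.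
Proof. apply pow2_sqrt. nra. Qed.
Lemma hyp_ge0 kappa s : (0 <= hyp kappa s)%R.
Proof. apply sqrt_pos. Qed.
Lemma hyp_0 kappa : hyp kappa 0 = Rabs kappa.
Proof.
  unfold hyp. replace (kappa ^ 2 + 0 ^ 2)%R with (Rsqr kappa) by (unfold Rsqr; ring). apply sqrt_Rsqr_abs.
Qed.
Lemma hyp_ge_l kappa s : (Rabs kappa <= hyp kappa s)%R.
Proof. rewrite <- hyp_0. apply sqrt_le_1_alt. nra. Qed.
Lemma hyp_ge_r kappa s : (0 <= s)%R -> (s <= hyp kappa s)%R.
Proof. intro H. assert (H1 := hyp_sq kappa s). assert (H2 := hyp_ge0 kappa s). nra. Qed.
Lemma hyp_pos kappa s : (0 < s)%R -> (0 < hyp kappa s)%R.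
Proof. intro H. apply sqrt_lt_R0. nra. Qed.
Lemma hyp_mono kappa s s' : (0 <= s <= s')%R -> (hyp kappa s <= hyp kappa s')%R.
Proof. intro H. apply sqrt_le_1_alt. nra. Qed.
Lemma cont_hyp {T : UniformSpace} kappa (f : T -> R) p : continuous f p -> continuous (fun q => hyp kappa (f q)) p.
Proof.
  intro H. apply cont_sqrt, cont_Rplus; [apply continuous_const|now apply cont_Rpow].
Qed.
Lemma cont_slope {T : UniformSpace} kappa (f : T -> R) p : continuous f p -> continuous (fun q => slope kappa (f q)) p.
Proof.
  intro H. unfold slope. destruct (Req_EM_T kappa 0) as [Hk|Hk]; [apply continuous_const|].
  apply cont_Rdiv; [|exact H|now apply cont_hyp].
  apply Rgt_not_eq. apply Rlt_le_trans with (Rabs kappa); [now apply Rabs_pos_lt|apply hyp_ge_l].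
Qed.
Lemma is_derive_hyp kappa s : (0 < s)%R -> is_derive (hyp kappa) s (slope kappa s).
Proof.
  intro H. assert (H1 := is_derive_hyperbola kappa s H). unfold slope.
  destruct (Req_EM_T kappa 0) as [Hk|Hk]; [|exact H1].
  replace 1%R with (s / sqrt (kappa ^ 2 + s ^ 2))%R; [exact H1|].
  subst kappa. replace (0 ^ 2 + s ^ 2)%R with (s ^ 2)%R by ring. rewrite sqrt_pow2 by lra. field. lra.
Qed.
Lemma slope_bound kappa s : (0 <= s)%R -> (0 <= slope kappa s <= 1)%R.
Proof.
  intro H. unfold slope. destruct (Req_EM_T kappa 0) as [Hk|Hk]; [lra|].
  assert (Hp : (0 < hyp kappa s)%R).
  { apply Rlt_le_trans with (Rabs kappa); [now apply Rabs_pos_lt|apply hyp_ge_l]. }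
  assert (H1 := hyp_ge_r kappa s H). split.
  - apply Rmult_le_pos; [exact H|]. left. now apply Rinv_0_lt_compat.
  - apply Rle_div_l; lra.
Qed.

(** At the cut the squared height is (r^2 + kappa^2) / 2. Everything beyond lies at height at least
    r / 2, where the exponential factor takes effect. *)
Lemma hyperbola_cut_facts kappa r : (Rabs kappa <= r)%R -> (0 < r)%R ->
  (0 <= hyperbola_cut kappa r <= r)%R /\ (r / 2 <= hyp kappa (hyperbola_cut kappa r) <= r)%R.
Proof.
  intros Hk Hr. assert (H0 : (0 <= hyperbola_cut kappa r)%R) by apply sqrt_pos.
  assert (Hk2 : (kappa ^ 2 <= r ^ 2)%R) by (apply pow_maj_Rabs; exact Hk).
  assert (H1 : (hyperbola_cut kappa r ^ 2 = (r ^ 2 - kappa ^ 2) / 2)%R) by (apply pow2_sqrt; lra).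
  assert (H2 := hyp_sq kappa (hyperbola_cut kappa r)).
  assert (H3 := hyp_ge0 kappa (hyperbola_cut kappa r)). rewrite H1 in H2.
  assert (0 <= kappa ^ 2)%R by nra.
  repeat split; try nra.
Qed.

(** * Regions, arcs and deformation estimates *)

Definition quadrant (sg : R) (z : C) : Prop := (0 < sg * Re z)%R /\ (0 < Im z)%R.
(** The hyperbola divides each closed quadrant of the upper half plane in two. The low region for sg
    = -1 and the up region for sg = 1 are the closures of the two components of D^+; the other two
    regions make up the complement. *)
Definition low_region (sg kappa : R) (z : C) : Prop :=
  (0 <= sg * Re z)%R /\ (0 <= Im z)%R /\ (Im z ^ 2 <= kappa ^ 2 + Re z ^ 2)%R.
Definition up_region (sg kappa : R) (z : C) : Prop :=
  (0 <= sg * Re z)%R /\ (0 <= Im z)%R /\ (kappa ^ 2 + Re z ^ 2 <= Im z ^ 2)%R.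

(** The integrands for which the deformations work. Holomorphy is required in the open quadrant
    only, continuity everywhere. The decay is tied to a region because the boundary term of the
    global relation decays only where Im omega >= 0. *)
Record good (sg : R) (reg : C -> Prop) (y C0 R0 : R) (f : C -> C) : Prop := {
  good_cont : Cont f;
  good_holo : holo (quadrant sg) f;
  good_bound : forall z, reg z -> (R0 <= Cmod z)%R -> (Cmod (f z) <= C0 * exp (- (y * Im z)) * / Cmod z)%R }.

(** Taken without the tangent factor [sg], which is restored explicitly in [deform_low]. *)
Definition arc_real (f : C -> C) (sg r : R) : C := CInt (fun s => f (sg * s, 0)%R) 0 r.
Definition arc_imag (f : C -> C) (a b : R) : C := CInt (fun s => f (0, s)%R * Ci) a b.
Definition arc_hyp (f : C -> C) (sg kappa h : R) : C :=
  CInt (fun s => f (sg * s, hyp kappa s)%R * (sg, slope kappa s)) 0 h.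

Lemma cont_f_pair {T : UniformSpace} (f : C -> C) (a b : T -> R) (p : T) : Cont f ->
  continuous a p -> continuous b p -> continuous (fun q => f (a q, b q)) p.
Proof.
  intros Hf Ha Hb. apply (continuous_comp (fun q => (a q, b q) : C) f); [now apply cont_pair|apply Hf].
Qed.

Lemma cont_sgs (sg : R) (x : R_UniformSpace) : continuous (fun s : R_UniformSpace => (sg * s)%R : R_UniformSpace) x.
Proof. apply cont_Rmult; [apply continuous_const|apply continuous_id]. Qed.
Lemma arc_real_Cont (f : C -> C) (sg : R) : Cont f -> Cont (fun s => f (sg * s, 0)%R).
Proof. intros Hf s. apply (cont_f_pair f (fun s : R => (sg * s)%R) (fun _ => 0%R)); [exact Hf|apply cont_sgs|apply continuous_const]. Qed.
Lemma arc_imag_Cont (f : C -> C) : Cont f -> Cont (fun s => f (0, s)%R * Ci).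
Proof.
  intros Hf s. apply cont_Cmult; [|apply continuous_const].
  apply (cont_f_pair f (fun _ => 0%R) (fun s => s)); [exact Hf|apply continuous_const|apply continuous_id].
Qed.
Lemma arc_hyp_Cont (f : C -> C) (sg kappa : R) : Cont f -> Cont (fun s => f (sg * s, hyp kappa s)%R * (sg, slope kappa s)).
Proof.
  intros Hf s. apply cont_Cmult.
  - apply (cont_f_pair f (fun s => (sg * s)%R) (hyp kappa)); [exact Hf|apply cont_sgs|].
    apply (cont_hyp kappa (fun s => s)), continuous_id.
  - apply cont_pair; [apply continuous_const|]. apply (cont_slope kappa (fun s => s)), continuous_id.
Qed.

Lemma exp_neg_le (x : R) : (0 < x)%R -> (exp (- x) <= / x)%R.
Proof.
  intro H. rewrite exp_Ropp. apply Rinv_le_contravar; [exact H|].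
  assert (H1 := exp_ineq1_le x). lra.
Qed.

Lemma Cmod_ge_pair_l a b : (Rabs a <= Cmod (a, b))%R.
Proof. apply (Re_le_Cmod (a, b)). Qed.

Section Deform.
Context (sg kappa y C0 R0 : R) (f : C -> C).
Context (Hsg : sg = 1%R \/ sg = (-1)%R) (Hy : (0 < y)%R) (HC0 : (0 <= C0)%R) (HR0 : (Rabs kappa + 1 <= R0)%R).

Lemma sg_sq : (sg * sg = 1)%R.
Proof. destruct Hsg as [-> | ->]; ring. Qed.
Lemma sg_abs s : Rabs (sg * s) = Rabs s.
Proof.
  destruct Hsg as [-> | ->]; unfold Rabs; repeat destruct Rcase_abs; lra.
Qed.
Lemma sg_mul s : (sg * (sg * s) = s)%R.
Proof. rewrite <- Rmult_assoc, sg_sq. ring. Qed.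

Lemma small_factor r : (2 * R0 <= r)%R -> (exp (- (y * (r / 2))) <= 2 / (y * r))%R.
Proof.
  intro Hr. assert (Hk := Rabs_pos kappa). assert (Hp : (0 < y * (r / 2))%R) by (apply Rmult_lt_0_compat; lra).
  eapply Rle_trans; [now apply exp_neg_le|]. right. field. split; lra.
Qed.

(** At height at least r / 2 the exponential is at most 2 / (y r) and 1 / |z| at most 2 / r. The
    product is O(r^(-2)), enough against arcs of length O(r). *)
Lemma far_bound (reg : C -> Prop) (z : C) r : good sg reg y C0 R0 f -> reg z -> (2 * R0 <= r)%R ->
  (r / 2 <= Im z)%R -> (Cmod (f z) <= 4 * C0 / (y * r * r))%R.
Proof.
  intros Hg Hz Hr Hi. assert (Hk := Rabs_pos kappa).
  assert (Hm := Im_le_Cmod z). rewrite Rabs_pos_eq in Hm by lra.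
  eapply Rle_trans; [apply (good_bound _ _ _ _ _ _ Hg); [exact Hz|lra]|].
  assert (H1 := small_factor r Hr).
  assert (H2 : (exp (- (y * Im z)) <= exp (- (y * (r / 2))))%R).
  { destruct Hi as [Hi|Hi].
    - left. apply exp_increasing. apply Ropp_lt_contravar. now apply Rmult_lt_compat_l.
    - rewrite Hi. lra. }
  assert (H3 : (/ Cmod z <= 2 / r)%R).
  { replace (2 / r)%R with (/ (r / 2))%R by (field; lra). apply Rinv_le_contravar; lra. }
  assert (H4 : (0 < / Cmod z)%R) by (apply Rinv_0_lt_compat; lra).
  assert (H5 := exp_pos (- (y * Im z))).
  replace (4 * C0 / (y * r * r))%R with (C0 * (2 / (y * r)) * (2 / r))%R by (field; split; lra).
  apply Rmult_le_compat; try lra.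
  - apply Rmult_le_pos; lra.
  - apply Rmult_le_compat_l; lra.
Qed.

(** The contour is cut by |lambda| <= r, whereas the rectangle in [deform_low] ends at parameter r.
    The piece of hyperbola in between has parameter length at most r and tangent at most 2, hence
    the constant 8. *)
Lemma hyp_tail (reg : C -> Prop) r : good sg reg y C0 R0 f -> (2 * R0 <= r)%R ->
  (forall s, (0 <= s)%R -> reg (sg * s, hyp kappa s)%R) ->
  (Cmod (arc_hyp f sg kappa r - arc_hyp f sg kappa (hyperbola_cut kappa r)) <= 8 * C0 / (y * r))%R.
Proof.
  intros Hg Hr Hreg. assert (Hk := Rabs_pos kappa).
  destruct (hyperbola_cut_facts kappa r ltac:(lra) ltac:(lra)) as [[H1 H2] [H3 H4]].
  set (h := hyperbola_cut kappa r) in *.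
  assert (Hc := arc_hyp_Cont f sg kappa (good_cont _ _ _ _ _ _ Hg)).
  assert (E : arc_hyp f sg kappa h + CInt (fun s => f (sg * s, hyp kappa s)%R * (sg, slope kappa s)) h r
    = arc_hyp f sg kappa r) by exact (CInt_Chasles _ 0 h r Hc).
  rewrite <- E.
  match goal with |- (Cmod (?a + ?b - ?a) <= _)%R => replace (a + b - a) with b by ring end.
  apply Rle_trans with ((r - h) * (4 * C0 / (y * r * r) * 2))%R.
  - apply CInt_bound; [exact Hc|exact H2|]. intros s Hs. rewrite Cmod_mult.
    apply Rmult_le_compat; try apply Cmod_ge_0.
    + apply (far_bound reg); [exact Hg|apply Hreg; lra|exact Hr|].
      simpl. apply Rle_trans with (hyp kappa h); [exact H3|apply hyp_mono; lra].
    + eapply Rle_trans; [apply Cmod_sum_le|].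
      assert (Hsl := slope_bound kappa s ltac:(lra)). rewrite (Rabs_pos_eq (slope kappa s)) by lra.
      replace (Rabs sg) with 1%R; [lra|]. rewrite <- (Rmult_1_r sg), sg_abs, Rabs_R1. reflexivity.
  - replace (8 * C0 / (y * r))%R with (r * (4 * C0 / (y * r * r) * 2))%R by (field; split; lra).
    apply Rmult_le_compat_r; [|lra].
    apply Rmult_le_pos; [|lra]. apply Rmult_le_pos; [lra|].
    left. apply Rinv_0_lt_compat. repeat apply Rmult_lt_0_compat; lra.
Qed.

Lemma quadrant_pair a b : quadrant sg (a, b) <-> (0 < sg * a /\ 0 < b)%R.
Proof. reflexivity. Qed.

Lemma Rd_const (c s : R) : is_derive (fun _ : R => c) s 0%R.
Proof. apply (@is_derive_const R_AbsRing R_NormedModule). Qed.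
Lemma Rd_scal_id (c s : R) : is_derive (fun q : R => c * q)%R s c.
Proof. auto_derive; [exact I|ring]. Qed.

(** The map (s, th) to (sg s, th [hyp] s) sweeps the region below the hyperbola. Its sides are the
    real axis (th = 0), the hyperbola (th = 1), the segment from 0 to i |kappa| (s = 0) and a
    vertical edge (s = r). The edge contributes C0 / (y r) and the mismatch of the cut-offs 8 C0 /
    (y r). *)
Lemma deform_low r : good sg (low_region sg kappa) y C0 R0 f -> (2 * R0 <= r)%R ->
  (Cmod (RtoC sg * arc_real f sg r - arc_imag f 0 (Rabs kappa) - arc_hyp f sg kappa (hyperbola_cut kappa r))
    <= 9 * C0 / (y * r))%R.
Proof.
  intros Hg Hr. assert (Hk := Rabs_pos kappa). assert (Hf := good_cont _ _ _ _ _ _ Hg).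
  assert (HT := hyp_tail (low_region sg kappa) r Hg Hr).
  assert (Hrect := rectangle (quadrant sg) f (fun s th => (sg * s, th * hyp kappa s)%R)
    (fun s th => (sg, th * slope kappa s)%R) (fun s th => (0, hyp kappa s)%R) (fun s th => (0, slope kappa s)%R)
    Hf (good_holo _ _ _ _ _ _ Hg)).
  assert (E : CInt (fun s => f (sg * s, 1 * hyp kappa s)%R * (sg, 1 * slope kappa s)%R) 0 r -
      CInt (fun s => f (sg * s, 0 * hyp kappa s)%R * (sg, 0 * slope kappa s)%R) 0 r =
    CInt (fun th => f (sg * r, th * hyp kappa r)%R * (0, hyp kappa r)%R) 0 1 -
      CInt (fun th => f (sg * 0, th * hyp kappa 0)%R * (0, hyp kappa 0)%R) 0 1).
  { apply Hrect.
    - intros T a b p Ha Hb. apply cont_pair.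
      + apply cont_Rmult; [apply continuous_const|exact Ha].
      + apply cont_Rmult; [exact Hb|now apply cont_hyp].
    - intros T a b p Ha Hb. apply cont_pair; [apply continuous_const|].
      apply cont_Rmult; [exact Hb|now apply cont_slope].
    - intros T a b p Ha Hb. apply cont_pair; [apply continuous_const|now apply cont_hyp].
    - intros T a b p Ha Hb. apply cont_pair; [apply continuous_const|now apply cont_slope].
    - intros s th Hs Hth. apply quadrant_pair. rewrite sg_mul. split; [exact Hs|].
      apply Rmult_lt_0_compat; [lra|now apply hyp_pos].
    - intros s th Hs Hth. apply Cd_pair; [apply Rd_scal_id|].
      apply (is_derive_scal (hyp kappa)). now apply is_derive_hyp.
    - intros s th Hs Hth. apply Cd_pair; [apply Rd_const|].
      apply (is_derive_ext (fun q => hyp kappa s * q)%R); [intro; apply Rmult_comm|apply Rd_scal_id].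
    - intros s th Hs Hth. apply Cd_pair; [apply Rd_const|].
      apply (is_derive_ext (fun q => slope kappa s * q)%R); [intro; apply Rmult_comm|apply Rd_scal_id].
    - intros s th Hs Hth. apply Cd_pair; [apply Rd_const|now apply is_derive_hyp].
    - lra. }
  clear Hrect.
  replace (CInt (fun s => f (sg * s, 1 * hyp kappa s)%R * (sg, 1 * slope kappa s)%R) 0 r)
    with (arc_hyp f sg kappa r) in E.
  2: { unfold arc_hyp. apply CInt_ext. intros s _. now rewrite !Rmult_1_l. }
  replace (CInt (fun s => f (sg * s, 0 * hyp kappa s)%R * (sg, 0 * slope kappa s)%R) 0 r)
    with (RtoC sg * arc_real f sg r) in E.
  2: { unfold arc_real. rewrite <- CInt_scal by now apply arc_real_Cont.
       apply CInt_ext. intros s _. rewrite !Rmult_0_l. change (sg, 0%R) with (RtoC sg). ring. }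
  replace (CInt (fun th => f (sg * 0, th * hyp kappa 0)%R * (0, hyp kappa 0)%R) 0 1)
    with (arc_imag f 0 (Rabs kappa)) in E.
  2: { unfold arc_imag. symmetry. apply CInt_unique.
       assert (HS := CInt_subst (fun s => f (0, s)%R * Ci) (fun th => (Rabs kappa * th)%R) (fun _ => Rabs kappa) 0 1
         (arc_imag_Cont f Hf)).
       rewrite Rmult_0_r, Rmult_1_r in HS.
       eapply is_CRInt_ext; [|apply HS].
       - intros th _. cbv beta. rewrite hyp_0, Rmult_0_r, (Rmult_comm th).
         set (v := f (0, Rabs kappa * th)%R). destruct v.
         apply injective_projections; simpl; ring.
       - intros th _. split; [apply Rd_scal_id|apply continuous_const]. }
  set (edge := CInt (fun th => f (sg * r, th * hyp kappa r)%R * (0, hyp kappa r)%R) 0 1) in *.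
  assert (Hedge : (Cmod edge <= C0 / (y * r))%R).
  { assert (Hh : (0 < hyp kappa r)%R) by (apply hyp_pos; lra).
    set (H := hyp kappa r) in *.
    (* The edge reaches down to the real axis and has length of order r, so a supremum bound would
       only give O(1). Integrating the exponential exactly gains the factor 1 / y in place of the
       length. *)
    assert (HI : is_RInt (fun th => C0 / r * (H * exp (- (y * H * th))))%R 0 1
       (C0 / r * (1 - exp (- (y * H))) / y)%R).
    { replace (C0 / r * (1 - exp (- (y * H))) / y)%R with
        (minus ((fun th => - (C0 / r / y) * exp (- (y * H * th)))%R 1%R)
               ((fun th => - (C0 / r / y) * exp (- (y * H * th)))%R 0%R)).
      - apply (is_RInt_derive (V := R_CompleteNormedModule) (fun th => - (C0 / r / y) * exp (- (y * H * th)))%R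
          (fun th => C0 / r * (H * exp (- (y * H * th))))%R 0 1).
        + intros th _. auto_derive; [exact I|]. field. lra.
        + intros th _. apply cont_Rmult; [apply continuous_const|].
          apply cont_Rmult; [apply continuous_const|]. apply cont_exp, cont_Ropp.
          apply cont_Rmult; [apply continuous_const|apply continuous_id].
      - unfold minus, plus, opp; simpl. rewrite !Rmult_0_r, !Rmult_1_r, Ropp_0, exp_0. field. split; lra. }
    apply Rle_trans with (C0 / r * (1 - exp (- (y * H))) / y)%R.
    - refine (CInt_bound_fun _ _ 0 1 _ _ _ HI _).
      + intro th. apply cont_Cmult; [|apply continuous_const].
        apply (cont_f_pair f (fun _ => (sg * r)%R) (fun th => (th * H)%R)); [exact Hf|apply continuous_const|].
        apply cont_Rmult; [apply continuous_id|apply continuous_const].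
      + exact Rle_0_1.
      + intros th Hth. rewrite Cmod_mult.
        replace (Cmod (0, H)%R) with H.
        2: { destruct (Cmod_sq 0 H) as [Q1 Q2]. nra. }
        assert (Hm : (r <= Cmod (sg * r, th * H)%R)%R).
        { eapply Rle_trans; [|apply Cmod_ge_pair_l]. rewrite sg_abs. apply Rle_abs. }
        assert (HB := good_bound _ _ _ _ _ _ Hg (sg * r, th * H)%R).
        assert (Hin : low_region sg kappa (sg * r, th * H)%R).
        { unfold low_region; simpl Re; simpl Im. rewrite sg_mul. split; [lra|]. split; [nra|].
          replace ((sg * r) ^ 2)%R with ((sg * sg) * r ^ 2)%R by ring. rewrite sg_sq, Rmult_1_l.
          unfold H. rewrite <- (hyp_sq kappa r). fold H.
          replace ((th * H) ^ 2)%R with (th * th * H ^ 2)%R by ring.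
          rewrite <- (Rmult_1_l (H ^ 2)) at 2. apply Rmult_le_compat_r; nra. }
        specialize (HB Hin ltac:(lra)). simpl Im in HB.
        apply Rle_trans with (C0 * exp (- (y * (th * H))) * / Cmod (sg * r, th * H)%R * H)%R.
        { apply Rmult_le_compat_r; [lra|exact HB]. }
        replace (y * (th * H))%R with (y * H * th)%R by ring.
        assert (He := exp_pos (- (y * H * th))).
        assert (Hi : (/ Cmod (sg * r, th * H)%R <= / r)%R) by (apply Rinv_le_contravar; lra).
        replace (C0 / r * (H * exp (- (y * H * th))))%R with (C0 * exp (- (y * H * th)) * H * / r)%R by (unfold Rdiv; ring).
        replace (C0 * exp (- (y * H * th)) * / Cmod (sg * r, th * H)%R * H)%R with
          (C0 * exp (- (y * H * th)) * H * / Cmod (sg * r, th * H)%R)%R by ring.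
        apply Rmult_le_compat_l; [|exact Hi].
        apply Rmult_le_pos; [apply Rmult_le_pos|]; lra.
    - assert (He := exp_pos (- (y * H))).
      replace (C0 / (y * r))%R with (C0 / r * 1 / y)%R by (field; split; lra).
      apply Rmult_le_compat_r; [left; now apply Rinv_0_lt_compat|].
      apply Rmult_le_compat_l; [|lra]. apply Rmult_le_pos; [lra|left; apply Rinv_0_lt_compat; lra]. }
  replace (RtoC sg * arc_real f sg r - arc_imag f 0 (Rabs kappa) - arc_hyp f sg kappa (hyperbola_cut kappa r))
    with ((arc_hyp f sg kappa r - arc_hyp f sg kappa (hyperbola_cut kappa r)) +
     (- (arc_hyp f sg kappa r - RtoC sg * arc_real f sg r) - arc_imag f 0 (Rabs kappa))) by ring.
  rewrite E.
  replace (- (edge - arc_imag f 0 (Rabs kappa)) - arc_imag f 0 (Rabs kappa)) with (- edge) by ring.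
  eapply Rle_trans; [apply Cmod_triangle|]. rewrite Cmod_opp.
  replace (9 * C0 / (y * r))%R with (8 * C0 / (y * r) + C0 / (y * r))%R by (field; split; lra).
  apply Rplus_le_compat; [|exact Hedge]. apply HT.
  intros s Hs. unfold low_region; simpl Re; simpl Im. rewrite sg_mul, hyp_sq.
  split; [exact Hs|]. split; [apply hyp_ge0|].
  replace ((sg * s) ^ 2)%R with ((sg * sg) * s ^ 2)%R by ring. rewrite sg_sq. lra.
Qed.

(** The substitution b = [hyp] s, done through the chain rule on the open interval, because for
    kappa = 0 [hyp] has a corner at 0. *)
Lemma arc_imag_hyp h : Cont f -> (0 <= h)%R ->
  CInt (fun s => f (0, hyp kappa s)%R * (0, slope kappa s)%R) 0 h = arc_imag f (Rabs kappa) (hyp kappa h).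
Proof.
  intros Hf Hh.
  assert (Hc : Cont (fun s => f (0, hyp kappa s)%R * (0, slope kappa s)%R)).
  { intro s. apply cont_Cmult.
    - apply (cont_f_pair f (fun _ => 0%R) (hyp kappa)); [exact Hf|apply continuous_const|].
      apply (cont_hyp kappa (fun s => s)), continuous_id.
    - apply cont_pair; [apply continuous_const|]. apply (cont_slope kappa (fun s => s)), continuous_id. }
  assert (Hi := arc_imag_Cont f Hf).
  etransitivity; [apply (CInt_FTC (fun s => arc_imag f (Rabs kappa) (hyp kappa s)) _ 0 h Hh Hc)|].
  3: { rewrite hyp_0. unfold arc_imag at 2. rewrite CInt_point. ring. }
  - intros s _. apply (continuous_comp (hyp kappa) (fun b => arc_imag f (Rabs kappa) b)).
    + apply (cont_hyp kappa (fun s => s)), continuous_id.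
    + eapply is_Cderive_continuous. apply is_derive_CInt. exact Hi.
  - intros s Hs. eapply Cd_eq.
    + apply (Cd_comp (fun b => arc_imag f (Rabs kappa) b) (hyp kappa)).
      * apply is_derive_CInt. exact Hi.
      * apply is_derive_hyp. lra.
    + cbv beta. destruct (f (0, hyp kappa s)%R). apply injective_projections; simpl; ring.
Qed.

(** The map (s, th) to (sg th s, [hyp] s) sweeps the region above the hyperbola by horizontal
    segments. The side s = 0 collapses to i |kappa|, and the remaining edge lies at height at least
    r / 2, where [far_bound] suffices. This edge and the missing piece of the imaginary axis cost 4
    C0 / (y r) each; the constant 9 is rounded up to match [deform_low]. *)
Lemma deform_up r : good sg (up_region sg kappa) y C0 R0 f -> (2 * R0 <= r)%R ->
  (Cmod (arc_imag f (Rabs kappa) r - arc_hyp f sg kappa (hyperbola_cut kappa r)) <= 9 * C0 / (y * r))%R.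
Proof.
  intros Hg Hr. assert (Hk := Rabs_pos kappa). assert (Hf := good_cont _ _ _ _ _ _ Hg).
  assert (Hrect := rectangle (quadrant sg) f (fun s th => (sg * th * s, hyp kappa s)%R)
    (fun s th => (sg * th, slope kappa s)%R) (fun s th => (sg * s, 0)%R) (fun s th => (sg, 0)%R)
    Hf (good_holo _ _ _ _ _ _ Hg)).
  destruct (hyperbola_cut_facts kappa r ltac:(lra) ltac:(lra)) as [[H1 H2] [H3 H4]].
  assert (Hpos : (0 < hyperbola_cut kappa r)%R).
  { apply sqrt_lt_R0. assert (Rabs kappa ^ 2 = kappa ^ 2)%R by apply pow2_abs. nra. }
  set (h := hyperbola_cut kappa r) in *.
  assert (E : CInt (fun s => f (sg * 1 * s, hyp kappa s)%R * (sg * 1, slope kappa s)%R) 0 h -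
      CInt (fun s => f (sg * 0 * s, hyp kappa s)%R * (sg * 0, slope kappa s)%R) 0 h =
    CInt (fun th => f (sg * th * h, hyp kappa h)%R * (sg * h, 0)%R) 0 1 -
      CInt (fun th => f (sg * th * 0, hyp kappa 0)%R * (sg * 0, 0)%R) 0 1).
  { apply Hrect.
    - intros T a b p Ha Hb. apply cont_pair; [|now apply cont_hyp].
      apply cont_Rmult; [|exact Ha]. apply cont_Rmult; [apply continuous_const|exact Hb].
    - intros T a b p Ha Hb. apply cont_pair; [|now apply cont_slope].
      apply cont_Rmult; [apply continuous_const|exact Hb].
    - intros T a b p Ha Hb. apply cont_pair; [|apply continuous_const].
      apply cont_Rmult; [apply continuous_const|exact Ha].
    - intros T a b p Ha Hb. apply continuous_const.
    - intros s th Hs Hth. apply quadrant_pair.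
      replace (sg * (sg * th * s))%R with ((sg * sg) * (th * s))%R by ring. rewrite sg_sq.
      split; [nra|now apply hyp_pos].
    - intros s th Hs Hth. apply Cd_pair; [apply Rd_scal_id|now apply is_derive_hyp].
    - intros s th Hs Hth. apply Cd_pair; [|apply Rd_const].
      apply (is_derive_ext (fun q => sg * s * q)%R); [intro q; change (sg * s * q = sg * q * s)%R; ring|apply Rd_scal_id].
    - intros s th Hs Hth. apply Cd_pair; [apply Rd_scal_id|apply Rd_const].
    - intros s th Hs Hth. apply Cd_pair; [apply Rd_scal_id|apply Rd_const].
    - exact Hpos. }
  clear Hrect.
  replace (CInt (fun s => f (sg * 1 * s, hyp kappa s)%R * (sg * 1, slope kappa s)%R) 0 h)
    with (arc_hyp f sg kappa h) in E.
  2: { unfold arc_hyp. apply CInt_ext. intros s _. now rewrite !Rmult_1_r. }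
  replace (CInt (fun s => f (sg * 0 * s, hyp kappa s)%R * (sg * 0, slope kappa s)%R) 0 h)
    with (arc_imag f (Rabs kappa) (hyp kappa h)) in E.
  2: { rewrite <- arc_imag_hyp by (exact Hf || lra). apply CInt_ext. intros s _.
       now rewrite !Rmult_0_r, !Rmult_0_l. }
  replace (CInt (fun th => f (sg * th * 0, hyp kappa 0)%R * (sg * 0, 0)%R) 0 1) with (RtoC 0) in E.
  2: { rewrite (CInt_ext _ (fun _ => 0 * 0)).
       - rewrite CInt_scal by (intro; apply continuous_const). ring.
       - intros th _. rewrite !Rmult_0_r. change (0%R, 0%R) with (RtoC 0). ring. }
  set (edge := CInt (fun th => f (sg * th * h, hyp kappa h)%R * (sg * h, 0)%R) 0 1) in *.
  assert (Hyr : (0 < y * r)%R) by (apply Rmult_lt_0_compat; lra).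
  assert (Hq : (0 <= 4 * C0 / (y * r * r))%R).
  { apply Rmult_le_pos; [lra|]. left. apply Rinv_0_lt_compat. apply Rmult_lt_0_compat; lra. }
  assert (Hedge : (Cmod edge <= 4 * C0 / (y * r))%R).
  { apply Rle_trans with ((1 - 0) * (4 * C0 / (y * r * r) * r))%R.
    - apply CInt_bound; [|exact Rle_0_1|].
      + intro th. apply cont_Cmult; [|apply continuous_const].
        apply (cont_f_pair f (fun th => (sg * th * h)%R) (fun _ => hyp kappa h)); [exact Hf| |apply continuous_const].
        apply cont_Rmult; [apply cont_sgs|apply continuous_const].
      + intros th Hth. rewrite Cmod_mult. apply Rmult_le_compat; try apply Cmod_ge_0.
        * apply (far_bound (up_region sg kappa)); [exact Hg| |exact Hr|exact H3].
          unfold up_region; simpl Re; simpl Im. rewrite hyp_sq.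
          replace (sg * (sg * th * h))%R with ((sg * sg) * (th * h))%R by ring.
          replace ((sg * th * h) ^ 2)%R with ((sg * sg) * (th * th * h ^ 2))%R by ring. rewrite sg_sq.
          split; [nra|]. split; [apply hyp_ge0|].
          apply Rplus_le_compat_l. rewrite Rmult_1_l. rewrite <- (Rmult_1_l (h ^ 2)) at 2.
          apply Rmult_le_compat_r; nra.
        * change (sg * h, 0)%R with (RtoC (sg * h)). rewrite Cmod_R, sg_abs, Rabs_pos_eq; lra.
    - right. field. split; lra. }
  assert (Htail : (Cmod (arc_imag f (Rabs kappa) r - arc_imag f (Rabs kappa) (hyp kappa h)) <= 4 * C0 / (y * r))%R).
  { assert (Hc := arc_imag_Cont f Hf).
    assert (E' : arc_imag f (Rabs kappa) (hyp kappa h) + CInt (fun s => f (0, s)%R * Ci) (hyp kappa h) r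
      = arc_imag f (Rabs kappa) r) by exact (CInt_Chasles _ (Rabs kappa) (hyp kappa h) r Hc).
    rewrite <- E'.
    match goal with |- (Cmod (?a + ?b - ?a) <= _)%R => replace (a + b - a) with b by ring end.
    apply Rle_trans with ((r - hyp kappa h) * (4 * C0 / (y * r * r)))%R.
    - apply CInt_bound; [exact Hc|exact H4|]. intros s Hs. rewrite Cmod_mult, Cmod_Ci, Rmult_1_r.
      apply (far_bound (up_region sg kappa)); [exact Hg| |exact Hr|simpl; lra].
      unfold up_region; simpl Re; simpl Im. rewrite Rmult_0_r.
      assert (Hks := hyp_ge_l kappa h).
      split; [lra|]. split; [lra|].
      assert (Rabs kappa ^ 2 = kappa ^ 2)%R by apply pow2_abs. nra.
    - replace (4 * C0 / (y * r))%R with (r * (4 * C0 / (y * r * r)))%R by (field; split; lra).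
      apply Rmult_le_compat_r; lra. }
  replace (arc_imag f (Rabs kappa) r - arc_hyp f sg kappa h) with
    ((arc_imag f (Rabs kappa) r - arc_imag f (Rabs kappa) (hyp kappa h)) -
     (arc_hyp f sg kappa h - arc_imag f (Rabs kappa) (hyp kappa h))) by ring.
  rewrite E. replace (edge - 0) with edge by ring.
  eapply Rle_trans; [apply Cmod_triangle|]. rewrite Cmod_opp.
  assert (Hz : (0 <= C0 / (y * r))%R).
  { apply Rmult_le_pos; [lra|]. left. now apply Rinv_0_lt_compat. }
  replace (9 * C0 / (y * r))%R with (4 * C0 / (y * r) + 4 * C0 / (y * r) + C0 / (y * r))%R by (field; split; lra).
  lra.
Qed.
End Deform.

(** * The root nu and the two parts of the boundary integrand *)

(* For sg = 1 (resp. -1) the square root of z in the closed first (resp. second)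
   quadrant when sg * Im z >= 0; globally continuous in z. *)
Definition rt (sg : R) (z : C) : C :=
  (sg * sqrt ((Cmod z + Re z) / 2), sqrt ((Cmod z - Re z) / 2))%R.

Lemma rt_radicands z : (0 <= (Cmod z + Re z) / 2)%R /\ (0 <= (Cmod z - Re z) / 2)%R.
Proof.
  assert (H := Re_le_Cmod z). assert (H1 := Rle_abs (Re z)). assert (H2 := Rle_abs (- Re z)).
  rewrite Rabs_Ropp in H2. split; lra.
Qed.
Lemma Cmod_sqE z : (Cmod z ^ 2 = Re z ^ 2 + Im z ^ 2)%R.
Proof. destruct z as [a b]. apply (Cmod_sq a b). Qed.

Lemma rt_sq sg z : (sg = 1 \/ sg = -1)%R -> (0 <= sg * Im z)%R -> rt sg z * rt sg z = z.
Proof.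
  intros Hsg Hi. destruct (rt_radicands z) as [H1 H2].
  assert (E1 := sqrt_sqrt _ H1). assert (E2 := sqrt_sqrt _ H2).
  assert (E3 : (sqrt ((Cmod z + Re z) / 2) * sqrt ((Cmod z - Re z) / 2) = sg * Im z / 2)%R).
  { rewrite <- sqrt_mult by assumption.
    replace ((Cmod z + Re z) / 2 * ((Cmod z - Re z) / 2))%R with ((sg * Im z / 2) ^ 2)%R.
    - apply sqrt_pow2. lra.
    - assert (E := Cmod_sqE z). destruct Hsg as [-> | ->]; nra. }
  unfold rt. set (a := sqrt ((Cmod z + Re z) / 2)) in *. set (b := sqrt ((Cmod z - Re z) / 2)) in *.
  destruct z as [x y]. unfold Cmult; simpl fst; simpl snd. simpl Re in *; simpl Im in *.
  assert (Hs : (sg * sg = 1)%R) by (destruct Hsg as [-> | ->]; ring).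
  f_equal.
  - replace (sg * a * (sg * a) - b * b)%R with ((sg * sg) * (a * a) - b * b)%R by ring.
    rewrite Hs, E1, E2. field.
  - replace (sg * a * b + b * (sg * a))%R with (2 * sg * (a * b))%R by ring. rewrite E3.
    replace (2 * sg * (sg * y / 2))%R with ((sg * sg) * y)%R by field. rewrite Hs. ring.
Qed.
Lemma rt_Im_ge0 sg z : (0 <= Im (rt sg z))%R.
Proof. apply sqrt_pos. Qed.
Lemma rt_Im_pos sg z : Im z <> 0%R -> (0 < Im (rt sg z))%R.
Proof.
  intro H. apply sqrt_lt_R0. assert (E := Cmod_sqE z). assert (H0 := Cmod_ge_0 z).
  assert (0 < Im z ^ 2)%R by (apply pow2_gt_0; exact H). nra.
Qed.
Lemma rt_Cont sg : Cont (rt sg).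
Proof.
  intro z.
  assert (Hm : continuous (fun z : C => Cmod z) z) by (apply (cont_Cmod (fun z => z)), continuous_id).
  assert (Hr : continuous (fun z : C => Re z) z) by (apply (cont_Re (fun z => z)), continuous_id).
  apply cont_pair.
  - apply cont_Rmult; [apply continuous_const|]. apply cont_sqrt.
    apply cont_Rmult; [|apply continuous_const]. apply cont_Rplus; [exact Hm|exact Hr].
  - apply cont_sqrt. apply cont_Rmult; [|apply continuous_const]. apply cont_Rminus; [exact Hm|exact Hr].
Qed.

Lemma half_angle (m q : R) : (0 <= m)%R -> (-1 <= q <= 1)%R ->
  (sqrt m * cos (acos q / 2) = sqrt ((m + m * q) / 2))%R /\
  (sqrt m * sin (acos q / 2) = sqrt ((m - m * q) / 2))%R.
Proof.
  intros Hm Hq. assert (HB := acos_bound q). assert (HP := PI_RGT_0).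
  assert (HC := cos_acos q Hq). set (al := acos q) in *.
  assert (Hc : (0 <= cos (al / 2))%R) by (apply cos_ge_0; lra).
  assert (Hs : (0 <= sin (al / 2))%R) by (apply sin_ge_0; lra).
  assert (H2 := cos_2a_cos (al / 2)). assert (H3 := cos_2a_sin (al / 2)).
  replace (2 * (al / 2))%R with al in H2, H3 by field. rewrite HC in H2, H3.
  assert (Hsm := sqrt_sqrt m Hm). assert (Hsp := sqrt_pos m).
  split; symmetry; apply sqrt_lem_1.
  - nra.
  - now apply Rmult_le_pos.
  - replace (sqrt m * cos (al / 2) * (sqrt m * cos (al / 2)))%R with
      ((sqrt m * sqrt m) * (cos (al / 2) * cos (al / 2)))%R by ring. rewrite Hsm. nra.
  - nra.
  - now apply Rmult_le_pos.
  - replace (sqrt m * sin (al / 2) * (sqrt m * sin (al / 2)))%R with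
      ((sqrt m * sqrt m) * (sin (al / 2) * sin (al / 2)))%R by ring. rewrite Hsm. nra.
Qed.

Lemma ratio_bounds z : (0 < Cmod z)%R -> (-1 <= Re z / Cmod z <= 1)%R.
Proof.
  intro H. destruct (rt_radicands z) as [H1 H2]. split.
  - apply Rle_div_r; lra.
  - apply Rle_div_l; lra.
Qed.

Lemma sqrt_star_0 eps sg : sqrt_star eps 0 = rt sg 0.
Proof.
  unfold sqrt_star, rt. rewrite Cmod_0, sqrt_0. simpl Re.
  replace ((0 + 0) / 2)%R with 0%R by field. replace ((0 - 0) / 2)%R with 0%R by field.
  rewrite sqrt_0. apply injective_projections; simpl; ring.
Qed.

(** Here the argument lies in [pi/2, pi]. Since eps < 1 < pi/2 the branch leaves it unchanged, and
    halving lands in the first quadrant. *)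
Lemma sqrt_star_left eps z : (0 < eps < 1)%R -> (0 <= Im z)%R -> (Re z <= 0)%R ->
  sqrt_star eps z = rt 1 z.
Proof.
  intros He Hi Hr. destruct (Req_dec (Cmod z) 0) as [H0|H0].
  { apply Cmod_eq_0 in H0. subst z. apply sqrt_star_0. }
  assert (Hm : (0 < Cmod z)%R) by (assert (H := Cmod_ge_0 z); lra).
  assert (Hq := ratio_bounds z Hm).
  assert (Hq0 : (Re z / Cmod z <= 0)%R) by (apply Rle_div_l; lra).
  destruct (half_angle (Cmod z) (Re z / Cmod z) ltac:(lra) Hq) as [E1 E2].
  assert (HPI := PI2_1).
  assert (Hal : (PI / 2 <= acos (Re z / Cmod z))%R).
  { apply Rnot_lt_le. intro Hlt. assert (HB := acos_bound (Re z / Cmod z)).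
    assert (Hc := cos_gt_0 (acos (Re z / Cmod z)) ltac:(lra) Hlt). rewrite cos_acos in Hc by exact Hq. lra. }
  unfold sqrt_star, arg_from, arg0. destruct (Rle_dec 0 (Im z)) as [_|]; [|lra].
  destruct (Rlt_dec (acos (Re z / Cmod z)) eps) as [|_]; [lra|].
  rewrite Cexp_imag. unfold rt, RtoC, Cmult; simpl fst; simpl snd.
  replace (Cmod z * (Re z / Cmod z))%R with (Re z) in E1, E2 by (field; exact H0).
  rewrite <- E1, <- E2. f_equal; ring.
Qed.

(** Arguments in the closed lower half plane lie in [pi, 2 pi], provided that the positive real axis
    is assigned 2 pi and not 0. This is the effect of a positive eps, and it makes the root
    continuous up to that axis with values in the second quadrant. *)
Lemma sqrt_star_right eps z : (0 < eps < 1)%R -> (Im z <= 0)%R ->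
  sqrt_star eps z = rt (-1) z.
Proof.
  intros He Hi. destruct (Req_dec (Cmod z) 0) as [H0|H0].
  { apply Cmod_eq_0 in H0. subst z. apply sqrt_star_0. }
  assert (Hm : (0 < Cmod z)%R) by (assert (H := Cmod_ge_0 z); lra).
  assert (Hq := ratio_bounds z Hm).
  destruct (half_angle (Cmod z) (Re z / Cmod z) ltac:(lra) Hq) as [E1 E2].
  replace (Cmod z * (Re z / Cmod z))%R with (Re z) in E1, E2 by (field; exact H0).
  assert (HPI := PI2_1). assert (HB := acos_bound (Re z / Cmod z)).
  assert (Harg : arg_from eps z = (2 * PI - acos (Re z / Cmod z))%R).
  { unfold arg_from, arg0. destruct (Rle_dec 0 (Im z)) as [Hi0|Hi0].
    - assert (Hz : (Im z = 0)%R) by lra.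
      assert (Es := Cmod_sqE z). rewrite Hz in Es.
      destruct (Rle_dec 0 (Re z)) as [Hx|Hx].
      + assert (Em : Cmod z = Re z) by nra.
        assert (Ea : acos (Re z / Cmod z) = 0%R).
        { rewrite <- Em. unfold Rdiv. rewrite Rinv_r by exact H0. apply acos_1. }
        rewrite Ea. destruct (Rlt_dec 0 eps); lra.
      + assert (Em : Cmod z = (- Re z)%R) by nra.
        assert (Ea : acos (Re z / Cmod z) = PI).
        { replace (Re z / Cmod z)%R with (- (1))%R by (rewrite Em; field; lra).
          rewrite acos_opp, acos_1. ring. }
        rewrite Ea. destruct (Rlt_dec PI eps); lra.
    - destruct (Rlt_dec (2 * PI - acos (Re z / Cmod z)) eps); lra. }
  unfold sqrt_star. rewrite Harg.
  replace ((2 * PI - acos (Re z / Cmod z)) / 2)%R with (PI - acos (Re z / Cmod z) / 2)%R by field.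
  rewrite Cexp_imag, Rtrigo_facts.cos_pi_minus, Rtrigo_facts.sin_pi_minus.
  unfold rt, RtoC, Cmult; simpl fst; simpl snd.
  rewrite <- E1, <- E2. f_equal; ring.
Qed.

(** The radicand has imaginary part - 2 Re(lambda) Im(lambda), of sign - sg on the quadrant [sg];
    hence the root is taken in the opposite quadrant. *)
Definition nq (sg kappa : R) (lambda : C) : C := rt (- sg) (- lambda ^ 2 - RtoC (2 * kappa ^ 2)).

Lemma radicand_parts kappa lambda :
  Re (- lambda ^ 2 - RtoC (2 * kappa ^ 2)) = (Im lambda ^ 2 - Re lambda ^ 2 - 2 * kappa ^ 2)%R /\
  Im (- lambda ^ 2 - RtoC (2 * kappa ^ 2)) = (- 2 * Re lambda * Im lambda)%R.
Proof. destruct lambda as [a b]. unfold Re, Im; simpl. split; ring. Qed.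

Lemma nu_left eps kappa lambda : (0 < eps < 1)%R -> low_region (-1) kappa lambda ->
  nu eps kappa lambda = nq (-1) kappa lambda.
Proof.
  intros He (H1 & H2 & H3). destruct (radicand_parts kappa lambda) as [ER EI].
  unfold nu, nq. replace (- -1)%R with 1%R by ring.
  apply sqrt_star_left; [exact He| |]; rewrite ?ER, ?EI; nra.
Qed.
Lemma nu_right eps kappa lambda : (0 < eps < 1)%R -> up_region 1 kappa lambda ->
  nu eps kappa lambda = nq 1 kappa lambda.
Proof.
  intros He (H1 & H2 & H3). destruct (radicand_parts kappa lambda) as [ER EI].
  unfold nu, nq. apply sqrt_star_right; [exact He|]. rewrite EI. nra.
Qed.

Definition closed_quadrant (sg : R) (z : C) : Prop := (0 <= sg * Re z)%R /\ (0 <= Im z)%R.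

Lemma nq_sq sg kappa lambda : (sg = 1 \/ sg = -1)%R -> closed_quadrant sg lambda ->
  nq sg kappa lambda * nq sg kappa lambda = - lambda ^ 2 - RtoC (2 * kappa ^ 2).
Proof.
  intros Hsg [H1 H2]. destruct (radicand_parts kappa lambda) as [ER EI].
  apply rt_sq; [destruct Hsg as [-> | ->]; [right|left]; ring|]. rewrite EI.
  replace (- sg * (- 2 * Re lambda * Im lambda))%R with (2 * (sg * Re lambda * Im lambda))%R by ring.
  apply Rmult_le_pos; [lra|]. now apply Rmult_le_pos.
Qed.
Lemma nq_Cont sg kappa : Cont (nq sg kappa).
Proof.
  intro z. apply (continuous_comp (fun z => - z ^ 2 - RtoC (2 * kappa ^ 2)) (rt (- sg))); [|apply rt_Cont].
  apply cont_Cminus; [|apply continuous_const]. apply cont_Copp, cont_Cpow, continuous_id.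
Qed.
Lemma nq_neq sg kappa lambda : (sg = 1 \/ sg = -1)%R -> closed_quadrant sg lambda ->
  lambda ^ 2 <> - RtoC (kappa ^ 2) -> nq sg kappa lambda - lambda <> 0.
Proof.
  intros Hsg Hq Hne E. apply Hne. assert (E1 := nq_sq sg kappa lambda Hsg Hq).
  replace (nq sg kappa lambda) with lambda in E1.
  2: { replace (nq sg kappa lambda) with (nq sg kappa lambda - lambda + lambda) by ring. rewrite E. ring. }
  assert (E2 : 2 * lambda ^ 2 = 2 * (- RtoC (kappa ^ 2))).
  { replace (2 * lambda ^ 2) with (lambda * lambda + lambda ^ 2) by ring. rewrite E1.
    replace (RtoC (2 * kappa ^ 2)) with (2 * RtoC (kappa ^ 2)) by (rewrite <- RtoC_mult; reflexivity). ring. }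
  replace (lambda ^ 2) with (/ 2 * (2 * lambda ^ 2)) by field.
  rewrite E2. field.
Qed.
Lemma quadrant_closed sg z : quadrant sg z -> closed_quadrant sg z.
Proof. intros [H1 H2]. split; lra. Qed.
Lemma quadrant_neq sg kappa z : quadrant sg z -> z ^ 2 <> - RtoC (kappa ^ 2).
Proof.
  intros [H1 H2] E. apply (f_equal Im) in E. destruct z as [a b]. unfold Re, Im in *; simpl in *.
  assert (Eab : (2 * (a * b) = 0)%R) by (ring_simplify in E; lra).
  assert (a <> 0)%R by (intro; subst a; lra).
  assert (a * b <> 0)%R by (apply Rmult_integral_contrapositive; split; lra). lra.
Qed.

(** A regular form of (2 lambda L(nu) - (lambda + nu) L(lambda)) / (nu - lambda): subtracting 2
    lambda L(lambda) completes a difference quotient, and what is left of the numerator is - (nu -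
    lambda) L(lambda). *)
Definition Aint (f : R -> C) (sg kappa y : R) (lambda : C) : C :=
  Cexp (Ci * lambda * RtoC y) * (2 * lambda * lap_quot f lambda (nq sg kappa lambda) - lap f lambda).
Definition Bint (w : nat -> R -> R -> C) (kappa t y : R) (lambda : C) : C :=
  Cexp (Ci * lambda * RtoC y) * bhat w kappa t lambda.

Lemma Cmod_Cexp_y lambda y : Cmod (Cexp (Ci * lambda * RtoC y)) = exp (- (y * Im lambda)).
Proof. rewrite Cmod_Cexp. f_equal. unfold Re, Im; simpl. ring. Qed.

Lemma holo_Cexp_y (S : C -> Prop) y : holo S (fun lambda => Cexp (Ci * lambda * RtoC y)).
Proof.
  apply (holo_comp S (fun _ => True) Cexp (fun l => Ci * l * RtoC y)); [intros; exact I|apply holo_Cexp|].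
  apply holo_mult; [|apply holo_const]. apply holo_mult; [apply holo_const|apply holo_id].
Qed.

Section AB.
Context (f g : R -> C) (K kappa y : R).
Context (Hf : Cont f) (Hg : Cont g) (HK : dom4 K f) (HKg : dom4 K g).
Context (Hd : forall s, (0 < s)%R -> is_Cderive f s (g s)).
Context (sg : R) (Hsg : (sg = 1 \/ sg = -1)%R).

Lemma Aint_quot lambda : closed_quadrant sg lambda -> nq sg kappa lambda - lambda <> 0 ->
  Aint f sg kappa y lambda = Cexp (Ci * lambda * RtoC y) *
    ((2 * lambda * lap f (nq sg kappa lambda) - (lambda + nq sg kappa lambda) * lap f lambda)
      / (nq sg kappa lambda - lambda)).
Proof.
  intros [H1 H2] Hne. unfold Aint. f_equal.
  set (n := nq sg kappa lambda) in *.
  assert (E := lap_quotE f K Hf HK lambda n H2 (rt_Im_ge0 _ _)).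
  assert (EQ : lap_quot f lambda n = (lap f n - lap f lambda) / (n - lambda)).
  { rewrite E. field. exact Hne. }
  rewrite EQ. field. exact Hne.
Qed.

Lemma Aint_Cont : Cont (Aint f sg kappa y).
Proof.
  intro z. apply cont_Cmult.
  - apply cont_Cexp, cont_Cmult; [|apply continuous_const].
    apply cont_Cmult; [apply continuous_const|apply continuous_id].
  - apply cont_Cminus; [|apply (lap_cont f K Hf HK)].
    apply cont_Cmult; [apply cont_Cmult; [apply continuous_const|apply continuous_id]|].
    apply (continuous_comp (fun z => (z, nq sg kappa z)) (fun p : C * C => lap_quot f (fst p) (snd p))).
    + apply continuous_pair; [apply continuous_id|apply nq_Cont].
    + apply (lap_quot_cont f K Hf HK).
Qed.

Lemma holo_nq : holo (quadrant sg) (nq sg kappa).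
Proof.
  apply (holo_sqrt _ _ (fun z => - z ^ 2 - RtoC (2 * kappa ^ 2))).
  - intros z _. apply nq_Cont.
  - intros z Hz. apply nq_sq; [exact Hsg|now apply quadrant_closed].
  - intros z [H1 H2]. apply rt_Im_pos. destruct (radicand_parts kappa z) as [_ EI]. rewrite EI.
    apply Rmult_integral_contrapositive. split; [|lra].
    apply Rmult_integral_contrapositive. split; [lra|]. intro E. rewrite E in H1. lra.
  - apply holo_minus; [|apply holo_const]. apply holo_opp, holo_pow, holo_id.
Qed.

Lemma Aint_holo : holo (quadrant sg) (Aint f sg kappa y).
Proof.
  apply (holo_ext _ (fun lambda => Cexp (Ci * lambda * RtoC y) *
    ((2 * lambda * lap f (nq sg kappa lambda) - (lambda + nq sg kappa lambda) * lap f lambda)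
      / (nq sg kappa lambda - lambda)))).
  - intros z Hz. symmetry. apply Aint_quot; [now apply quadrant_closed|].
    apply nq_neq; [exact Hsg|now apply quadrant_closed|now apply (quadrant_neq sg)].
  - intros z _. apply Aint_Cont.
  - assert (HL : holo (quadrant sg) (fun z => lap f (nq sg kappa z))).
    { apply (holo_comp _ (fun z => (0 <= Im z)%R) (lap f)); [intros; apply rt_Im_ge0|now apply (holo_lap f K)|apply holo_nq]. }
    assert (HL2 : holo (quadrant sg) (fun z => lap f z)).
    { apply (holo_comp _ (fun z => (0 <= Im z)%R) (lap f) (fun z => z)); [intros z [_ Hz]; lra|now apply (holo_lap f K)|apply holo_id]. }
    apply holo_mult; [apply holo_Cexp_y|]. apply holo_div.
    + intros z Hz. apply nq_neq; [exact Hsg|now apply quadrant_closed|now apply (quadrant_neq sg)].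
    + apply holo_minus; apply holo_mult; [apply holo_mult; [apply holo_const|apply holo_id]|exact HL
        |apply holo_plus; [apply holo_id|apply holo_nq]|exact HL2].
    + apply holo_minus; [apply holo_nq|apply holo_id].
Qed.

(** For |z| >= 2 |kappa| + 1 one has kappa^2 <= |z|^2 / 4, so nu and nu - z are comparable to z.
    With [lap] bounded by 3 K over the modulus of its argument, the numerator is at most 12 K + 9 K;
    division by |nu - z| >= |z| / 2 gives 42 K / |z|. *)
Lemma Aint_good (reg : C -> Prop) : (forall z, reg z -> closed_quadrant sg z) ->
  good sg reg y (42 * K) (2 * Rabs kappa + 1) (Aint f sg kappa y).
Proof.
  intro Hreg. constructor; [apply Aint_Cont|apply Aint_holo|].
  intros z Hz HR. assert (Hq := Hreg z Hz). destruct Hq as [Hq1 Hq2].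
  assert (HK0 := dom4_K0 _ _ HK).
  assert (Hka := Rabs_pos kappa). assert (Hk2 : (Rabs kappa ^ 2 = kappa ^ 2)%R) by apply pow2_abs.
  set (L := Cmod z) in *.
  assert (Hk4 : (kappa ^ 2 <= L ^ 2 / 4)%R) by nra.
  assert (E := nq_sq sg kappa z Hsg (Hreg z Hz)).
  set (n := nq sg kappa z) in *.
  assert (EC : RtoC (2 * kappa ^ 2) = 2 * RtoC (kappa ^ 2)) by (rewrite <- RtoC_mult; reflexivity).
  assert (Hmk : Cmod (RtoC (kappa ^ 2)) = (kappa ^ 2)%R) by (rewrite Cmod_R; apply Rabs_pos_eq; nra).
  assert (Hm2 : Cmod 2 = 2%R) by (rewrite Cmod_R; apply Rabs_pos_eq; lra).
  assert (Hz2 : Cmod (z ^ 2) = (L ^ 2)%R).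
  { replace (z ^ 2) with (z * z) by ring. rewrite Cmod_mult. fold L. ring. }
  assert (Hn2 : (Cmod n * Cmod n = Cmod (z ^ 2 + RtoC (2 * kappa ^ 2)))%R).
  { rewrite <- Cmod_mult, E. replace (- z ^ 2 - RtoC (2 * kappa ^ 2)) with (- (z ^ 2 + RtoC (2 * kappa ^ 2))) by ring.
    apply Cmod_opp. }
  assert (Hup : (Cmod n * Cmod n <= L ^ 2 + 2 * kappa ^ 2)%R).
  { rewrite Hn2. eapply Rle_trans; [apply Cmod_triangle|]. rewrite Hz2, EC, Cmod_mult, Hmk, Hm2. lra. }
  assert (Hlo : (L ^ 2 - 2 * kappa ^ 2 <= Cmod n * Cmod n)%R).
  { rewrite Hn2, <- Hz2.
    replace (z ^ 2) with ((z ^ 2 + RtoC (2 * kappa ^ 2)) + - RtoC (2 * kappa ^ 2)) at 1 by ring.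
    assert (H := Cmod_triangle (z ^ 2 + RtoC (2 * kappa ^ 2)) (- RtoC (2 * kappa ^ 2))).
    rewrite Cmod_opp, EC, Cmod_mult, Hmk, Hm2 in H. rewrite EC. lra. }
  assert (Hn0 := Cmod_ge_0 n).
  assert (Ha1 : (L / 2 <= Cmod n)%R) by nra.
  assert (Ha2 : (Cmod n <= 2 * L)%R) by nra.
  (* A lower bound for |nu - z| comes from the explicit product (nu - z)(nu + z) = - 2 (z^2 +
     kappa^2) and the upper bound 3 |z| for the other factor. *)
  assert (Hprod : (2 * (L ^ 2 - kappa ^ 2) <= Cmod (n - z) * Cmod (n + z))%R).
  { rewrite <- Cmod_mult. replace ((n - z) * (n + z)) with (- (2 * (z ^ 2 + RtoC (kappa ^ 2)))).
    - rewrite Cmod_opp, Cmod_mult, Hm2. apply Rmult_le_compat_l; [lra|].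
      assert (H := Cmod_triangle (z ^ 2 + RtoC (kappa ^ 2)) (- RtoC (kappa ^ 2))).
      replace (z ^ 2 + RtoC (kappa ^ 2) + - RtoC (kappa ^ 2)) with (z ^ 2) in H by ring.
      rewrite Cmod_opp, Hmk, Hz2 in H. lra.
    - replace ((n - z) * (n + z)) with (n * n - z ^ 2) by ring. rewrite E, EC. ring. }
  assert (Hsum : (Cmod (n + z) <= 3 * L)%R).
  { eapply Rle_trans; [apply Cmod_triangle|]. fold L. lra. }
  assert (Hdm := Cmod_ge_0 (n - z)). assert (Hsm := Cmod_ge_0 (n + z)).
  assert (HL1 : (1 <= L)%R) by lra.
  assert (Hdiff : (L / 2 <= Cmod (n - z))%R).
  { apply Rnot_lt_le. intro Hlt.
    assert (Cmod (n - z) * Cmod (n + z) <= L / 2 * (3 * L))%R by (apply Rmult_le_compat; lra). nra. }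
  assert (Hne : n - z <> 0).
  { intro E0. rewrite E0, Cmod_0 in Hdiff. lra. }
  rewrite Aint_quot by (exact (Hreg z Hz) || exact Hne). fold n.
  rewrite Cmod_mult, Cmod_Cexp_y, (Cmod_div _ _ Hne).
  assert (Hd1 := lap_decay f g K K n Hf Hg HK HKg Hd (rt_Im_ge0 _ _)).
  assert (Hd2 := lap_decay f g K K z Hf Hg HK HKg Hd Hq2). fold L in Hd2.
  assert (Hl1 := Cmod_ge_0 (lap f n)). assert (Hl2 := Cmod_ge_0 (lap f z)).
  assert (Hnum : (Cmod (2 * z * lap f n - (z + n) * lap f z) <= 21 * K)%R).
  { eapply Rle_trans; [apply Cmod_triangle|]. rewrite Cmod_opp, !Cmod_mult, Hm2. fold L.
    rewrite (Cplus_comm z n).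
    assert (2 * L * Cmod (lap f n) <= 12 * K)%R by nra.
    assert (Cmod (n + z) * Cmod (lap f z) <= 9 * K)%R by nra. lra. }
  replace (42 * K * exp (- (y * Im z)) * / L)%R with (exp (- (y * Im z)) * (21 * K / (L / 2)))%R by (field; lra).
  apply Rmult_le_compat_l; [left; apply exp_pos|].
  apply Rmult_le_compat; [apply Cmod_ge_0| |exact Hnum|apply Rinv_le_contravar; lra].
  left. apply Rinv_0_lt_compat. lra.
Qed.
End AB.

Section BGood.
Context (kappa tmax K t y : R) (w wt : nat -> R -> R -> C).
Context (HW : halfline_solution kappa tmax K w wt) (Ht : (0 < t < tmax)%R).

Lemma holo_omega (S : C -> Prop) : holo S (omega kappa).
Proof. apply (holo_pow S (fun z => RtoC (kappa ^ 2) + z ^ 2)), holo_plus; [apply holo_const|apply holo_pow, holo_id]. Qed.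

Lemma holo_bhat (S : C -> Prop) : holo S (bhat w kappa t).
Proof.
  assert (HT : forall k, (k <= 4)%nat -> holo S (fun z => ttr (w k 0%R) t (omega kappa z))).
  { intros k Hk. apply (holo_comp S (fun _ => True) (ttr (w k 0%R) t)); [intros; exact I| |apply holo_omega].
    apply holo_ttr; [lra|]. apply (hs_Cont_t kappa tmax K w wt HW); exact Hk. }
  assert (Hp : holo S (fun z => z ^ 2 + RtoC (2 * kappa ^ 2))).
  { apply holo_plus; [apply holo_pow, holo_id|apply holo_const]. }
  assert (Hi : holo S (fun z => Ci * z)) by (apply holo_mult; [apply holo_const|apply holo_id]).
  unfold bhat. apply (holo_mult S (fun _ => Ci)); [apply holo_const|].
  apply holo_minus; [apply holo_minus; [apply holo_plus|]|].
  - apply HT; lia.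
  - apply holo_mult; [exact Hi|apply HT; lia].
  - apply holo_mult; [exact Hp|apply HT; lia].
  - apply holo_mult; [apply holo_mult; [exact Hi|exact Hp]|apply HT; lia].
Qed.

(** For |z| = L >= 2 |kappa| + 1 one has |omega| >= L^4 / 2, so [ttr_decay] bounds each time
    transform by 2 c / L^4 with c = (2 + t) K. The polynomial coefficients sum to at most 6 L^3,
    whence 12 c / L. *)
Lemma Bint_good sg (reg : C -> Prop) : (forall z, reg z -> (0 <= Im (omega kappa z))%R) ->
  good sg reg y (12 * ((2 + t) * K)) (2 * Rabs kappa + 1) (Bint w kappa t y).
Proof.
  intro Hreg.
  assert (HH : forall S, holo S (Bint w kappa t y)).
  { intro S. apply holo_mult; [apply holo_Cexp_y|apply holo_bhat]. }
  constructor; [intro z; apply (HH (fun _ => True)); exact I|apply HH|].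
  intros z Hz HR. assert (Hom := Hreg z Hz).
  assert (HK0 : (0 <= K)%R) by (apply (dom4_K0 K (fun y => w 0%nat y 0%R)), (hs_dom4 kappa tmax K w wt HW); lia).
  assert (Hka := Rabs_pos kappa). assert (Hk2 : (Rabs kappa ^ 2 = kappa ^ 2)%R) by apply pow2_abs.
  set (L := Cmod z) in *.
  assert (Hk4 : (kappa ^ 2 <= L ^ 2 / 4)%R) by nra.
  assert (HL1 : (1 <= L)%R) by lra.
  assert (Hmk : Cmod (RtoC (kappa ^ 2)) = (kappa ^ 2)%R) by (rewrite Cmod_R; apply Rabs_pos_eq; nra).
  assert (Hm2 : Cmod 2 = 2%R) by (rewrite Cmod_R; apply Rabs_pos_eq; lra).
  assert (Hz2 : Cmod (z ^ 2) = (L ^ 2)%R).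
  { replace (z ^ 2) with (z * z) by ring. rewrite Cmod_mult. fold L. ring. }
  assert (EC : RtoC (2 * kappa ^ 2) = 2 * RtoC (kappa ^ 2)) by (rewrite <- RtoC_mult; reflexivity).
  assert (Hlo : (3 / 4 * L ^ 2 <= Cmod (RtoC (kappa ^ 2) + z ^ 2))%R).
  { assert (H := Cmod_triangle (RtoC (kappa ^ 2) + z ^ 2) (- RtoC (kappa ^ 2))).
    replace (RtoC (kappa ^ 2) + z ^ 2 + - RtoC (kappa ^ 2)) with (z ^ 2) in H by ring.
    rewrite Cmod_opp, Hmk, Hz2 in H. lra. }
  assert (Hw : (L ^ 4 / 2 <= Cmod (omega kappa z))%R).
  { unfold omega. replace ((RtoC (kappa ^ 2) + z ^ 2) ^ 2) with ((RtoC (kappa ^ 2) + z ^ 2) * (RtoC (kappa ^ 2) + z ^ 2)) by ring.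
    rewrite Cmod_mult. set (m := Cmod (RtoC (kappa ^ 2) + z ^ 2)) in *.
    apply Rle_trans with ((3 / 4 * L ^ 2) * (3 / 4 * L ^ 2))%R.
    - assert (0 <= L ^ 4)%R by (apply pow_le; lra). nra.
    - apply Rmult_le_compat; nra. }
  assert (Hup : (Cmod (z ^ 2 + RtoC (2 * kappa ^ 2)) <= 2 * L ^ 2)%R).
  { eapply Rle_trans; [apply Cmod_triangle|]. rewrite Hz2, EC, Cmod_mult, Hmk, Hm2. nra. }
  assert (Hc : (0 <= (2 + t) * K)%R).
  { apply Rmult_le_pos; [destruct Ht; lra|exact HK0]. }
  set (c := ((2 + t) * K)%R) in *.
  assert (HT : forall k, (k <= 3)%nat -> (Cmod (ttr (w k 0%R) t (omega kappa z)) <= 2 * c / L ^ 4)%R).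
  { intros k Hk.
    assert (Hdec := ttr_decay (w k 0%R) (wt k 0%R) t K (omega kappa z) ltac:(lra)
      (hs_Cont_t kappa tmax K w wt HW k 0%R ltac:(lia))
      (jcont2_r (wt k) 0%R (hs_tcont _ _ _ _ _ HW k Hk))).
    assert (E1 : forall v : R, (K * / (1 + 0) ^ 4 = K)%R).
    { intros _. replace ((1 + 0) ^ 4)%R with 1%R by ring. rewrite Rinv_1. ring. }
    assert (Hdec2 : (Cmod (omega kappa z) * Cmod (ttr (w k 0%R) t (omega kappa z)) <= c)%R).
    { apply Hdec.
      - intro s. rewrite <- (E1 0%R). apply (hs_bound _ _ _ _ _ HW); [lia|lra].
      - intro s. rewrite <- (E1 0%R). apply (hs_tbound _ _ _ _ _ HW); [lia|lra].
      - intros s Hs. apply (hs_dT _ _ _ _ _ HW); [lia|lra].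
      - exact Hom. }
    assert (HL4 : (0 < L ^ 4)%R) by (apply pow_lt; lra).
    assert (H0 := Cmod_ge_0 (ttr (w k 0%R) t (omega kappa z))).
    apply Rle_div_r; [exact HL4|]. nra. }
  unfold Bint. rewrite Cmod_mult, Cmod_Cexp_y.
  replace (12 * c * exp (- (y * Im z)) * / L)%R with (exp (- (y * Im z)) * (12 * c / L))%R by (unfold Rdiv; ring).
  apply Rmult_le_compat_l; [left; apply exp_pos|].
  unfold bhat. rewrite Cmod_mult, Cmod_Ci, Rmult_1_l.
  set (q := (2 * c / L ^ 4)%R) in *.
  assert (Hq0 : (0 <= q)%R).
  { apply Rmult_le_pos; [lra|]. left. apply Rinv_0_lt_compat, pow_lt. lra. }
  assert (H3 := HT 3%nat ltac:(lia)). assert (H2 := HT 2%nat ltac:(lia)).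
  assert (H1 := HT 1%nat ltac:(lia)). assert (H0 := HT 0%nat ltac:(lia)).
  set (T3 := ttr (w 3%nat 0%R) t (omega kappa z)) in *. set (T2 := ttr (w 2%nat 0%R) t (omega kappa z)) in *.
  set (T1 := ttr (w 1%nat 0%R) t (omega kappa z)) in *. set (T0 := ttr (w 0%nat 0%R) t (omega kappa z)) in *.
  set (p := z ^ 2 + RtoC (2 * kappa ^ 2)) in *.
  assert (HA : (Cmod (Ci * z * T2) <= L * q)%R).
  { rewrite !Cmod_mult, Cmod_Ci, Rmult_1_l. fold L. apply Rmult_le_compat_l; [lra|exact H2]. }
  assert (HB : (Cmod (p * T1) <= 2 * L ^ 2 * q)%R).
  { rewrite Cmod_mult. apply Rmult_le_compat; try apply Cmod_ge_0; assumption. }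
  assert (HC : (Cmod (Ci * z * p * T0) <= L * (2 * L ^ 2) * q)%R).
  { rewrite !Cmod_mult, Cmod_Ci, Rmult_1_l. fold L.
    apply Rmult_le_compat; [apply Rmult_le_pos; [lra|apply Cmod_ge_0]|apply Cmod_ge_0| |exact H0].
    apply Rmult_le_compat_l; [lra|exact Hup]. }
  apply Rle_trans with (q + L * q + 2 * L ^ 2 * q + L * (2 * L ^ 2) * q)%R.
  - unfold Cminus.
    eapply Rle_trans; [apply Cmod_triangle|]. rewrite Cmod_opp. apply Rplus_le_compat; [|exact HC].
    eapply Rle_trans; [apply Cmod_triangle|]. rewrite Cmod_opp. apply Rplus_le_compat; [|exact HB].
    eapply Rle_trans; [apply Cmod_triangle|]. apply Rplus_le_compat; [exact H3|exact HA].
  - replace (12 * c / L)%R with (6 * L ^ 3 * q)%R by (unfold q; field; lra).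
    replace (q + L * q + 2 * L ^ 2 * q + L * (2 * L ^ 2) * q)%R with ((1 + L + 2 * L ^ 2 + 2 * L ^ 3) * q)%R by ring.
    apply Rmult_le_compat_r; [exact Hq0|].
    assert (L <= L ^ 2)%R by nra. assert (L ^ 2 <= L ^ 3)%R by nra. lra.
Qed.
End BGood.

(** * The sign of Im omega and the splitting of the boundary integrand *)

Lemma Im_omega kappa z : Im (omega kappa z) = (4 * Re z * Im z * (kappa ^ 2 + Re z ^ 2 - Im z ^ 2))%R.
Proof. destruct z as [a b]. unfold omega, Re, Im; simpl. ring. Qed.
Lemma omega_low kappa z : low_region 1 kappa z -> (0 <= Im (omega kappa z))%R.
Proof.
  intros (H1 & H2 & H3). rewrite Im_omega. apply Rmult_le_pos; [|lra]. apply Rmult_le_pos; lra.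
Qed.
Lemma omega_up kappa z : up_region (-1) kappa z -> (0 <= Im (omega kappa z))%R.
Proof.
  intros (H1 & H2 & H3). rewrite Im_omega.
  replace (4 * Re z * Im z * (kappa ^ 2 + Re z ^ 2 - Im z ^ 2))%R with
    (4 * (-1 * Re z) * Im z * (Im z ^ 2 - (kappa ^ 2 + Re z ^ 2)))%R by ring.
  apply Rmult_le_pos; [|lra]. apply Rmult_le_pos; lra.
Qed.

(** The weights 2 lambda / (nu - lambda) and - (lambda + nu) / (nu - lambda) sum to - 1, and
    weighted with nu and lambda they sum to lambda. So the transforms of w_yyy and w_yy occur
    exactly as in - B(lambda). The explicit terms of [G] with [g0] and [g1] correct the coefficients
    of the two known traces. *)
Lemma integrand_split (kappa tmax K t x y eps sg : R) (w wt : nat -> R -> R -> C) (u0 g0 g1 : R -> R -> C)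
    (lambda : C) :
  halfline_solution kappa tmax K w wt -> (0 < t < tmax)%R -> (sg = 1 \/ sg = -1)%R ->
  (forall z, (0 <= Im z)%R -> half_space_transform u0 kappa (- z) = lap (fun s => w 0%nat s 0%R) z) ->
  (forall om, Cexp (Ci * om * RtoC t) * t_transform g0 kappa (- (Ci * om)) t = ttr (w 0%nat 0%R) t om) ->
  (forall om, Cexp (Ci * om * RtoC t) * t_transform g1 kappa (- (Ci * om)) t = ttr (w 1%nat 0%R) t om) ->
  closed_quadrant sg lambda -> nu eps kappa lambda = nq sg kappa lambda ->
  lambda ^ 2 <> - RtoC (kappa ^ 2) ->
  E kappa lambda x y t * G eps u0 g0 g1 kappa lambda t =
  Cexp (Ci * RtoC kappa * RtoC x) *
    (Aint (fun s => w 0%nat s t) sg kappa y lambda - Bint w kappa t y lambda).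
Proof.
  intros HW Ht Hsg Hu0 Hg0 Hg1 Hq Hnu Hne.
  assert (Hnz := nq_neq sg kappa lambda Hsg Hq Hne).
  assert (Hn2 := nq_sq sg kappa lambda Hsg Hq).
  rewrite (Aint_quot (fun s => w 0%nat s t) K kappa y) by
    (exact Hq || exact Hnz || apply (hs_Cont_y kappa tmax K w wt HW) || apply (hs_dom4 kappa tmax K w wt HW); lia).
  unfold G. rewrite Hnu.
  assert (Hin := rt_Im_ge0 (- sg) (- lambda ^ 2 - RtoC (2 * kappa ^ 2))).
  change (rt (- sg) (- lambda ^ 2 - RtoC (2 * kappa ^ 2))) with (nq sg kappa lambda) in Hin.
  set (n := nq sg kappa lambda) in *.
  rewrite (Hu0 n Hin), (Hu0 lambda (proj2 Hq)).
  change ((RtoC (kappa ^ 2) + lambda ^ 2) ^ 2) with (omega kappa lambda).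
  assert (Eom : omega kappa n = omega kappa lambda).
  { unfold omega. replace (n ^ 2) with (n * n) by ring. rewrite Hn2.
    replace (RtoC (2 * kappa ^ 2)) with (2 * RtoC (kappa ^ 2)) by (rewrite <- RtoC_mult; reflexivity). ring. }
  assert (G1 := global_relation kappa tmax K t w wt HW Ht n Hin).
  assert (G2 := global_relation kappa tmax K t w wt HW Ht lambda (proj2 Hq)).
  rewrite Eom in G1. specialize (Hg0 (omega kappa lambda)). specialize (Hg1 (omega kappa lambda)).
  assert (Eon : omega kappa (- n) = omega kappa lambda) by (rewrite <- Eom; unfold omega; ring).
  assert (Eol : omega kappa (- lambda) = omega kappa lambda) by (unfold omega; ring).
  unfold bhat in G1, G2. rewrite Eon in G1. rewrite Eol in G2.
  unfold Bint, bhat.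
  unfold E. change ((RtoC (kappa ^ 2) + lambda ^ 2) ^ 2) with (omega kappa lambda).
  rewrite !Cexp_plus.
  set (e := Cexp (Ci * omega kappa lambda * RtoC t)) in *.
  set (T3 := ttr (w 3%nat 0%R) t (omega kappa lambda)) in *. set (T2 := ttr (w 2%nat 0%R) t (omega kappa lambda)) in *.
  set (T1 := ttr (w 1%nat 0%R) t (omega kappa lambda)) in *. set (T0 := ttr (w 0%nat 0%R) t (omega kappa lambda)) in *.
  set (un := lap (fun y => w 0%nat y 0%R) n) in *. set (ul := lap (fun y => w 0%nat y 0%R) lambda) in *.
  set (vn := lap (fun y => w 0%nat y t) n) in *. set (vl := lap (fun y => w 0%nat y t) lambda) in *.
  set (p0 := t_transform g0 kappa (- (Ci * omega kappa lambda)) t) in *.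
  set (p1 := t_transform g1 kappa (- (Ci * omega kappa lambda)) t) in *.
  set (ex := Cexp (Ci * RtoC kappa * RtoC x)). set (ey := Cexp (Ci * lambda * RtoC y)).
  (* Eliminating kappa through nu^2 = - lambda^2 - 2 kappa^2 leaves an identity of rational
     functions in lambda and nu. *)
  assert (Ek : RtoC (2 * kappa ^ 2) = - lambda ^ 2 - n * n) by (rewrite Hn2; ring).
  rewrite Ek in *.
  set (bn := Ci * (T3 + Ci * - n * T2 - ((- n) ^ 2 + (- lambda ^ 2 - n * n)) * T1
     - Ci * - n * ((- n) ^ 2 + (- lambda ^ 2 - n * n)) * T0)) in *.
  set (bl := Ci * (T3 + Ci * - lambda * T2 - ((- lambda) ^ 2 + (- lambda ^ 2 - n * n)) * T1
     - Ci * - lambda * ((- lambda) ^ 2 + (- lambda ^ 2 - n * n)) * T0)) in *.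
  assert (F1 : e * un = bn + vn) by (rewrite <- G1; ring).
  assert (F2 : e * ul = bl + vl) by (rewrite <- G2; ring).
  transitivity (ex * ey * (2 * lambda / (n - lambda) * (e * un) - (lambda + n) / (n - lambda) * (e * ul)
     + 2 * (lambda ^ 2 * n + lambda * n ^ 2) * (e * p0) + 2 * Ci * (lambda ^ 2 + lambda * n) * (e * p1))).
  { field. exact Hnz. }
  rewrite F1, F2, Hg0, Hg1. unfold bn, bl.
  assert (ECi : Ci * Ci = - (1)) by (apply injective_projections; simpl; ring).
  assert (Key : 2 * lambda / (n - lambda) * (bn + vn) - (lambda + n) / (n - lambda) * (bl + vl)
     + 2 * (lambda ^ 2 * n + lambda * n ^ 2) * T0 + 2 * Ci * (lambda ^ 2 + lambda * n) * T1 =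
    (2 * lambda * vn - (lambda + n) * vl) / (n - lambda) -
    (Ci * T3 + Ci * Ci * lambda * T2 - Ci * (lambda ^ 2 + (- lambda ^ 2 - n * n)) * T1
       - Ci * Ci * lambda * (lambda ^ 2 + (- lambda ^ 2 - n * n)) * T0)).
  { replace bn with (Ci * T3 - (Ci * Ci) * n * T2 + Ci * lambda ^ 2 * T1 - (Ci * Ci) * n * lambda ^ 2 * T0)
      by (unfold bn; ring).
    replace bl with (Ci * T3 - (Ci * Ci) * lambda * T2 + Ci * n * n * T1 - (Ci * Ci) * lambda * n * n * T0)
      by (unfold bl; ring).
    rewrite ECi. field. exact Hnz. }
  fold bn bl. rewrite Key. field. exact Hnz.
Qed.

(** * Fourier inversion *)

Definition tends (F : R -> C) (l : C) : Prop :=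
  forall e, (0 < e)%R -> exists r0, (0 < r0)%R /\ forall r, (r0 <= r)%R -> (Cmod (F r - l) < e)%R.

Lemma tends_plus F G l m : tends F l -> tends G m -> tends (fun r => F r + G r) (l + m).
Proof.
  intros HF HG e He. destruct (HF (e / 2)%R ltac:(lra)) as (r1 & H1 & HF').
  destruct (HG (e / 2)%R ltac:(lra)) as (r2 & H2 & HG').
  exists (Rmax r1 r2). split; [apply Rlt_le_trans with r1; [exact H1|apply Rmax_l]|].
  intros r Hr. assert (A := Rmax_l r1 r2). assert (B := Rmax_r r1 r2).
  replace (F r + G r - (l + m)) with ((F r - l) + (G r - m)) by ring.
  eapply Rle_lt_trans; [apply Cmod_triangle|].
  assert (C1 := HF' r ltac:(lra)). assert (C2 := HG' r ltac:(lra)). lra.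
Qed.
Lemma tends_scal c F l : tends F l -> tends (fun r => c * F r) (c * l).
Proof.
  intros HF e He. assert (Hc := Cmod_ge_0 c).
  destruct (HF (e / (Cmod c + 1))%R ltac:(apply Rdiv_lt_0_compat; lra)) as (r1 & H1 & HF').
  exists r1. split; [exact H1|]. intros r Hr. specialize (HF' r Hr).
  replace (c * F r - c * l) with (c * (F r - l)) by ring. rewrite Cmod_mult.
  apply Rle_lt_trans with ((Cmod c) * (e / (Cmod c + 1)))%R.
  - apply Rmult_le_compat_l; lra.
  - apply Rlt_le_trans with ((Cmod c + 1) * (e / (Cmod c + 1)))%R.
    + apply Rmult_lt_compat_r; [apply Rdiv_lt_0_compat; lra|lra].
    + right. field. lra.
Qed.
Lemma tends_ext F G l (r1 : R) : (forall r, (r1 <= r)%R -> F r = G r) -> tends F l -> tends G l.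
Proof.
  intros H HF e He. destruct (HF e He) as (r0 & H0 & HF').
  exists (Rmax r0 r1). split; [apply Rlt_le_trans with r0; [exact H0|apply Rmax_l]|].
  intros r Hr. assert (A := Rmax_l r0 r1). assert (B := Rmax_r r0 r1).
  rewrite <- H by lra. apply HF'. lra.
Qed.
Lemma tends_opp F l : tends F l -> tends (fun r => - F r) (- l).
Proof.
  intros HF. replace (- l) with (- (1) * l) by ring.
  apply (tends_ext (fun r => - (1) * F r) _ _ 0); [intros; ring|now apply tends_scal].
Qed.
Lemma tends_minus F G l m : tends F l -> tends G m -> tends (fun r => F r - G r) (l - m).
Proof. intros HF HG. apply (tends_plus F (fun r => - G r) l (- m) HF). now apply tends_opp. Qed.
Lemma tends_of_bound F l (K r1 : R) : (forall r, (r1 <= r)%R -> (Cmod (F r - l) <= K / r)%R) -> tends F l.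
Proof.
  intros H e He. assert (HK := Rabs_pos K).
  exists (Rmax r1 (2 * (Rabs K + 1) / e))%R.
  assert (Hp : (0 < 2 * (Rabs K + 1) / e)%R) by (apply Rdiv_lt_0_compat; lra).
  split; [apply Rlt_le_trans with (1 := Hp); apply Rmax_r|].
  intros r Hr. assert (A := Rmax_l r1 (2 * (Rabs K + 1) / e)). assert (B := Rmax_r r1 (2 * (Rabs K + 1) / e)).
  eapply Rle_lt_trans; [apply H; lra|].
  assert (Hr0 : (0 < r)%R) by lra. apply Rlt_div_l; [exact Hr0|].
  assert (H1 : (2 * (Rabs K + 1) <= r * e)%R) by (apply Rle_div_l; lra).
  assert (H2 := Rle_abs K). lra.
Qed.
Lemma tends_unique F l m : tends F l -> tends F m -> l = m.
Proof.
  intros H1 H2. assert (E : l - m = 0); [|replace l with (l - m + m) by ring; rewrite E; ring].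
  apply Cmod_eq_0. apply Rle_antisym; [|apply Cmod_ge_0]. apply Rnot_lt_le. intro Hlt.
  destruct (H1 (Cmod (l - m) / 2)%R ltac:(lra)) as (r1 & _ & A).
  destruct (H2 (Cmod (l - m) / 2)%R ltac:(lra)) as (r2 & _ & B).
  specialize (A (Rmax r1 r2) (Rmax_l _ _)). specialize (B (Rmax r1 r2) (Rmax_r _ _)).
  assert (H : (Cmod (l - m) <= Cmod (F (Rmax r1 r2) - m) + Cmod (F (Rmax r1 r2) - l))%R).
  { replace (l - m) with ((F (Rmax r1 r2) - m) + - (F (Rmax r1 r2) - l)) at 1 by ring.
    eapply Rle_trans; [apply Cmod_triangle|]. rewrite Cmod_opp. lra. }
  lra.
Qed.

(** * The Riemann-Lebesgue lemma *)

Lemma cont_sin_phase {T : UniformSpace} (r c : R) (f : T -> R) (p : T) : continuous f p ->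
  continuous (fun q => RtoC (sin (r * f q + c))) p.
Proof.
  intro H. apply cont_RtoC, cont_sin, cont_Rplus; [|apply continuous_const].
  apply cont_Rmult; [apply continuous_const|exact H].
Qed.
Lemma Cmod_sin_le x : (Cmod (RtoC (sin x)) <= 1)%R.
Proof. rewrite Cmod_R. apply Rabs_le. apply SIN_bound. Qed.

Lemma Cont_shift (h : R -> C) (d : R) : Cont h -> Cont (fun s => h (s + d)%R).
Proof.
  intros Hh s. apply (continuous_comp (fun s : R => (s + d)%R) h); [|apply Hh].
  apply cont_Rplus; [apply continuous_id|apply continuous_const].
Qed.
Lemma CInt_shift (h : R -> C) (a b d : R) : Cont h ->
  CInt (fun s => h (s + d)%R) a b = CInt h (a + d) (b + d).
Proof.
  intro Hh. apply CInt_unique.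
  assert (H := CInt_subst h (fun s => (s + d)%R) (fun _ => 1%R) a b Hh).
  eapply is_CRInt_ext; [|apply H].
  - intros s _. cbv beta. destruct (h (s + d)%R). apply injective_projections; simpl; ring.
  - intros s _. split; [auto_derive; [exact I|ring]|apply continuous_const].
Qed.

Lemma Cont_bounded (h : R -> C) (a b : R) : Cont h ->
  exists B, (0 <= B)%R /\ forall s, (a <= s <= b)%R -> (Cmod (h s) <= B)%R.
Proof.
  intro Hh. destruct (bounded_continuity (V := C_R_NormedModule) h a b) as [B HB].
  - intros x _. apply Hh.
  - exists (Rabs B). split; [apply Rabs_pos|]. intros s Hs. specialize (HB s Hs).
    rewrite Cmod_norm. assert (H := Rle_abs B). apply Rlt_le in HB. eapply Rle_trans; [exact HB|exact H].
Qed.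

(* Shifting by half a period, s -> s + pi / r, flips the sign of the sine. *)
Lemma riemann_lebesgue (h : R -> C) (a b : R) : Cont h -> (a <= b)%R ->
  forall e, (0 < e)%R -> exists r0, (0 < r0)%R /\ forall r c, (r0 <= r)%R ->
    (Cmod (CInt (fun s => RtoC (sin (r * s + c)%R) * h s)%C a b) < e)%R.
Proof.
  intros Hh Hab e He.
  destruct (Cont_bounded h (a - 1) (b + 1) Hh) as (B & HB0 & HB).
  assert (He1 : (0 < e / (b - a + 1))%R) by (apply Rdiv_lt_0_compat; lra).
  destruct (uniform_tube (fun (q : R) s => h (s + q)%R) a b 0%R) with (e := (e / (b - a + 1))%R) as [d Hd].
  { intros s _. apply (continuous_comp (fun z : R * R => (snd z + fst z)%R) h); [|apply Hh].
    apply cont_Rplus; [apply continuous_snd|apply continuous_fst]. }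
  { exact He1. }
  assert (Hd0 := cond_pos d). assert (HPI := PI_RGT_0). assert (HP4 := PI_4).
  (* The shift pi / r must stay below the modulus of uniform continuity, below 1 so that the bound
     [B] applies, and small enough that each of the two end pieces is at most e / 2. None of this
     involves the phase [c], so the threshold on [r] is uniform in it. *)
  set (dm := Rmin (Rmin d 1) (e / (2 * (B + 1)))).
  assert (Hdm : (0 < dm)%R).
  { unfold dm. repeat apply Rmin_glb_lt; try lra. apply Rdiv_lt_0_compat; lra. }
  exists (2 * PI / dm)%R. split; [apply Rdiv_lt_0_compat; lra|].
  intros r c Hr.
  assert (Hr0 : (0 < r)%R) by (apply Rlt_le_trans with (2 * PI / dm)%R; [apply Rdiv_lt_0_compat; lra|exact Hr]).
  set (dl := (PI / r)%R).
  assert (Hdl : (0 < dl < dm)%R).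
  { split; [now apply Rdiv_lt_0_compat|]. apply Rlt_div_l; [exact Hr0|].
    assert (H : (2 * PI <= r * dm)%R) by (apply Rle_div_l; lra). lra. }
  assert (Hm1 : (dm <= d)%R) by (unfold dm; eapply Rle_trans; [apply Rmin_l|apply Rmin_l]).
  assert (Hm2 : (dm <= 1)%R) by (unfold dm; eapply Rle_trans; [apply Rmin_l|apply Rmin_r]).
  assert (Hm3 : (dm <= e / (2 * (B + 1)))%R) by (unfold dm; apply Rmin_r).
  set (S := fun s : R => RtoC (sin (r * s + c))).
  assert (HS : Cont S) by (intro s; apply (cont_sin_phase r c (fun s => s)), continuous_id).
  set (I := CInt (fun s => S s * h s) a b).
  assert (HSh : Cont (fun s => S s * h s)) by (intro s; apply cont_Cmult; [apply HS|apply Hh]).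
  assert (Hflip : forall s, S (s + dl)%R = - S s).
  { intro s. unfold S. rewrite <- RtoC_opp. f_equal.
    replace (r * (s + dl) + c)%R with (r * s + c + PI)%R by (unfold dl; field; lra).
    apply neg_sin. }
  assert (HSd : Cont (fun s => S (s + dl)%R)) by now apply Cont_shift.
  assert (Hhd : Cont (fun s => h (s + dl)%R)) by now apply Cont_shift.
  assert (HF : Cont (fun s => S (s + dl)%R * h (s + dl)%R)) by (intro s; apply cont_Cmult; [apply HSd|apply Hhd]).
  assert (HD : Cont (fun s => S (s + dl)%R * (h (s + dl)%R - h s))).
  { intro s. apply cont_Cmult; [apply HSd|]. apply cont_Cminus; [apply Hhd|apply Hh]. }
  assert (E1 : I = CInt (fun s => S (s + dl)%R * h (s + dl)%R) (a - dl) (b - dl)).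
  { rewrite (CInt_shift (fun s => S s * h s) (a - dl) (b - dl) dl HSh).
    unfold I. f_equal; ring. }
  assert (E2 : I = - CInt (fun s => S (s + dl)%R * h s) a b).
  { unfold I. replace (- CInt (fun s => S (s + dl)%R * h s) a b) with ((- (1)) * CInt (fun s => S (s + dl)%R * h s) a b) by ring.
    rewrite <- CInt_scal by (intro s; apply cont_Cmult; [apply HSd|apply Hh]).
    apply CInt_ext. intros s _. rewrite Hflip. ring. }
  assert (E3 : CInt (fun s => S (s + dl)%R * (h (s + dl)%R - h s)) a b =
    CInt (fun s => S (s + dl)%R * h (s + dl)%R) a b - CInt (fun s => S (s + dl)%R * h s) a b).
  { rewrite <- CInt_minus; [|exact HF|intro s; apply cont_Cmult; [apply HSd|apply Hh]].
    apply CInt_ext. intros; ring. }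
  assert (E4 : CInt (fun s => S (s + dl)%R * h (s + dl)%R) (a - dl) (b - dl) =
    CInt (fun s => S (s + dl)%R * h (s + dl)%R) (a - dl) a + CInt (fun s => S (s + dl)%R * h (s + dl)%R) a b
     - CInt (fun s => S (s + dl)%R * h (s + dl)%R) (b - dl) b).
  { pose (F1 := fun s => S (s + dl)%R * h (s + dl)%R).
    change (CInt F1 (a - dl) (b - dl) = CInt F1 (a - dl) a + CInt F1 a b - CInt F1 (b - dl) b).
    rewrite <- (CInt_Chasles F1 (a - dl) a (b - dl) HF), <- (CInt_Chasles F1 a b (b - dl) HF).
    rewrite (CInt_swap F1 (b - dl) b HF). ring. }
  assert (E5 : I + I = CInt (fun s => S (s + dl)%R * (h (s + dl)%R - h s)) a b
     + CInt (fun s => S (s + dl)%R * h (s + dl)%R) (a - dl) a - CInt (fun s => S (s + dl)%R * h (s + dl)%R) (b - dl) b).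
  { rewrite E1 at 1. rewrite E2, E3, E4. ring. }
  assert (HSb : forall s, (Cmod (S s) <= 1)%R) by (intro s; apply Cmod_sin_le).
  assert (B1 : (Cmod (CInt (fun s => S (s + dl)%R * (h (s + dl)%R - h s))%C a b) <= (b - a) * (e / (b - a + 1)))%R).
  { apply CInt_bound; [exact HD|exact Hab|]. intros s Hs. rewrite Cmod_mult.
    assert (H1 := Hd dl ltac:(change (Rabs (dl - 0) < d)%R; rewrite Rminus_0_r, Rabs_pos_eq; lra) s Hs).
    cbv beta in H1. rewrite Rplus_0_r in H1.
    assert (H2 := HSb (s + dl)%R). assert (H3 := Cmod_ge_0 (h (s + dl)%R - h s)).
    assert (H4 := Cmod_ge_0 (S (s + dl)%R)). nra. }
  assert (B2 : forall p, (a - dl <= p <= b - dl)%R ->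
     (Cmod (CInt (fun s => S (s + dl)%R * h (s + dl)%R)%C p (p + dl)) <= dl * B)%R).
  { intros p Hp. replace (dl * B)%R with ((p + dl - p) * B)%R by ring.
    apply CInt_bound; [exact HF|lra|]. intros s Hs. rewrite Cmod_mult.
    assert (H1 := HB (s + dl)%R ltac:(lra)). assert (H2 := HSb (s + dl)%R).
    assert (H3 := Cmod_ge_0 (h (s + dl)%R)). assert (H4 := Cmod_ge_0 (S (s + dl)%R)). nra. }
  assert (B3 := B2 (a - dl)%R ltac:(lra)). assert (B4 := B2 (b - dl)%R ltac:(lra)).
  replace (a - dl + dl)%R with a in B3 by ring. replace (b - dl + dl)%R with b in B4 by ring.
  assert (B5 : (2 * Cmod I <= (b - a) * (e / (b - a + 1)) + dl * B + dl * B)%R).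
  { replace (2 * Cmod I)%R with (Cmod (I + I)).
    - rewrite E5. eapply Rle_trans; [apply Cmod_triangle|]. rewrite Cmod_opp.
      apply Rplus_le_compat; [|exact B4]. eapply Rle_trans; [apply Cmod_triangle|]. lra.
    - replace (I + I) with (2 * I) by ring. rewrite Cmod_mult, Cmod_R, Rabs_pos_eq; lra. }
  assert (B6 : ((b - a) * (e / (b - a + 1)) < e)%R).
  { replace e with ((b - a + 1) * (e / (b - a + 1)))%R at 2 by (field; lra).
    apply Rmult_lt_compat_r; [exact He1|lra]. }
  assert (B7 : (dl * B <= e / 2)%R).
  { apply Rle_trans with (e / (2 * (B + 1)) * B)%R; [apply Rmult_le_compat_r; lra|].
    apply Rle_trans with (e / (2 * (B + 1)) * (B + 1))%R.
    - apply Rmult_le_compat_l; [left; apply Rdiv_lt_0_compat; lra|lra].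
    - right. field. lra. }
  change (Cmod I < e)%R. lra.
Qed.

(** The phase may depend on [r]: translating the Dirichlet kernel by b introduces the phase r b. *)
Lemma riemann_lebesgue_inf (h : R -> C) (M : R) (c : R -> R) : Cont h -> dom2 M h ->
  tends (fun r => CI (fun s => RtoC (sin (r * s + c r)) * h s)) 0.
Proof.
  intros Hh Hd e He. assert (HM := dom2_M0 _ _ Hd).
  set (b := (4 * (M + 1) / e)%R).
  assert (Hb : (0 < b)%R) by (apply Rdiv_lt_0_compat; lra).
  destruct (riemann_lebesgue h 0 b Hh ltac:(lra) (e / 2)%R ltac:(lra)) as (r0 & Hr0 & H).
  exists r0. split; [exact Hr0|]. intros r Hr. specialize (H r (c r) Hr).
  set (F := fun s => RtoC (sin (r * s + c r)) * h s) in *.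
  assert (HF : Cont F).
  { intro s. apply cont_Cmult; [|apply Hh]. apply (cont_sin_phase r (c r) (fun s => s)), continuous_id. }
  assert (HdF : dom2 M F) by (apply dom2_mult_le1; [intros; apply Cmod_sin_le|exact Hd]).
  assert (Ht := CI_tail F M b HF HdF ltac:(lra)).
  replace (CI F - 0) with ((CI F - CInt F 0 b) + CInt F 0 b) by ring.
  eapply Rle_lt_trans; [apply Cmod_triangle|].
  assert (H1 : (2 * M * / (1 + b) < e / 2)%R); [|lra].
  apply Rmult_lt_reg_r with (1 + b)%R; [lra|]. rewrite Rmult_assoc, Rinv_l by lra.
  assert (H2 : (b * e = 4 * (M + 1))%R) by (unfold b; field; lra). nra.
Qed.

Lemma CI_split (F : R -> C) (M b : R) : Cont F -> dom2 M F -> (0 <= b)%R ->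
  CI F = CInt F 0 b + CI (fun s => F (s + b)%R).
Proof.
  intros HF Hd Hb. assert (HM := dom2_M0 _ _ Hd).
  apply (Ceq_of_bound _ _ (4 * M)). intros c Hc.
  assert (Hd2 : dom2 M (fun s => F (s + b)%R)).
  { intros s Hs. eapply Rle_trans; [apply Hd; lra|]. apply Rmult_le_compat_l; [exact HM|].
    apply Rinv_le_contravar; [apply pow_lt; lra|]. apply pow_incr. lra. }
  assert (HFs := Cont_shift F b HF).
  assert (H1 := CI_tail (fun s : R => F (s + b)%R) M c HFs Hd2 Hc). assert (H2 := CI_tail F M (c + b) HF Hd ltac:(lra)).
  rewrite (CInt_shift F 0 c b HF) in H1. rewrite Rplus_0_l in H1.
  replace (CI F - (CInt F 0 b + CI (fun s => F (s + b)%R))) with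
    ((CI F - CInt F 0 (c + b)) - (CI (fun s => F (s + b)%R) - CInt F b (c + b))).
  2: { rewrite <- (CInt_Chasles F 0 b (c + b) HF). ring. }
  eapply Rle_trans; [apply Cmod_triangle|]. rewrite Cmod_opp.
  assert (H3 : (/ (1 + (c + b)) <= / (1 + c))%R) by (apply Rinv_le_contravar; lra).
  nra.
Qed.

(** * The Dirichlet kernel *)

Definition dker (r s : R) : C := CInt (fun l => Cexp (- (Ci * RtoC l * RtoC s))) (- r) r.

Lemma jcont_ex : jcont2 (fun l s => Cexp (- (Ci * RtoC l * RtoC s))).
Proof. intros T a b p Ha Hb. now apply cont_ex. Qed.
Lemma dker_Cont r : (0 <= r)%R -> Cont (dker r).
Proof.
  intros Hr s. apply (cont_CInt_param (fun s l => Cexp (- (Ci * RtoC l * RtoC s)))); [lra|].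
  intros q l. apply (cont_ex (fun z : R * R => snd z) (fun z => fst z)); [apply continuous_snd|apply continuous_fst].
Qed.
Lemma dker_bound r s : (0 <= r)%R -> (Cmod (dker r s) <= 2 * r)%R.
Proof.
  intro Hr. replace (2 * r)%R with ((r - - r) * 1)%R by ring.
  apply CInt_bound; [apply (jcont2_l (fun l s => Cexp (- (Ci * RtoC l * RtoC s)))), jcont_ex|lra|].
  intros l _. rewrite Cmod_Cexp_x. lra.
Qed.
Lemma dker_even r s : dker r (- s) = dker r s.
Proof.
  unfold dker. assert (H := CInt_neg (fun l => Cexp (- (Ci * RtoC l * RtoC s))) (- r) r
    (jcont2_l (fun l s => Cexp (- (Ci * RtoC l * RtoC s))) s jcont_ex)).
  rewrite Ropp_involutive in H. rewrite <- H. apply CInt_ext. intros l _. f_equal.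
  apply injective_projections; simpl; ring.
Qed.
(** The kernel is 2 sin(r s) / s. Its definition as an integral avoids the division and makes it
    continuous at 0; the phase 0 matches the form of the Riemann-Lebesgue lemma. *)
Lemma dker_sin r s : (0 <= r)%R -> RtoC s * dker r s = RtoC (2 * sin (r * s + 0)).
Proof.
  intro Hr. rewrite Rplus_0_r.
  assert (Hc : Cont (fun l => Cexp (- (Ci * RtoC l * RtoC s)))) by apply (jcont2_l (fun l s => Cexp (- (Ci * RtoC l * RtoC s)))), jcont_ex.
  unfold dker. rewrite <- CInt_scal by exact Hc.
  rewrite (CInt_FTC (fun l => Ci * Cexp (- (Ci * RtoC l * RtoC s))) (fun l => RtoC s * Cexp (- (Ci * RtoC l * RtoC s)))).
  - replace (- (Ci * RtoC r * RtoC s)) with (Ci * RtoC (- (r * s))) by (apply injective_projections; simpl; ring).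
    replace (- (Ci * RtoC (- r) * RtoC s)) with (Ci * RtoC (r * s)) by (apply injective_projections; simpl; ring).
    rewrite !Cexp_imag, cos_neg, sin_neg. apply injective_projections; simpl; ring.
  - lra.
  - intro l. apply cont_Cmult; [apply continuous_const|apply Hc].
  - intros l _. apply cont_Cmult; [apply continuous_const|apply Hc].
  - intros l _. eapply Cd_eq.
    + apply Cd_scal, Cd_Cexp, Cd_opp, Cd_mult; [|apply Cd_const]. apply Cd_mult; [apply Cd_const|apply Cd_id].
    + cbv beta. set (x := Cexp (- (Ci * RtoC l * RtoC s))). destruct x.
      apply injective_projections; simpl; ring.
Qed.

Lemma exp_neg_dom (s : R) : (0 <= s)%R -> (exp (- s) <= 4 * / (1 + s) ^ 2)%R.
Proof.
  intro Hs. rewrite exp_Ropp.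
  assert (H : ((1 + s) ^ 2 / 4 <= exp s)%R).
  { replace s with (s / 2 + s / 2)%R at 2 by field. rewrite exp_plus.
    assert (H1 := exp_ineq1_le (s / 2)). nra. }
  replace (4 * / (1 + s) ^ 2)%R with (/ ((1 + s) ^ 2 / 4))%R by (field; lra).
  apply Rinv_le_contravar; [nra|exact H].
Qed.

(** Reference profile with value 1 at 0 whose Dirichlet integral is explicit; subtracting a multiple
    of it reduces a general profile to one vanishing at 0. *)
Definition expn (s : R) : C := RtoC (exp (- s)).
Lemma expn_Cont : Cont expn.
Proof. intro s. apply cont_RtoC, cont_exp, cont_Ropp, continuous_id. Qed.
Lemma expn_dom2 : dom2 4 expn.
Proof.
  intros s Hs. unfold expn. rewrite Cmod_R, Rabs_pos_eq by (left; apply exp_pos). now apply exp_neg_dom.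
Qed.

Lemma one_plus_il_neq l : 1 + Ci * RtoC l <> 0.
Proof. intro E. apply (f_equal Re) in E. simpl in E. lra. Qed.

Lemma CI_expn l : CI (fun s => Cexp (- (Ci * RtoC l * RtoC s)) * expn s) = / (1 + Ci * RtoC l).
Proof.
  assert (Hne := one_plus_il_neq l).
  assert (Hc : Cont (fun s => Cexp (- (Ci * RtoC l * RtoC s)) * expn s)).
  { intro s. apply cont_Cmult; [|apply expn_Cont]. apply (cont_ex (fun _ => l) (fun s => s)); [apply continuous_const|apply continuous_id]. }
  assert (Hd : dom2 4 (fun s => Cexp (- (Ci * RtoC l * RtoC s)) * expn s)).
  { apply dom2_mult_le1; [intros; rewrite Cmod_Cexp_x; lra|apply expn_dom2]. }
  rewrite (CI_FTC (fun s => - / (1 + Ci * RtoC l) * (Cexp (- (Ci * RtoC l * RtoC s)) * expn s)) _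
    (Cmod (- / (1 + Ci * RtoC l)) * 4) 4).
  - unfold expn. rewrite Ropp_0, exp_0, Cmult_0_r. replace (- 0) with (RtoC 0) by ring. rewrite Cexp_0. ring.
  - intro s. apply cont_Cmult; [apply continuous_const|apply Hc].
  - exact Hc.
  - now apply dom2_scal.
  - exact Hd.
  - intros s _. eapply Cd_eq.
    + apply Cd_scal, Cd_mult.
      * apply Cd_Cexp, Cd_opp, Cd_mult; [apply Cd_const|apply Cd_id].
      * apply (Cd_RtoC (fun s => exp (- s)) s (- exp (- s))). auto_derive; [exact I|ring].
    + cbv beta. unfold expn. rewrite RtoC_opp. field. exact Hne.
Qed.

Lemma atan_limit e : (0 < e)%R -> exists r0, (0 < r0)%R /\ forall r, (r0 <= r)%R -> (PI / 2 - e < atan r < PI / 2)%R.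
Proof.
  intro He. assert (HPI := PI_RGT_0).
  set (d := Rmin (e / 2) (PI / 4)). assert (Hd : (0 < d)%R) by (apply Rmin_glb_lt; lra).
  assert (Hd1 := Rmin_l (e / 2) (PI / 4)). assert (Hd2 := Rmin_r (e / 2) (PI / 4)). fold d in Hd1, Hd2.
  exists (tan (PI / 2 - d)). split; [apply tan_gt_0; lra|].
  intros r Hr. assert (HB := atan_bound r). split; [|lra].
  assert (H : (atan (tan (PI / 2 - d)) <= atan r)%R).
  { destruct Hr as [Hr|Hr]; [left; now apply atan_increasing|rewrite Hr; lra]. }
  rewrite atan_tan in H by lra. lra.
Qed.

(** By Fubini this is the integral over [-r, r] of 1 / (1 + i l): the real part integrates to 2 atan
    r, and the imaginary part is odd. *)
Lemma dker_expn r : (0 <= r)%R -> CI (fun s => dker r s * expn s) = RtoC (2 * atan r).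
Proof.
  intro Hr.
  transitivity (CI (fun s => CInt (fun l => Cexp (- (Ci * RtoC l * RtoC s)) * expn s) (- r) r)).
  { apply CI_ext. intros s _. unfold dker. rewrite Cmult_comm, <- CInt_scal.
    - apply CInt_ext. intros; ring.
    - apply (jcont2_l (fun l s => Cexp (- (Ci * RtoC l * RtoC s)))), jcont_ex. }
  rewrite <- (CInt_CI_Fubini (fun l s => Cexp (- (Ci * RtoC l * RtoC s)) * expn s) 4).
  - rewrite (CInt_ext _ (fun l => / (1 + Ci * RtoC l))) by (intros; apply CI_expn).
    assert (Hc : Cont (fun l => / (1 + Ci * RtoC l))).
    { intro l. apply cont_Cinv; [apply one_plus_il_neq|]. apply cont_Cplus; [apply continuous_const|].
      apply cont_Cmult; [apply continuous_const|apply cont_RtoC, continuous_id]. }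
    apply CInt_unique.
    assert (HR : is_RInt (fun l => / (1 + l ^ 2))%R (- r) r (2 * atan r)%R).
    { replace (2 * atan r)%R with (minus (atan r) (atan (- r))).
      - apply (is_RInt_derive (V := R_CompleteNormedModule) atan (fun l => / (1 + l ^ 2))%R).
        + intros l _. apply is_derive_Reals.
          apply derivable_pt_lim_atan.
        + intros l _. apply cont_Rinv; [nra|]. apply cont_Rplus; [apply continuous_const|]. apply cont_Rpow, continuous_id.
      - rewrite atan_opp. unfold minus, plus, opp; simpl. ring. }
    assert (HI : is_RInt (fun l => - l / (1 + l ^ 2))%R (- r) r 0%R).
    { replace 0%R with (minus (- (/ 2) * ln (1 + r ^ 2)) (- (/ 2) * ln (1 + (- r) ^ 2)))%R.
      - apply (is_RInt_derive (V := R_CompleteNormedModule) (fun l => - (/ 2) * ln (1 + l ^ 2))%R (fun l => - l / (1 + l ^ 2))%R).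
        + intros l _. auto_derive; [nra|]. field. nra.
        + intros l _. apply cont_Rdiv; [nra|apply cont_Ropp, continuous_id|].
          apply cont_Rplus; [apply continuous_const|]. apply cont_Rpow, continuous_id.
      - unfold minus, plus, opp; simpl. replace (- r * (- r * 1))%R with (r * (r * 1))%R by ring. ring. }
    apply (is_RInt_fct_extend_pair (U := R_NormedModule) (V := R_NormedModule)).
    + apply (is_RInt_ext (V := R_NormedModule) (fun l => / (1 + l ^ 2))%R); [|exact HR].
      intros l _. simpl. field. nra.
    + apply (is_RInt_ext (V := R_NormedModule) (fun l => - l / (1 + l ^ 2))%R); [|exact HI].
      intros l _. simpl. field. nra.
  - intros T a b p Ha Hb. apply cont_Cmult; [now apply jcont_ex|].
    apply (continuous_comp b expn); [exact Hb|apply expn_Cont].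
  - intro l. apply dom2_mult_le1; [intros; rewrite Cmod_Cexp_x; lra|apply expn_dom2].
Qed.

Lemma dker_expn_tends : tends (fun r => CI (fun s => dker r s * expn s)) (RtoC PI).
Proof.
  intros e He. destruct (atan_limit (e / 2)%R ltac:(lra)) as (r0 & Hr0 & H).
  exists r0. split; [exact Hr0|]. intros r Hr. rewrite dker_expn by lra.
  rewrite <- RtoC_minus, Cmod_R. specialize (H r Hr). apply Rabs_def1; lra.
Qed.

(** The function g(s) - g(0) exp(-s) vanishes at 0 and equals s h(s), where h extends continuously
    by g'(0) + g(0). Against the kernel it becomes 2 sin(r s) h(s), which tends to 0 by
    Riemann-Lebesgue. The subtracted part contributes g(0) times the limit pi of 2 atan r. *)
Lemma dirichlet_half (g : R -> C) (M : R) (g1 : C) : Cont g -> dom2 M g -> is_Cderive g 0%R g1 ->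
  tends (fun r => CI (fun s => dker r s * g s)) (RtoC PI * g 0%R).
Proof.
  intros Hg HM Hd.
  set (num := fun s => g s - g 0%R * expn s).
  set (h := fun s : R => if Req_EM_T s 0 then g1 + g 0%R else num s / RtoC s).
  assert (Hnum : Cont num).
  { intro s. apply cont_Cminus; [apply Hg|]. apply cont_Cmult; [apply continuous_const|apply expn_Cont]. }
  assert (Hn0 : num 0%R = 0).
  { unfold num, expn. rewrite Ropp_0, exp_0. ring. }
  assert (Hnd : is_Cderive num 0%R (g1 + g 0%R)).
  { eapply Cd_eq.
    - apply Cd_minus; [exact Hd|]. apply Cd_scal.
      apply (Cd_RtoC (fun s => exp (- s)) 0 (- exp (- 0))). auto_derive; [exact I|ring].
    - rewrite Ropp_0, exp_0. apply injective_projections; simpl; ring. }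
  assert (Hsh : forall s, num s = RtoC s * h s).
  { intro s. unfold h. destruct (Req_EM_T s 0) as [->|Hs]; [rewrite Hn0; ring|].
    field. intro E. apply Hs. now apply RtoC_inj in E. }
  assert (Hh : Cont h).
  { intro s. destruct (Req_EM_T s 0) as [->|Hs].
    - apply continuous_Cmod_iff. intros e He.
      destruct Hnd as [_ Hnd]. specialize (Hnd 0%R (fun P H => H) (mkposreal (e / 2) ltac:(lra))).
      revert Hnd. apply filter_imp. intros s Hs.
      unfold h at 2. destruct (Req_EM_T 0 0) as [_|n0]; [|now destruct n0].
      unfold h. destruct (Req_EM_T s 0) as [->|Hs0].
      { replace (g1 + g 0%R - (g1 + g 0%R)) with (RtoC 0) by ring. now rewrite Cmod_0. }
      assert (Hs' : (Cmod (num s - num 0%R - RtoC (s - 0) * (g1 + g 0%R)) <= e / 2 * Rabs (s - 0))%R).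
      { eapply Rle_trans; [|exact Hs]. right. rewrite Cmod_norm. f_equal.
        unfold minus, plus, opp, scal; simpl. destruct (num s), (num 0%R), (g1 + g 0%R).
        apply injective_projections; simpl; unfold plus, opp, scal; simpl; unfold mult; simpl; ring. }
      rewrite Hn0, Rminus_0_r in Hs'.
      assert (Hsp := Rabs_pos_lt s Hs0).
      assert (Hsn : RtoC s <> 0) by (intro E; apply Hs0; now apply RtoC_inj in E).
      replace (num s / RtoC s - (g1 + g 0%R)) with ((num s - 0 - RtoC s * (g1 + g 0%R)) / RtoC s) by (field; exact Hsn).
      rewrite Cmod_div by exact Hsn. rewrite Cmod_R. apply Rlt_div_l; [exact Hsp|]. nra.
    - apply (continuous_ext_loc _ (fun s => num s / RtoC s)).
      + assert (Hp := Rabs_pos_lt s Hs). exists (mkposreal _ Hp). intros q Hq.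
        assert (Hq' : (Rabs (q - s) < Rabs s)%R) by exact Hq.
        unfold h. destruct (Req_EM_T q 0) as [->|]; [|reflexivity].
        replace (0 - s)%R with (- s)%R in Hq' by ring. rewrite Rabs_Ropp in Hq'. lra.
      + apply cont_Cdiv; [intro E; apply Hs; now apply RtoC_inj in E|apply Hnum|apply cont_RtoC, continuous_id]. }
  destruct (Cont_bounded h 0 1 Hh) as (B & HB0 & HB).
  assert (HMp := dom2_M0 _ _ HM). assert (Hg0 := Cmod_ge_0 (g 0%R)).
  (* On [0, 1] the quotient is bounded by [B] and (1 + s)^2 <= 4; beyond 1 division by s only
     decreases the numerator. *)
  assert (Hhd : dom2 (4 * B + (M + Cmod (g 0%R) * 4)) h).
  { intros s Hs. assert (Hi : (0 < / (1 + s) ^ 2)%R) by (apply Rinv_0_lt_compat, pow_lt; lra).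
    rewrite Rmult_plus_distr_r.
    destruct (Rle_lt_dec s 1) as [H1|H1].
    - apply Rle_trans with (4 * B * / (1 + s) ^ 2)%R.
      + eapply Rle_trans; [apply HB; lra|].
        apply Rmult_le_reg_r with ((1 + s) ^ 2)%R; [apply pow_lt; lra|].
        rewrite Rmult_assoc, Rinv_l by (apply pow_nonzero; lra).
        assert (Hs4 : ((1 + s) ^ 2 <= 4)%R) by nra.
        apply Rle_trans with (B * 4)%R; [now apply Rmult_le_compat_l|lra].
      + assert (0 <= (M + Cmod (g 0%R) * 4) * / (1 + s) ^ 2)%R by (apply Rmult_le_pos; lra). lra.
    - apply Rle_trans with ((M + Cmod (g 0%R) * 4) * / (1 + s) ^ 2)%R.
      + unfold h. destruct (Req_EM_T s 0) as [|Hs0]; [lra|].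
        rewrite Cmod_div by (intro E; apply Hs0; now apply RtoC_inj in E).
        rewrite Cmod_R, Rabs_pos_eq by lra.
        apply Rle_trans with (Cmod (num s)).
        * apply Rle_div_l; [lra|]. assert (H := Cmod_ge_0 (num s)). nra.
        * unfold num. eapply Rle_trans; [apply Cmod_triangle|]. rewrite Cmod_opp, Cmod_mult, Rmult_plus_distr_r.
          apply Rplus_le_compat; [now apply HM|]. rewrite Rmult_assoc.
          apply Rmult_le_compat_l; [exact Hg0|now apply expn_dom2].
      + assert (0 <= 4 * B * / (1 + s) ^ 2)%R by (apply Rmult_le_pos; lra). lra. }
  assert (HRL := riemann_lebesgue_inf h _ (fun _ => 0%R) Hh Hhd).
  assert (HL := tends_plus _ _ _ _ (tends_scal (g 0%R) _ _ dker_expn_tends) (tends_scal 2 _ _ HRL)).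
  replace (g 0%R * RtoC PI + 2 * 0) with (RtoC PI * g 0%R) in HL by ring.
  revert HL. apply tends_ext with 0%R. intros r Hr.
  set (M' := (4 * B + (M + Cmod (g 0%R) * 4))%R) in *.
  assert (Hsin : Cont (fun s => RtoC (sin (r * s + 0)) * h s)).
  { intro s. apply cont_Cmult; [apply (cont_sin_phase r 0 (fun s => s)), continuous_id|apply Hh]. }
  assert (Hsd : dom2 M' (fun s => RtoC (sin (r * s + 0)) * h s)).
  { apply dom2_mult_le1; [intros; apply Cmod_sin_le|exact Hhd]. }
  assert (Hke : Cont (fun s => dker r s * expn s)).
  { intro s. apply cont_Cmult; [now apply dker_Cont|apply expn_Cont]. }
  assert (Hkd : dom2 (2 * r * 4) (fun s => dker r s * expn s)).
  { intros s Hs. rewrite Cmod_mult, Rmult_assoc.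
    apply Rmult_le_compat; try apply Cmod_ge_0; [now apply dker_bound|now apply expn_dom2]. }
  rewrite <- (CI_scal _ _ _ Hke Hkd), <- (CI_scal _ _ _ Hsin Hsd).
  rewrite <- (CI_plus _ _ (Cmod (g 0%R) * (2 * r * 4)) (Cmod 2 * M')).
  - apply CI_ext. intros s Hs.
    assert (Es : dker r s * num s = 2 * (RtoC (sin (r * s + 0)) * h s)).
    { rewrite Hsh. replace (dker r s * (RtoC s * h s)) with ((RtoC s * dker r s) * h s) by ring.
      rewrite dker_sin by exact Hr. rewrite RtoC_mult. ring. }
    rewrite <- Es. unfold num. ring.
  - intro s. apply cont_Cmult; [apply continuous_const|apply Hke].
  - intro s. apply cont_Cmult; [apply continuous_const|apply Hsin].
  - now apply dom2_scal.
  - now apply dom2_scal.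
Qed.

(** Away from 0 the quotient by s is harmless and Riemann-Lebesgue applies directly; [Rmax b] only
    keeps the denominator nonzero for every real parameter. *)
Lemma dker_far_tends (g : R -> C) (M b : R) : Cont g -> dom2 M g -> (0 < b)%R ->
  tends (fun r => CI (fun s => dker r (s + b) * g (s + b)%R)) 0.
Proof.
  intros Hg HM Hb. assert (HMp := dom2_M0 _ _ HM).
  set (h := fun s : R => 2 * (g (s + b)%R * / RtoC (Rmax b (s + b)))).
  assert (Hmx : forall s : R, RtoC (Rmax b (s + b)) <> 0).
  { intros s E. apply RtoC_inj in E. assert (H := Rmax_l b (s + b)). lra. }
  assert (Hh : Cont h).
  { intro s. apply cont_Cmult; [apply continuous_const|]. apply cont_Cmult; [now apply Cont_shift|].
    apply cont_Cinv; [apply Hmx|]. apply cont_RtoC, cont_Rmax; [apply continuous_const|].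
    apply cont_Rplus; [apply continuous_id|apply continuous_const]. }
  assert (Hd : dom2 (2 * (M / b)) h).
  { intros s Hs. unfold h. rewrite !Cmod_mult, Cmod_inv by apply Hmx.
    rewrite !Cmod_R, (Rabs_pos_eq 2) by lra. rewrite Rmax_right by lra. rewrite (Rabs_pos_eq (s + b)) by lra.
    rewrite Rmult_assoc. apply Rmult_le_compat_l; [lra|].
    assert (H1 : (Cmod (g (s + b)%R) <= M * / (1 + s) ^ 2)%R).
    { eapply Rle_trans; [apply HM; lra|]. apply Rmult_le_compat_l; [exact HMp|].
      apply Rinv_le_contravar; [apply pow_lt; lra|]. apply pow_incr. lra. }
    assert (H2 : (/ (s + b) <= / b)%R) by (apply Rinv_le_contravar; lra).
    assert (H3 : (0 < / (s + b))%R) by (apply Rinv_0_lt_compat; lra).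
    replace (M / b * / (1 + s) ^ 2)%R with (M * / (1 + s) ^ 2 * / b)%R by (unfold Rdiv; ring).
    apply Rmult_le_compat; [apply Cmod_ge_0|lra|exact H1|exact H2]. }
  assert (HRL := riemann_lebesgue_inf h _ (fun r => r * b)%R Hh Hd).
  revert HRL. apply tends_ext with 0%R. intros r Hr. apply CI_ext. intros s Hs.
  unfold h. rewrite Rmax_right by lra.
  assert (E := dker_sin r (s + b) Hr).
  assert (Hne : RtoC (s + b) <> 0) by (intro E0; apply RtoC_inj in E0; lra).
  replace (dker r (s + b)) with (RtoC (s + b) * dker r (s + b) / RtoC (s + b)) by (field; exact Hne).
  rewrite E, RtoC_mult. replace (r * (s + b) + 0)%R with (r * s + r * b)%R by ring. field. exact Hne.
Qed.

(** No decay of g beyond [b] is assumed, so g is frozen at [b] and multiplied by a decaying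
    exponential. The half-line limit for this extension minus its far part gives the interval. *)
Lemma dirichlet_interval (g : R -> C) (b : R) (g1 : C) : Cont g -> (0 < b)%R -> is_Cderive g 0%R g1 ->
  tends (fun r => CInt (fun s => dker r s * g s) 0 b) (RtoC PI * g 0%R).
Proof.
  intros Hg Hb Hd.
  set (G := fun s => g (Rmin s b) * expn (Rmax 0 (s - b))).
  assert (HG : Cont G).
  { intro s. apply cont_Cmult.
    - apply (continuous_comp (fun s : R => Rmin s b) g); [|apply Hg].
      apply cont_Rmin; [apply continuous_id|apply continuous_const].
    - apply (continuous_comp (fun s : R => Rmax 0 (s - b)) expn); [|apply expn_Cont].
      apply cont_Rmax; [apply continuous_const|]. apply cont_Rminus; [apply continuous_id|apply continuous_const]. }
  assert (HGg : forall s, (s <= b)%R -> G s = g s).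
  { intros s Hs. unfold G. rewrite Rmin_left, Rmax_left by lra. unfold expn. rewrite Ropp_0, exp_0. ring. }
  destruct (Cont_bounded g 0 b Hg) as (B & HB0 & HB).
  assert (HdG : dom2 (B * (4 * (1 + b) ^ 2)) G).
  { intros s Hs. unfold G. rewrite Cmod_mult, Rmult_assoc.
    apply Rmult_le_compat; try apply Cmod_ge_0.
    - apply HB. split; [apply Rmin_glb; lra|apply Rmin_r].
    - eapply Rle_trans; [apply expn_dom2, Rmax_l|]. rewrite Rmult_assoc. apply Rmult_le_compat_l; [lra|].
      assert (H1 := Rmax_l 0 (s - b)). assert (H2 := Rmax_r 0 (s - b)).
      set (m := Rmax 0 (s - b)) in *.
      apply Rmult_le_reg_r with ((1 + m) ^ 2 * (1 + s) ^ 2)%R.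
      { apply Rmult_lt_0_compat; apply pow_lt; lra. }
      replace (/ (1 + m) ^ 2 * ((1 + m) ^ 2 * (1 + s) ^ 2))%R with ((1 + s) ^ 2)%R by (field; lra).
      replace ((1 + b) ^ 2 * / (1 + s) ^ 2 * ((1 + m) ^ 2 * (1 + s) ^ 2))%R with ((1 + b) ^ 2 * (1 + m) ^ 2)%R by (field; lra).
      rewrite <- Rpow_mult_distr. apply pow_incr. nra. }
  assert (HdG0 : is_Cderive G 0%R g1).
  { apply (is_derive_ext_loc g).
    - exists (mkposreal b Hb). intros s Hs. assert (Hs' : (Rabs (s - 0) < b)%R) by exact Hs.
      apply Rabs_def2 in Hs'. symmetry. apply HGg. lra.
    - exact Hd. }
  assert (H1 := dirichlet_half G _ g1 HG HdG HdG0).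
  assert (H2 := dker_far_tends G _ b HG HdG Hb).
  assert (H3 := tends_minus _ _ _ _ H1 H2). rewrite (HGg 0%R) in H3 by lra.
  replace (RtoC PI * g 0%R - 0) with (RtoC PI * g 0%R) in H3 by ring.
  revert H3. apply tends_ext with 0%R. intros r Hr.
  assert (Hc : Cont (fun s => dker r s * G s)).
  { intro s. apply cont_Cmult; [now apply dker_Cont|apply HG]. }
  assert (HD : dom2 (2 * r * (B * (4 * (1 + b) ^ 2))) (fun s => dker r s * G s)).
  { intros s Hs. rewrite Cmod_mult, Rmult_assoc.
    apply Rmult_le_compat; try apply Cmod_ge_0; [now apply dker_bound|now apply HdG]. }
  rewrite (CI_split (fun s : R => dker r s * G s) _ b Hc HD) by lra.
  rewrite (CInt_ext_le (fun s => dker r s * g s) (fun s => dker r s * G s)); [|lra|].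
  - ring.
  - intros s Hs. rewrite HGg by lra. reflexivity.
Qed.

(** Exchanging the integrals gives the Dirichlet kernel centred at y. The half line splits there
    into [0, y] and [y, oo), and each side contributes pi w(y); the first one needs the version on
    an interval, since w is controlled only for nonnegative arguments. *)
Lemma inversion_half (w : R -> C) (K y : R) (w1 : C) : Cont w -> dom2 K w -> (0 < y)%R ->
  is_Cderive w y w1 ->
  tends (fun r => CInt (fun l => Cexp (Ci * RtoC l * RtoC y) * lap w (- RtoC l)) (- r) r) (RtoC (2 * PI) * w y).
Proof.
  intros Hw HK Hy Hd. assert (HKp := dom2_M0 _ _ HK).
  assert (HR : tends (fun r => CI (fun s => dker r s * w (s + y)%R)) (RtoC PI * w (0 + y)%R)).
  { apply (dirichlet_half (fun s => w (s + y)%R) K w1).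
    - now apply Cont_shift.
    - intros s Hs. eapply Rle_trans; [apply HK; lra|]. apply Rmult_le_compat_l; [exact HKp|].
      apply Rinv_le_contravar; [apply pow_lt; lra|]. apply pow_incr. lra.
    - eapply Cd_eq.
      + apply (Cd_comp w (fun s => (s + y)%R) 0 w1 1); [rewrite Rplus_0_l; exact Hd|]. auto_derive; [exact I|ring].
      + ring. }
  assert (HL : tends (fun r => CInt (fun s => dker r s * w (y - s)%R) 0 y) (RtoC PI * w (y - 0)%R)).
  { apply (dirichlet_interval (fun s => w (y - s)%R) y (RtoC (-1) * w1)).
    - intro s. apply (continuous_comp (fun s : R => (y - s)%R) w); [|apply Hw].
      apply cont_Rminus; [apply continuous_const|apply continuous_id].
    - exact Hy.
    - apply (Cd_comp w (fun s => (y - s)%R) 0 w1 (-1)); [rewrite Rminus_0_r; exact Hd|apply Rd_sub]. }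
  assert (HS := tends_plus _ _ _ _ HL HR).
  rewrite Rminus_0_r, Rplus_0_l in HS.
  replace (RtoC PI * w y + RtoC PI * w y) with (RtoC (2 * PI) * w y) in HS by (rewrite RtoC_mult; ring).
  revert HS. apply tends_ext with 0%R. intros r Hr.
  assert (Hj : jcont2 (fun l s => Cexp (- (Ci * RtoC l * RtoC (s - y))) * w s)).
  { intros T a b p Ha Hb. apply cont_Cmult.
    - apply (cont_ex a (fun q => (b q - y)%R)); [exact Ha|]. apply cont_Rminus; [exact Hb|apply continuous_const].
    - apply (continuous_comp b w); [exact Hb|apply Hw]. }
  assert (HD : forall l, dom2 K (fun s => Cexp (- (Ci * RtoC l * RtoC (s - y))) * w s)).
  { intro l. apply dom2_mult_le1; [intros s _; rewrite Cmod_Cexp_x; lra|exact HK]. }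
  transitivity (CInt (fun l => CI (fun s => Cexp (- (Ci * RtoC l * RtoC (s - y))) * w s)) (- r) r).
  2: { apply CInt_ext. intros l _. unfold lap.
       rewrite <- (CI_scal _ _ K).
       - apply CI_ext. intros s _. rewrite zc_id by (simpl; lra).
         rewrite Cmult_assoc, <- Cexp_plus. f_equal. f_equal.
         apply injective_projections; simpl; ring.
       - now apply lap_Cont_integrand.
       - intros s Hs. rewrite Cmod_mult. rewrite <- (Rmult_1_l (K * / (1 + s) ^ 2)).
         apply Rmult_le_compat; try apply Cmod_ge_0; [|now apply HK]. now apply Cmod_Cexp_le, Re_Ci_zc. }
  rewrite (CInt_CI_Fubini (fun l s => Cexp (- (Ci * RtoC l * RtoC (s - y))) * w s) K (- r) r Hj HD).
  assert (Hk : Cont (fun s => dker r (s - y) * w s)).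
  { intro s. apply cont_Cmult; [|apply Hw]. apply (continuous_comp (fun s : R => (s - y)%R) (dker r)); [|now apply dker_Cont].
    apply cont_Rminus; [apply continuous_id|apply continuous_const]. }
  assert (Hkd : dom2 (2 * r * K) (fun s => dker r (s - y) * w s)).
  { intros s Hs. rewrite Cmod_mult, Rmult_assoc.
    apply Rmult_le_compat; try apply Cmod_ge_0; [now apply dker_bound|now apply HK]. }
  transitivity (CI (fun s => dker r (s - y) * w s)).
  2: { apply CI_ext. intros s _. unfold dker. rewrite Cmult_comm, <- CInt_scal.
       - apply CInt_ext. intros; ring.
       - apply (jcont2_l (fun l s => Cexp (- (Ci * RtoC l * RtoC s)))), jcont_ex. }
  rewrite (CI_split (fun s : R => dker r (s - y) * w s) _ y Hk Hkd) by lra. apply (f_equal2 Cplus).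
  - symmetry.
    assert (Hk2 : Cont (fun s => dker r s * w (y - s)%R)).
    { intro s. apply cont_Cmult; [now apply dker_Cont|].
      apply (continuous_comp (fun s : R => (y - s)%R) w); [|apply Hw].
      apply cont_Rminus; [apply continuous_const|apply continuous_id]. }
    assert (Hneg := CInt_neg (fun s : R => dker r (s - y) * w s) (- y) 0 Hk).
    rewrite Ropp_involutive, Ropp_0 in Hneg. rewrite <- Hneg.
    assert (Hsh := CInt_shift (fun s : R => dker r s * w (y - s)%R) (- y) 0 y Hk2).
    replace (- y + y)%R with 0%R in Hsh by ring. rewrite Rplus_0_l in Hsh. rewrite <- Hsh.
    apply CInt_ext. intros s _. replace (- s - y)%R with (- (s + y))%R by ring. rewrite dker_even.
    replace (y - (s + y))%R with (- s)%R by ring. reflexivity.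
  - apply CI_ext. intros s _. replace (s + y - y)%R with s by ring. reflexivity.
Qed.

Lemma FI_shift (f : R -> C) (M x : R) : Cont f -> fdom2 M f ->
  fdom2 (M * (1 + Rabs x) ^ 2) (fun s => f (s + x)%R) /\ FI (fun s => f (s + x)%R) = FI f.
Proof.
  intros Hf HM. assert (HMp := dom2_M0 _ _ (fdom2_pos _ _ HM)). assert (Hx := Rabs_pos x).
  assert (HM' : fdom2 (M * (1 + Rabs x) ^ 2) (fun s => f (s + x)%R)).
  { intro s. eapply Rle_trans; [apply HM|]. rewrite Rmult_assoc. apply Rmult_le_compat_l; [exact HMp|].
    assert (Hs := Rabs_pos s). assert (Hsx := Rabs_pos (s + x)).
    assert (Ht : (Rabs s <= Rabs (s + x) + Rabs x)%R).
    { replace s with (s + x + - x)%R at 1 by ring. eapply Rle_trans; [apply Rabs_triang|]. rewrite Rabs_Ropp. lra. }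
    apply Rmult_le_reg_r with ((1 + Rabs (s + x)) ^ 2 * (1 + Rabs s) ^ 2)%R.
    { apply Rmult_lt_0_compat; apply pow_lt; lra. }
    replace (/ (1 + Rabs (s + x)) ^ 2 * ((1 + Rabs (s + x)) ^ 2 * (1 + Rabs s) ^ 2))%R with ((1 + Rabs s) ^ 2)%R by (field; lra).
    replace ((1 + Rabs x) ^ 2 * / (1 + Rabs s) ^ 2 * ((1 + Rabs (s + x)) ^ 2 * (1 + Rabs s) ^ 2))%R
      with ((1 + Rabs x) ^ 2 * (1 + Rabs (s + x)) ^ 2)%R by (field; lra).
    rewrite <- Rpow_mult_distr. apply pow_incr. nra. }
  split; [exact HM'|].
  apply (Ceq_of_bound _ _ (4 * (M * (1 + Rabs x) ^ 2) + 4 * M)). intros r Hr.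
  set (c := (r + Rabs x)%R).
  assert (H1 := FI_tail (fun s : R => f (s + x)%R) _ c c (Cont_shift f x Hf) HM' ltac:(unfold c; lra) ltac:(unfold c; lra)).
  assert (Hxl := Rle_abs x). assert (Hxr := Rle_abs (- x)). rewrite Rabs_Ropp in Hxr.
  assert (H2 := FI_tail f M (c - x) (c + x) Hf HM ltac:(unfold c; lra) ltac:(unfold c; lra)).
  rewrite (CInt_shift f (- c) c x Hf) in H1. replace (- (c - x))%R with (- c + x)%R in H2 by ring.
  match type of H1 with (Cmod (?A - ?J) <= _)%R => match type of H2 with (Cmod (?B - _) <= _)%R =>
    replace (A - B) with ((A - J) - (B - J)) by ring end end.
  eapply Rle_trans; [apply Cmod_triangle|]. rewrite Cmod_opp.
  assert (I1 : (/ (1 + c) <= / (1 + r))%R) by (apply Rinv_le_contravar; unfold c; lra).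
  assert (I2 : (/ (1 + (c - x)) <= / (1 + r))%R) by (apply Rinv_le_contravar; unfold c; lra).
  assert (I3 : (/ (1 + (c + x)) <= / (1 + r))%R) by (apply Rinv_le_contravar; unfold c; lra).
  assert (HMx : (0 <= M * (1 + Rabs x) ^ 2)%R) by (apply Rmult_le_pos; [exact HMp|apply pow_le; lra]).
  nra.
Qed.

(** After translating x to the origin, folding the line gives two half-line Dirichlet integrals,
    each with limit pi f(x). *)
Lemma inversion_line (f : R -> C) (M x : R) (f1 : C) : Cont f -> fdom2 M f -> is_Cderive f x f1 ->
  tends (fun r => CInt (fun k => Cexp (Ci * RtoC k * RtoC x) *
    FI (fun s => Cexp (- (Ci * RtoC s * RtoC k)) * f s)) (- r) r) (RtoC (2 * PI) * f x).
Proof.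
  intros Hf HM Hd.
  set (g := fun s => f (s + x)%R).
  destruct (FI_shift f M x Hf HM) as [HgM _]. fold g in HgM.
  assert (Hg : Cont g) by now apply Cont_shift.
  set (M' := (M * (1 + Rabs x) ^ 2)%R) in *.
  assert (Hdg : is_Cderive g 0%R f1).
  { eapply Cd_eq.
    - apply (Cd_comp f (fun s => (s + x)%R) 0 f1 1); [rewrite Rplus_0_l; exact Hd|]. auto_derive; [exact I|ring].
    - ring. }
  assert (HR := dirichlet_half g M' f1 Hg (fdom2_pos _ _ HgM) Hdg).
  assert (HL := dirichlet_half (fun s => g (- s)%R) M' (RtoC (-1) * f1) (Cont_neg g Hg) (fdom2_neg _ _ HgM)).
  cbv beta in HL. rewrite Ropp_0 in HL.
  assert (HL' := HL ltac:(apply (Cd_comp g (fun s => (- s)%R) 0 f1 (-1)); [rewrite Ropp_0; exact Hdg|auto_derive; [exact I|ring]])).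
  assert (HS := tends_plus _ _ _ _ HR HL').
  replace (RtoC PI * g 0%R + RtoC PI * g 0%R) with (RtoC (2 * PI) * f x) in HS.
  2: { unfold g. rewrite Rplus_0_l, RtoC_mult. ring. }
  revert HS. apply tends_ext with 0%R. intros r Hr.
  assert (Hj : jcont2 (fun k s => Cexp (- (Ci * RtoC k * RtoC s)) * g s)).
  { intros T a b p Ha Hb. apply cont_Cmult; [now apply jcont_ex|]. apply (continuous_comp b g); [exact Hb|apply Hg]. }
  assert (HD : forall k, fdom2 M' (fun s => Cexp (- (Ci * RtoC k * RtoC s)) * g s)).
  { intro k. apply fdom2_mult_le1; [intros s; rewrite Cmod_Cexp_x; lra|exact HgM]. }
  transitivity (CInt (fun k => FI (fun s => Cexp (- (Ci * RtoC k * RtoC s)) * g s)) (- r) r).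
  2: { apply CInt_ext. intros k _.
       assert (Hfc : Cont (fun s => Cexp (- (Ci * RtoC s * RtoC k)) * f s)).
       { intro s. apply cont_Cmult; [|apply Hf]. apply (cont_ex (fun s => s) (fun _ => k)); [apply continuous_id|apply continuous_const]. }
       assert (Hfd : fdom2 M (fun s => Cexp (- (Ci * RtoC s * RtoC k)) * f s)).
       { apply fdom2_mult_le1; [intro; rewrite Cmod_Cexp_x; lra|exact HM]. }
       destruct (FI_shift (fun s : R => Cexp (- (Ci * RtoC s * RtoC k)) * f s) M x Hfc Hfd) as [Hsd Esh].
       cbv beta in Esh, Hsd. rewrite <- Esh.
       rewrite <- (FI_scal _ (fun s : R => Cexp (- (Ci * RtoC (s + x) * RtoC k)) * f (s + x)%R) _
         (Cont_shift (fun s : R => Cexp (- (Ci * RtoC s * RtoC k)) * f s) x Hfc) Hsd).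
       apply FI_ext. intro s. unfold g. rewrite Cmult_assoc, <- Cexp_plus. f_equal. f_equal.
       apply injective_projections; simpl; ring. }
  unfold FI.
  rewrite (CInt_CI_Fubini (fun k s => Cexp (- (Ci * RtoC k * RtoC s)) * g s + Cexp (- (Ci * RtoC k * RtoC (- s))) * g (- s)%R) (M' + M')).
  - assert (Hk : forall g', Cont g' -> Cont (fun s => dker r s * g' s)).
    { intros g' Hg' s. apply cont_Cmult; [now apply dker_Cont|apply Hg']. }
    assert (Hkd : forall g', dom2 M' g' -> dom2 (2 * r * M') (fun s => dker r s * g' s)).
    { intros g' Hg' s Hs. rewrite Cmod_mult, Rmult_assoc.
      apply Rmult_le_compat; try apply Cmod_ge_0; [now apply dker_bound|now apply Hg']. }
    rewrite <- (CI_plus _ _ (2 * r * M') (2 * r * M')).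
    + apply CI_ext. intros s _.
      assert (Hc1 : forall s c, Cont (fun k => Cexp (- (Ci * RtoC k * RtoC s)) * c)).
      { intros s' c k. apply cont_Cmult; [|apply continuous_const].
        apply (jcont2_l (fun l s => Cexp (- (Ci * RtoC l * RtoC s)))), jcont_ex. }
      rewrite CInt_plus by apply Hc1.
      assert (Ec : forall s c, CInt (fun k => Cexp (- (Ci * RtoC k * RtoC s)) * c) (- r) r = dker r s * c).
      { intros s' c. unfold dker. rewrite Cmult_comm, <- CInt_scal.
        - apply CInt_ext. intros; ring.
        - apply (jcont2_l (fun l s => Cexp (- (Ci * RtoC l * RtoC s)))), jcont_ex. }
      rewrite !Ec, dker_even. reflexivity.
    + now apply Hk.
    + apply (Hk (fun s => g (- s)%R)). now apply Cont_neg.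
    + apply Hkd. now apply fdom2_pos.
    + apply (Hkd (fun s => g (- s)%R)). now apply fdom2_neg.
  - exact (jcont2_sym _ Hj).
  - intro k. exact (dom2_plus _ _ _ _ (fdom2_pos _ _ (HD k)) (fdom2_neg _ _ (HD k))).
Qed.

(** * The integral of the initial datum over the real line *)

Section Phase.
Context (y t : R).

Definition ph (k l : R) : R := ((k ^ 2 + l ^ 2) ^ 2 * t + l * y)%R.
Definition dph (k l : R) : R := (4 * t * l * (k ^ 2 + l ^ 2) + y)%R.
Definition ddph (k l : R) : R := (4 * t * (k ^ 2 + 3 * l ^ 2))%R.
Definition eph (k l : R) : C := Cexp (Ci * RtoC (ph k l)).
(** Transform of exp(-s). It has the leading behaviour 1 / (i l) of a transform with boundary value
    1, without a singularity at l = 0. *)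
Definition ai (l : R) : C := / (1 + Ci * RtoC l).
(* Regularised integration by parts: exp(i ph) a = (exp(i ph) pp)' + exp(i ph) rho
   with pp = - i ph' a / (1 + ph'^2), which avoids dividing by the zeros of ph'. *)
Definition pp (k l : R) : C := - Ci * ai l * RtoC (dph k l / (1 + dph k l ^ 2)).
Definition rho (k l : R) : C :=
  ai l * RtoC (/ (1 + dph k l ^ 2)) +
  Ci * ((- Ci * (ai l * ai l)) * RtoC (dph k l / (1 + dph k l ^ 2)) +
        ai l * RtoC (ddph k l * (1 - dph k l ^ 2) / (1 + dph k l ^ 2) ^ 2)).

Lemma Cd_ai l : is_Cderive ai l (- Ci * (ai l * ai l)).
Proof.
  assert (Hq : forall x, (1 + x * x <> 0)%R) by (intro; nra).
  apply (is_derive_ext (fun l => (/ (1 + l * l), - l / (1 + l * l))%R)).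
  { intro x. unfold ai. apply injective_projections; simpl; field; specialize (Hq x); nra. }
  eapply Cd_eq.
  - apply (Cd_pair (fun l => / (1 + l * l))%R (fun l => - l / (1 + l * l))%R l
      (- (2 * l) / (1 + l * l) ^ 2)%R ((l * l - 1) / (1 + l * l) ^ 2)%R).
    + auto_derive; [apply Hq|]. field. apply Hq.
    + auto_derive; [apply Hq|]. field. apply Hq.
  - unfold ai. apply injective_projections; simpl; field; specialize (Hq l); nra.
Qed.

Lemma Rd_ph k l : is_derive (ph k) l (dph k l).
Proof. unfold ph, dph. auto_derive; [exact I|ring]. Qed.
Lemma Rd_quot k l : is_derive (fun l => dph k l / (1 + dph k l ^ 2))%R l
  (ddph k l * (1 - dph k l ^ 2) / (1 + dph k l ^ 2) ^ 2)%R.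
Proof.
  assert (H1 : is_derive (dph k) l (ddph k l)) by (unfold dph, ddph; auto_derive; [exact I|ring]).
  assert (H2 : is_derive (fun q => q / (1 + q ^ 2))%R (dph k l)
    ((1 - dph k l ^ 2) / (1 + dph k l ^ 2) ^ 2)%R).
  { assert (0 <= dph k l ^ 2)%R by apply pow2_ge_0. auto_derive; [lra|]. field. lra. }
  replace (ddph k l * (1 - dph k l ^ 2) / (1 + dph k l ^ 2) ^ 2)%R
    with (scal (ddph k l) ((1 - dph k l ^ 2) / (1 + dph k l ^ 2) ^ 2)%R)
    by (unfold scal; simpl; unfold mult; simpl; unfold Rdiv; ring).
  exact (is_derive_comp _ _ _ _ _ H2 H1).
Qed.

Lemma Cd_pp k l : is_Cderive (fun l => eph k l * pp k l) l (eph k l * (ai l - rho k l)).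
Proof.
  eapply Cd_eq.
  - apply Cd_mult.
    + apply (Cd_Cexp (fun l => Ci * RtoC (ph k l))), Cd_scal, Cd_RtoC, Rd_ph.
    + apply Cd_mult; [apply Cd_scal, Cd_ai|apply Cd_RtoC, Rd_quot].
  - cbv beta. fold (eph k l). unfold pp, rho.
    assert (E1 : RtoC (dph k l) * RtoC (dph k l / (1 + dph k l ^ 2)) = 1 - RtoC (/ (1 + dph k l ^ 2))).
    { rewrite <- RtoC_mult, <- RtoC_minus. f_equal. field. nra. }
    set (q := RtoC (dph k l / (1 + dph k l ^ 2))) in *.
    set (v := RtoC (ddph k l * (1 - dph k l ^ 2) / (1 + dph k l ^ 2) ^ 2)).
    assert (ECi : Ci * Ci = - (1)) by (apply injective_projections; simpl; ring).
    transitivity (eph k l * (- (Ci * Ci) * ai l * (RtoC (dph k l) * q) - Ci * ((- Ci * (ai l * ai l)) * q + ai l * v))); [ring|].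
    rewrite E1, ECi. ring.
Qed.

Lemma Cmod_eph k l : Cmod (eph k l) = 1%R.
Proof.
  unfold eph. rewrite Cmod_Cexp. replace (Re (Ci * RtoC (ph k l))) with 0%R; [apply exp_0|].
  unfold Re; simpl; ring.
Qed.
Lemma Cmod_ai_sq l : (Cmod (ai l) * Cmod (ai l) = / (1 + l ^ 2))%R.
Proof.
  unfold ai. rewrite Cmod_inv by apply one_plus_il_neq.
  assert (E : (Cmod (1 + Ci * RtoC l) ^ 2 = 1 + l ^ 2)%R).
  { rewrite Cmod_sqE. unfold Re, Im; simpl. ring. }
  rewrite <- E. field. intro E0. apply Cmod_eq_0 in E0. now apply one_plus_il_neq in E0.
Qed.
Lemma Cmod_ai_le1 l : (Cmod (ai l) <= 1)%R.
Proof.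
  assert (H := Cmod_ai_sq l). assert (H0 := Cmod_ge_0 (ai l)).
  assert (H1 : (/ (1 + l ^ 2) <= 1)%R).
  { apply Rle_trans with (/ 1)%R; [apply Rinv_le_contravar; nra|rewrite Rinv_1; lra]. }
  nra.
Qed.
Lemma Cmod_ai_le_inv l : (0 < Rabs l)%R -> (Cmod (ai l) <= / Rabs l)%R.
Proof.
  intro Hl. unfold ai. rewrite Cmod_inv by apply one_plus_il_neq.
  apply Rinv_le_contravar; [exact Hl|]. assert (H := Im_le_Cmod (1 + Ci * RtoC l)).
  replace (Im (1 + Ci * RtoC l)) with l in H by (unfold Im; simpl; ring). exact H.
Qed.

Lemma quot_bound d : (Rabs (d / (1 + d ^ 2)) <= 1)%R.
Proof.
  unfold Rdiv. rewrite Rabs_mult, (Rabs_pos_eq (/ _)) by (left; apply Rinv_0_lt_compat; nra).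
  apply Rle_div_l; [nra|]. rewrite <- (pow2_abs d). assert (H := Rabs_pos d). nra.
Qed.

Lemma pp_bound k l : (0 < Rabs l)%R -> (Cmod (pp k l) <= / Rabs l)%R.
Proof.
  intro Hl. unfold pp. rewrite !Cmod_mult, Cmod_opp, Cmod_Ci, Cmod_R, Rmult_1_l.
  assert (H1 := Cmod_ai_le_inv l Hl). assert (H2 := quot_bound (dph k l)). assert (H3 := Cmod_ge_0 (ai l)).
  assert (H4 := Rabs_pos (dph k l / (1 + dph k l ^ 2))). nra.
Qed.

(** For large |l| the phase derivative is of size at least 2 t |l|^3 uniformly in k, because the
    terms l k^2 and l^3 have the same sign. [Q] marks where the constant y is absorbed; the two
    summands of [c] serve |l| <= [Q] and |l| > [Q]. *)
Lemma dph_lower : (0 < t)%R -> (0 < y)%R ->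
  exists c, (0 < c)%R /\ forall k l, (/ (1 + dph k l ^ 2) <= c * / (1 + l ^ 2) ^ 2)%R.
Proof.
  intros Ht Hy. set (Q := Rmax 1 (y / (2 * t))).
  assert (HQ1 : (1 <= Q)%R) by apply Rmax_l. assert (HQ2 : (y / (2 * t) <= Q)%R) by apply Rmax_r.
  set (c := ((1 + Q ^ 2) ^ 2 + / t ^ 2)%R).
  assert (Hi : (0 < / t ^ 2)%R) by (apply Rinv_0_lt_compat, pow_lt; exact Ht).
  assert (Hc : (0 < c)%R) by (unfold c; nra).
  exists c. split; [exact Hc|]. intros k l.
  assert (Hl2 : (0 < (1 + l ^ 2) ^ 2)%R) by (apply pow_lt; nra).
  assert (Hd2 : (0 < 1 + dph k l ^ 2)%R) by nra.
  apply Rmult_le_reg_r with ((1 + dph k l ^ 2) * (1 + l ^ 2) ^ 2)%R; [now apply Rmult_lt_0_compat|].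
  replace (/ (1 + dph k l ^ 2) * ((1 + dph k l ^ 2) * (1 + l ^ 2) ^ 2))%R with ((1 + l ^ 2) ^ 2)%R by (field; lra).
  replace (c * / (1 + l ^ 2) ^ 2 * ((1 + dph k l ^ 2) * (1 + l ^ 2) ^ 2))%R with (c * (1 + dph k l ^ 2))%R by (field; nra).
  destruct (Rle_lt_dec (Rabs l) Q) as [Hl|Hl].
  - apply Rle_trans with ((1 + Q ^ 2) ^ 2 * 1)%R.
    + rewrite Rmult_1_r. apply pow_incr. rewrite <- (pow2_abs l). assert (H := Rabs_pos l). nra.
    + assert (H1 : (0 <= (1 + Q ^ 2) ^ 2)%R) by (apply pow_le; nra).
      apply Rmult_le_compat; try lra; unfold c; nra.
  - assert (Hq : (y <= 2 * t * Rabs l)%R).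
    { assert (H : (y / (2 * t) <= Rabs l)%R) by lra. apply Rle_div_l in H; lra. }
    set (q := Rabs l) in *. assert (Eq : (q ^ 2 = l ^ 2)%R) by apply pow2_abs.
    assert (Hq3 : (q <= q ^ 3)%R) by (assert (1 <= q ^ 2)%R by nra; nra).
    assert (Hyq : (y <= 2 * t * q ^ 3)%R) by nra.
    assert (Hd : (2 * t * q ^ 3 <= Rabs (dph k l))%R).
    { unfold dph.
      assert (H1 : (4 * t * q ^ 3 <= Rabs (4 * t * l * (k ^ 2 + l ^ 2)))%R).
      { rewrite !Rabs_mult. fold q. rewrite (Rabs_pos_eq 4), (Rabs_pos_eq t), (Rabs_pos_eq (k ^ 2 + l ^ 2)) by nra.
        rewrite <- Eq. assert (0 <= k ^ 2)%R by nra.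
        replace (4 * t * q * (k ^ 2 + q ^ 2))%R with (4 * t * q ^ 3 + 4 * t * q * k ^ 2)%R by ring.
        assert (0 <= 4 * t * q * k ^ 2)%R by (apply Rmult_le_pos; [nra|assumption]). lra. }
      assert (H2 := Rabs_triang_inv (4 * t * l * (k ^ 2 + l ^ 2)) (- y)).
      rewrite Rabs_Ropp, (Rabs_pos_eq y) in H2 by lra. unfold Rminus in H2. rewrite Ropp_involutive in H2. lra. }
    assert (Hd' : (4 * t ^ 2 * q ^ 4 <= dph k l ^ 2)%R).
    { rewrite <- (pow2_abs (dph k l)).
      apply Rle_trans with ((2 * t * q ^ 3) ^ 2)%R.
      - replace ((2 * t * q ^ 3) ^ 2)%R with (4 * t ^ 2 * (q ^ 4 * q ^ 2))%R by ring.
        apply Rmult_le_compat_l; [nra|]. assert (1 <= q ^ 2)%R by nra. assert (0 <= q ^ 4)%R by (apply pow_le; lra). nra.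
      - apply pow_incr. split; [|exact Hd]. apply Rmult_le_pos; [lra|apply pow_le; lra]. }
    apply Rle_trans with (/ t ^ 2 * (4 * t ^ 2 * q ^ 4))%R.
    + replace (/ t ^ 2 * (4 * t ^ 2 * q ^ 4))%R with ((2 * q ^ 2) ^ 2)%R by (field; lra).
      apply pow_incr. rewrite <- Eq. nra.
    + apply Rmult_le_compat; try (unfold c; nra).
Qed.

(** The second derivative of the phase grows like k^2 + l^2; [dph_lower] absorbs its growth in l but
    not in k, whence the factor 1 + k^2. The decay in l is integrable, which was the purpose of the
    integration by parts. *)
Lemma rho_bound : (0 < t)%R -> (0 < y)%R ->
  exists D, (0 <= D)%R /\ forall k l, (Cmod (rho k l) <= D * (1 + k ^ 2) * / (1 + l ^ 2))%R.
Proof.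
  intros Ht Hy. destruct (dph_lower Ht Hy) as (c & Hc & H).
  exists (c + 1 + 12 * t * c)%R. split; [nra|]. intros k l.
  specialize (H k l).
  set (i2 := (/ (1 + dph k l ^ 2))%R) in *.
  assert (Hi2 : (0 < i2)%R) by (apply Rinv_0_lt_compat; nra).
  set (j := (/ (1 + l ^ 2))%R).
  assert (Hj : (0 < j)%R) by (apply Rinv_0_lt_compat; nra).
  assert (Hj1 : (j * (1 + l ^ 2) = 1)%R) by (unfold j; field; nra).
  assert (Ej : (/ (1 + l ^ 2) ^ 2 = j * j)%R) by (unfold j; field; nra).
  rewrite Ej in H.
  assert (Hjle : (j <= 1)%R) by nra.
  assert (B1 : (Cmod (ai l * RtoC i2) <= c * j)%R).
  { rewrite Cmod_mult, Cmod_R, Rabs_pos_eq by lra. assert (H1 := Cmod_ai_le1 l). assert (H2 := Cmod_ge_0 (ai l)).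
    apply Rle_trans with (1 * (c * (j * j)))%R; [apply Rmult_le_compat; lra|]. rewrite Rmult_1_l.
    apply Rmult_le_compat_l; [lra|nra]. }
  assert (B2 : (Cmod ((- Ci * (ai l * ai l)) * RtoC (dph k l / (1 + dph k l ^ 2))) <= j)%R).
  { rewrite !Cmod_mult, Cmod_opp, Cmod_Ci, Rmult_1_l, Cmod_ai_sq, Cmod_R. fold j.
    assert (H1 := quot_bound (dph k l)). assert (H2 := Rabs_pos (dph k l / (1 + dph k l ^ 2))). nra. }
  assert (B3 : (Cmod (ai l * RtoC (ddph k l * (1 - dph k l ^ 2) / (1 + dph k l ^ 2) ^ 2)) <= 12 * t * c * (1 + k ^ 2) * j)%R).
  { rewrite Cmod_mult, Cmod_R. assert (H1 := Cmod_ai_le1 l). assert (H2 := Cmod_ge_0 (ai l)).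
    assert (H3 : (Rabs (ddph k l * (1 - dph k l ^ 2) / (1 + dph k l ^ 2) ^ 2) <= ddph k l * i2)%R).
    { replace (ddph k l * (1 - dph k l ^ 2) / (1 + dph k l ^ 2) ^ 2)%R with (ddph k l * i2 * ((1 - dph k l ^ 2) * i2))%R
        by (unfold i2; field; assert (0 <= dph k l ^ 2)%R by apply pow2_ge_0; lra).
      assert (Hdd : (0 <= ddph k l)%R) by (unfold ddph; nra).
      rewrite Rabs_mult, (Rabs_pos_eq (ddph k l * i2)) by (apply Rmult_le_pos; lra).
      rewrite <- (Rmult_1_r (ddph k l * i2)) at 2. apply Rmult_le_compat_l; [apply Rmult_le_pos; lra|].
      assert (Hx : (i2 * (1 + dph k l ^ 2) = 1)%R) by (unfold i2; field; assert (0 <= dph k l ^ 2)%R by apply pow2_ge_0; lra).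
      apply Rabs_le. set (d2 := (dph k l ^ 2)%R) in *. assert (0 <= d2)%R by (unfold d2; nra). nra. }
    assert (H4 : (ddph k l <= 12 * t * (1 + k ^ 2) * (1 + l ^ 2))%R).
    { unfold ddph. assert (0 <= k ^ 2 * l ^ 2)%R by (apply Rmult_le_pos; apply pow2_ge_0).
      assert (0 <= k ^ 2)%R by apply pow2_ge_0.
      replace (12 * t * (1 + k ^ 2) * (1 + l ^ 2))%R with
        (4 * t * (3 + 3 * k ^ 2 + 3 * l ^ 2 + 3 * (k ^ 2 * l ^ 2)))%R by ring.
      apply Rmult_le_compat_l; lra. }
    assert (Hdd : (0 <= ddph k l)%R) by (unfold ddph; nra).
    apply Rle_trans with (1 * (12 * t * (1 + k ^ 2) * (1 + l ^ 2) * (c * (j * j))))%R.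
    - apply Rmult_le_compat; [exact H2|apply Rabs_pos|exact H1|].
      eapply Rle_trans; [exact H3|]. apply Rmult_le_compat; lra.
    - right. replace (1 * (12 * t * (1 + k ^ 2) * (1 + l ^ 2) * (c * (j * j))))%R with
        (12 * t * c * (1 + k ^ 2) * j * (j * (1 + l ^ 2)))%R by ring. rewrite Hj1. ring. }
  unfold rho. fold i2. eapply Rle_trans; [apply Cmod_triangle|]. rewrite (Cmod_mult Ci), Cmod_Ci, Rmult_1_l.
  assert (B4 := Cmod_triangle ((- Ci * (ai l * ai l)) * RtoC (dph k l / (1 + dph k l ^ 2)))
    (ai l * RtoC (ddph k l * (1 - dph k l ^ 2) / (1 + dph k l ^ 2) ^ 2))).
  assert (Hk : (0 <= k ^ 2)%R) by nra.
  apply Rle_trans with (c * j + (j + 12 * t * c * (1 + k ^ 2) * j))%R; [lra|].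
  replace ((c + 1 + 12 * t * c) * (1 + k ^ 2) * j)%R with
    (c * j + j + 12 * t * c * (1 + k ^ 2) * j + (c + 1) * (k ^ 2 * j))%R by ring.
  assert (0 <= (c + 1) * (k ^ 2 * j))%R by (apply Rmult_le_pos; [lra|apply Rmult_le_pos; lra]). lra.
Qed.

Lemma ph_cont {T : UniformSpace} (a b : T -> R) (p : T) : continuous a p -> continuous b p ->
  continuous (fun q => ph (a q) (b q)) p /\ continuous (fun q => dph (a q) (b q)) p /\ continuous (fun q => ddph (a q) (b q)) p.
Proof.
  intros Ha Hb.
  assert (Ha2 : continuous (fun q => a q ^ 2)%R p) by now apply cont_Rpow.
  assert (Hb2 : continuous (fun q => b q ^ 2)%R p) by now apply cont_Rpow.
  assert (Hs : continuous (fun q => a q ^ 2 + b q ^ 2)%R p) by now apply cont_Rplus.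
  repeat split.
  - apply cont_Rplus; apply cont_Rmult; [now apply cont_Rpow|apply continuous_const|exact Hb|apply continuous_const].
  - apply cont_Rplus; [|apply continuous_const]. apply cont_Rmult; [|exact Hs].
    apply cont_Rmult; [apply continuous_const|exact Hb].
  - apply cont_Rmult; [apply continuous_const|]. apply cont_Rplus; [exact Ha2|].
    apply cont_Rmult; [apply continuous_const|exact Hb2].
Qed.
Lemma cont_ai {T : UniformSpace} (b : T -> R) (p : T) : continuous b p -> continuous (fun q => ai (b q)) p.
Proof.
  intro Hb. apply cont_Cinv; [apply one_plus_il_neq|]. apply cont_Cplus; [apply continuous_const|].
  apply cont_Cmult; [apply continuous_const|now apply cont_RtoC].
Qed.
Lemma eph_jcont : jcont2 eph.
Proof.
  intros T a b p Ha Hb. apply cont_Cexp, cont_Cmult; [apply continuous_const|]. apply cont_RtoC. exact (proj1 (ph_cont a b p Ha Hb)).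
Qed.
Lemma cont_1d {T : UniformSpace} (a b : T -> R) (p : T) (n : nat) : continuous a p -> continuous b p ->
  continuous (fun q => ((1 + dph (a q) (b q) ^ 2) ^ n)%R) p.
Proof.
  intros Ha Hb. apply cont_Rpow, cont_Rplus; [apply continuous_const|]. apply cont_Rpow. exact (proj1 (proj2 (ph_cont a b p Ha Hb))).
Qed.
Lemma rho_jcont : jcont2 rho.
Proof.
  intros T a b p Ha Hb. destruct (ph_cont a b p Ha Hb) as (H1 & H2 & H3). assert (Hai := cont_ai b p Hb).
  assert (Hd2 : continuous (fun q => dph (a q) (b q) ^ 2)%R p) by now apply cont_Rpow.
  assert (Hd : continuous (fun q => 1 + dph (a q) (b q) ^ 2)%R p).
  { apply cont_Rplus; [apply continuous_const|exact Hd2]. }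
  assert (Hn : (1 + dph (a p) (b p) ^ 2 <> 0)%R).
  { assert (0 <= dph (a p) (b p) ^ 2)%R by apply pow2_ge_0. lra. }
  apply cont_Cplus.
  - apply cont_Cmult; [exact Hai|]. apply cont_RtoC, cont_Rinv; [exact Hn|exact Hd].
  - apply cont_Cmult; [apply continuous_const|]. apply cont_Cplus; apply cont_Cmult.
    + apply cont_Cmult; [apply continuous_const|]. apply cont_Cmult; exact Hai.
    + apply cont_RtoC, cont_Rdiv; [exact Hn|exact H2|exact Hd].
    + exact Hai.
    + apply cont_RtoC, cont_Rdiv; [now apply pow_nonzero| |now apply cont_1d].
      apply cont_Rmult; [exact H3|]. apply cont_Rminus; [apply continuous_const|exact Hd2].
Qed.
End Phase.

Lemma inv_sq_le l : (/ (1 + l ^ 2) <= 2 * / (1 + Rabs l) ^ 2)%R.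
Proof.
  assert (H := Rabs_pos l). rewrite <- (pow2_abs l).
  replace (2 * / (1 + Rabs l) ^ 2)%R with (/ ((1 + Rabs l) ^ 2 / 2))%R by (field; lra).
  assert (H1 := pow2_ge_0 (1 - Rabs l)).
  assert (H2 : (0 < (1 + Rabs l) ^ 2)%R) by (apply pow_lt; lra).
  apply Rinv_le_contravar; [|simpl in *]; lra.
Qed.

(** * Splitting of the transformed initial datum *)

Section InitialIntegral.
Context (tmax M : R) (u : R -> R -> R -> C) (V : list axis -> R -> R -> R -> C).
Context (HV : smooth_ext 8 tmax M u V) (y t : R) (Hy : (0 < y)%R) (Ht : (0 < t < tmax)%R).

Notation W j := (fun k s => fourier_x (V (repeat Y j)) k s 0).
Notation L j k l := (lap (fun s => fourier_x (V (repeat Y j)) k s 0) (- RtoC l)).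

Lemma W_dom4 j k : (j <= 2)%nat -> dom4 (8 * M * / (1 + k ^ 2)) (W j k).
Proof.
  intros Hj s Hs.
  assert (H := fx_decay2 tmax M u V HV (repeat Y j) k s 0%R ltac:(rewrite repeat_length; lia)).
  rewrite (Rmax_right 0 s) in H by exact Hs.
  assert (Hk : (0 < 1 + k ^ 2)%R) by nra.
  apply Rmult_le_reg_l with (1 + k ^ 2)%R; [exact Hk|].
  eapply Rle_trans; [exact H|]. right. field. split; [lra|nra].
Qed.
Lemma W_Cont j k : (j <= 8)%nat -> Cont (W j k).
Proof.
  intros Hj. assert (H := fx_jcont3 tmax M u V HV (repeat Y j) ltac:(rewrite repeat_length; lia)).
  apply (jcont2_l (fun s tau => fourier_x (V (repeat Y j)) k s tau)). exact (jcont3_23 _ k H).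
Qed.
Lemma W_jcont j : (j <= 8)%nat -> jcont2 (W j).
Proof.
  intros Hj. assert (H := fx_jcont3 tmax M u V HV (repeat Y j) ltac:(rewrite repeat_length; lia)).
  exact (jcont3_12 _ 0%R H).
Qed.

Lemma L_bound j k l : (j <= 2)%nat -> (Cmod (L j k l) <= 16 * M * / (1 + k ^ 2))%R.
Proof.
  intro Hj. eapply Rle_trans; [apply (lap_bound _ _ (W_Cont j k ltac:(lia)) (W_dom4 j k Hj))|]. right; ring.
Qed.
Lemma L_jcont j : (j <= 2)%nat -> jcont2 (fun k l => L j k l).
Proof.
  intros Hj T a b p Ha Hb.
  assert (HW := W_jcont j ltac:(lia)). assert (HM := ext_bound_nonneg tmax M u V HV).
  apply (continuous_comp (fun q => (a q, b q)) (fun z : R * R => L j (fst z) (snd z))).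
  { now apply continuous_pair. }
  apply (cont_CI_param (fun (z : R * R) s => Cexp (Ci * zc (- RtoC (snd z)) * RtoC s) * W j (fst z) s) (8 * M)).
  - intros q s. apply cont_Cmult.
    + apply cont_Cexp, (cont_Cexp_zc (fun z : R * R * R => - RtoC (snd (fst z))) (fun z => snd z)).
      * apply cont_Copp, cont_RtoC, cont_snd, continuous_fst.
      * apply continuous_snd.
    + apply (HW _ (fun z : R * R * R => fst (fst z)) (fun z => snd z)); [apply cont_fst, continuous_fst|apply continuous_snd].
  - intros q s Hs. eapply Rle_trans; [apply (lap_dom2 _ _ (W_dom4 j (fst q) Hj)); exact Hs|].
    assert (Hi := inv_pow_pos 2 s Hs).
    apply Rmult_le_compat_r; [lra|]. rewrite <- (Rmult_1_r (8 * M)) at 2. apply Rmult_le_compat_l; [lra|].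
    apply Rle_trans with (/ 1)%R; [apply Rinv_le_contravar; nra|rewrite Rinv_1; lra].
Qed.

(** The remainder of L[w] after the leading term w(0) / (1 + i l). It comes from integrating (1 +
    d_s)^2 w by parts twice, since (1 + i l)^2 L[w] equals the transform of (1 + d_s)^2 w plus
    boundary values; hence it is O(l^(-2)). *)
Definition tail_symbol (k l : R) : C :=
  (W 0%nat k 0%R + W 1%nat k 0%R + (L 0%nat k l + 2 * L 1%nat k l + L 2%nat k l)) * (ai l * ai l).

Lemma L_expand k l : L 0%nat k l = W 0%nat k 0%R * ai l + tail_symbol k l.
Proof.
  assert (Hne := one_plus_il_neq l).
  assert (HS := halfline_solution_fourier k tmax M u V HV).
  assert (E1 := lap_succ k tmax (4 * M) _ _ HS 0 0%R (- RtoC l) ltac:(lia) ltac:(simpl; lra)).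
  assert (E2 := lap_succ k tmax (4 * M) _ _ HS 1 0%R (- RtoC l) ltac:(lia) ltac:(simpl; lra)).
  cbv beta in E1, E2. unfold tail_symbol. cbv beta.
  set (L0 := L 0%nat k l) in *. set (L1 := L 1%nat k l) in *. set (L2 := L 2%nat k l) in *.
  set (a0 := fourier_x (V (repeat Y 0)) k 0 0) in *. set (a1 := fourier_x (V (repeat Y 1)) k 0 0) in *.
  rewrite E2, E1. unfold ai. field. exact Hne.
Qed.

(** Absolutely integrable replacement for the integrand of the datum: in the leading term [ai] is
    replaced by [rho], which changes the integrand by the exact derivative of a function vanishing
    at infinity. *)
Definition full_symbol (k l : R) : C := eph y t k l * (W 0%nat k 0%R * rho y t k l + tail_symbol k l).

Lemma full_symbol_jcont : jcont2 full_symbol.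
Proof.
  intros T a b p Ha Hb.
  assert (HW0 := W_jcont 0 ltac:(lia)). assert (HW1 := W_jcont 1 ltac:(lia)).
  assert (H0 : continuous (fun q => W 0%nat (a q) 0%R) p) by (apply (HW0 _ a (fun _ => 0%R)); [exact Ha|apply continuous_const]).
  assert (H1 : continuous (fun q => W 1%nat (a q) 0%R) p) by (apply (HW1 _ a (fun _ => 0%R)); [exact Ha|apply continuous_const]).
  assert (HL : forall j, (j <= 2)%nat -> continuous (fun q => L j (a q) (b q)) p).
  { intros j Hj. exact (L_jcont j Hj T a b p Ha Hb). }
  assert (Hai := cont_ai b p Hb).
  apply cont_Cmult; [exact (eph_jcont y t T a b p Ha Hb)|]. apply cont_Cplus.
  - apply cont_Cmult; [exact H0|exact (rho_jcont y t T a b p Ha Hb)].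
  - apply cont_Cmult.
    + apply cont_Cplus; [apply cont_Cplus; [exact H0|exact H1]|].
      apply cont_Cplus; [apply cont_Cplus|]; [exact (HL 0%nat ltac:(lia))| |exact (HL 2%nat ltac:(lia))].
      apply cont_Cmult; [apply continuous_const|exact (HL 1%nat ltac:(lia))].
    + apply cont_Cmult; exact Hai.
Qed.

(** The growth 1 + k^2 of [rho] is compensated by [fx_decay4], leaving 16 M D / (1 + k^2). The tail
    contributes 8 + 8 from the boundary values and 16 + 32 + 16 from the three transforms, in total
    80 M / (1 + k^2). *)
Lemma full_symbol_bound : exists D, (0 <= D)%R /\ forall k, fdom2 (D * / (1 + k ^ 2)) (full_symbol k).
Proof.
  destruct (rho_bound y t ltac:(lra) Hy) as (D & HD & Hrho).
  assert (HM := ext_bound_nonneg tmax M u V HV).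
  exists (2 * (16 * M * D + 80 * M))%R. split; [nra|].
  intros k l. unfold full_symbol. rewrite Cmod_mult, Cmod_eph, Rmult_1_l.
  assert (Hk : (0 < 1 + k ^ 2)%R) by nra.
  set (i := (/ (1 + k ^ 2))%R). assert (Hi : (0 < i)%R) by now apply Rinv_0_lt_compat.
  assert (Hi1 : (i * (1 + k ^ 2) = 1)%R) by (unfold i; field; nra).
  set (j := (/ (1 + l ^ 2))%R). assert (Hj : (0 < j)%R) by (apply Rinv_0_lt_compat; nra).
  assert (E40 : (/ (1 + Rmax 0 0) ^ 4 = 1)%R).
  { rewrite Rmax_left by lra. replace ((1 + 0) ^ 4)%R with 1%R by ring. apply Rinv_1. }
  assert (H0 : (Cmod (W 0%nat k 0%R) <= 16 * M * (i * i))%R).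
  { assert (H := fx_decay4 tmax M u V HV (repeat Y 0) k 0%R 0%R ltac:(simpl; lia)). rewrite E40 in H.
    set (a0 := Cmod (fourier_x (V (repeat Y 0)) k 0 0)) in *.
    replace a0 with ((i * (1 + k ^ 2)) * (i * (1 + k ^ 2)) * a0)%R by (rewrite Hi1; ring).
    replace (i * (1 + k ^ 2) * (i * (1 + k ^ 2)) * a0)%R with ((i * i) * ((1 + k ^ 2) ^ 2 * a0))%R by ring.
    rewrite (Rmult_comm (16 * M)). apply Rmult_le_compat_l; [nra|lra]. }
  assert (H01 : forall n, (n <= 2)%nat -> (Cmod (W n k 0%R) <= 8 * M * i)%R).
  { intros n Hn. assert (H := W_dom4 n k Hn 0%R ltac:(lra)). cbv beta in H. fold i in H.
    replace ((1 + 0) ^ 4)%R with 1%R in H by ring. rewrite Rinv_1, Rmult_1_r in H. exact H. }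
  assert (HL : forall n, (n <= 2)%nat -> (Cmod (L n k l) <= 16 * M * i)%R) by (intros n Hn; now apply L_bound).
  assert (HA : (Cmod (W 0%nat k 0%R * rho y t k l) <= 16 * M * D * i * j)%R).
  { rewrite Cmod_mult. apply Rle_trans with (16 * M * (i * i) * (D * (1 + k ^ 2) * j))%R.
    - apply Rmult_le_compat; try apply Cmod_ge_0; [exact H0|apply Hrho].
    - right. replace (16 * M * (i * i) * (D * (1 + k ^ 2) * j))%R with (16 * M * D * i * j * (i * (1 + k ^ 2)))%R by ring.
      rewrite Hi1. ring. }
  assert (HB : (Cmod (tail_symbol k l) <= 80 * M * i * j)%R).
  { unfold tail_symbol. rewrite Cmod_mult, Cmod_mult, Cmod_ai_sq. fold j.
    apply Rmult_le_compat_r; [lra|].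
    assert (Q0 := H01 0%nat ltac:(lia)). assert (Q1 := H01 1%nat ltac:(lia)).
    assert (P0 := HL 0%nat ltac:(lia)). assert (P1 := HL 1%nat ltac:(lia)). assert (P2 := HL 2%nat ltac:(lia)).
    cbv beta in Q0, Q1, P0, P1, P2 |- *.
    set (a0 := fourier_x (V (repeat Y 0)) k 0 0) in *. set (a1 := fourier_x (V (repeat Y 1)) k 0 0) in *.
    set (L0 := L 0%nat k l) in *. set (L1 := L 1%nat k l) in *. set (L2 := L 2%nat k l) in *.
    eapply Rle_trans; [apply Cmod_triangle|].
    assert (T1 := Cmod_triangle a0 a1). assert (T2 := Cmod_triangle (L0 + 2 * L1) L2).
    assert (T3 := Cmod_triangle L0 (2 * L1)). rewrite (Cmod_mult 2 L1), Cmod_R, Rabs_pos_eq in T3 by lra. lra. }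
  eapply Rle_trans; [apply Cmod_triangle|].
  apply Rle_trans with ((16 * M * D + 80 * M) * i * j)%R; [lra|].
  assert (Hjl := inv_sq_le l). fold j in Hjl.
  replace (2 * (16 * M * D + 80 * M) * i * / (1 + Rabs l) ^ 2)%R with
    ((16 * M * D + 80 * M) * i * (2 * / (1 + Rabs l) ^ 2))%R by ring.
  apply Rmult_le_compat_l; [|exact Hjl]. apply Rmult_le_pos; nra.
Qed.

(** The truncated integrals of the original integrand and of [full_symbol] differ by the values of
    w(0) [eph] [pp] at r and - r, which are O(1 / r). *)
Lemma initial_tends k :
  tends (fun r => CInt (fun l => eph y t k l * L 0%nat k l) (- r) r) (FI (full_symbol k)).
Proof.
  destruct full_symbol_bound as (D & HD & HB). specialize (HB k).
  set (K := (D * / (1 + k ^ 2))%R) in *.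
  assert (HFC : Cont (full_symbol k)) by (apply (jcont2_r full_symbol), full_symbol_jcont).
  assert (HK : (0 <= K)%R) by exact (dom2_M0 _ _ (fdom2_pos _ _ HB)).
  set (c0 := W 0%nat k 0%R).
  assert (Hmain : Cont (fun l => c0 * (eph y t k l * (ai l - rho y t k l)))).
  { intro l. apply cont_Cmult; [apply continuous_const|]. apply cont_Cmult; [apply (jcont2_r _ k (eph_jcont y t))|].
    apply cont_Cminus; [apply (cont_ai (fun l => l)), continuous_id|apply (jcont2_r _ k (rho_jcont y t))]. }
  apply (tends_ext (fun r => (c0 * (eph y t k r * pp y t k r) - c0 * (eph y t k (- r) * pp y t k (- r))) + CInt (full_symbol k) (- r) r) _ _ 1).
  - intros r Hr.
    assert (E : CInt (fun l => c0 * (eph y t k l * (ai l - rho y t k l))) (- r) r =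
      c0 * (eph y t k r * pp y t k r) - c0 * (eph y t k (- r) * pp y t k (- r))).
    { apply (CInt_FTC (fun l => c0 * (eph y t k l * pp y t k l))); [lra|exact Hmain| |].
      - intros l _. apply (is_Cderive_continuous _ _ _ (Cd_scal c0 _ _ _ (Cd_pp y t k l))).
      - intros l _. apply (Cd_scal c0), Cd_pp. }
    rewrite <- E. rewrite <- CInt_plus by (exact Hmain || exact HFC).
    apply CInt_ext. intros l _. unfold full_symbol. rewrite (L_expand k l). fold c0. cbv beta. fold c0. ring.
  - replace (FI (full_symbol k)) with (0 + FI (full_symbol k)) by ring.
    apply tends_plus.
    + apply (tends_of_bound _ _ (2 * Cmod c0) 1). intros r Hr.
      replace (c0 * (eph y t k r * pp y t k r) - c0 * (eph y t k (- r) * pp y t k (- r)) - 0) with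
        (c0 * (eph y t k r * pp y t k r - eph y t k (- r) * pp y t k (- r))) by ring.
      rewrite Cmod_mult. assert (Hc0 := Cmod_ge_0 c0).
      replace (2 * Cmod c0 / r)%R with (Cmod c0 * (/ r + / r))%R by (field; lra).
      apply Rmult_le_compat_l; [exact Hc0|].
      eapply Rle_trans; [apply Cmod_triangle|]. rewrite Cmod_opp, !Cmod_mult, !Cmod_eph, !Rmult_1_l.
      assert (P1 := pp_bound y t k r). assert (P2 := pp_bound y t k (- r)%R).
      rewrite Rabs_Ropp in P2. rewrite Rabs_pos_eq in P1, P2 by lra.
      apply Rplus_le_compat; [apply P1|apply P2]; lra.
    + apply (tends_of_bound _ _ (4 * K) 1). intros r Hr.
      assert (H := FI_tail (full_symbol k) K r r HFC HB ltac:(lra) ltac:(lra)).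
      rewrite <- Cmod_opp. replace (- (CInt (full_symbol k) (- r) r - FI (full_symbol k))) with
        (FI (full_symbol k) - CInt (full_symbol k) (- r) r) by ring.
      eapply Rle_trans; [exact H|].
      assert (Hi : (/ (1 + r) <= / r)%R) by (apply Rinv_le_contravar; lra).
      unfold Rdiv. nra.
Qed.

Definition inner1 (x k : R) : C := Cexp (Ci * RtoC k * RtoC x) * FI (full_symbol k).

Lemma inner1_Cont x : Cont (inner1 x).
Proof.
  destruct full_symbol_bound as (D & HD & HB). intro k. apply cont_Cmult.
  - apply cont_Cexp, cont_Cmult; [|apply continuous_const]. apply cont_Cmult; [apply continuous_const|apply cont_RtoC, continuous_id].
  - apply (cont_FI_param full_symbol D).
    + intros q s. apply jcont2_pair, full_symbol_jcont.
    + intros q l. eapply Rle_trans; [apply HB|]. assert (Hi := inv_pow_pos 2 (Rabs l) (Rabs_pos l)).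
      apply Rmult_le_compat_r; [lra|]. rewrite <- (Rmult_1_r D) at 2. apply Rmult_le_compat_l; [exact HD|].
      apply Rle_trans with (/ 1)%R; [apply Rinv_le_contravar; nra|rewrite Rinv_1; lra].
Qed.
Lemma inner1_fdom2 x : exists D, fdom2 D (inner1 x).
Proof.
  destruct full_symbol_bound as (D & HD & HB). exists (8 * D)%R. intro k. unfold inner1.
  rewrite Cmod_mult. replace (Cmod (Cexp (Ci * RtoC k * RtoC x))) with 1%R.
  2: { rewrite Cmod_Cexp. replace (Re (Ci * RtoC k * RtoC x)) with 0%R; [now rewrite exp_0|]. unfold Re; simpl; ring. }
  rewrite Rmult_1_l. eapply Rle_trans; [apply FI_bound; [apply (jcont2_r full_symbol), full_symbol_jcont|apply HB]|].
  assert (H := inv_sq_le k). replace (8 * D * / (1 + Rabs k) ^ 2)%R with (4 * D * (2 * / (1 + Rabs k) ^ 2))%R by ring.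
  rewrite <- Rmult_assoc. apply Rmult_le_compat_l; [lra|exact H].
Qed.
End InitialIntegral.

(** * The contour integral *)

Lemma is_CInt_contour_of_tends (f : C -> C) gamma (F : R -> C) l (r1 : R) :
  (forall r, (r1 <= r)%R -> is_CInt_cut f gamma r (F r)) -> tends F l -> is_CInt_contour f gamma l.
Proof.
  intros HF Hl P [e He].
  destruct (Hl e (cond_pos e)) as (r0 & _ & Hr0).
  exists (Rmax r1 r0). intros r Hr.
  assert (H1 := Rmax_l r1 r0). assert (H2 := Rmax_r r1 r0).
  exists (F r). split; [apply HF; lra|]. apply He.
  assert (H := Hr0 r ltac:(lra)).
  assert (H3 := Re_le_Cmod (F r - l)). assert (H4 := Im_le_Cmod (F r - l)).
  split; eapply Rle_lt_trans; [exact H3|exact H|exact H4|exact H].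
Qed.

Lemma Cminus_0_r (z : C) : z - 0 = z.
Proof. ring. Qed.

Lemma CDerive_id_pair (c s : R) : CDerive (fun s => (s, c)) s = 1.
Proof. apply (CDerive_pair (fun s => s) (fun _ => c) s 1 0); [apply (is_derive_id s)|apply Rd_const]. Qed.

Lemma real_line_cut (g : R -> C) (h : C -> C) (r : R) : Cont g -> (forall l : R, h (RtoC l) = g l) ->
  is_CInt_cut h real_line r (CInt g (- r) r).
Proof.
  intros Hg Hh. exists (CInt g (- r) r), 0. split; [|split; [reflexivity|ring]].
  apply (is_CRInt_ext g); [|now apply CInt_correct].
  intros s _. cbn [pt]. rewrite (CDerive_id_pair 0 s : CDerive RtoC s = 1), Hh. ring.
Qed.

Lemma sqr_pair (a b : R) : ((a, b) : C) ^ 2 = ((a ^ 2 - b ^ 2)%R, (2 * a * b)%R).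
Proof. apply injective_projections; simpl; ring. Qed.

(** The integrand agrees with globally continuous functions except where z^2 = - kappa^2. On the
    contour this happens only at i |kappa|, always an endpoint of an arc, and integrals ignore
    endpoints. *)
Lemma boundary_Dplus_cut (f fL fR : C -> C) (kappa r : R) : Cont fL -> Cont fR ->
  (forall z, low_region (-1) kappa z -> z ^ 2 <> - RtoC (kappa ^ 2) -> f z = fL z) ->
  (forall z, up_region 1 kappa z -> z ^ 2 <> - RtoC (kappa ^ 2) -> f z = fR z) ->
  (Rabs kappa < r)%R ->
  is_CInt_cut f (boundary_Dplus kappa) r
    (arc_real fL (-1) r + (arc_imag fL 0 (Rabs kappa) + (arc_hyp fL (-1) kappa (hyperbola_cut kappa r) +
      (- arc_imag fR (Rabs kappa) r + (arc_hyp fR 1 kappa (hyperbola_cut kappa r) + 0))))).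
Proof.
  intros HfL HfR HL HR Hr. set (h := hyperbola_cut kappa r).
  assert (Hk0 := Rabs_pos kappa). assert (Hk2 := pow2_abs kappa).
  assert (Hh : (0 <= h)%R) by apply sqrt_pos.
  assert (Hne : forall a b : R, (a ^ 2 - b ^ 2 <> - kappa ^ 2 \/ a * b <> 0)%R ->
    ((a, b) : C) ^ 2 <> - RtoC (kappa ^ 2)).
  { intros a b Hab E. rewrite sqr_pair in E. injection E. intros E2 E1. destruct Hab as [H|H]; apply H; lra. }
  assert (Hhp : forall s, (0 < s)%R -> (0 < hyp kappa s)%R) by (intros; now apply hyp_pos).
  eexists; exists (arc_imag fL 0 (Rabs kappa) + (arc_hyp fL (-1) kappa h +
      (- arc_imag fR (Rabs kappa) r + (arc_hyp fR 1 kappa h + 0)))).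
  split; [|split; [|reflexivity]].
  { cbn [pt from to].
    replace (arc_real fL (-1) r) with (CInt (fun s => fL (s, 0%R)) (- r) 0).
    - apply (is_CRInt_ext (fun s => fL (s, 0%R))).
      + intros s Hs. rewrite Rmin_left, Rmax_right in Hs by lra. rewrite CDerive_id_pair, HL; [ring| |].
        * unfold low_region, Re, Im; simpl. repeat split; nra.
        * apply Hne. left. assert (0 <= kappa ^ 2)%R by apply pow2_ge_0. nra.
      + apply CInt_correct. intro s. apply (cont_f_pair fL (fun s : R => s) (fun _ => 0%R)); [exact HfL|apply continuous_id|apply continuous_const].
    - unfold arc_real.
      rewrite (CInt_ext (fun s => fL (-1 * s, 0)%R) (fun s => fL ((- s)%R, 0%R))).
      2: { intros s _. now replace (-1 * s)%R with (- s)%R by ring. }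
      rewrite (CInt_neg (fun s => fL (s, 0%R)) 0 r).
      + now rewrite Ropp_0.
      + intro s. apply (cont_f_pair fL (fun s : R => s) (fun _ => 0%R)); [exact HfL|apply continuous_id|apply continuous_const]. }
  eexists; exists (arc_hyp fL (-1) kappa h + (- arc_imag fR (Rabs kappa) r + (arc_hyp fR 1 kappa h + 0))).
  split; [|split; [|reflexivity]].
  { cbn [pt from to]. apply (is_CRInt_ext (fun s => fL (0%R, s) * Ci)); [|apply CInt_correct, arc_imag_Cont, HfL].
    intros s Hs. rewrite Rmin_left, Rmax_right in Hs by lra.
    rewrite (CDerive_pair (fun _ => 0%R) (fun s => s) s 0 1 (Rd_const 0 s) (is_derive_id s)).
    rewrite HL; [reflexivity| |].
    - unfold low_region, Re, Im; simpl. repeat split; nra.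
    - apply Hne. left. nra. }
  eexists; exists (- arc_imag fR (Rabs kappa) r + (arc_hyp fR 1 kappa h + 0)).
  split; [|split; [|reflexivity]].
  { cbn [pt from to]. fold h.
    apply (is_CRInt_ext (fun s => fL (-1 * s, hyp kappa s)%R * ((-1)%R, slope kappa s)));
      [|apply CInt_correct, arc_hyp_Cont, HfL].
    intros s Hs. rewrite Rmin_left, Rmax_right in Hs by lra.
    assert (Hd : is_derive (fun s => - s)%R s (-1)%R) by (auto_derive; [exact I|ring]).
    rewrite (CDerive_pair (fun s => - s)%R (fun s => sqrt (kappa ^ 2 + s ^ 2)) s (-1) (slope kappa s) Hd (is_derive_hyp kappa s ltac:(lra))).
    replace (-1 * s)%R with (- s)%R by ring. fold (hyp kappa s).
    assert (Hq := hyp_sq kappa s). specialize (Hhp s ltac:(lra)).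
    rewrite HL; [reflexivity| |].
    - unfold low_region, Re, Im; cbn [fst snd]. replace ((- s) ^ 2)%R with (s ^ 2)%R by ring.
      rewrite Hq. repeat split; lra.
    - apply Hne. right. assert (0 < s * hyp kappa s)%R by (apply Rmult_lt_0_compat; lra). lra. }
  eexists; exists (arc_hyp fR 1 kappa h + 0).
  split; [|split; [|reflexivity]].
  { cbn [pt from to].
    assert (HC := arc_imag_Cont fR HfR).
    (* This arc descends the imaginary axis, so after reflection of the parameter it counts with a
       minus sign. *)
    replace (- arc_imag fR (Rabs kappa) r) with (CInt (fun s => - (fR (0%R, (- s)%R) * Ci)) (- r) (- Rabs kappa)).
    - apply (is_CRInt_ext (fun s => - (fR (0%R, (- s)%R) * Ci))).
      + intros s Hs. rewrite Rmin_left, Rmax_right in Hs by lra.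
        assert (Hd : is_derive (fun s => - s)%R s (-1)%R) by (auto_derive; [exact I|ring]).
        rewrite (CDerive_pair (fun _ => 0%R) (fun s => - s)%R s 0 (-1) (Rd_const 0 s) Hd).
        rewrite HR.
        * replace (((0, -1)%R : C)) with (- Ci) by (apply injective_projections; simpl; ring). ring.
        * unfold up_region, Re, Im; simpl. repeat split; nra.
        * apply Hne. left. nra.
      + apply CInt_correct. intro s. apply cont_Copp. exact (Cont_neg _ HC s).
    - unfold arc_imag.
      rewrite (CInt_ext _ (fun s => -(1) * (fR (0%R, (- s)%R) * Ci))) by (intros; ring).
      rewrite (CInt_scal _ (fun s => fR (0%R, (- s)%R) * Ci)) by (exact (Cont_neg _ HC)).
      rewrite (CInt_neg (fun s => fR (0%R, s) * Ci) _ _ HC), !Ropp_involutive. ring. }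
  eexists; exists 0. split; [|split; [reflexivity|reflexivity]].
  cbn [pt from to]. fold h.
  apply (is_CRInt_ext (fun s => fR (1 * s, hyp kappa s)%R * (1%R, slope kappa s)));
    [|apply CInt_correct, arc_hyp_Cont, HfR].
  intros s Hs. rewrite Rmin_left, Rmax_right in Hs by lra.
  rewrite (CDerive_pair (fun s => s)%R (fun s => sqrt (kappa ^ 2 + s ^ 2)) s 1 (slope kappa s) (is_derive_id s) (is_derive_hyp kappa s ltac:(lra))).
  replace (1 * s)%R with s by ring. fold (hyp kappa s).
  assert (Hq := hyp_sq kappa s). specialize (Hhp s ltac:(lra)).
  rewrite HR; [reflexivity| |].
  - unfold up_region, Re, Im; cbn [fst snd]. rewrite Hq. repeat split; lra.
  - apply Hne. right. assert (0 < s * hyp kappa s)%R by (apply Rmult_lt_0_compat; lra). lra.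
Qed.

Lemma arc_real_comb (c : C) (f g : C -> C) sg r : Cont f -> Cont g ->
  arc_real (fun z => c * (f z - g z)) sg r = c * (arc_real f sg r - arc_real g sg r).
Proof.
  intros Hf Hg. assert (Cf := arc_real_Cont f sg Hf). assert (Cg := arc_real_Cont g sg Hg).
  unfold arc_real. apply CInt_unique.
  apply is_CRInt_scal, is_CRInt_minus; apply CInt_correct; [exact Cf|exact Cg].
Qed.
Lemma arc_imag_comb (c : C) (f g : C -> C) a b : Cont f -> Cont g ->
  arc_imag (fun z => c * (f z - g z)) a b = c * (arc_imag f a b - arc_imag g a b).
Proof.
  intros Hf Hg. assert (Cf := arc_imag_Cont f Hf). assert (Cg := arc_imag_Cont g Hg).
  unfold arc_imag. rewrite (CInt_ext _ (fun s => c * (f (0%R, s) * Ci - g (0%R, s) * Ci))) by (intros; ring).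
  apply CInt_unique.
  apply is_CRInt_scal, is_CRInt_minus; apply CInt_correct; [exact Cf|exact Cg].
Qed.
Lemma arc_hyp_comb (c : C) (f g : C -> C) sg kappa h : Cont f -> Cont g ->
  arc_hyp (fun z => c * (f z - g z)) sg kappa h = c * (arc_hyp f sg kappa h - arc_hyp g sg kappa h).
Proof.
  intros Hf Hg. assert (Cf := arc_hyp_Cont f sg kappa Hf). assert (Cg := arc_hyp_Cont g sg kappa Hg).
  unfold arc_hyp.
  rewrite (CInt_ext _ (fun s => c * (f (sg * s, hyp kappa s)%R * (sg, slope kappa s) -
    g (sg * s, hyp kappa s)%R * (sg, slope kappa s)))) by (intros; ring).
  apply CInt_unique.
  apply is_CRInt_scal, is_CRInt_minus; apply CInt_correct; [exact Cf|exact Cg].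
Qed.

Lemma arc_real_sum (f : C -> C) (r : R) : Cont f ->
  arc_real f (-1) r + arc_real f 1 r = CInt (fun l => f (RtoC l)) (- r) r.
Proof.
  intro Hf.
  assert (Cf : Cont (fun s : R => f (RtoC s))).
  { intro s. apply (cont_f_pair f (fun s : R => s) (fun _ => 0%R)); [exact Hf|apply continuous_id|apply continuous_const]. }
  rewrite <- (CInt_Chasles (fun l => f (RtoC l)) (- r) 0 r Cf). unfold arc_real. f_equal.
  - rewrite (CInt_ext (fun s => f (-1 * s, 0)%R) (fun s => f (RtoC (- s)))).
    + rewrite (CInt_neg (fun l => f (RtoC l)) 0 r Cf). now rewrite Ropp_0.
    + intros s _. now replace (-1 * s)%R with (- s)%R by ring.
  - apply CInt_ext. intros s _. now replace (1 * s)%R with s by ring.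
Qed.

Section HalflineContour.
Context (kappa tmax K t x y : R) (w wt : nat -> R -> R -> C).
Context (HW : halfline_solution kappa tmax K w wt) (Ht : (0 < t < tmax)%R) (Hy : (0 < y)%R).

Lemma Bint_real l : Bint w kappa t y (RtoC l) =
  eph y t kappa l * lap (fun s => w 0%nat s 0%R) (- RtoC l) -
  Cexp (Ci * RtoC l * RtoC y) * lap (fun s => w 0%nat s t) (- RtoC l).
Proof.
  unfold Bint. assert (H := global_relation kappa tmax K t w wt HW Ht (- RtoC l)).
  replace (- - RtoC l) with (RtoC l) in H by ring. rewrite <- H by (simpl; lra).
  replace (eph y t kappa l) with (Cexp (Ci * RtoC l * RtoC y) * Cexp (Ci * omega kappa (- RtoC l) * RtoC t)); [ring|].
  rewrite <- Cexp_plus. unfold eph, omega, ph. f_equal.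
  apply injective_projections; simpl; ring.
Qed.

(** [T1] and [T2] are the two boundary components for A, [T3] and [T4] the complementary regions for
    B~, and [T5] evaluates B~ on the real line. *)
Lemma boundary_integral_tends (E G : C -> C) (l0 : C) :
  tends (fun r => CInt (fun l => eph y t kappa l * lap (fun s => w 0%nat s 0%R) (- RtoC l)) (- r) r) l0 ->
  (forall z, low_region (-1) kappa z -> z ^ 2 <> - RtoC (kappa ^ 2) ->
    E z * G z = Cexp (Ci * RtoC kappa * RtoC x) * (Aint (fun s => w 0%nat s t) (-1) kappa y z - Bint w kappa t y z)) ->
  (forall z, up_region 1 kappa z -> z ^ 2 <> - RtoC (kappa ^ 2) ->
    E z * G z = Cexp (Ci * RtoC kappa * RtoC x) * (Aint (fun s => w 0%nat s t) 1 kappa y z - Bint w kappa t y z)) ->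
  is_CInt_contour (fun z => E z * G z) (boundary_Dplus kappa)
    (Cexp (Ci * RtoC kappa * RtoC x) * (RtoC (2 * PI) * w 0%nat y t - l0)).
Proof.
  intros Hl0 HL HR.
  set (eX := Cexp (Ci * RtoC kappa * RtoC x)) in *.
  set (f0 := fun s => w 0%nat s t) in *. set (B := Bint w kappa t y) in *.
  assert (Hf0 : Cont f0) by (apply (hs_Cont_y kappa tmax K w wt HW 0 t); lia).
  assert (Hf1 : Cont (fun s => w 1%nat s t)) by (apply (hs_Cont_y kappa tmax K w wt HW 1 t); lia).
  assert (D0 : dom4 K f0) by (apply (hs_dom4 kappa tmax K w wt HW 0 t); lia).
  assert (D1 : dom4 K (fun s => w 1%nat s t)) by (apply (hs_dom4 kappa tmax K w wt HW 1 t); lia).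
  assert (Hd : forall s, (0 < s)%R -> is_Cderive f0 s (w 1%nat s t)).
  { intros s Hs. apply (hs_dY kappa tmax K w wt HW 0 ltac:(lia) s t Hs). }
  assert (HK : (0 <= K)%R).
  { assert (H := D0 0%R ltac:(lra)). rewrite Rplus_0_r, pow1, Rinv_1, Rmult_1_r in H.
    eapply Rle_trans; [apply Cmod_ge_0|exact H]. }
  assert (s1 : (1 = 1 \/ 1 = -1)%R) by (left; reflexivity).
  assert (sm : (-1 = 1 \/ -1 = -1)%R) by (right; reflexivity).
  set (R0 := (2 * Rabs kappa + 1)%R).
  assert (HR0 : (Rabs kappa + 1 <= R0)%R) by (unfold R0; assert (H := Rabs_pos kappa); lra).
  assert (GAm : good (-1) (low_region (-1) kappa) y (42 * K) R0 (Aint f0 (-1) kappa y)).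
  { apply (Aint_good f0 (fun s => w 1%nat s t) K kappa y Hf0 Hf1 D0 D1 Hd (-1) sm).
    intros z (H1 & H2 & _). split; [exact H1|exact H2]. }
  assert (GAp : good 1 (up_region 1 kappa) y (42 * K) R0 (Aint f0 1 kappa y)).
  { apply (Aint_good f0 (fun s => w 1%nat s t) K kappa y Hf0 Hf1 D0 D1 Hd 1 s1).
    intros z (H1 & H2 & _). split; [exact H1|exact H2]. }
  assert (GBp : good 1 (low_region 1 kappa) y (12 * ((2 + t) * K)) R0 B).
  { apply (Bint_good kappa tmax K t y w wt HW Ht). intros z. apply omega_low. }
  assert (GBm : good (-1) (up_region (-1) kappa) y (12 * ((2 + t) * K)) R0 B).
  { apply (Bint_good kappa tmax K t y w wt HW Ht). intros z. apply omega_up. }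
  assert (CAm := good_cont _ _ _ _ _ _ GAm). assert (CAp := good_cont _ _ _ _ _ _ GAp).
  assert (CB := good_cont _ _ _ _ _ _ GBp).
  set (Am := Aint f0 (-1) kappa y) in *. set (Ap := Aint f0 1 kappa y) in *.
  assert (K1 : (0 <= 42 * K)%R) by lra.
  assert (K2 : (0 <= 12 * ((2 + t) * K))%R) by nra.
  assert (T1 : tends (fun r => RtoC (-1) * arc_real Am (-1) r - arc_imag Am 0 (Rabs kappa) -
      arc_hyp Am (-1) kappa (hyperbola_cut kappa r)) 0).
  { apply (tends_of_bound _ _ (9 * (42 * K) / y) (2 * R0)). intros r Hr.
    assert (0 < r)%R by (unfold R0 in Hr; assert (H := Rabs_pos kappa); lra).
    rewrite Cminus_0_r.
    replace (9 * (42 * K) / y / r)%R with (9 * (42 * K) / (y * r))%R by (field; lra).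
    exact (deform_low (-1) kappa y (42 * K) R0 Am sm Hy K1 HR0 r GAm Hr). }
  assert (T2 : tends (fun r => arc_imag Ap (Rabs kappa) r - arc_hyp Ap 1 kappa (hyperbola_cut kappa r)) 0).
  { apply (tends_of_bound _ _ (9 * (42 * K) / y) (2 * R0)). intros r Hr.
    assert (0 < r)%R by (unfold R0 in Hr; assert (H := Rabs_pos kappa); lra).
    rewrite Cminus_0_r.
    replace (9 * (42 * K) / y / r)%R with (9 * (42 * K) / (y * r))%R by (field; lra).
    exact (deform_up 1 kappa y (42 * K) R0 Ap s1 Hy K1 HR0 r GAp Hr). }
  assert (T3 : tends (fun r => RtoC 1 * arc_real B 1 r - arc_imag B 0 (Rabs kappa) -
      arc_hyp B 1 kappa (hyperbola_cut kappa r)) 0).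
  { apply (tends_of_bound _ _ (9 * (12 * ((2 + t) * K)) / y) (2 * R0)). intros r Hr.
    assert (0 < r)%R by (unfold R0 in Hr; assert (H := Rabs_pos kappa); lra).
    rewrite Cminus_0_r.
    replace (9 * (12 * ((2 + t) * K)) / y / r)%R with (9 * (12 * ((2 + t) * K)) / (y * r))%R by (field; lra).
    exact (deform_low 1 kappa y _ R0 B s1 Hy K2 HR0 r GBp Hr). }
  assert (T4 : tends (fun r => arc_imag B (Rabs kappa) r - arc_hyp B (-1) kappa (hyperbola_cut kappa r)) 0).
  { apply (tends_of_bound _ _ (9 * (12 * ((2 + t) * K)) / y) (2 * R0)). intros r Hr.
    assert (0 < r)%R by (unfold R0 in Hr; assert (H := Rabs_pos kappa); lra).
    rewrite Cminus_0_r.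
    replace (9 * (12 * ((2 + t) * K)) / y / r)%R with (9 * (12 * ((2 + t) * K)) / (y * r))%R by (field; lra).
    exact (deform_up (-1) kappa y _ R0 B sm Hy K2 HR0 r GBm Hr). }
  assert (CW : Cont (fun l : R => lap f0 (- RtoC l))).
  { intro l. apply (continuous_comp (fun l : R => - RtoC l) (lap f0)).
    - apply cont_Copp, cont_RtoC, continuous_id.
    - exact (lap_cont f0 K Hf0 D0 _). }
  assert (CW0 : Cont (fun l : R => lap (fun s => w 0%nat s 0%R) (- RtoC l))).
  { intro l. apply (continuous_comp (fun l : R => - RtoC l) (lap (fun s => w 0%nat s 0%R))).
    - apply cont_Copp, cont_RtoC, continuous_id.
    - apply (lap_cont (fun s => w 0%nat s 0%R) K).
      + apply (hs_Cont_y kappa tmax K w wt HW 0 0); lia.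
      + apply (hs_dom4 kappa tmax K w wt HW 0 0); lia. }
  (* On the real line the global relation splits B~ into the datum integrand, with limit [l0], and
     the transform at time t, which inversion on the half line evaluates. *)
  assert (T5 : tends (fun r => arc_real B (-1) r + arc_real B 1 r) (l0 - RtoC (2 * PI) * w 0%nat y t)).
  { assert (D2 : dom2 K f0).
    { intros s Hs. eapply Rle_trans; [exact (D0 s Hs)|]. apply Rmult_le_compat_l; [exact HK|]. now apply inv_pow42. }
    assert (HI := inversion_half f0 K y (w 1%nat y t) Hf0 D2 Hy (Hd y Hy)).
    refine (tends_ext _ _ _ 0 _ (tends_minus _ _ _ _ Hl0 HI)).
    intros r _. cbv beta. rewrite (arc_real_sum B r CB).
    rewrite <- CInt_minus.
    - apply CInt_ext. intros l _. symmetry. apply Bint_real.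
    - intro l. apply cont_Cmult; [apply (jcont2_r _ kappa (eph_jcont y t))|apply CW0].
    - intro l. apply cont_Cmult; [|apply CW]. apply cont_Cexp, cont_Cmult; [|apply continuous_const].
      apply cont_Cmult; [apply continuous_const|apply cont_RtoC, continuous_id]. }
  apply (is_CInt_contour_of_tends _ _ (fun r =>
    arc_real (fun z => eX * (Am z - B z)) (-1) r + (arc_imag (fun z => eX * (Am z - B z)) 0 (Rabs kappa) +
    (arc_hyp (fun z => eX * (Am z - B z)) (-1) kappa (hyperbola_cut kappa r) +
      (- arc_imag (fun z => eX * (Ap z - B z)) (Rabs kappa) r +
      (arc_hyp (fun z => eX * (Ap z - B z)) 1 kappa (hyperbola_cut kappa r) + 0))))) _ (2 * R0)).
  - intros r Hr.
    apply (boundary_Dplus_cut (fun z => E z * G z) (fun z => eX * (Am z - B z)) (fun z => eX * (Ap z - B z)) kappa r).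
    + intro z. apply cont_Cmult; [apply continuous_const|]. apply cont_Cminus; [apply CAm|apply CB].
    + intro z. apply cont_Cmult; [apply continuous_const|]. apply cont_Cminus; [apply CAp|apply CB].
    + exact HL.
    + exact HR.
    + unfold R0 in Hr. assert (H := Rabs_pos kappa). lra.
  (* Up to null terms the contour sum of A is - [T1] - [T2], while that of B~ is the real line
     integral [T5] - [T3] - [T4]; the signs follow from the orientation of the arcs. *)
  - assert (T := tends_scal eX _ _ (tends_minus _ _ _ _ (tends_plus _ _ _ _ T3 T4)
        (tends_plus _ _ _ _ (tends_plus _ _ _ _ T1 T2) T5))).
    replace (eX * (RtoC (2 * PI) * w 0%nat y t - l0)) with (eX * (0 + 0 - (0 + 0 + (l0 - RtoC (2 * PI) * w 0%nat y t)))) by ring.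
    refine (tends_ext _ _ _ 0 _ T). intros r _. cbv beta.
    rewrite (arc_real_comb eX Am B _ _ CAm CB), (arc_imag_comb eX Am B _ _ CAm CB), (arc_imag_comb eX Ap B _ _ CAp CB),
      (arc_hyp_comb eX Am B _ _ _ CAm CB), (arc_hyp_comb eX Ap B _ _ _ CAp CB).
    generalize (arc_real Am (-1) r) (arc_real B (-1) r) (arc_real B 1 r) (arc_imag Am 0 (Rabs kappa))
      (arc_imag B 0 (Rabs kappa)) (arc_imag Ap (Rabs kappa) r) (arc_imag B (Rabs kappa) r)
      (arc_hyp Am (-1) kappa (hyperbola_cut kappa r)) (arc_hyp B (-1) kappa (hyperbola_cut kappa r))
      (arc_hyp Ap 1 kappa (hyperbola_cut kappa r)) (arc_hyp B 1 kappa (hyperbola_cut kappa r)).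
    intros. replace (RtoC (-1)) with (- (1)) by (apply injective_projections; simpl; ring). ring.
Qed.
End HalflineContour.

(** * The representation formula *)

Section Representation.
Context (tmax M : R) (u : R -> R -> R -> C) (V : list axis -> R -> R -> R -> C) (HV : smooth_ext 8 tmax M u V).
Context (u0 g0 g1 : R -> R -> C) (Hdata : has_data tmax u u0 g0 g1).
Context (x y t : R) (Hy : (0 < y)%R) (Ht : (0 < t < tmax)%R).

Lemma half_space_transform_lap kappa z : (0 <= Im z)%R ->
  half_space_transform u0 kappa (- z) = lap (fun s => fourier_x (V (repeat Y 0)) kappa s 0) z.
Proof.
  intro Hz. rewrite (half_space_transformE tmax M u V HV u0 kappa (- z)); [|lra|apply Hdata|unfold Im in *; simpl; lra].
  unfold lap. rewrite (zc_id z Hz). apply CI_ext. intros s _. cbn [repeat]. f_equal. f_equal. ring.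
Qed.

(** The factor exp(i omega t) moves under the integral. Traces known at interior times suffice,
    because t < tmax and the integral ignores its endpoints. *)
Lemma t_transform_ttr (g : R -> R -> C) (k : nat) kappa om : (k <= 8)%nat ->
  (forall s tau, (0 < tau < tmax)%R -> g s tau = V (repeat Y k) s 0%R tau) ->
  Cexp (Ci * om * RtoC t) * t_transform g kappa (- (Ci * om)) t = ttr (fourier_x (V (repeat Y k)) kappa 0) t om.
Proof.
  intros Hk Hg. unfold t_transform.
  assert (HC : Cont (fourier_x (V (repeat Y k)) kappa 0)).
  { apply (jcont2_r (fun y tau => fourier_x (V (repeat Y k)) kappa y tau)), jcont3_23.
    apply (fx_jcont3 tmax M u V HV). now rewrite repeat_length. }
  rewrite (CInt_ext _ (fun tau => Cexp (- (Ci * om) * RtoC tau) * fourier_x (V (repeat Y k)) kappa 0 tau)).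
  - rewrite <- (CInt_scal (Cexp (Ci * om * RtoC t)) (fun tau => Cexp (- (Ci * om) * RtoC tau) * fourier_x (V (repeat Y k)) kappa 0 tau)).
    + apply CInt_ext. intros tau _. rewrite Cmult_assoc, <- Cexp_plus. f_equal. f_equal. rewrite RtoC_minus. ring.
    + intro tau. apply cont_Cmult; [|apply HC]. apply cont_Cexp, cont_Cmult; [apply continuous_const|apply cont_RtoC, continuous_id].
  - intros tau Htau. rewrite Rmin_left, Rmax_right in Htau by lra. f_equal.
    replace (fun s : R => Cexp (- (Ci * RtoC s * RtoC kappa)) * g s tau) with
      (fun s : R => Cexp (- (Ci * RtoC s * RtoC kappa)) * V (repeat Y k) s 0%R tau).
    + assert (Hl : (length (repeat Y k) <= 8)%nat) by now rewrite repeat_length.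
      apply (CInt_line_FI _ (M * / (1 + Rmax 0 0) ^ 4)).
      * exact (fx_Cont tmax M u V HV (repeat Y k) kappa 0%R tau).
      * exact (fx_fdom2 tmax M u V HV (repeat Y k) kappa 0%R tau Hl).
    + apply functional_extensionality. intro s. rewrite Hg by lra. reflexivity.
Qed.

Lemma dirichlet_trace s tau : (0 < tau < tmax)%R -> g0 s tau = V (repeat Y 0) s 0%R tau.
Proof.
  intro Htau. destruct Hdata as (H & _). rewrite <- (H s tau Htau). symmetry. apply (se_u _ _ _ _ _ HV).
  simpl. lra.
Qed.

(** Both sides are limits of the normal derivative as y decreases to 0: one by the definition of the
    data, the other by continuity of the extension. *)
Lemma neumann_trace s tau : (0 < tau < tmax)%R -> g1 s tau = V (repeat Y 1) s 0%R tau.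
Proof.
  intro Htau. destruct Hdata as (_ & H & _). specialize (H s tau Htau).
  refine (filterlim_locally_unique (V := C_R_NormedModule) (F := at_right 0) (fun y => partial [Y] u s y tau) _ _ H _).
  apply (filterlim_ext_loc (fun y => V [Y] s y tau)).
  - exists (mkposreal 1 Rlt_0_1). intros z _ Hz. apply (se_open _ _ _ _ _ HV); [simpl; lia|simpl; lra].
  - assert (HC : continuous (fun z => V [Y] s z tau) 0%R).
    { apply (se_cont _ _ _ _ _ HV [Y] _ (fun _ => s) (fun z => z) (fun _ => tau));
        [apply continuous_const|apply continuous_id|apply continuous_const]. }
    intros P HP. apply (filter_le_within (F := locally 0%R)). exact (HC P HP).
Qed.

Definition wave (kappa : R) : C := Cexp (Ci * RtoC kappa * RtoC x) * fourier_x (V []) kappa y t.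

Lemma wave_Cont : Cont wave.
Proof.
  intro k. apply cont_Cmult.
  - apply cont_Cexp, cont_Cmult; [|apply continuous_const]. apply cont_Cmult; [apply continuous_const|apply cont_RtoC, continuous_id].
  - apply (fx_jcont3 tmax M u V HV [] ltac:(simpl; lia) _ (fun k => k) (fun _ => y) (fun _ => t));
      [apply continuous_id|apply continuous_const|apply continuous_const].
Qed.
Lemma wave_fdom2 : fdom2 (16 * M) wave.
Proof.
  intro k. unfold wave. rewrite Cmod_mult. replace (Cmod (Cexp (Ci * RtoC k * RtoC x))) with 1%R.
  2: { rewrite Cmod_Cexp. replace (Re (Ci * RtoC k * RtoC x)) with 0%R; [now rewrite exp_0|]. unfold Re; simpl; ring. }
  rewrite Rmult_1_l. assert (HM := ext_bound_nonneg tmax M u V HV).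
  assert (H := fx_decay2 tmax M u V HV [] k y t ltac:(simpl; lia)). rewrite (Rmax_right 0 y) in H by lra.
  assert (H1 : (/ (1 + y) ^ 4 <= 1)%R).
  { rewrite <- Rinv_1. apply Rinv_le_contravar; [lra|]. rewrite <- (pow1 4) at 1. apply pow_incr. lra. }
  assert (H2 := inv_sq_le k). assert (Hk : (0 < 1 + k ^ 2)%R) by (assert (H3 := pow2_ge_0 k); lra).
  set (a := Cmod (fourier_x (V []) k y t)) in *.
  assert (Ha : ((1 + k ^ 2) * a <= 8 * M)%R).
  { eapply Rle_trans; [exact H|]. rewrite <- (Rmult_1_r (8 * M)) at 2. apply Rmult_le_compat_l; lra. }
  replace a with ((1 + k ^ 2) * a * / (1 + k ^ 2))%R by (field; lra).
  apply Rle_trans with (8 * M * / (1 + k ^ 2))%R.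
  - apply Rmult_le_compat_r; [left; now apply Rinv_0_lt_compat|exact Ha].
  - replace (16 * M * / (1 + Rabs k) ^ 2)%R with (8 * M * (2 * / (1 + Rabs k) ^ 2))%R by ring.
    apply Rmult_le_compat_l; [lra|exact H2].
Qed.

(** Both sides are limits of the symmetric truncations of the integral in kappa: one by absolute
    convergence, the other by Fourier inversion in x. *)
Lemma FI_wave : FI wave = RtoC (2 * PI) * u x y t.
Proof.
  rewrite <- (se_u _ _ _ _ _ HV x y t) by (simpl; lra).
  assert (HM := ext_bound_nonneg tmax M u V HV).
  apply (tends_unique (fun r => CInt wave (- r) r)).
  - apply (tends_of_bound _ _ (4 * (16 * M)) 1). intros r Hr.
    assert (H := FI_tail wave (16 * M) r r wave_Cont wave_fdom2 ltac:(lra) ltac:(lra)).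
    rewrite <- Cmod_opp. replace (- (CInt wave (- r) r - FI wave)) with (FI wave - CInt wave (- r) r) by ring.
    eapply Rle_trans; [exact H|].
    assert (Hi : (/ (1 + r) <= / r)%R) by (apply Rinv_le_contravar; lra).
    unfold Rdiv. nra.
  - apply (inversion_line (fun s => V [] s y t) M x (V [X] x y t)).
    + intro s. apply (se_cont _ _ _ _ _ HV [] _ (fun s => s) (fun _ => y) (fun _ => t));
        [apply continuous_id|apply continuous_const|apply continuous_const].
    + intro s. assert (H := fx_fdom2 tmax M u V HV [] 0%R y t ltac:(simpl; lia) s). cbv beta in H.
      rewrite Cmod_mult, Cmod_Cexp in H.
      replace (Re (- (Ci * RtoC s * RtoC 0))) with 0%R in H by (unfold Re; simpl; ring).
      rewrite exp_0, Rmult_1_l in H. eapply Rle_trans; [exact H|].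
      assert (Hs := inv_pow_pos 2 (Rabs s) (Rabs_pos s)).
      apply Rmult_le_compat_r; [lra|]. rewrite <- (Rmult_1_r M) at 2. apply Rmult_le_compat_l; [exact HM|].
      rewrite (Rmax_right 0 y) by lra. rewrite <- Rinv_1. apply Rinv_le_contravar; [lra|].
      rewrite <- (pow1 4) at 1. apply pow_incr. lra.
    + apply (se_dX _ _ _ _ _ HV []). simpl; lia.
Qed.

Lemma initial_integral : is_iterated_CInt
  (fun kappa lambda => E kappa lambda x y t * half_space_transform u0 kappa lambda)
  (fun _ => real_line) (FI (inner1 V y t x)).
Proof.
  destruct (inner1_fdom2 tmax M u V HV y t Hy Ht x) as [D HD].
  exists (inner1 V y t x). split; [|exact (FI_is_RInt_gen _ D (inner1_Cont tmax M u V HV y t Hy Ht x) HD)].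
  intro k.
  set (w0 := fun s => fourier_x (V (repeat Y 0)) k s 0).
  assert (HS := halfline_solution_fourier k tmax M u V HV).
  assert (CW : Cont (fun l : R => eph y t k l * lap w0 (- RtoC l))).
  { intro l. apply cont_Cmult; [apply (jcont2_r _ k (eph_jcont y t))|].
    apply (continuous_comp (fun l : R => - RtoC l) (lap w0)).
    - apply cont_Copp, cont_RtoC, continuous_id.
    - apply (lap_cont w0 (4 * M)).
      + exact (hs_Cont_y k tmax _ _ _ HS 0 0%R ltac:(lia)).
      + exact (hs_dom4 k tmax _ _ _ HS 0 0%R ltac:(lia)). }
  set (eX := Cexp (Ci * RtoC k * RtoC x)).
  apply (is_CInt_contour_of_tends (fun lambda => E k lambda x y t * half_space_transform u0 k lambda) _ (fun r => eX * CInt (fun l => eph y t k l * lap w0 (- RtoC l)) (- r) r) _ 0).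
  - intros r _. rewrite <- (CInt_scal eX (fun l => eph y t k l * lap w0 (- RtoC l)) _ _ CW).
    apply (real_line_cut (fun l => eX * (eph y t k l * lap w0 (- RtoC l)))).
    + intro l. apply cont_Cmult; [apply continuous_const|apply CW].
    + intro l. replace (RtoC l) with (- - RtoC l) at 2 by ring.
      rewrite half_space_transform_lap by (simpl; lra). fold w0. rewrite Cmult_assoc. f_equal.
      unfold eX, eph, E, ph. rewrite <- Cexp_plus. f_equal. apply injective_projections; simpl; ring.
  - apply tends_scal. exact (initial_tends tmax M u V HV y t Hy Ht k).
Qed.

Lemma boundary_integral eps : (0 < eps < 1)%R -> is_iterated_CInt
  (fun kappa lambda => E kappa lambda x y t * G eps u0 g0 g1 kappa lambda t)
  boundary_Dplus (RtoC (2 * PI) * FI wave - FI (inner1 V y t x)).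
Proof.
  intro Heps.
  destruct (inner1_fdom2 tmax M u V HV y t Hy Ht x) as [D HD].
  assert (CI1 := inner1_Cont tmax M u V HV y t Hy Ht x).
  exists (fun k => RtoC (2 * PI) * wave k - inner1 V y t x k). split.
  - intro k. assert (HS := halfline_solution_fourier k tmax M u V HV).
    set (w := fun j => fourier_x (V (repeat Y j)) k) in *.
    assert (Hsplit : forall sg z, (sg = 1 \/ sg = -1)%R -> closed_quadrant sg z -> nu eps k z = nq sg k z ->
      z ^ 2 <> - RtoC (k ^ 2) -> E k z x y t * G eps u0 g0 g1 k z t =
      Cexp (Ci * RtoC k * RtoC x) * (Aint (fun s => w 0%nat s t) sg k y z - Bint w k t y z)).
    { intros sg z Hsg Hq Hnu Hz.
      apply (integrand_split k tmax (4 * M) t x y eps sg w _ u0 g0 g1 z HS Ht Hsg).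
      - intros z' Hz'. exact (half_space_transform_lap k z' Hz').
      - intro om. exact (t_transform_ttr g0 0 k om ltac:(lia) dirichlet_trace).
      - intro om. exact (t_transform_ttr g1 1 k om ltac:(lia) neumann_trace).
      - exact Hq.
      - exact Hnu.
      - exact Hz. }
    replace (RtoC (2 * PI) * wave k - inner1 V y t x k) with
      (Cexp (Ci * RtoC k * RtoC x) * (RtoC (2 * PI) * w 0%nat y t - FI (full_symbol V y t k))).
    2: { unfold wave, inner1, w. cbn [repeat]. ring. }
    apply (boundary_integral_tends k tmax (4 * M) t x y w _ HS Ht Hy (fun z => E k z x y t) (fun z => G eps u0 g0 g1 k z t)).
    + exact (initial_tends tmax M u V HV y t Hy Ht k).
    + intros z Hz Hne. apply Hsplit; [right; reflexivity| |now apply nu_left|exact Hne].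
      destruct Hz as (H1 & H2 & _). split; [exact H1|exact H2].
    + intros z Hz Hne. apply Hsplit; [left; reflexivity| |now apply nu_right|exact Hne].
      destruct Hz as (H1 & H2 & _). split; [exact H1|exact H2].
  - apply (is_RInt_gen_minus (V := C_R_NormedModule)).
    + assert (C2 : Cont (fun k => RtoC (2 * PI) * wave k)).
      { intro k. apply cont_Cmult; [apply continuous_const|apply wave_Cont]. }
      assert (D2 : fdom2 (2 * PI * (16 * M)) (fun k => RtoC (2 * PI) * wave k)).
      { intro k. assert (HP := PI_RGT_0). rewrite Cmod_mult, Cmod_R, Rabs_pos_eq by lra.
        rewrite (Rmult_assoc (2 * PI)). apply Rmult_le_compat_l; [lra|apply wave_fdom2]. }
      rewrite <- (FI_scal (RtoC (2 * PI)) wave (16 * M) wave_Cont wave_fdom2).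
      exact (FI_is_RInt_gen _ _ C2 D2).
    + exact (FI_is_RInt_gen _ D CI1 HD).
Qed.
End Representation.

Theorem mainTheorem3 :
  exists (N : nat) (eps0 : R), 0 < eps0 /\
  forall (tmax : R) (u : R -> R -> R -> C) (u0 g0 g1 : R -> R -> C) (eps : R),
    0 < tmax ->
    CN_up_to_boundary N tmax u ->
    decays N tmax u ->
    solves_biharmonic_schrodinger tmax u ->
    has_data tmax u u0 g0 g1 ->
    0 < eps < eps0 ->
    forall x y t : R, 0 < y -> 0 < t < tmax ->
    exists I1 I2 : C,
      is_iterated_CInt
        (fun kappa lambda => E kappa lambda x y t * half_space_transform u0 kappa lambda)
        (fun _ => real_line) I1 /\
      is_iterated_CInt
        (fun kappa lambda => E kappa lambda x y t * G eps u0 g0 g1 kappa lambda t)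
        boundary_Dplus I2 /\
      u x y t = / RtoC ((2 * PI) ^ 2) * I1 + / RtoC ((2 * PI) ^ 2) * I2.
Proof.
  (* Eight powers of decay allow fourth powers in both x and y, and eps < 1 < pi/2 keeps the branch
     cut away from the radicands in question. *)
  exists 8%nat, 1%R. split; [apply Rlt_0_1|].
  intros tmax u u0 g0 g1 eps Htm HN Hdec Hsol Hdata Heps x y t Hy Ht.
  destruct (smooth_ext_exists tmax u Htm HN Hdec Hsol) as (M & V & HV).
  (* The datum term reappears with the opposite sign in the contour term, so the sum is 2 pi times
     [FI wave], that is (2 pi)^2 u. *)
  exists (FI (inner1 V y t x)), (RtoC (2 * PI) * FI (wave V x y t) - FI (inner1 V y t x)).
  split; [exact (initial_integral tmax M u V HV u0 g0 g1 Hdata x y t Hy Ht)|].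
  split; [exact (boundary_integral tmax M u V HV u0 g0 g1 Hdata x y t Hy Ht eps Heps)|].
  rewrite (FI_wave tmax M u V HV x y t Hy Ht).
  replace (RtoC ((2 * PI) ^ 2)) with (RtoC (2 * PI) * RtoC (2 * PI)).
  - field. intro H. apply RtoC_inj in H. assert (HP := PI_RGT_0). lra.
  - rewrite <- RtoC_mult. f_equal. ring.
Qed.
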